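(* Assume condition (A1) (stated in the context). Let $D\subset\mathbb{R}^d$ be a bounded Lipschitz domain with $0\in D$ satisfying a uniform exterior sphere condition, and let $c\in C(\bar D)$. Let $\lambda_D$ be the generalized principal eigenvalue of $L$ in $D$ with potential $c$ (defined in the context). Then there exists a unique $\psi_D\in C_b(\mathbb{R}^d)$ satisfying (in the viscosity sense) $$L\psi_D+c\,\psi_D=-\lambda_D\psi_D\ \text{ in } D,\qquad \psi_D=0\ \text{ in } D^c,\qquad \psi_D>0\ \text{ in } D,\qquad \psi_D(0)=1.$$ Moreover, if $u\in C_{b,+}(\mathbb{R}^d)$ is positive in $D$ and satisfies $Lu+cu\le-\lambda u$ in $D$ (in the viscosity sense) for some $\lambda\in\mathbb{R}$, then $\lambda\le\lambda_D$. Furthermore, if $\lambda=\lambda_D$ and $u=0$ in $D^c$, then $u=k\psi_D$ for some $k>0$. Furthermore, $\lambda_D$ is the only Dirichlet eigenvalue with a positive eigenfunction, i.e. if $\lambda\in\mathbb{R}$ and $u\in C_b(\mathbb{R}^d)$ satisfy $Lu+cu=-\lambda u$ in $D$ in the viscosity sense, $u>0$ in $D$ and $u=0$ in $D^c$, then $\lambda=\lambda_D$.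
   Context: Operator: $j:\mathbb{R}^d\setminus\{0\}\to[0,\infty)$ is a fixed measurable function with $\int_{\mathbb{R}^d}(1\wedge|y|^2)j(y)\,dy<\infty$, and $$Lu(x)=\Delta u(x)+\int_{\mathbb{R}^d}\big(u(x+y)-u(x)-\mathbf 1_{\{|y|\le1\}}\,y\cdot\nabla u(x)\big)j(y)\,dy.$$ Exponent and condition (A1): $\psi(z)=\int_{\mathbb{R}^d}(1-e^{iz\cdot\xi}+\mathbf 1_{\{|\xi|\le1\}}\,iz\cdot\xi)\,j(\xi)\,d\xi$. Condition (A1): for some constant $C>0$, $|\mathrm{Im}\,\psi(p)|\le C(|p|^2+|\mathrm{Re}\,\psi(p)|)$ for all $p\in\mathbb{R}^d$, and for all $r>0$, $\sup_{|p|\le r}(|p|^2+\mathrm{Re}\,\psi(p))>0$. Viscosity solutions: functions are Borel measurable. A bounded $u:\mathbb{R}^d\to\mathbb{R}$, upper (lower) semicontinuous in $\bar D$, is a viscosity subsolution (supersolution) of $Lu=f$ in $D$, written $Lu\ge f$ ($Lu\le f$), if for every $x\in D$, every neighbourhood $N_x$ of $x$ in $D$ and every $\varphi\in C^2(\overline{N_x})$ such that $\varphi-u$ attains minimum (maximum) $0$ in $N_x$ at $x$, the function $v$ equal to $\varphi$ in $N_x$ and to $u$ elsewhere satisfies $Lv(x)\ge f(x)$ ($Lv(x)\le f(x)$). A viscosity solution is both. For equations with zeroth-order terms, the terms $cu$, $\lambda u$ are evaluated at $x$ and moved to the right-hand side. Principal eigenvalue: $C_+(D)$ is the set of positive continuous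 functions in $D$, $C_{b,+}(\mathbb{R}^d)$ the set of bounded non-negative continuous functions on $\mathbb{R}^d$, and $$\lambda_D=\sup\{\lambda:\ \exists\, v\in C_+(D)\cap C_{b,+}(\mathbb{R}^d)\ \text{with}\ Lv+cv+\lambda v\le0\ \text{in } D\ \text{(viscosity sense)}\}.$$ Uniform exterior sphere condition: there is $r>0$ such that for every $y\in\partial D$ there is $z\in D^c$ with $|y-z|=r$ and $B_r(z)\cap D=\emptyset$. $C_b$: bounded continuous functions. *)

(* Defs.v *)
From HB Require Import structures.
From mathcomp Require Import all_boot all_order all_algebra.
From mathcomp Require Import complex.
From mathcomp Require Import all_classical all_reals all_analysis.

Set Implicit Arguments.
Unset Strict Implicit.
Unset Printing Implicit Defensive.
Import Order.TTheory GRing.Theory Num.Theory.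
Import numFieldNormedType.Exports.

Local Open Scope classical_set_scope.
Local Open Scope ring_scope.

Lemma pushforward_sigma_additive d1 d2 (T1 : measurableType d1)
    (T2 : measurableType d2) (R : realType) (m : {measure set T1 -> \bar R})
    (f : T1 -> T2) : measurable_fun setT f ->
  semi_sigma_additive (pushforward m f).
Proof.
move=> mf F mF tF mUF; rewrite /pushforward preimage_bigcup.
apply: measure_semi_sigma_additive.
- by move=> n; rewrite -[X in measurable X]setTI; exact: mf.
- apply/trivIsetP => /= i k _ _ ik; rewrite -preimage_setI.
  by move/trivIsetP : tF => /(_ _ _ _ _ ik) ->//; rewrite preimage_set0.
- by rewrite -preimage_bigcup -[X in measurable X]setTI; exact: mf.
Qed.

Lemma pushforward_product_sigma_finite d1 d2 d3 (T1 : measurableType d1)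
    (T2 : measurableType d2) (T3 : measurableType d3) (R : realType)
    (m1 : {sigma_finite_measure set T1 -> \bar R})
    (m2 : {sigma_finite_measure set T2 -> \bar R})
    (f : T1 * T2 -> T3) (g : T3 -> T1 * T2) :
  measurable_fun setT g -> cancel f g ->
  sigma_finite setT (pushforward (m1 \x m2)%E f).
Proof.
move=> mg fK.
have /sigma_finiteP[F [FT ndF Foo]] := sigma_finiteT m1.
have /sigma_finiteP[G [GT ndG Goo]] := sigma_finiteT m2.
exists (fun n => g @^-1` (F n `*` G n)).
  rewrite -preimage_bigcup -[LHS](preimage_setT g); congr (_ @^-1` _).
  apply/esym/seteqP; split => // -[x y] _.
  have [[i _ Fix] [k _ Gky]] : (\bigcup_i F i) x /\ (\bigcup_i G i) y.
    by rewrite -FT -GT.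
  exists (maxn i k) => //; split => /=.
  - by move: x Fix; exact/subsetPset/ndF/leq_maxl.
  - by move: y Gky; exact/subsetPset/ndG/leq_maxr.
move=> n; have [mFn Fnoo] := Foo n; have [mGn Gnoo] := Goo n; split.
  by rewrite -[X in measurable X]setTI; apply: mg => //; exact: measurableX.
rewrite /pushforward -comp_preimage (_ : g \o f = id); last first.
  by apply/funext => x; exact: fK.
by rewrite preimage_id product_measure1E// lte_mul_pinfty// ge0_fin_numE.
Qed.

Section tuple_lebesgue.
Variable R : realType.
Local Notation T := (measurableTypeR R).

Definition tuple_cons n (p : T * n.-tuple T) : n.+1.-tuple T :=
  [tuple of p.1 :: p.2].

Definition tuple_uncons n (t : n.+1.-tuple T) : T * n.-tuple T :=
  (thead t, [tuple of behead t]).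

Lemma tuple_consK n : cancel (@tuple_cons n) (@tuple_uncons n).
Proof. by move=> [x t]; congr (_, _); exact/val_inj. Qed.

Lemma measurable_tuple_cons n : measurable_fun setT (@tuple_cons n).
Proof. exact: measurable_cons. Qed.

Lemma measurable_tuple_uncons n : measurable_fun setT (@tuple_uncons n).
Proof.
apply: measurable_fun_pair; last exact: measurable_behead.
exact: measurable_tnth.
Qed.

Section step.
Variables (n : nat) (m : {sigma_finite_measure set (n.-tuple T) -> \bar R}).

Definition lebesgue_tupleS : set (n.+1.-tuple T) -> \bar R :=
  pushforward (lebesgue_measure \x m)%E (@tuple_cons n).

Let lebesgue_tupleS0 : lebesgue_tupleS set0 = 0%E.
Proof. by rewrite /lebesgue_tupleS /pushforward preimage_set0 measure0. Qed.

Let lebesgue_tupleS_ge0 A : (0 <= lebesgue_tupleS A)%E.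
Proof. by apply: integral_ge0 => x _; exact: measure_ge0. Qed.

Let lebesgue_tupleS_sigma_additive : semi_sigma_additive lebesgue_tupleS.
Proof.
exact: (pushforward_sigma_additive (m := (lebesgue_measure \x m)%E)
  (@measurable_tuple_cons n)).
Qed.

HB.instance Definition _ := isMeasure.Build _ _ _ lebesgue_tupleS
  lebesgue_tupleS0 lebesgue_tupleS_ge0 lebesgue_tupleS_sigma_additive.

Let lebesgue_tupleS_sigma_finite : sigma_finite setT lebesgue_tupleS.
Proof.
have := @pushforward_product_sigma_finite _ _ _ _ _ _ R lebesgue_measure m
  (@tuple_cons n) (@tuple_uncons n) (@measurable_tuple_uncons n) (@tuple_consK n).
exact.
Qed.

HB.instance Definition _ := Measure_isSigmaFinite.Build _ _ _ lebesgue_tupleS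
  lebesgue_tupleS_sigma_finite.

End step.

Fixpoint lebesgue_tuple n : {sigma_finite_measure set (n.-tuple T) -> \bar R} :=
  if n is k.+1 then lebesgue_tupleS (lebesgue_tuple k)
  else dirac ([tuple] : 0.-tuple T).

End tuple_lebesgue.

Definition borel_rV (R : realType) (d : nat) :=
  g_sigma_algebraType (@open 'rV[R]_d).

Section lebesgue_rV.
Variables (R : realType) (d : nat).
Local Notation T := (measurableTypeR R).

Definition tuple_rV (t : d.-tuple T) : borel_rV R d := \row_i tnth t i.

Definition rV_tuple (v : borel_rV R d) : d.-tuple T :=
  [tuple (v : 'rV[R]_d) ord0 i | i < d].

Lemma tuple_rVK : cancel tuple_rV rV_tuple.
Proof.
by move=> t; apply: eq_from_tnth => i; rewrite tnth_mktuple mxE.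
Qed.

Lemma measurable_coord (i : 'I_d) :
  measurable_fun setT (fun v : borel_rV R d => (v : 'rV[R]_d) ord0 i : T).
Proof.
apply: (measurability _ (measurable_realfun.RGenOpens.measurableE R)).
move=> _ [_ [a [b ->] <-]]; rewrite setTI; apply: sub_sigma_algebra.
by have /continuousP := @coord_continuous R 1 d ord0 i; apply; exact: interval_open.
Qed.

Lemma measurable_rV_tuple : measurable_fun setT rV_tuple.
Proof.
apply/measurable_fun_tnthP => i.
rewrite (_ : _ \o _ = fun v : borel_rV R d => (v : 'rV[R]_d) ord0 i).
  exact: measurable_coord.
by apply/funext => v /=; rewrite tnth_mktuple.
Qed.

Lemma measurable_tuple_rV : measurable_fun setT tuple_rV.
Proof.
apply: (@measurability _ _ _ (borel_rV R d) setT tuple_rV (@open 'rV[R]_d)) => //.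
move=> _ [U oU <-]; rewrite setTI.
pose box (q : {ffun 'I_d -> rat * rat}) : set 'rV[R]_d :=
  [set v | forall i, v ord0 i \in `]ratr (q i).1, ratr (q i).2[].
have -> : U = \bigcup_(q in [set q | box q `<=` U]) box q.
  apply/seteqP; split => [v Uv|v [q /= qU /qU]//].
  have /nbhs_ballP[e /= e0 eU] : nbhs v U by exact: open_nbhs_nbhs.
  have /choice[q hq] : forall i : 'I_d, exists q : rat * rat,
      [/\ v ord0 i - e < ratr q.1, ratr q.1 < v ord0 i,
          v ord0 i < ratr q.2 & ratr q.2 < v ord0 i + e].
    move=> i.
    have [|q1] := @rat_in_itvoo R (v ord0 i - e) (v ord0 i).
      by rewrite ltrBlDr ltrDl.
    have [|q2] := @rat_in_itvoo R (v ord0 i) (v ord0 i + e).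
      by rewrite ltrDl.
    rewrite !in_itv/= => /andP[a b] /andP[c f].
    by exists (q1, q2).
  exists [ffun i => q i]; last first.
    by move=> i; rewrite ffunE in_itv/=; have [_ -> -> _] := hq i.
  move=> w /= wq; apply: eU; split => // i k; rewrite ord1.
  rewrite -ball_normE/= ltr_distlC.
  have := wq k; rewrite ffunE in_itv/= => /andP[a b].
  have [c1 c2 c3 c4] := hq k.
  by rewrite (lt_trans c1 a)/= (lt_trans b c4).
rewrite preimage_bigcup bigcup_mkcond.
apply: countable_bigcupT_measurable; first exact: countableP.
move=> q; case: ifPn => // _.
rewrite (_ : _ @^-1` _ = \bigcap_(i in [set: 'I_d])
  ((fun t : d.-tuple T => tnth t i) @^-1` `]ratr (q i).1, ratr (q i).2[%classic)).
  apply: fin_bigcap_measurable; first exact: finite_finset.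
  move=> i _; rewrite -[X in measurable X]setTI.
  by apply: measurable_tnth => //; exact: measurable_itv.
apply/seteqP; split => t /= h i => [_|]; first by have := h i; rewrite /= mxE.
by rewrite mxE; exact: h.
Qed.

Definition lebesgue_rV : set (borel_rV R d) -> \bar R :=
  pushforward (lebesgue_tuple R d) tuple_rV.

Let lebesgue_rV0 : lebesgue_rV set0 = 0%E.
Proof. by rewrite /lebesgue_rV /pushforward preimage_set0 measure0. Qed.

Let lebesgue_rV_ge0 A : (0 <= lebesgue_rV A)%E.
Proof. exact: (measure_ge0 (lebesgue_tuple R d)). Qed.

Let lebesgue_rV_sigma_additive : semi_sigma_additive lebesgue_rV.
Proof.
exact: (pushforward_sigma_additive (m := lebesgue_tuple R d)
  measurable_tuple_rV).
Qed.

HB.instance Definition _ := isMeasure.Build _ _ _ lebesgue_rV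
  lebesgue_rV0 lebesgue_rV_ge0 lebesgue_rV_sigma_additive.

Let lebesgue_rV_sigma_finite : sigma_finite setT lebesgue_rV.
Proof.
have [F FT Foo] := sigma_finiteT (lebesgue_tuple R d).
exists (fun n => rV_tuple @^-1` F n).
  by rewrite -preimage_bigcup -FT preimage_setT.
move=> n; have [mFn Fnoo] := Foo n; split.
  by rewrite -[X in measurable X]setTI; exact: measurable_rV_tuple.
rewrite /lebesgue_rV /pushforward -comp_preimage (_ : _ \o _ = id)//.
by apply/funext => x; exact: tuple_rVK.
Qed.

HB.instance Definition _ := Measure_isSigmaFinite.Build _ _ _ lebesgue_rV
  lebesgue_rV_sigma_finite.

End lebesgue_rV.

Lemma lebesgue_tuple_box (R : realType) (d : nat)
    (A : 'I_d -> set (measurableTypeR R)) : (forall i, measurable (A i)) ->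
  lebesgue_tuple R d [set t | forall i, A i (tnth t i)] =
  \big[*%E/1%E]_(i < d) lebesgue_measure (A i).
Proof.
elim: d A => [A _|d IHd A mA].
  rewrite big_ord0 /= diracE mem_set//=; first by case.
rewrite big_ord_recl -(IHd (fun i => A (lift ord0 i)))//=.
rewrite -product_measure1E//; last first.
  rewrite (_ : [set t | _] = \bigcap_(i in [set: 'I_d])
    ((fun t : d.-tuple (measurableTypeR R) => tnth t i) @^-1` A (lift ord0 i))).
    apply: fin_bigcap_measurable; first exact: finite_finset.
    move=> i _; rewrite -[X in measurable X]setTI.
    by apply: measurable_tnth => //; exact: mA.
  by apply/seteqP; split => t /= h i => [_|]; exact: h.
rewrite /lebesgue_tupleS /pushforward; congr (_ _).
apply/seteqP; split => [[x t]/= h|[x t]/= [h0 h] i].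
  split; first by have := h ord0.
  by move=> i; have := h (lift ord0 i); rewrite tnthS.
by have [k ->|->//] := unliftP ord0 i; rewrite tnthS; exact: h.
Qed.

Lemma lebesgue_rV_box (R : realType) (d : nat)
    (A : 'I_d -> set (measurableTypeR R)) : (forall i, measurable (A i)) ->
  lebesgue_rV [set v : 'rV[R]_d | forall i, A i (v ord0 i)] =
  \big[*%E/1%E]_(i < d) lebesgue_measure (A i).
Proof.
move=> mA; rewrite -lebesgue_tuple_box// /lebesgue_rV /pushforward.
congr (_ _); apply/seteqP; split => t /= h i; have := h i; by rewrite mxE.
Qed.

Section euclidean.
Variables (R : realType) (d : nat).
Implicit Types (x y z : 'rV[R]_d) (D N : set 'rV[R]_d) (u f phi : 'rV[R]_d -> R).

(* The library norm on 'rV[R]_d is the max norm; it is used below only through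
   the topology and through boundedness of sets. *)
Definition dotv x y : R := \sum_i x ord0 i * y ord0 i.

Definition enorm x : R := Num.sqrt (dotv x x).

Definition eball z (r : R) : set 'rV[R]_d := [set y | enorm (y - z) < r].

Definition frontier D : set 'rV[R]_d := closure D `\` D°.

(* Around each boundary point D is the strict epigraph, in some direction nu,
   of a Lipschitz function gamma of the component orthogonal to nu. *)
Definition lipschitz_boundary D : Prop :=
  forall y, frontier D y ->
  exists (nu : 'rV[R]_d) (r K : R) (gamma : 'rV[R]_d -> R),
    [/\ enorm nu = 1, 0 < r,
        forall a b, `|gamma a - gamma b| <= K * enorm (a - b) &
        forall x, eball y r x ->
          (D x <-> gamma (x - dotv x nu *: nu) < dotv x nu)].

Definition bounded_lipschitz_domain D : Prop :=
  [/\ open D, connected D, bounded_set D & lipschitz_boundary D].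

Definition uniform_exterior_sphere D : Prop :=
  exists2 r : R, 0 < r & forall y, frontier D y ->
    exists z, [/\ ~ D z, enorm (y - z) = r & eball z r `&` D = set0].

Definition Cb u : Prop := continuous u /\ bounded_fun u.

Definition Cb_nonneg u : Prop := Cb u /\ forall x, 0 <= u x.

Definition unitv (i : 'I_d) : 'rV[R]_d := delta_mx ord0 i.

Definition gradient u x : 'rV[R]_d := \row_i 'D_(unitv i) u x.

Definition laplacian u x : R := \sum_i 'D_(unitv i) ('D_(unitv i) u) x.

Definition extends_continuously N u : Prop :=
  exists2 g : 'rV[R]_d -> R, {within closure N, continuous g} & {in N, u =1 g}.

(* phi is C^2 in the open set N, and phi and its partial derivatives of order
   at most 2 extend continuously to the closure of N. *)
Definition C2_closure N phi : Prop :=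
  [/\ {within closure N, continuous phi},
      forall i, (forall x, N x -> derivable phi x (unitv i)) /\
        extends_continuously N ('D_(unitv i) phi) &
      forall i k, (forall x, N x -> derivable ('D_(unitv i) phi) x (unitv k)) /\
        extends_continuously N ('D_(unitv k) ('D_(unitv i) phi))].

(* Points outside A are isolated in [subspace A], so these are semicontinuity
   of the restriction of u to A. *)
Definition lsc_within (A : set 'rV[R]_d) u : Prop :=
  @lower_semicontinuous (subspace A) R (fun x => (u x)%:E).

Definition usc_within (A : set 'rV[R]_d) u : Prop := lsc_within A (\- u).

Section operator.
Variable j : 'rV[R]_d -> R.

(* j is a function on R^d \ {0}: j 0 is a dummy value, and every integrand
   below vanishes at 0. *)
Definition levy_density : Prop :=
  [/\ measurable_fun [set y : borel_rV R d | y != 0] (j : borel_rV R d -> R),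
      forall y, y != 0 -> 0 <= j y &
      (\int[@lebesgue_rV R d]_y (Num.min 1 (enorm y ^+ 2) * j y)%:E < +oo)%E].

Definition Lop u x : R :=
  laplacian u x +
  \int[@lebesgue_rV R d]_y
    ((u (x + y) - u x - (enorm y <= 1)%R%:R * dotv y (gradient u x)) * j y).

Definition Cintegral (F : 'rV[R]_d -> R[i]) : R[i] :=
  ((\int[@lebesgue_rV R d]_x complex.Re (F x))
    +i* (\int[@lebesgue_rV R d]_x complex.Im (F x)))%C.

Definition expi (t : R) : R[i] := (cos t +i* sin t)%C.

Definition levy_exponent z : R[i] :=
  Cintegral (fun xi =>
    (1 - expi (dotv z xi) + (enorm xi <= 1)%R%:R * (0 +i* dotv z xi)%C)
      * ((j xi)%:C)%C).

Definition condition_A1 : Prop :=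
  exists2 C : R, 0 < C &
    (forall p, `|complex.Im (levy_exponent p)|
                 <= C * (enorm p ^+ 2 + `|complex.Re (levy_exponent p)|)) /\
    (forall r : R, 0 < r ->
       (0 < ereal_sup [set (enorm p ^+ 2 + complex.Re (levy_exponent p))%:E
                      | p in [set p | (enorm p <= r)%R]])%E).

Definition open_nbhd_in D x N : Prop := [/\ open N, N x & N `<=` D].

(* L u >= f in D *)
Definition visc_subsol D u f : Prop :=
  [/\ measurable_fun setT (u : borel_rV R d -> R), bounded_fun u,
      usc_within (closure D) u &
      forall x, D x -> forall N, open_nbhd_in D x N ->
      forall phi, C2_closure N phi ->
        (forall y, N y -> 0 <= phi y - u y) -> phi x - u x = 0 ->
        f x <= Lop (patch u N phi) x].

(* L u <= f in D *)
Definition visc_supersol D u f : Prop :=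
  [/\ measurable_fun setT (u : borel_rV R d -> R), bounded_fun u,
      lsc_within (closure D) u &
      forall x, D x -> forall N, open_nbhd_in D x N ->
      forall phi, C2_closure N phi ->
        (forall y, N y -> phi y - u y <= 0) -> phi x - u x = 0 ->
        Lop (patch u N phi) x <= f x].

Definition visc_sol D u f : Prop := visc_subsol D u f /\ visc_supersol D u f.

Section eigenvalue.
Variables (D : set 'rV[R]_d) (c : 'rV[R]_d -> R).

(* L u + c u + lambda u <= 0 (resp. = 0) in D *)
Definition eigen_supersol (lambda : R) u : Prop :=
  visc_supersol D u (fun x => - c x * u x - lambda * u x).

Definition eigen_sol (lambda : R) u : Prop :=
  visc_sol D u (fun x => - c x * u x - lambda * u x).

Definition admissible (lambda : R) : Prop :=
  exists v, [/\ Cb_nonneg v, forall x, D x -> 0 < v x &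
               eigen_supersol lambda v].

Definition principal_eigenvalue : \bar R :=
  ereal_sup [set lambda%:E | lambda in admissible].

Definition pos_eigenfunction (lambda : R) u : Prop :=
  [/\ Cb u, eigen_sol lambda u, forall x, ~ D x -> u x = 0 &
      forall x, D x -> 0 < u x].

End eigenvalue.
End operator.
End euclidean.

(* Main.v *)
(* Uniqueness and the comparison statements rest on one positive eigenfunction psi
   that is a uniform limit of C^2 functions P with L P locally uniformly close to
   -(c + lambda) psi. Subtracting a multiple of such a psi from a viscosity
   supersolution v gives again a viscosity supersolution, and sliding t psi under v
   with the strong maximum principle, and a maximum principle near the boundary
   given by exterior-sphere barriers, yields v = t psi or a strict inequality
   between the eigenvalues.

   To construct psi, L is discretised by a monotone scheme on lattices h Z^d;
   Perron-Frobenius gives positive discrete eigenpairs. The eigenvalues are bounded,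
   barriers control the eigenfunctions near the boundary, and a coupling by
   reflection, which uses only the discrete Laplacian and hence no regularity of j,
   makes them equicontinuous. Limits along an ultrafilter give psi, and smoothing
   the discrete eigenfunctions with an exact lattice partition of unity gives the
   functions P. *)
Require Import Defs.
From mathcomp Require Import all_boot all_order all_algebra.
From mathcomp Require Import ring lra.
From mathcomp Require Import all_classical all_reals all_analysis.
From mathcomp Require Import measurable_realfun.
Set Implicit Arguments.
Unset Strict Implicit.
Unset Printing Implicit Defensive.
Import Order.TTheory GRing.Theory Num.Theory.
Import numFieldNormedType.Exports.
Local Open Scope classical_set_scope.
Local Open Scope ring_scope.

(** The density [j] is only measurable with finite second-order mass near 0. No regularity theory is
    invoked to make an eigenfunction C^2, and the viscosity inequalities of two solutions cannot
    simply be subtracted. The notion [nice] is shaped by this: it controls L of the smooth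
    approximations but none of their derivatives. The weak hypothesis on [j] also fixes the scales.
    Small jumps are controlled only through the fact that eta^2 times the mass of the jumps longer
    than eta tends to 0, which is just enough against a barrier whose Laplacian is of order eta^-2.
    On the lattice, the consistency error is bounded only for functions with three controlled
    derivatives, whereas the discrete eigenfunctions are merely equicontinuous up to a tolerance.
    Averaging at a scale chosen independently of the mesh bridges this gap: since it commutes with
    the scheme, it merely averages the right-hand sides of the discrete equation. *)

Section enorm_theory.
Context {R : realType} {d : nat}.
Implicit Types (x y z : 'rV[R]_d) (r t : R).

Lemma dotvDl x y z : dotv (x + y) z = dotv x z + dotv y z.
Proof. by rewrite -big_split; apply: eq_bigr => i _; rewrite mxE mulrDl. Qed.

Lemma dotvC x y : dotv x y = dotv y x.
Proof. by apply: eq_bigr => i _; rewrite mulrC. Qed.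

Lemma dotvDr x y z : dotv z (x + y) = dotv z x + dotv z y.
Proof. by rewrite dotvC dotvDl !(dotvC z). Qed.

Lemma dotvZl t x y : dotv (t *: x) y = t * dotv x y.
Proof. by rewrite mulr_sumr; apply: eq_bigr => i _; rewrite mxE mulrA. Qed.

Lemma dotvZr t x y : dotv x (t *: y) = t * dotv x y.
Proof. by rewrite dotvC dotvZl dotvC. Qed.

Lemma dotv0l y : dotv 0 y = 0.
Proof. by rewrite -(scale0r 0) dotvZl mul0r. Qed.

Lemma dotvv_ge0 x : 0 <= dotv x x.
Proof. by apply: sumr_ge0 => i _; rewrite -expr2 sqr_ge0. Qed.

Lemma sqr_enorm x : enorm x ^+ 2 = dotv x x.
Proof. by rewrite sqr_sqrtr// dotvv_ge0. Qed.

Lemma enorm_ge0 x : 0 <= enorm x.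
Proof. exact: sqrtr_ge0. Qed.

Lemma enorm0 : enorm (0 : 'rV[R]_d) = 0.
Proof. by rewrite /enorm dotv0l sqrtr0. Qed.

Lemma coord_le_enorm x i : `|x ord0 i| <= enorm x.
Proof.
rewrite -(@ler_pXn2r _ 2)// ?nnegrE ?enorm_ge0// real_normK ?num_real//.
rewrite sqr_enorm /dotv (bigD1 i)//= -expr2 lerDl.
by apply: sumr_ge0 => k _; rewrite -expr2 sqr_ge0.
Qed.

Lemma dotv_le_enorm x y : `|dotv x y| <= enorm x * enorm y.
Proof.
rewrite -(@ler_pXn2r _ 2)// ?nnegrE ?mulr_ge0 ?enorm_ge0//.
rewrite real_normK ?num_real// exprMn !sqr_enorm.
have [y0|yN0] := eqVneq (dotv y y) 0.
  have yi i : y ord0 i = 0.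
    have := coord_le_enorm y i; rewrite /enorm y0 sqrtr0.
    by rewrite normr_le0 => /eqP.
  have -> : dotv x y = 0 by rewrite /dotv big1// => i _; rewrite yi mulr0.
  by rewrite expr0n/= y0 mulr0.
have yp : 0 < dotv y y by rewrite lt_neqAle eq_sym yN0 dotvv_ge0.
have := dotvv_ge0 (dotv y y *: x + (- dotv x y) *: y).
rewrite !(dotvDl, dotvDr, dotvZl, dotvZr) (dotvC y x).
set a := dotv x x; set b := dotv x y; set c := dotv y y => H.
have : 0 <= c * (a * c - b ^+ 2).
  by apply: le_trans H _; rewrite le_eqVlt; apply/orP; left; apply/eqP; ring.
by rewrite pmulr_rge0// subr_ge0.
Qed.

Lemma ler_enormD x y : enorm (x + y) <= enorm x + enorm y.
Proof.
rewrite -(@ler_pXn2r _ 2)// ?nnegrE ?addr_ge0 ?enorm_ge0//.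
rewrite sqrrD !sqr_enorm dotvDl !dotvDr (dotvC y x).
have := le_trans (ler_norm _) (dotv_le_enorm x y).
by rewrite mulr2n; lra.
Qed.

Lemma enormZ t x : enorm (t *: x) = `|t| * enorm x.
Proof.
by rewrite /enorm dotvZl dotvZr mulrA -expr2 sqrtrM ?sqr_ge0// sqrtr_sqr.
Qed.

Lemma enormN x : enorm (- x) = enorm x.
Proof. by rewrite -scaleN1r enormZ normrN normr1 mul1r. Qed.

Lemma enormB x y : enorm (x - y) = enorm (y - x).
Proof. by rewrite -enormN opprB. Qed.

Lemma enorm_unitv i : enorm (@unitv R d i) = 1.
Proof.
rewrite /enorm /dotv (bigD1 i)//= big1 => [|k ki].
  by rewrite /unitv !mxE !eqxx mulr1 addr0 sqrtr1.
by rewrite /unitv !mxE (negbTE ki) andbF mul0r.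
Qed.

Lemma norm_le_enorm x : `|x| <= enorm x.
Proof.
rewrite [leLHS]mx_normrE; apply/bigmax_leP; split; first exact: enorm_ge0.
by move=> [i k] _ /=; rewrite ord1; exact: coord_le_enorm.
Qed.

Lemma coord_le_norm x i : `|x ord0 i| <= `|x|.
Proof.
rewrite [leRHS]mx_normrE.
exact: (@le_bigmax _ _ _ 0 (fun ij : 'I_1 * 'I_d => `|x ij.1 ij.2|) (ord0, i)).
Qed.

Lemma enorm_le_sum x : enorm x <= \sum_i `|x ord0 i|.
Proof.
have S0 : 0 <= \sum_i `|x ord0 i| by exact: sumr_ge0.
rewrite -(@ler_pXn2r _ 2)// ?nnegrE ?enorm_ge0//.
rewrite sqr_enorm /dotv [leRHS]expr2 mulr_suml ler_sum// => i _.
rewrite -expr2 -[leLHS]real_normK ?num_real// expr2 ler_wpM2l//.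
by rewrite (bigD1 i)//= lerDl sumr_ge0.
Qed.

Lemma enorm_le_norm x : enorm x <= d%:R * `|x|.
Proof.
apply: le_trans (enorm_le_sum x) _.
have -> : d%:R * `|x| = \sum_(i < d) `|x| by rewrite sumr_const card_ord mulr_natl.
by apply: ler_sum => i _; exact: coord_le_norm.
Qed.

Lemma continuous_coord i : continuous (fun x : 'rV[R]_d => x ord0 i).
Proof. exact: coord_continuous. Qed.

Lemma continuousDf (T : topologicalType) (f g : T -> R) :
  continuous f -> continuous g -> continuous (fun p => f p + g p).
Proof. by move=> cf cg p; apply: cvgD; [exact: cf|exact: cg]. Qed.

Lemma continuousMf (T : topologicalType) (f g : T -> R) :
  continuous f -> continuous g -> continuous (fun p => f p * g p).
Proof. by move=> cf cg p; apply: cvgM; [exact: cf|exact: cg]. Qed.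

Lemma continuousBf (T : topologicalType) (f g : T -> R) :
  continuous f -> continuous g -> continuous (fun p => f p - g p).
Proof. by move=> cf cg p; apply: cvgB; [exact: cf|exact: cg]. Qed.

Lemma continuousZf (T : topologicalType) (k : R) (f : T -> R) :
  continuous f -> continuous (fun p => k * f p).
Proof. by move=> cf; apply: continuousMf => // p; exact: cvg_cst. Qed.

Lemma continuous_cstf (T : topologicalType) (k : R) :
  continuous (fun _ : T => k).
Proof. by move=> p; exact: cvg_cst. Qed.

Lemma continuous_compf (T : topologicalType) (f : T -> R) (g : R -> R) :
  continuous f -> continuous g -> continuous (fun p => g (f p)).
Proof. by move=> cf cg p; apply: (@continuous_comp _ _ _ f g); [exact: cf|exact: cg]. Qed.

Lemma continuous_sumf (T : topologicalType) (I : Type) (s : seq I)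
    (P : pred I) (F : I -> T -> R) :
  (forall i, continuous (F i)) -> continuous (fun p => \sum_(i <- s | P i) F i p).
Proof.
move=> cF; elim: s => [|a s IH].
  rewrite (_ : (fun _ => _) = fun=> 0); first exact: continuous_cstf.
  by apply/funext => p; rewrite big_nil.
rewrite (_ : (fun _ => _) =
    fun p => (if P a then F a p else 0) + \sum_(i <- s | P i) F i p).
  by apply: continuousDf => //; case: (P a) => //; exact: continuous_cstf.
by apply/funext => p; rewrite big_cons; case: (P a) => //; rewrite add0r.
Qed.

Lemma continuous_dotv y : continuous (fun x => dotv x y).
Proof.
apply: continuous_sumf => i; apply: continuousMf; last exact: continuous_cstf.
exact: continuous_coord.
Qed.

Lemma continuous_enorm : continuous (@enorm R d).
Proof.
apply: (@continuous_compf 'rV[R]_d (fun x => dotv x x)); last exact: sqrt_continuous.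
apply: continuous_sumf => i; apply: continuousMf; exact: continuous_coord.
Qed.

Lemma open_fun_lt (T : topologicalType) (f : T -> R) (a : R) :
  continuous f -> open [set y | f y < a].
Proof. by move=> /continuousP cf; exact: (cf _ (@open_lt R a)). Qed.

Lemma open_fun_gt (T : topologicalType) (f : T -> R) (a : R) :
  continuous f -> open [set y | a < f y].
Proof. by move=> /continuousP cf; exact: (cf _ (@open_gt R a)). Qed.

Lemma continuous_shift (x : 'rV[R]_d) : continuous (fun y => x + y).
Proof.
move=> y; apply: (@continuousD R 'rV[R]_d 'rV[R]_d (fun=> x) id) => //.
exact: cst_continuous.
Qed.

End enorm_theory.

(** * The Lévy integral *)
Section levy_integral.
Context {R : realType} {d : nat}.
Implicit Types (F G : 'rV[R]_d -> R).

Definition mrV F := measurable_fun setT (F : borel_rV R d -> R).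

Lemma mrV_cst (k : R) : mrV (fun=> k).
Proof. exact: measurable_cst. Qed.

Lemma mrVD F G : mrV F -> mrV G -> mrV (fun x => F x + G x).
Proof. exact: measurable_funD. Qed.

Lemma mrVM F G : mrV F -> mrV G -> mrV (fun x => F x * G x).
Proof. exact: measurable_funM. Qed.

Lemma mrVB F G : mrV F -> mrV G -> mrV (fun x => F x - G x).
Proof. exact: measurable_funB. Qed.

Lemma mrV_open (U : set 'rV[R]_d) : open U -> measurable (U : set (borel_rV R d)).
Proof. by move=> oU; exact: sub_sigma_algebra. Qed.

Lemma mrV_continuous F : continuous F -> mrV F.
Proof.
move=> cF; apply: (measurability _ (RGenOpens.measurableE R)).
move=> _ [_ [a [b ->] <-]]; rewrite setTI; apply: sub_sigma_algebra.
by have /continuousP := cF; apply; exact: interval_open.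
Qed.

Lemma mrV_if (b : 'rV[R]_d -> bool) F G :
  measurable ([set x | b x] : set (borel_rV R d)) ->
  mrV F -> mrV G -> mrV (fun x => if b x then F x else G x).
Proof.
move=> mb mF mG.
apply: (@measurable_fun_ifT _ _ (borel_rV R d) R F G b) => //.
by apply: (@measurable_fun_bool _ (borel_rV R d) setT b true); rewrite setTI.
Qed.

Lemma measurable_enorm_le (a : R) :
  measurable ([set y | (enorm y <= a)%R] : set (borel_rV R d)).
Proof.
rewrite (_ : mkset _ = ~` [set y | a < enorm y]); last first.
  by apply/seteqP; split => y /=; rewrite ltNge; [move=> ->|move/negP/negPn].
by apply: measurableC; exact: (mrV_open (open_fun_gt a (@continuous_enorm R d))).
Qed.

Lemma mrV_indic_enorm (a : R) : mrV (fun y => (enorm y <= a)%R%:R).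
Proof.
rewrite [X in mrV X](_ : _ = fun y : 'rV[R]_d => if enorm y <= a then 1 else 0).
  by apply: mrV_if; [exact: measurable_enorm_le|exact: mrV_cst|exact: mrV_cst].
by apply/funext => y; case: ifP.
Qed.

Lemma mrV_enorm : mrV (@enorm R d).
Proof. by apply: mrV_continuous; exact: continuous_enorm. Qed.

Lemma mrV_shift (x : 'rV[R]_d) F : mrV F -> mrV (fun y => F (x + y)).
Proof.
move=> mF; pose s (y : borel_rV R d) : borel_rV R d := x + (y : 'rV[R]_d).
have ms : measurable_fun setT s.
  apply: (@measurability _ _ (borel_rV R d) (borel_rV R d) setT s (@open 'rV[R]_d)) => //.
  move=> _ [U oU <-]; rewrite setTI; apply: mrV_open.
  by have /continuousP cs := @continuous_shift R d x; exact: cs.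
exact: (measurableT_comp mF ms).
Qed.

Definition mwt (y : 'rV[R]_d) : R := Num.min 1 (enorm y ^+ 2).

(** Domination by the Lévy weight [mwt] yields integrability against [j], and it forces F 0 = 0, so
    that the dummy value [j 0] never enters. *)
Definition adm F := mrV F /\ exists C : R, forall y, `|F y| <= C * mwt y.

Lemma mwt_ge0 y : 0 <= mwt y.
Proof. by rewrite /mwt le_min ler01 sqr_ge0. Qed.

Lemma mwt_le1 y : mwt y <= 1.
Proof. by rewrite /mwt ge_min lexx. Qed.

Lemma mwt_small y : enorm y <= 1 -> mwt y = enorm y ^+ 2.
Proof. by move=> y1; rewrite /mwt min_r// exprn_ile1// enorm_ge0. Qed.

Lemma mwt_large y : 1 <= enorm y -> mwt y = 1.
Proof. by move=> y1; rewrite /mwt min_l// exprn_ege1. Qed.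

Lemma mwt0 : mwt 0 = 0.
Proof. by rewrite mwt_small ?enorm0 ?ler01// expr0n. Qed.

Lemma mrV_mwt : mrV mwt.
Proof.
apply: measurable_minr; first exact: measurable_cst.
by apply: mrVM; exact: mrV_enorm.
Qed.

Lemma adm_mwt : adm mwt.
Proof.
split; first exact: mrV_mwt.
by exists 1 => y; rewrite mul1r ger0_norm// mwt_ge0.
Qed.

Lemma admD F G : adm F -> adm G -> adm (fun y => F y + G y).
Proof.
move=> [mF [C FC]] [mG [C' GC]]; split; first exact: mrVD.
exists (C + C') => y; rewrite mulrDl.
by apply: le_trans (ler_normD _ _) _; exact: lerD.
Qed.

Lemma admZ (k : R) F : adm F -> adm (fun y => k * F y).
Proof.
move=> [mF [C FC]]; split; first by apply: mrVM => //; exact: mrV_cst.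
by exists (`|k| * C) => y; rewrite normrM -mulrA ler_wpM2l.
Qed.

Lemma admB F G : adm F -> adm G -> adm (fun y => F y - G y).
Proof.
move=> aF /(admZ (-1)) aG; have := admD aF aG.
by congr adm; apply/funext => y; rewrite mulN1r.
Qed.

Lemma adm_le (C : R) F : mrV F -> (forall y, `|F y| <= C * mwt y) -> adm F.
Proof. by move=> mF FC; split => //; exists C. Qed.

Lemma adm_le_adm F G : mrV F -> (forall y, `|F y| <= G y) -> adm G -> adm F.
Proof.
move=> mF FG [_ [C GC]]; split => //; exists C => y.
by apply: le_trans (FG y) _; apply: le_trans (ler_norm _) (GC y).
Qed.

Variable j : 'rV[R]_d -> R.
Hypothesis hj : levy_density j.
Local Notation mu := (@lebesgue_rV R d).

Definition Ij F : R := \int[mu]_y (F y * j y).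

Let adm0 F : adm F -> F 0 = 0.
Proof.
by move=> [_ [C /(_ 0)]]; rewrite mwt0 mulr0 normr_le0 => /eqP.
Qed.

(** [j] is measurable and nonnegative only off the origin. Its modification at 0 has both properties
    everywhere and has the same products with functions in [adm], which vanish at 0. *)
Let j' y := if y == 0 then 0 else j y.

Let j'_ge0 y : 0 <= j' y.
Proof.
by case: hj => _ j0 _; rewrite /j'; case: ifPn => // /j0.
Qed.

Let measurable_neq0 : measurable ([set y | y != 0] : set (borel_rV R d)).
Proof.
apply: mrV_open.
rewrite (_ : mkset _ = [set y : 'rV[R]_d | 0 < enorm y]); last first.
  apply/seteqP; split => y /=.
    move=> y0; rewrite lt_neqAle enorm_ge0 andbT eq_sym; apply: contra y0 => /eqP y0.
    have := norm_le_enorm y; rewrite y0 normr_le0; exact.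
  by apply: contraTneq => ->; rewrite enorm0 ltxx.
exact: (open_fun_gt 0 (@continuous_enorm R d)).
Qed.

Let mj' : mrV j'.
Proof.
have -> : j' = j \_ [set y | y != 0].
  apply/funext => y; rewrite /j' /patch; case: ifPn => [/eqP ->|y0].
    by rewrite memNset//= eqxx.
  by rewrite mem_set.
apply/(measurable_restrictT (j : borel_rV R d -> R)) => //.
by case: hj.
Qed.

Let FjE F : adm F -> (fun y => F y * j y) = (fun y => F y * j' y).
Proof.
move=> aF; apply/funext => y; rewrite /j'; case: eqP => // ->.
by rewrite (adm0 aF) !mul0r.
Qed.

Let mFj F : adm F -> mrV (fun y => F y * j y).
Proof. by move=> aF; rewrite FjE//; apply: mrVM => //; case: aF. Qed.

Let int_mwt : mu.-integrable setT (EFin \o (fun y => mwt y * j y)).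
Proof.
apply/integrableP; split; first by apply/measurable_EFinP; exact: (mFj adm_mwt).
case: hj => _ j0 hlt; apply: le_lt_trans hlt; rewrite le_eqVlt; apply/orP; left.
apply/eqP; apply: eq_integral => y _ /=.
rewrite ger0_norm//; have [->|/j0 jy] := eqVneq y 0.
  by rewrite mwt0 mul0r.
by rewrite mulr_ge0// mwt_ge0.
Qed.

Let Fj_le F C : adm F -> (forall y, `|F y| <= C * mwt y) ->
  forall y, `|F y * j y| <= C * (mwt y * j y).
Proof.
move=> aF FC y.
have := congr1 (fun f => f y) (FjE aF); rewrite /= => ->.
have := congr1 (fun f => f y) (FjE adm_mwt); rewrite /= => ->.
by rewrite normrM mulrA (ger0_norm (j'_ge0 y)) ler_wpM2r.
Qed.

Lemma adm_integrable F : adm F ->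
  mu.-integrable setT (EFin \o (fun y => F y * j y)).
Proof.
move=> aF; have [_ [C FC]] := aF.
have iC : mu.-integrable setT (EFin \o (fun y => C * (mwt y * j y))).
  by apply: eq_integrable (integrableZl measurableT C int_mwt).
apply: (le_integrable measurableT _ _ iC).
  by apply/measurable_EFinP; exact: mFj.
move=> y _ /=; rewrite lee_fin.
by apply: le_trans (Fj_le aF FC y) (ler_norm _).
Qed.

Lemma IjD F G : adm F -> adm G -> Ij (fun y => F y + G y) = Ij F + Ij G.
Proof.
move=> aF aG; rewrite /Ij -RintegralD//; [|exact: adm_integrable..].
by apply: eq_Rintegral => y _; rewrite mulrDl.
Qed.

Lemma IjZ (k : R) F : adm F -> Ij (fun y => k * F y) = k * Ij F.
Proof.
move=> aF; rewrite /Ij -RintegralZl//; last exact: adm_integrable.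
by apply: eq_Rintegral => y _; rewrite mulrA.
Qed.

Lemma IjB F G : adm F -> adm G -> Ij (fun y => F y - G y) = Ij F - Ij G.
Proof.
move=> aF aG; rewrite -[- Ij G]mulN1r -IjZ// -IjD//; last exact: admZ.
by congr Ij; apply/funext => y; rewrite mulN1r.
Qed.

Lemma le_Ij F G : adm F -> adm G -> (forall y, F y <= G y) -> Ij F <= Ij G.
Proof.
move=> aF aG FG; apply: le_Rintegral => //; [exact: adm_integrable..|].
move=> y _; have := congr1 (fun f => f y) (FjE aF); rewrite /= => ->.
have := congr1 (fun f => f y) (FjE aG); rewrite /= => ->.
by rewrite ler_wpM2r.
Qed.

Definition Lam := Ij mwt.

Lemma Ij0 : Ij (fun=> 0) = 0.
Proof.
transitivity (Ij (fun y => 0 * mwt y)).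
  by congr Ij; apply/funext => y; rewrite mul0r.
by rewrite IjZ ?mul0r//; exact: adm_mwt.
Qed.

Lemma adm_cst0 : adm (fun=> 0).
Proof. by split; [exact: mrV_cst|exists 0 => y; rewrite normr0 mul0r]. Qed.

Lemma Ij_ge0 F : adm F -> (forall y, 0 <= F y) -> 0 <= Ij F.
Proof. by move=> aF F0; rewrite -Ij0; apply: le_Ij => //; exact: adm_cst0. Qed.

Lemma Lam_ge0 : 0 <= Lam.
Proof. by apply: Ij_ge0; [exact: adm_mwt|exact: mwt_ge0]. Qed.

Lemma Ij_norm_le F G : adm F -> adm G -> (forall y, `|F y| <= G y) ->
  `|Ij F| <= Ij G.
Proof.
move=> aF aG FG; rewrite ler_norml; apply/andP; split.
  rewrite -mulN1r -IjZ//; apply: le_Ij => //; first exact: admZ.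
  by move=> y; rewrite mulN1r; have := FG y; rewrite ler_norml => /andP[].
by apply: le_Ij => // y; have := FG y; rewrite ler_norml => /andP[].
Qed.

Lemma Ij_cvg (F_ : nat -> 'rV[R]_d -> R) F (C : R) :
  (forall n, mrV (F_ n)) -> mrV F ->
  (forall n y, `|F_ n y| <= C * mwt y) ->
  (forall y, F_ n y @[n --> \oo] --> F y) ->
  Ij (F_ n) @[n --> \oo] --> Ij F.
Proof.
move=> mF_ mF FC FF.
have aF_ n : adm (F_ n) by exact: adm_le (FC n).
have aF : adm F.
  apply: (@adm_le C) => // y.
  have cv : `|F_ n y| @[n --> \oo] --> `|F y| by apply: cvg_norm.
  by apply: (cvgr_to_le cv); near=> n; exact: FC.
have iC : mu.-integrable setT (EFin \o (fun y => C * (mwt y * j y))).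
  by apply: eq_integrable (integrableZl measurableT C int_mwt).
have := @dominated_convergence _ _ _ mu setT measurableT
  (fun n y => (F_ n y * j y)%:E) (fun y => (F y * j y)%:E) _ _ _ _ iC.
case.
- by move=> n; by apply/measurable_EFinP; exact: mFj.
- by apply/measurable_EFinP; exact: mFj.
- apply: aeW => y _; apply: cvg_EFin; first by near=> n.
  by apply: cvgM; [exact: FF|exact: cvg_cst].
- by apply: aeW => y n _ /=; rewrite lee_fin; exact: Fj_le.
move=> _ _ H; apply: fine_cvg; rewrite fineK//.
by apply: integrable_fin_num => //; exact: adm_integrable.
Unshelve. all: by end_near.
Qed.

End levy_integral.

(** * Twice differentiable functions and the operator *)
Section jets.
Context {R : realType} {d : nat}.
Implicit Types (x y z v : 'rV[R]_d) (U N : set 'rV[R]_d) (F G : 'rV[R]_d -> R).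
Local Notation vec := 'rV[R]_d.
Local Notation e_ := (@unitv R d).

Lemma unitvE (i k : 'I_d) : e_ i ord0 k = (k == i)%:R.
Proof. by rewrite mxE eqxx. Qed.

Lemma line_quotient F z v (t : R) :
  (fun h => h^-1 *: (((fun s => F (z + s *: v)) \o shift t) (h *: 1) - F (z + t *: v))) =
  (fun h => h^-1 *: ((F \o shift (z + t *: v)) (h *: v) - F (z + t *: v))).
Proof.
apply/funext => h /=; congr (_ *: (F _ - _)).
by rewrite /shift /= [h *: 1]mulr1 scalerDl addrCA addrC.
Qed.

(** Passes to one real variable, where the mean value theorem and the differentiation rules for real
    functions apply. *)
Lemma is_derive_line F z v (t D : R) :
  is_derive (z + t *: v) v F D <-> is_derive t 1 (fun s => F (z + s *: v)) D.
Proof.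
have E := line_quotient F z v t; split=> -[H1 H2].
- apply: DeriveDef; first by rewrite /derivable E.
  by rewrite /derive E.
- apply: DeriveDef; first by rewrite /derivable -E.
  by rewrite /derive -E.
Qed.

Lemma is_derive_line0 F x v (D : R) :
  is_derive (0 : R) 1 (fun s => F (x + s *: v)) D -> is_derive x v F D.
Proof. by move=> /is_derive_line; rewrite scale0r addr0. Qed.

(* The partial derivatives are carried as data, so that closure properties and
   uniform bounds can be stated without mentioning ['D_]. *)
Record jet2 U F (f1 : 'I_d -> vec -> R) (f2 : 'I_d -> 'I_d -> vec -> R) : Prop := Jet2 {
  jet2_cont : forall x, U x -> {for x, continuous F};
  jet2_d1 : forall i x, U x -> is_derive x (e_ i) F (f1 i x);
  jet2_cont1 : forall i x, U x -> {for x, continuous (f1 i)};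
  jet2_d2 : forall i k x, U x -> is_derive x (e_ k) (f1 i) (f2 i k x);
  jet2_cont2 : forall i k x, U x -> {for x, continuous (f2 i k)} }.

Lemma jet2_sub U V F f1 f2 : V `<=` U -> jet2 U F f1 f2 -> jet2 V F f1 f2.
Proof.
move=> VU [h1 h2 h3 h4 h5]; split=> *;
  [exact/h1/VU|exact/h2/VU|exact/h3/VU|exact/h4/VU|exact/h5/VU].
Qed.

Lemma near_open U x (P : vec -> Prop) :
  open U -> U x -> (forall y, U y -> P y) -> \forall y \near x, P y.
Proof.
move=> oU Ux UP; have : nbhs x U by apply: open_nbhs_nbhs; split.
by apply: filterS.
Qed.

Lemma near_eq_cont F G x : (\forall y \near x, F y = G y) ->
  {for x, continuous F} -> {for x, continuous G}.
Proof.
move=> FG cF; rewrite /prop_for /continuous_at -(nbhs_singleton FG).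
have GF : \forall y \near x, F y = G y by apply: filterS FG => y ->.
by apply: cvg_trans cF; exact: (near_eq_cvg GF).
Qed.

Lemma continuousDat (T : topologicalType) (f g : T -> R) (p : T) :
  {for p, continuous f} -> {for p, continuous g} ->
  {for p, continuous (fun q => f q + g q)}.
Proof. by move=> cf cg; apply: cvgD; [exact: cf|exact: cg]. Qed.

Lemma continuousMat (T : topologicalType) (f g : T -> R) (p : T) :
  {for p, continuous f} -> {for p, continuous g} ->
  {for p, continuous (fun q => f q * g q)}.
Proof. by move=> cf cg; apply: cvgM; [exact: cf|exact: cg]. Qed.

Lemma continuousZat (T : topologicalType) (k : R) (f : T -> R) (p : T) :
  {for p, continuous f} -> {for p, continuous (fun q => k * f q)}.
Proof. by move=> cf; apply: continuousMat => //; exact: cst_continuous. Qed.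

Lemma jet2_eq U F G f1 f2 : open U -> (forall x, U x -> F x = G x) ->
  jet2 U F f1 f2 -> jet2 U G f1 f2.
Proof.
move=> oU FG [h1 h2 h3 h4 h5]; split => //.
- by move=> x Ux; apply: near_eq_cont (h1 x Ux); exact: near_open oU Ux FG.
- move=> i x Ux; apply: near_eq_is_derive (h2 i x Ux).
  exact: near_open oU Ux FG.
Qed.

Lemma jet2_cst U (k : R) : jet2 U (fun=> k) (fun _ _ => 0) (fun _ _ _ => 0).
Proof.
split=> [x|i x|i x|i l x|i l x] _; try exact: cst_continuous.
- exact: (is_derive_cst k x (e_ i)).
- exact: (is_derive_cst 0 x (e_ l)).
Qed.

Lemma jet2D U F G f1 f2 g1 g2 : jet2 U F f1 f2 -> jet2 U G g1 g2 ->
  jet2 U (fun x => F x + G x) (fun i x => f1 i x + g1 i x)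
    (fun i k x => f2 i k x + g2 i k x).
Proof.
move=> [a1 a2 a3 a4 a5] [b1 b2 b3 b4 b5]; split.
- by move=> x Ux; apply: continuousDat; [exact: a1|exact: b1].
- by move=> i x Ux; apply: (@is_deriveD _ _ _ F G); [exact: a2|exact: b2].
- by move=> i x Ux; apply: continuousDat; [exact: a3|exact: b3].
- by move=> i k x Ux; apply: (@is_deriveD _ _ _ (f1 i) (g1 i)); [exact: a4|exact: b4].
- by move=> i k x Ux; apply: continuousDat; [exact: a5|exact: b5].
Qed.

Lemma jet2Z U F f1 f2 (k : R) : jet2 U F f1 f2 ->
  jet2 U (fun x => k * F x) (fun i x => k * f1 i x) (fun i l x => k * f2 i l x).
Proof.
move=> [a1 a2 a3 a4 a5]; split.
- by move=> x Ux; apply: continuousZat; [exact: a1].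
- by move=> i x Ux; apply: (@is_deriveZ _ _ _ F); exact: a2.
- by move=> i x Ux; apply: continuousZat; [exact: a3].
- by move=> i l x Ux; apply: (@is_deriveZ _ _ _ (f1 i)); exact: a4.
- by move=> i l x Ux; apply: continuousZat; [exact: a5].
Qed.

Section at_point.
Variables (U : set vec) (F : vec -> R).
Variables (f1 : 'I_d -> vec -> R) (f2 : 'I_d -> 'I_d -> vec -> R).
Hypotheses (oU : open U) (jF : jet2 U F f1 f2).

Lemma jet2_partial i x : U x -> 'D_(e_ i) F x = f1 i x.
Proof. by move=> Ux; have [_ <-] := jet2_d1 jF i Ux. Qed.

Lemma jet2_partial2 i k x : U x -> 'D_(e_ k) ('D_(e_ i) F) x = f2 i k x.
Proof.
move=> Ux; have [_ <-] := jet2_d2 jF i k Ux; apply: near_eq_derive.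
exact: near_open oU Ux (@jet2_partial i).
Qed.

Lemma jet2_gradient x : U x -> gradient F x = \row_i f1 i x.
Proof. by move=> Ux; apply/rowP => i; rewrite !mxE jet2_partial. Qed.

Lemma jet2_laplacian x : U x -> laplacian F x = \sum_i f2 i i x.
Proof. by move=> Ux; apply: eq_bigr => i _; exact: jet2_partial2. Qed.

Lemma jet2_C2_closure N : open N -> closure N `<=` U -> C2_closure N F.
Proof.
move=> oN NU; have sN : N `<=` U by apply: subset_trans NU; exact: subset_closure.
split.
- by apply: continuous_in_subspaceT => x /[!inE] Nx; apply: (jet2_cont jF); exact: NU.
- move=> i; split=> [x Nx|]; first by have [] := jet2_d1 jF i (sN _ Nx).
  exists (f1 i); last by move=> x /[!inE] Nx; rewrite jet2_partial//; exact: sN.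
  by apply: continuous_in_subspaceT => x /[!inE] Nx; apply: (jet2_cont1 jF); exact: NU.
- move=> i k; split=> [x Nx|].
    have [dx _] := jet2_d2 jF i k (sN _ Nx); apply: near_eq_derivable dx.
    by apply: near_open oU (sN _ Nx) _ => y Uy; rewrite jet2_partial.
  exists (f2 i k); last by move=> x /[!inE] Nx; rewrite jet2_partial2//; exact: sN.
  by apply: continuous_in_subspaceT => x /[!inE] Nx; apply: (jet2_cont2 jF); exact: NU.
Qed.

End at_point.

Lemma within_closure_for N (g : vec -> R) x : open N -> N x ->
  {within closure N, continuous g} -> {for x, continuous g}.
Proof.
move=> oN Nx /(@continuous_subspaceW _ _ _ _ _ (@subset_closure _ N)).
by rewrite continuous_open_subspace// => cg; apply: cg; rewrite inE.
Qed.

Lemma C2_closure_jet2 N F : open N -> C2_closure N F ->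
  jet2 N F (fun i => 'D_(e_ i) F) (fun i k => 'D_(e_ k) ('D_(e_ i) F)).
Proof.
move=> oN [cF c1 c2].
have ext (f : vec -> R) x (g : vec -> R) : N x -> {within closure N, continuous g} ->
    {in N, f =1 g} -> {for x, continuous f}.
  move=> Nx cg ig; apply: (@near_eq_cont g); last exact: within_closure_for cg.
  by apply: near_open oN Nx _ => y Ny; rewrite ig// inE.
split.
- by move=> x Nx; exact: within_closure_for cF.
- by move=> i x Nx; apply: derivableP; exact: (c1 i).1.
- by move=> i x Nx; have [_ [g cg ig]] := c1 i; exact: ext ig.
- by move=> i k x Nx; apply: derivableP; exact: (c2 i k).1.
- by move=> i k x Nx; have [_ [g cg ig]] := c2 i k; exact: ext ig.
Qed.

(** The clause [0 < s * t] places the intermediate point strictly on the side of t. This strictness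
    is what lets a positive second derivative contradict a maximum in [jet2_local_max]. *)
Lemma mvt_line F v (f' : vec -> R) z (t : R) :
  (forall s : R, `|s| <= `|t| -> is_derive (z + s *: v) v F (f' (z + s *: v))) ->
  exists2 s : R, `|s| <= `|t| /\ (t != 0 -> 0 < s * t) &
    F (z + t *: v) - F z = t * f' (z + s *: v).
Proof.
move=> dF; pose g s := F (z + s *: v); pose g' s := f' (z + s *: v).
have dg (s : R) : `|s| <= `|t| -> is_derive s 1 g (g' s).
  by move=> st; apply/is_derive_line; exact: dF.
have cg (a b : R) : (forall s : R, s \in `[a, b] -> `|s| <= `|t|) -> {within `[a, b], continuous g}.
  move=> st; apply: continuous_in_subspaceT => s /[!inE] sab.
  have [dgs _] := dg s (st s sab).
  exact/differentiable_continuous/derivable1_diffP.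
have g0 : g 0 = F z by rewrite /g scale0r addr0.
have [t0|t0|t0] := ltgtP 0 t.
- have b (s : R) : s \in `[0, t] -> `|s| <= `|t|.
    by rewrite in_itv/= => /andP[s0 st]; rewrite !ger0_norm// ltW.
  have dgs (s : R) : s \in `]0, t[ -> is_derive s 1 g (g' s).
    by move=> s0t; apply: dg; apply: b; exact: subset_itv_oo_cc.
  have [s st E] := MVT t0 dgs (cg _ _ b).
  exists s; last by rewrite -g0 -/(g t) E subr0 mulrC.
  split; first by apply: b; exact: subset_itv_oo_cc.
  by move=> _; move: st; rewrite in_itv/= => /andP[s0 _]; rewrite mulr_gt0.
- have b (s : R) : s \in `[t, 0] -> `|s| <= `|t|.
    rewrite in_itv/= => /andP[s0 st].
    by rewrite ler0_norm// ltr0_norm// lerN2.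
  have dgs (s : R) : s \in `]t, 0[ -> is_derive s 1 g (g' s).
    by move=> s0t; apply: dg; apply: b; exact: subset_itv_oo_cc.
  have [s st E] := MVT t0 dgs (cg _ _ b).
  exists s; last by rewrite -g0 -/(g t) -opprB E sub0r mulrN opprK mulrC.
  split; first by apply: b; exact: subset_itv_oo_cc.
  by move=> _; move: st; rewrite in_itv/= => /andP[_ s0]; rewrite nmulr_rgt0.
- exists 0; first by rewrite normr0; split; rewrite ?normr_ge0// -t0 eqxx.
  by rewrite -t0 !scale0r addr0 mul0r subrr.
Qed.

Lemma unitv_norm i : `|e_ i| = 1.
Proof.
apply/eqP; rewrite eq_le; apply/andP; split.
  by rewrite -(@enorm_unitv R d i) norm_le_enorm.
by have := coord_le_norm (e_ i) i; rewrite unitvE eqxx normr1.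
Qed.

Definition trunc_coord (m : nat) (y : vec) : vec :=
  \row_i (if (i < m)%N then y ord0 i else 0).

Lemma mx_norm_le (y : vec) (M : R) :
  0 <= M -> (forall i, `|y ord0 i| <= M) -> `|y| <= M.
Proof.
move=> M0 yM; rewrite [leLHS]mx_normrE; apply/bigmax_leP; split => //.
by move=> [i k] _ /=; rewrite ord1.
Qed.

(** The increment telescopes over [trunc_coord], which switches on one coordinate at a time, so
    partial derivatives suffice. The intermediate points stay in the max-norm ball of radius |y|
    about a, since their offsets have coordinates no larger than those of y. *)
Lemma mvt_coord F (f1 : 'I_d -> vec -> R) (a y : vec) :
  (forall i z, `|z - a| <= `|y| -> is_derive z (e_ i) F (f1 i z)) ->
  exists2 xi : 'I_d -> vec, forall i, `|xi i - a| <= `|y| &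
    F (a + y) - F a = \sum_i y ord0 i * f1 i (xi i).
Proof.
move=> dF.
have step m (im : (m < d)%N) : let i := Ordinal im in
  exists2 x, `|x - a| <= `|y| &
    F (a + trunc_coord m.+1 y) - F (a + trunc_coord m y) = y ord0 i * f1 i x.
  move=> i.
  have E s : a + trunc_coord m y + s *: e_ i - a =
      \row_k (if (k < m)%N then y ord0 k else if k == i then s else 0).
    rewrite addrAC [a + _]addrC addrK; apply/rowP => k; rewrite !mxE eqxx andTb.
    case: ifPn => [km|]; last by rewrite add0r; case: eqP => _; rewrite ?mulr1 ?mulr0.
    case: eqP => [ki|]; last by rewrite mulr0 addr0.
    by move: km; rewrite ki /= ltnn.
  have B s : `|s| <= `|y ord0 i| ->
      `|a + trunc_coord m y + s *: e_ i - a| <= `|y|.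
    move=> sy; rewrite E; apply: mx_norm_le => // k; rewrite mxE.
    case: ifP => _; first exact: coord_le_norm.
    case: ifP => _; last by rewrite normr0.
    by apply: le_trans sy _; exact: coord_le_norm.
  have [s [sy _] Es] := @mvt_line F (e_ i) (f1 i) (a + trunc_coord m y) (y ord0 i)
    (fun s sy => dF i _ (B s sy)).
  exists (a + trunc_coord m y + s *: e_ i); first exact: B.
  rewrite -Es -addrA; congr (F (a + _) - _).
  apply/rowP => k; rewrite !mxE eqxx andTb.
  have [->|ki] := eqVneq k i; first by rewrite ltnSn ltnn add0r mulr1.
  by rewrite mulr0 addr0 ltnS leq_eqVlt (negbTE (ki : (k : nat) != m)).
have /choice[g gP] : forall i : 'I_d, exists x : vec, `|x - a| <= `|y| /\
    F (a + trunc_coord i.+1 y) - F (a + trunc_coord i y) = y ord0 i * f1 i x.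
  move=> i; have [x x1 x2] := step _ (ltn_ord i); exists x; split => //.
  by rewrite x2; congr (y _ _ * f1 _ _); exact/val_inj.
exists g => [i|]; first by case: (gP i).
under eq_bigr do rewrite -(gP _).2.
rewrite -(big_mkord xpredT (fun i => F (a + trunc_coord i.+1 y) - F (a + trunc_coord i y))).
rewrite telescope_sumr//; congr (F (a + _) - F _).
  by apply/rowP => i; rewrite mxE ltn_ord.
by rewrite -[LHS]addr0; congr (a + _); apply/rowP => i; rewrite !mxE.
Qed.

End jets.

Section operator_theory.
Context {R : realType} {d : nat}.
Local Notation vec := 'rV[R]_d.
Local Notation e_ := (@unitv R d).
Implicit Types (x y z : vec) (U N : set vec) (F G : vec -> R).

Definition bnd F := exists M : R, forall y, `|F y| <= M.

Lemma bnd_cst (k : R) : bnd (fun=> k).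
Proof. by exists `|k|. Qed.

Lemma bndD F G : bnd F -> bnd G -> bnd (fun x => F x + G x).
Proof.
move=> [M FM] [M' GM]; exists (M + M') => y.
by apply: le_trans (ler_normD _ _) _; exact: lerD.
Qed.

Lemma bndZ (k : R) F : bnd F -> bnd (fun x => k * F x).
Proof. by move=> [M FM]; exists (`|k| * M) => y; rewrite normrM ler_wpM2l. Qed.

Lemma bndB F G : bnd F -> bnd G -> bnd (fun x => F x - G x).
Proof.
move=> [M FM] [M' GM]; exists (M + M') => y.
by apply: le_trans (ler_normB _ _) _; exact: lerD.
Qed.

Lemma bounded_fun_bnd F : bounded_fun F <-> bnd F.
Proof.
split=> [[M [_ MF]]|[M FM]].
  exists (`|M| + 1) => y; apply: MF => //.
  by rewrite (le_lt_trans (ler_norm M))// ltrDl.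
by exists M; split; [exact: num_real|move=> K MK y _; exact: le_trans (FM y) (ltW MK)].
Qed.

(** The integrand of the nonlocal part, with a free vector p in place of the gradient, so that it
    can be estimated for functions about which only a Taylor bound is known. *)
Definition Dlt F x (p : vec) y : R :=
  F (x + y) - F x - (enorm y <= 1)%R%:R * dotv y p.

Lemma mrV_Dlt F x p : mrV F -> mrV (Dlt F x p).
Proof.
move=> mF; apply: mrVB; first by apply: mrVB; [exact: mrV_shift|exact: mrV_cst].
apply: mrVM; first exact: mrV_indic_enorm.
by apply: mrV_continuous; exact: continuous_dotv.
Qed.

Lemma cut_dotv_le (eta : R) p y : 0 < eta -> eta <= 1 -> eta <= enorm y ->
  `|(enorm y <= 1)%R%:R * dotv y p| <= enorm p / eta ^+ 2 * mwt y.
Proof.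
move=> e0 e1 ey; have e2 : 0 < eta ^+ 2 by rewrite exprn_gt0.
have e21 : eta ^+ 2 <= 1 by rewrite exprn_ile1// ltW.
rewrite mulrAC ler_pdivlMr//.
case: (leP (enorm y) 1) => y1; rewrite ?mul1r ?mul0r; last first.
  by rewrite normr0 mul0r mulr_ge0 ?enorm_ge0 ?mwt_ge0.
apply: le_trans (ler_wpM2r (ltW e2) (dotv_le_enorm y p)) _.
rewrite mwt_small// [enorm y * _]mulrC -mulrA ler_wpM2l ?enorm_ge0//.
rewrite [enorm y ^+ 2]expr2 ler_wpM2l ?enorm_ge0//.
by apply: le_trans ey; rewrite expr2 ger_pMr.
Qed.

Lemma mwt_lower (eta : R) y : 0 < eta -> eta <= 1 -> eta <= enorm y ->
  eta ^+ 2 <= mwt y.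
Proof.
move=> e0 e1 ey; rewrite /mwt le_min exprn_ile1 ?(ltW e0)//=.
by rewrite ler_pXn2r// ?nnegrE ?enorm_ge0// ltW.
Qed.

(** Below eta the Taylor remainder is quadratic, like the weight. From eta on the weight is at least
    eta^2, so bounded terms are absorbed at the cost of a factor eta^-2. *)
Lemma Dlt_le F x p (M C eta : R) : 0 < eta -> eta <= 1 -> 0 <= C ->
  (forall y, `|F y| <= M) ->
  (forall y, enorm y < eta -> `|F (x + y) - F x - dotv y p| <= C * enorm y ^+ 2) ->
  forall y, `|Dlt F x p y| <= (C + (M + M + enorm p) / eta ^+ 2) * mwt y.
Proof.
move=> e0 e1 C0 FM FC y; have M0 : 0 <= M by apply: le_trans (FM 0).
have e2 : 0 < eta ^+ 2 by rewrite exprn_gt0.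
have [ye|ey] := ltP (enorm y) eta.
  have y1 : enorm y <= 1 by apply: le_trans e1; exact: ltW.
  rewrite /Dlt y1 mul1r; apply: le_trans (FC y ye) _.
  rewrite -(mwt_small y1) ler_wpM2r ?mwt_ge0// lerDl.
  by rewrite divr_ge0 ?(ltW e2)// !addr_ge0 ?enorm_ge0.
apply: le_trans (ler_normB _ _) _.
rewrite mulrDl -[leLHS]add0r lerD ?mulr_ge0 ?mwt_ge0// mulrDl [leRHS]mulrDl.
apply: lerD; last exact: cut_dotv_le.
have M2 : `|F (x + y) - F x| <= M + M.
  by apply: le_trans (ler_normB _ _) _; exact: lerD.
apply: le_trans M2 _; rewrite mulrAC ler_pdivlMr// ler_wpM2l ?addr_ge0//.
exact: mwt_lower.
Qed.

(** Two rounds of [mvt_coord], on F and then on each [f1 i]; each round contributes one factor d. *)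
Lemma taylor2 U F f1 f2 x (rho K : R) : jet2 U F f1 f2 ->
  (forall z, `|z - x| <= rho -> U z) ->
  (forall i k z, `|z - x| <= rho -> `|f2 i k z| <= K) ->
  forall y, `|y| <= rho ->
    `|F (x + y) - F x - dotv y (\row_i f1 i x)| <= (d%:R * d%:R * K) * enorm y ^+ 2.
Proof.
move=> jF xU fK y yr.
have [|xi xi1 ->] := @mvt_coord R d F f1 x y.
  by move=> i z zy; apply: (jet2_d1 jF); apply: xU; exact: le_trans zy yr.
rewrite /dotv -sumrB.
have K0 i : `|f1 i (xi i) - f1 i x| <= d%:R * K * `|y|.
  have H k z : `|z - x| <= `|xi i - x| -> is_derive z (e_ k) (f1 i) (f2 i k z).
    move=> zx; apply: (jet2_d2 jF); apply: xU.
    by apply: le_trans zx _; apply: le_trans (xi1 i) yr.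
  have [zeta z1] := mvt_coord H; rewrite [x + _]addrC subrK => ->.
  have -> : d%:R * K * `|y| = \sum_(k < d) `|y| * K.
    by rewrite sumr_const card_ord -mulr_natl; ring.
  apply: le_trans (ler_norm_sum _ _ _) _; apply: ler_sum => k _.
  rewrite normrM ler_pM//; first by apply: le_trans (coord_le_norm _ _) (xi1 i).
  apply: fK; apply: le_trans (z1 k) _; exact: le_trans (xi1 i) yr.
apply: (@le_trans _ _ (\sum_(i < d) enorm y * (d%:R * K * enorm y))); last first.
  by rewrite sumr_const card_ord -mulr_natl le_eqVlt; apply/orP; left; apply/eqP; ring.
apply: le_trans (ler_norm_sum _ _ _) _; apply: ler_sum => i _.
rewrite mxE -mulrBr normrM ler_pM//; first exact: coord_le_enorm.
apply: le_trans (K0 i) _.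
have dK : 0 <= d%:R * K.
  rewrite mulr_ge0//; apply: le_trans (fK i i x _) => //.
  by rewrite subrr normr0; apply: le_trans yr.
by rewrite ler_wpM2l// norm_le_enorm.
Qed.

Lemma near_cont F x (e : R) : {for x, continuous F} -> 0 < e ->
  \forall z \near x, `|F z - F x| < e.
Proof.
move=> cF e0; have /cvgrPdist_lt/(_ _ e0) : F z @[z --> x] --> F x := cF.
by apply: filterS => z; rewrite distrC.
Qed.

Lemma open_box U x : open U -> U x ->
  exists2 rho : R, 0 < rho & forall z, `|z - x| <= rho -> U z.
Proof.
move=> oU Ux; have : nbhs x U by apply: open_nbhs_nbhs; split.
move=> /nbhs_ballP[e /= e0 eU]; exists (e / 2); first by rewrite divr_gt0.
move=> z zx; apply: eU; rewrite -ball_normE/= distrC.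
by apply: le_lt_trans zx _; rewrite ltr_pdivrMr// ltr_pMr// ltr1n.
Qed.

Lemma near_box x (P : vec -> Prop) : (\forall z \near x, P z) ->
  exists2 rho : R, 0 < rho & forall z, `|z - x| <= rho -> P z.
Proof.
move=> /nbhs_ballP[e /= e0 eU]; exists (e / 2); first by rewrite divr_gt0.
move=> z zx; apply: eU; rewrite -ball_normE/= distrC.
by apply: le_lt_trans zx _; rewrite ltr_pdivrMr// ltr_pMr// ltr1n.
Qed.

Lemma closure_box x (rho : R) z : 0 < rho -> closure (ball x rho) z -> `|z - x| <= rho.
Proof.
move=> r0; rewrite -/(closed_ball x rho) closed_ballE//.
by rewrite /closed_ball_/= distrC.
Qed.

Lemma jet2_locally_bounded U F f1 f2 x : open U -> U x -> jet2 U F f1 f2 ->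
  exists rho K : R, [/\ 0 < rho, 0 <= K,
    forall z, `|z - x| <= rho -> U z &
    forall i k z, `|z - x| <= rho -> `|f2 i k z| <= K].
Proof.
move=> oU Ux jF.
have H (ik : 'I_d * 'I_d) : \forall z \near x, `|f2 ik.1 ik.2 z| <= `|f2 ik.1 ik.2 x| + 1.
  have cf : {for x, continuous (f2 ik.1 ik.2)} by exact: (jet2_cont2 jF).
  have := near_cont cf ltr01; apply: filterS => z zx.
  by rewrite -lerBlDl; apply: le_trans (ltW zx); exact: lerB_dist.
have [r0 r00 r0U] := open_box oU Ux.
have {}H : \forall z \near x, forall ik : 'I_d * 'I_d,
    `|f2 ik.1 ik.2 z| <= `|f2 ik.1 ik.2 x| + 1.
  exact: (@filter_forall _ _ (fun (ik : 'I_d * 'I_d) z =>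
    `|f2 ik.1 ik.2 z| <= `|f2 ik.1 ik.2 x| + 1) (nbhs x) _ H).
have [r1 r10 r1U] := near_box H.
exists (Num.min r0 r1), (\sum_(ik : 'I_d * 'I_d) (`|f2 ik.1 ik.2 x| + 1)); split.
- by rewrite lt_min r00.
- by apply: sumr_ge0 => ik _; rewrite addr_ge0.
- by move=> z; rewrite le_min => /andP[/r0U].
- move=> i k z; rewrite le_min => /andP[_ /r1U /(_ (i, k))/= zk].
  apply: le_trans zk _; rewrite (bigD1 (i, k))//= lerDl.
  by apply: sumr_ge0 => ik _; rewrite addr_ge0.
Qed.

(** One constant serves every centre z near x. This is what domination along moving contact points
    requires in [visc_sum_approx]. *)
Lemma taylor2_local U F f1 f2 x : open U -> U x -> jet2 U F f1 f2 ->
  exists rho K : R, [/\ 0 < rho, 0 <= K,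
    forall z, `|z - x| <= rho -> U z,
    forall i z, `|z - x| <= rho -> `|f1 i z| <= K &
    forall z, `|z - x| <= rho -> forall y, `|y| <= rho ->
     `|F (z + y) - F z - dotv y (\row_i f1 i z)| <= K * enorm y ^+ 2].
Proof.
move=> oU Ux jF; have [rho [K [r0 K0 rU fK]]] := jet2_locally_bounded oU Ux jF.
have H (i : 'I_d) : \forall z \near x, `|f1 i z| <= `|f1 i x| + 1.
  have cf : {for x, continuous (f1 i)} by exact: (jet2_cont1 jF).
  have := near_cont cf ltr01; apply: filterS => z zx.
  by rewrite -lerBlDl; apply: le_trans (ltW zx); exact: lerB_dist.
have {}H : \forall z \near x, forall i, `|f1 i z| <= `|f1 i x| + 1.
  exact: (@filter_forall _ _ (fun i z => `|f1 i z| <= `|f1 i x| + 1) (nbhs x) _ H).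
have [r1 r10 r1U] := near_box H.
have S0 : 0 <= \sum_i (`|f1 i x| + 1) by apply: sumr_ge0 => i _; rewrite addr_ge0.
have dK0 : 0 <= d%:R * d%:R * K by rewrite !mulr_ge0.
exists (Num.min (rho / 2) r1), (d%:R * d%:R * K + \sum_i (`|f1 i x| + 1)); split.
- by rewrite lt_min r10 divr_gt0.
- by rewrite addr_ge0.
- move=> z; rewrite le_min => /andP[zr _]; apply: rU; apply: le_trans zr _.
  by rewrite ler_pdivrMr// ler_pMr// ler1n.
- move=> i z; rewrite le_min => /andP[_ /r1U /(_ i) zk].
  apply: le_trans zk _; rewrite ler_wpDl// (bigD1 i)//= lerDl.
  by apply: sumr_ge0 => k _; rewrite addr_ge0.
- move=> z; rewrite le_min => /andP[zr _] y; rewrite le_min => /andP[yr _].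
  have zz w : `|w - z| <= rho / 2 -> `|w - x| <= rho.
    move=> wz; rewrite -(subrK z w) -addrA [leRHS](splitr rho).
    by apply: le_trans (ler_normD _ _) _; exact: lerD.
  have := @taylor2 U F f1 f2 z (rho / 2) K jF (fun w h => rU w (zz w h))
    (fun i k w h => fK i k w (zz w h)) y yr.
  by move=> /le_trans; apply; rewrite ler_wpM2r ?sqr_ge0// lerDl.
Qed.

Lemma mrV_patch F N G : open N -> (forall x, N x -> {for x, continuous G}) ->
  mrV F -> mrV (patch F N G).
Proof.
move=> oN cG mF; apply: (measurability _ (RGenOpens.measurableE R)).
move=> _ [_ [a [b ->] <-]]; rewrite setTI.
have -> : patch F N G @^-1` `]a, b[%classic =
  (N `&` G @^-1` `]a, b[%classic) `|` (~` N `&` F @^-1` `]a, b[%classic).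
  apply/seteqP; split => x /=; rewrite /patch.
    by case: ifPn => [/set_mem Nx Gx|/negP Nx Fx]; [left|right; split => // /mem_set].
  by move=> [[Nx Gx]|[Nx Fx]]; [rewrite mem_set|rewrite memNset].
apply: measurableU.
  apply: mrV_open; rewrite openE => x [Nx Gx].
  have nG : nbhs x (G @^-1` `]a, b[%classic).
    by apply: (cG x Nx); apply: open_nbhs_nbhs; split => //; exact: interval_open.
  by apply: filterI => //; apply: open_nbhs_nbhs; split.
apply: measurableI; first by apply: measurableC; exact: mrV_open.
by rewrite -[X in measurable X]setTI; apply: mF => //; exact: measurable_itv.
Qed.

Variable j : vec -> R.
Hypothesis hj : levy_density j.

Lemma Lop_jet U F f1 f2 x : open U -> U x -> jet2 U F f1 f2 ->
  Lop j F x = \sum_i f2 i i x + Ij j (Dlt F x (\row_i f1 i x)).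
Proof.
move=> oU Ux jF; rewrite /Lop (jet2_laplacian oU jF Ux).
by rewrite (jet2_gradient jF Ux).
Qed.

Lemma adm_Dlt_jet U F f1 f2 x : open U -> U x -> jet2 U F f1 f2 ->
  mrV F -> bnd F -> adm (Dlt F x (\row_i f1 i x)).
Proof.
move=> oU Ux jF mF [M FM]; have [rho [K [r0 K0 rU f1K TK]]] := taylor2_local oU Ux jF.
have e0 : 0 < Num.min rho 1 by rewrite lt_min r0 ltr01.
apply: adm_le (mrV_Dlt x _ mF) (@Dlt_le F x _ M K (Num.min rho 1) e0 _ K0 FM _).
  by rewrite ge_min lexx orbT.
move=> y yr; apply: TK; first by rewrite subrr normr0 ltW.
apply: le_trans (norm_le_enorm y) _; apply: ltW; apply: lt_le_trans yr _.
by rewrite ge_min lexx.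
Qed.

(** Equality near x makes the derivatives at x agree, so only the nonlocal terms remain to be
    compared. *)
Lemma le_Lop U F G f1 f2 x : open U -> U x -> jet2 U F f1 f2 ->
  mrV F -> bnd F -> mrV G -> bnd G ->
  (forall y, U y -> F y = G y) -> (forall y, F y <= G y) ->
  Lop j F x <= Lop j G x.
Proof.
move=> oU Ux jF mF bF mG bG FG leFG; have jG := jet2_eq oU FG jF.
rewrite (Lop_jet oU Ux jF) (Lop_jet oU Ux jG) lerD2l.
apply: le_Ij => //; [exact: adm_Dlt_jet jF mF bF|exact: adm_Dlt_jet jG mG bG|].
by move=> y; rewrite /Dlt (FG x Ux) !lerD2r.
Qed.

Lemma LopZ U F f1 f2 (k : R) x : open U -> U x -> jet2 U F f1 f2 ->
  mrV F -> bnd F -> Lop j (fun y => k * F y) x = k * Lop j F x.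
Proof.
move=> oU Ux jF mF bF; rewrite (Lop_jet oU Ux (jet2Z k jF)) (Lop_jet oU Ux jF).
rewrite mulrDr mulr_sumr; congr (_ + _); rewrite -IjZ//; last exact: adm_Dlt_jet jF mF bF.
congr (Ij _ _); apply/funext => y; rewrite /Dlt !mulrBr; congr (_ - _).
rewrite mulrCA; congr (_ * _); rewrite /dotv mulr_sumr; apply: eq_bigr => i _.
by rewrite !mxE mulrCA.
Qed.

Lemma LopD U F G f1 f2 g1 g2 x : open U -> U x -> jet2 U F f1 f2 ->
  jet2 U G g1 g2 -> mrV F -> bnd F -> mrV G -> bnd G ->
  Lop j (fun y => F y + G y) x = Lop j F x + Lop j G x.
Proof.
move=> oU Ux jF jG mF bF mG bG.
rewrite (Lop_jet oU Ux (jet2D jF jG)) (Lop_jet oU Ux jF) (Lop_jet oU Ux jG).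
rewrite addrACA big_split/= -IjD//; [|exact: adm_Dlt_jet jF mF bF|exact: adm_Dlt_jet jG mG bG].
congr (_ + Ij _ _); apply/funext => y; rewrite /Dlt.
have -> : dotv y (\row_i (f1 i x + g1 i x)) =
    dotv y (\row_i f1 i x) + dotv y (\row_i g1 i x).
  by rewrite -dotvDr; congr dotv; apply/rowP => i; rewrite !mxE.
by rewrite mulrDr; ring.
Qed.

Lemma Lop_cst (k : R) x : Lop j (fun=> k) x = 0.
Proof.
rewrite (Lop_jet openT I (jet2_cst setT k)) big1// add0r -[RHS](Ij0 hj).
congr (Ij _ _); apply/funext => y; rewrite /Dlt subrr sub0r.
by rewrite /dotv big1 ?mulr0 ?oppr0// => i _; rewrite mxE mulr0.
Qed.

(** Frees the viscosity definition from patching. If Q touches v from below up to a constant, then Q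
    plus that constant is an admissible test function on a small ball; replacing it by v off the
    ball only raises L at x0, and L annihilates constants. *)
Lemma visc_supersol_touch (D U : set vec) v f Q q1 q2 x0 :
  open D -> D x0 -> open U -> U x0 -> jet2 U Q q1 q2 -> mrV Q -> bnd Q ->
  visc_supersol j D v f -> (forall y, v x0 - Q x0 <= v y - Q y) ->
  Lop j Q x0 <= f x0.
Proof.
move=> oD Dx oU Ux jQ mQ bQ [mv bv _ vf] vQ.
have [rho r0 rDU] := open_box (openI oD oU) (conj Dx Ux).
pose N := ball x0 rho; pose k := v x0 - Q x0; pose phi y := Q y + k.
have oN : open N by exact: ball_open.
have Nx : N x0 by exact: ballxx.
have NDU y : closure N y -> D y /\ U y by move=> /(closure_box r0)/rDU.
have NU : N `<=` U by move=> y Ny; case: (NDU y) => //; exact: subset_closure.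
have jphi : jet2 U phi (fun i x => q1 i x + 0) (fun i l x => q2 i l x + 0).
  by apply: jet2D => //; exact: jet2_cst.
have bphi : bnd phi by apply: bndD => //; exact: bnd_cst.
have mphi : mrV phi by apply: mrVD => //; exact: mrV_cst.
have mp : mrV (patch v N phi).
  by apply: mrV_patch => // y Ny; apply: (jet2_cont jphi); exact: NU.
have bp : bnd (patch v N phi).
  move/bounded_fun_bnd : bv => [M vM]; case: bphi => M' pM.
  exists (`|M| + `|M'|) => y; rewrite /patch; case: ifP => _.
    by apply: le_trans (pM y) _; rewrite ler_wpDl// ler_norm.
  by apply: le_trans (vM y) _; rewrite ler_wpDr// ler_norm.
have <- : Lop j phi x0 = Lop j Q x0.
  rewrite (LopD oU Ux jQ (jet2_cst U k))//; [|exact: mrV_cst|exact: bnd_cst].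
  by rewrite Lop_cst addr0.
apply: (@le_trans _ _ (Lop j (patch v N phi) x0)).
  apply: (@le_Lop N _ _ _ _ _ oN Nx (jet2_sub NU jphi)) => //.
    by move=> y Ny; rewrite /patch mem_set.
  move=> y; rewrite /patch; case: ifP => // _.
  by rewrite /phi /k -lerBrDl; exact: vQ.
apply: vf => //.
- by split => // y Ny; case: (NDU y) => //; exact: subset_closure.
- by apply: (jet2_C2_closure oU jphi) => // y /NDU[].
- by move=> y _; rewrite /phi /k subr_le0 -lerBrDl; exact: vQ.
- by rewrite /phi /k; ring.
Qed.

End operator_theory.

(** * Gaussian estimates and the exterior-sphere barrier *)
Section gaussian.
Context {R : realType} {d : nat}.
Local Notation vec := 'rV[R]_d.
Local Notation e_ := (@unitv R d).
Implicit Types (x y z : vec).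

Definition gs (a : R) z x : R := expR (- a * dotv (x - z) (x - z)).

Definition gs1 (a : R) z (i : 'I_d) x : R := (- (2 * a)) * ((x - z) ord0 i * gs a z x).

Definition gs2 (a : R) z (i k : 'I_d) x : R :=
  (- (2 * a)) * ((i == k)%:R * gs a z x + (x - z) ord0 i * gs1 a z k x).

(** Third derivative in a single direction; it controls the error of second differences in
    [reg_affine_gs]. *)
Definition gs3 (a : R) z (i : 'I_d) x : R :=
  (- (2 * a)) * (gs1 a z i x + (gs1 a z i x + (x - z) ord0 i * gs2 a z i i x)).

Lemma gs_gt0 a z x : 0 < gs a z x.
Proof. exact: expR_gt0. Qed.

Lemma gs_le1 a z x : 0 <= a -> gs a z x <= 1.
Proof. by move=> a0; rewrite -expR0 ler_expR mulNr oppr_le0 mulr_ge0// dotvv_ge0. Qed.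

Lemma dotv_unitv x i : dotv x (e_ i) = x ord0 i.
Proof.
rewrite /dotv (bigD1 i)//= unitvE eqxx mulr1 big1 ?addr0// => k ki.
by rewrite unitvE (negbTE ki) mulr0.
Qed.

Lemma dotvv_add x y : dotv (x + y) (x + y) = dotv x x + 2 * dotv y x + dotv y y.
Proof. by rewrite !(dotvDl, dotvDr) (dotvC x y); ring. Qed.

Lemma is_derive_gs a z x i : is_derive x (e_ i) (gs a z) (gs1 a z i x).
Proof.
apply: is_derive_line0.
pose w := x - z; pose A := dotv w w; pose B := w ord0 i.
have -> : (fun s : R => gs a z (x + s *: e_ i)) =
    expR \o (fun s : R => - a * A + (- (2 * a) * B) * s + (- a) * s ^+ 2).
  apply/funext => s; rewrite /gs /=; congr expR.
  rewrite addrAC dotvv_add !(dotvZl, dotvZr) (dotvC (e_ i)) !dotv_unitv.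
  by rewrite unitvE eqxx /= -/A -/B; ring.
have H : is_derive (0 : R) 1 (fun s : R => - a * A + (- (2 * a) * B) * s + (- a) * s ^+ 2)
   (- (2 * a) * B).
  by apply: is_derive_eq; rewrite -![_ *: _]/(_ * _); ring.
apply: is_derive_eq.
by rewrite mulr0 expr0n/= mulr0 !addr0 /gs1 /gs -/w -/A; rewrite mulrC mulrA.
Qed.

Lemma is_derive_coordB z x i k : is_derive x (e_ k) (fun x => (x - z) ord0 i) (i == k)%:R.
Proof.
apply: is_derive_line0.
have -> : (fun s : R => (x + s *: e_ k - z) ord0 i) =
    fun s : R => (x - z) ord0 i + (i == k)%:R * s.
  by apply/funext => s; rewrite !mxE eqxx/=; ring.
by apply: is_derive_eq; rewrite -![_ *: _]/(_ * _); ring.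
Qed.

Lemma is_derive_scaleM (f g : vec -> R) x v (k df dg : R) :
  is_derive x v f df -> is_derive x v g dg ->
  is_derive x v (fun x => k * (f x * g x)) (k * (df * g x + f x * dg)).
Proof.
move=> hf hg; have h : is_derive x v (k \*: (f * g)) (k *: (f x *: dg + g x *: df)).
  exact: is_deriveZ.
apply: (is_derive_eq h); rewrite -![_ *: _]/(_ * _); ring.
Qed.

Lemma is_derive_gs1 a z x i k : is_derive x (e_ k) (gs1 a z i) (gs2 a z i k x).
Proof. by apply: is_derive_scaleM; [exact: is_derive_coordB|exact: is_derive_gs]. Qed.

Lemma is_derive_gs2 a z x i : is_derive x (e_ i) (gs2 a z i i) (gs3 a z i x).
Proof.
have h1 := @is_derive_scaleM _ _ x (e_ i) (- (2 * a)) _ _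
  (is_derive_coordB z x i i) (is_derive_gs1 a z x i i).
have h2 := @is_deriveZ _ _ _ (gs a z) (- (2 * a)) x (e_ i) _ (is_derive_gs a z x i).
have h3 := @is_deriveD _ _ _ _ _ _ _ _ _ h2 h1.
have -> : gs2 a z i i = (- (2 * a) \*: gs a z) +
    (fun x0 => - (2 * a) * ((x0 - z) ord0 i * gs1 a z i x0)).
  by apply/funext => y; rewrite /gs2 eqxx mul1r mulrDr.
apply: (is_derive_eq h3).
by rewrite -[_ *: _]/(_ * _) eqxx mul1r /gs3 !mulrDr.
Qed.

Lemma continuous_coordB z i : continuous (fun x => (x - z) ord0 i).
Proof.
rewrite (_ : (fun _ => _) = fun x : vec => x ord0 i - z ord0 i); last first.
  by apply/funext => x; rewrite !mxE.
by apply: continuousBf; [exact: continuous_coord|exact: continuous_cstf].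
Qed.

Lemma continuous_gs a z : continuous (gs a z).
Proof.
apply: (@continuous_compf _ 'rV[R]_d (fun x => - a * dotv (x - z) (x - z))).
  apply: continuousZf; apply: continuous_sumf => i.
  by apply: continuousMf; exact: continuous_coordB.
exact: continuous_expR.
Qed.

Lemma continuous_gs1 a z i : continuous (gs1 a z i).
Proof.
apply: continuousZf; apply: continuousMf; first exact: continuous_coordB.
exact: continuous_gs.
Qed.

Lemma continuous_gs2 a z i k : continuous (gs2 a z i k).
Proof.
apply: continuousZf; apply: continuousDf; first by apply: continuousZf; exact: continuous_gs.
by apply: continuousMf; [exact: continuous_coordB|exact: continuous_gs1].
Qed.

Lemma jet2_gs U a z : jet2 U (gs a z) (gs1 a z) (gs2 a z).
Proof.
split=> [x _|i x _|i x _|i k x _|i k x _].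
- exact: continuous_gs.
- exact: is_derive_gs.
- exact: continuous_gs1.
- exact: is_derive_gs1.
- exact: continuous_gs2.
Qed.

Lemma sum_gs2 a z x :
  \sum_i gs2 a z i i x = (4 * a ^+ 2 * enorm (x - z) ^+ 2 - 2 * d%:R * a) * gs a z x.
Proof.
rewrite sqr_enorm /dotv.
have E i : gs2 a z i i x = - (2 * a) * gs a z x +
   (4 * a ^+ 2 * gs a z x) * ((x - z) ord0 i * (x - z) ord0 i).
  by rewrite /gs2 /gs1 eqxx mul1r; ring.
rewrite (eq_bigr _ (fun i _ => E i)) big_split/= sumr_const card_ord -mulr_sumr.
by rewrite -[X in X + _]mulr_natl; ring.
Qed.

Lemma row_gs1 a z x : \row_i gs1 a z i x = - (2 * a * gs a z x) *: (x - z).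
Proof. by apply/rowP => i; rewrite !mxE /gs1 !mxE; ring. Qed.

Lemma gsD a z x y :
  gs a z (x + y) = gs a z x * expR (- a * (2 * dotv y (x - z) + enorm y ^+ 2)).
Proof.
rewrite /gs -expRD; congr expR; have -> : x + y - z = (x - z) + y by rewrite addrAC.
by rewrite sqr_enorm dotvv_add; ring.
Qed.

(** Integrated against [j], [tail] gives the mass of the long jumps, and [moment] bounds the drift
    that the compensator produces from the jumps between eta and 1. Both may blow up as eta tends to
    0. *)
Definition tail (eta : R) y : R := (eta < enorm y)%R%:R.
Definition moment (eta : R) y : R := ((eta < enorm y) && (enorm y <= 1))%R%:R * enorm y.

Lemma mrV_tail eta : mrV (tail eta).
Proof.
rewrite (_ : tail eta = fun y : vec => 1 - (enorm y <= eta)%R%:R).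
  by apply: mrVB; [exact: mrV_cst|exact: mrV_indic_enorm].
by apply/funext => y; rewrite /tail ltNge; case: (enorm y <= eta); rewrite ?subrr ?subr0.
Qed.

Lemma mrV_moment eta : mrV (moment eta).
Proof.
apply: mrVM; last exact: mrV_enorm.
rewrite (_ : (fun _ => _) = fun y : vec => tail eta y * (enorm y <= 1)%R%:R).
  by apply: mrVM; [exact: mrV_tail|exact: mrV_indic_enorm].
by apply/funext => y; rewrite /tail -natrM mulnb.
Qed.

Lemma tail_le eta y : 0 < eta -> eta <= 1 -> eta ^+ 2 * tail eta y <= mwt y.
Proof.
move=> e0 e1; rewrite /tail; case: ltP => ey; last by rewrite mulr0 mwt_ge0.
by rewrite mulr1; apply: mwt_lower => //; exact: ltW.
Qed.

Lemma moment_le eta y : 0 < eta -> eta <= 1 -> eta * moment eta y <= mwt y.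
Proof.
move=> e0 e1; rewrite /moment; case: ltP => ey /=; last by rewrite mul0r mulr0 mwt_ge0.
case: (leP (enorm y) 1) => y1 /=; last by rewrite mul0r mulr0 mwt_ge0.
by rewrite mul1r mwt_small// expr2 ler_wpM2r ?enorm_ge0// ltW.
Qed.

Lemma tail_ge0 eta y : 0 <= tail eta y.
Proof. by rewrite /tail ler0n. Qed.

Lemma moment_ge0 eta y : 0 <= moment eta y.
Proof. by rewrite mulr_ge0 ?enorm_ge0// ler0n. Qed.

Lemma adm_tail eta : 0 < eta -> eta <= 1 -> adm (tail eta).
Proof.
move=> e0 e1; apply: (@adm_le _ _ (eta ^- 2)); first exact: mrV_tail.
move=> y; rewrite ger0_norm ?tail_ge0// ler_pdivlMl ?exprn_gt0//.
exact: tail_le.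
Qed.

Lemma adm_moment eta : 0 < eta -> eta <= 1 -> adm (moment eta).
Proof.
move=> e0 e1; apply: (@adm_le _ _ (eta^-1)); first exact: mrV_moment.
move=> y; rewrite ger0_norm ?moment_ge0// ler_pdivlMl//.
exact: moment_le.
Qed.

Variable j : vec -> R.
Hypothesis hj : levy_density j.

Let nu eta := Ij j (tail eta).
Let mm eta := Ij j (moment eta).

(** After scaling by eta^2 and eta, both integrands lie below the Lévy weight and tend to 0
    pointwise, so dominated convergence applies. This replaces any quantitative assumption on [j]
    near the origin. *)
Lemma nu_mm_small (e : R) : 0 < e ->
  exists n0, forall n, (n0 <= n)%N ->
    (n.+1%:R : R) ^- 2 * nu n.+1%:R^-1 <= e /\ (n.+1%:R : R)^-1 * mm n.+1%:R^-1 <= e.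
Proof.
move=> e0; pose et n : R := n.+1%:R^-1.
have et0 n : 0 < et n by rewrite invr_gt0.
have et1 n : et n <= 1 by rewrite invf_le1// ler1n.
pose F n y := et n ^+ 2 * tail (et n) y + et n * moment (et n) y.
have F0 n y : 0 <= F n y.
  by rewrite addr_ge0// mulr_ge0 ?tail_ge0 ?moment_ge0 ?exprn_ge0 ?(ltW (et0 _)).
have aF n : adm (F n).
  by apply: admD; apply: admZ; [exact: adm_tail|exact: adm_moment].
have cF : Ij j (F n) @[n --> \oo] --> Ij j (fun=> 0).
  apply: (Ij_cvg hj (C := 2)).
  - by move=> n; case: (aF n).
  - exact: mrV_cst.
  - move=> n y; rewrite ger0_norm// mulrDl mul1r.
    by apply: lerD; [exact: tail_le|exact: moment_le].
  - move=> y; apply/cvgrPdist_le => eps eps0.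
    near=> n; rewrite sub0r normrN ger0_norm//.
    have : et n <= eps / 2.
      near: n; have := @cvg_harmonic R.
      move=> /cvgrPdist_le/(_ _ (divr_gt0 eps0 (ltr0Sn R 1))).
      by apply: filterS => n; rewrite sub0r normrN ger0_norm// ltW// /harmonic/= invr_gt0.
    move=> h; rewrite (splitr eps) lerD//.
      apply: le_trans h; rewrite /tail; case: ltP => _; rewrite ?mulr0 ?(ltW (et0 n))//.
      by rewrite mulr1 expr2 ger_pMr.
    apply: le_trans h; rewrite ger_pMr// /moment; case: ltP => _ /=; rewrite ?mul0r ?ler01//.
    by case: (leP (enorm y) 1) => // y1; rewrite ?mul1r ?mul0r ?ler01.
have {cF}/cvgrPdist_le/(_ e e0)[n0 _ Hn] := cF.
exists n0 => n nn; have := Hn n nn; rewrite (Ij0 hj) sub0r normrN.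
move=> /(le_trans (ler_norm _)).
rewrite (IjD hj); [|by apply: admZ; exact: adm_tail|by apply: admZ; exact: adm_moment].
rewrite !(IjZ hj); [|exact: adm_moment|exact: adm_tail].
have n1 : 0 <= et n ^+ 2 * Ij j (tail (et n)).
  rewrite mulr_ge0 ?exprn_ge0 ?(ltW (et0 n))//; apply: (Ij_ge0 hj); first exact: adm_tail.
  exact: tail_ge0.
have n2 : 0 <= et n * Ij j (moment (et n)).
  rewrite mulr_ge0 ?(ltW (et0 n))//; apply: (Ij_ge0 hj); first exact: adm_moment.
  exact: moment_ge0.
rewrite -exprVn /nu /mm -/(et n) => h; split; apply: le_trans h.
  by rewrite lerDl.
by rewrite lerDr.
Unshelve. all: by end_near. Qed.

(* On |y| <= eta use exp t >= 1 + t; for larger jumps F >= 0 leaves only the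
   value and gradient terms at x, integrated against the tail of j. *)
Lemma gauss_Dlt (F : vec -> R) (a b eta : R) z x :
  mrV F -> (forall y, 0 <= F y) -> 0 <= a -> 0 < eta -> eta <= 1 ->
  (forall y, enorm y <= eta -> F (x + y) = b * gs a z (x + y)) ->
  adm (Dlt F x (- (2 * a * F x) *: (x - z))) ->
  - (F x * (a * Lam j + nu eta + 2 * a * enorm (x - z) * mm eta)) <=
  Ij j (Dlt F x (- (2 * a * F x) *: (x - z))).
Proof.
move=> mF F0 a0 e0 e1 Fg aD.
have Fx : F x = b * gs a z x by rewrite -[x]addr0 Fg// enorm0 ltW.
pose G y := - F x * (a * mwt y + tail eta y + 2 * a * enorm (x - z) * moment eta y).
have aG : adm G.
  apply: admZ; apply: admD; last by apply: admZ; exact: adm_moment.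
  by apply: admD; [apply: admZ; exact: adm_mwt|exact: adm_tail].
have -> : - (F x * (a * Lam j + nu eta + 2 * a * enorm (x - z) * mm eta)) = Ij j G.
  rewrite (IjZ hj); last first.
    apply: admD; last by apply: admZ; exact: adm_moment.
    by apply: admD; [apply: admZ; exact: adm_mwt|exact: adm_tail].
  rewrite (IjD hj); [|apply: admD|by apply: admZ; exact: adm_moment].
  - rewrite (IjD hj); [|by apply: admZ; exact: adm_mwt|exact: adm_tail].
    by rewrite !(IjZ hj) ?mulNr//; [exact: adm_moment|exact: adm_mwt].
  - by apply: admZ; exact: adm_mwt.
  - exact: adm_tail.
apply: (le_Ij hj) => // y; rewrite /G /Dlt dotvZr.
have [ye|ey] := leP (enorm y) eta.
  have y1 : enorm y <= 1 by exact: le_trans ye e1.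
  rewrite Fg// gsD mulrA -Fx y1 mul1r mwt_small// /tail /moment ltNge ye /= mul0r mulr0 !addr0.
  have := expR_ge1Dx (- a * (2 * dotv y (x - z) + enorm y ^+ 2)).
  move=> /(ler_wpM2l (F0 x)); lra.
rewrite /tail /moment ey /=.
have h1 := F0 (x + y); have h2 := mulr_ge0 a0 (mwt_ge0 y).
have h3 := F0 x; have h4 := mulr_ge0 h3 h2.
case: (leP (enorm y) 1) => y1; rewrite ?mul1r ?mul0r; last by lra.
have h5 : - (dotv y (x - z)) <= enorm y * enorm (x - z).
  by apply: le_trans (ler_norm _) _; rewrite normrN; exact: dotv_le_enorm.
have h6 : 0 <= 2 * a * F x by rewrite !mulr_ge0.
have := ler_wpM2l h6 h5; lra.
Qed.

End gaussian.

Section barrier.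
Context {R : realType} {d : nat}.
Local Notation vec := 'rV[R]_d.
Implicit Types (x y z : vec).

Lemma small_inv (e : R) : 0 < e ->
  exists n0, forall n, (n0 <= n)%N -> (n.+1%:R : R)^-1 <= e.
Proof.
move=> e0; exists (Num.truncn e^-1) => n nn.
rewrite -[leRHS]invrK lef_pV2 ?posrE ?invr_gt0//.
by apply: ltW; apply: lt_le_trans (truncnS_gt _) _; rewrite ler_nat.
Qed.

Lemma enorm_shift x y z : enorm (x - z) <= enorm (x + y - z) + enorm y.
Proof.
have {1}-> : x - z = x + y - z - y by rewrite [x + y - z]addrAC addrK.
by rewrite -[enorm y]enormN ler_enormD.
Qed.

Definition chi (a b : R) z x : R := Num.max 0 (1 - b * gs a z x).

Lemma chi_ge0 a b z x : 0 <= chi a b z x.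
Proof. by rewrite /chi le_max lexx. Qed.

Lemma chi_le1 a b z x : 0 <= b -> chi a b z x <= 1.
Proof. by move=> b0; rewrite /chi ge_max ler01 gerBl mulr_ge0// ltW// gs_gt0. Qed.

Lemma chi_bnd a b z : 0 <= b -> bnd (chi a b z).
Proof. by move=> b0; exists 1 => x; rewrite ger0_norm ?chi_ge0 ?chi_le1. Qed.

Lemma chi_continuous a b z : continuous (chi a b z).
Proof.
have -> : chi a b z = fun x => (`|1 - b * gs a z x| + (1 - b * gs a z x)) / 2.
  apply/funext => x; rewrite /chi; set t := 1 - _.
  have [t0|t0] := leP 0 t; first by rewrite ger0_norm// mulrDl -splitr.
  by rewrite ltr0_norm// addNr mul0r.
apply: continuousMf; last exact: continuous_cstf.
have cg : continuous (fun x => 1 - b * gs a z x).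
  by apply: continuousBf; [exact: continuous_cstf|apply: continuousZf; exact: continuous_gs].
apply: continuousDf => //; apply: continuous_compf => //; exact: norm_continuous.
Qed.

Definition dchi (a b : R) z x : vec := \row_i (- b * gs1 a z i x).

Variable j : vec -> R.
Hypothesis hj : levy_density j.

(* The Gaussian is centred at the centre of the exterior ball but cut at a
   radius slightly smaller than r, with a width of order of that gap; the
   Laplacian then beats the jumps, since eta ^ 2 nu(|y| > eta) -> 0 as eta -> 0. *)
Lemma barrier (r K tau : R) : 0 < r -> 0 < tau -> tau <= 1 ->
  exists a b del del' eta c0 : R,
  [/\ [/\ 0 <= a, 0 < b, 0 < del, 0 < del' & del' < del] /\
      [/\ 0 < eta, eta <= 1, 0 < c0, c0 <= 1 & del <= 1],
      forall z x y, r <= enorm (x - z) -> enorm y <= eta ->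
        chi a b z (x + y) = 1 - b * gs a z (x + y),
      forall z x, r <= enorm (x - z) -> enorm (x - z) <= r + del ->
        \sum_i (- b * gs2 a z i i x) + Ij j (Dlt (chi a b z) x (dchi a b z x)) <= - K,
      forall z x, r + del <= enorm (x - z) -> c0 <= chi a b z x &
      (forall z x, enorm (x - z) < r + del -> chi a b z x < c0) /\
      (forall z x, enorm (x - z) <= r + del' -> chi a b z x <= tau * c0)].
Proof.
move=> r0 t0 t1.
pose q := r / (2 * r + 1); have q0 : 0 < q by rewrite divr_gt0// addr_gt0// mulr_gt0.
pose c1 := 1 - expR (- q).
have c10 : 0 < c1 by rewrite subr_gt0 -expR0 ltr_expR oppr_lt0.
have c11 : c1 <= 1 by rewrite gerBl expR_ge0.
(* The ratio of the layer width del to the scale eta: at distance eta from the ball the barrier has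
   to be at most tau times its value at distance del. *)
pose M0 := (tau * c1)^-1.
have tc : 0 < tau * c1 by rewrite mulr_gt0.
have M01 : 1 <= M0 by rewrite -invr1 lef_pV2 ?posrE// mulr_ile1// ltW.
have M00 : 0 < M0 by rewrite invr_gt0.
have r21 : 0 < 2 * r + 1 by rewrite addr_gt0// mulr_gt0.
(* With a = A / eta and del = M0 eta, the product a del = A M0 is free of eta. For this A the
   exponent of the Gaussian changes, between the radii rr and r + del, by at least q and at most 1.
   The first bound gives the height c1 of the barrier, the second keeps the Gaussian above 1/e in
   the layer. *)
pose A := (2 * M0 * (2 * r + 1))^-1.
have A0 : 0 < A by rewrite invr_gt0 !mulr_gt0.
have AM : A * M0 * (2 * (2 * r + 1)) = 1.
  by rewrite /A; field; rewrite !gt_eqF.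
have Ar : 0 < A ^+ 2 * r ^+ 2 by rewrite mulr_gt0 ?exprn_gt0.
have L0 := Lam_ge0 hj.
have d0 : 0 <= d%:R :> R by [].
pose E1 := expR 1 : R; have E10 : 0 < E1 by exact: expR_gt0.
have den : 0 < 1 + 2 * A * (r + 1) by rewrite addr_gt0// !mulr_gt0// addr_gt0.
have [n0 Hn0] := nu_mm_small hj (divr_gt0 Ar den).
have e10 : 0 < r / 2 by rewrite divr_gt0.
have e20 : 0 < A * r ^+ 2 / (2 * d%:R + Lam j + 1).
  rewrite divr_gt0 ?mulr_gt0 ?exprn_gt0//.
  by rewrite ltr_wpDl// addr_ge0// mulr_ge0.
have e30 : 0 < A ^+ 2 * r ^+ 2 / (`|K| * E1 + 1).
  by rewrite divr_gt0// ltr_wpDl// mulr_ge0// ltW.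
have M0i : 0 < (2 * M0)^-1 by rewrite invr_gt0 mulr_gt0.
have [n1 Hn1] := small_inv e10; have [n2 Hn2] := small_inv e20.
have [n3 Hn3] := small_inv e30; have [n4 Hn4] := small_inv M0i.
pose n := maxn n0 (maxn n1 (maxn n2 (maxn n3 n4))).
have nn0 : (n0 <= n)%N by rewrite leq_maxl.
have nn1 : (n1 <= n)%N by rewrite /n !leq_max leqnn !orbT.
have nn2 : (n2 <= n)%N by rewrite /n !leq_max leqnn !orbT.
have nn3 : (n3 <= n)%N by rewrite /n !leq_max leqnn !orbT.
have nn4 : (n4 <= n)%N by rewrite /n !leq_max leqnn !orbT.
have := Hn0 _ nn0; have := Hn1 _ nn1; have := Hn2 _ nn2; have := Hn3 _ nn3; have := Hn4 _ nn4.
pose eta : R := n.+1%:R^-1; rewrite -exprVn -/eta.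
set nu := Ij j (tail eta); set mm := Ij j (moment eta).
move=> eM eK eL er [enu emm].
have eta0 : 0 < eta by rewrite invr_gt0.
have eta1 : eta <= 1 by rewrite invf_le1// ler1n.
(* The truncation in [chi] takes place at radius rr, so from a point outside the ball of radius r a
   displacement of length at most eta does not cross the kink. *)
pose del := M0 * eta; pose a := A / eta; pose rr := r - eta.
have rr0 : 0 < rr by rewrite /rr; lra.
have a0 : 0 < a by rewrite divr_gt0.
have del0 : 0 < del by rewrite mulr_gt0.
have del2 : 2 * del <= 1.
  have := ler_wpM2l (ltW (mulr_gt0 (ltr0Sn R 1) M00)) eM.
  by rewrite divff ?gt_eqF ?mulr_gt0// /del mulrA.
have edel : eta <= del by rewrite /del ler_peMl// ltW.
have aeta : a * eta = A by rewrite /a mulfVK ?gt_eqF.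
have adel : a * del = A * M0 by rewrite /del mulrCA aeta mulrC.
pose b := expR (a * rr ^+ 2); have b0 : 0 < b by exact: expR_gt0.
have bg z x : b * gs a z x = expR (- (a * (enorm (x - z) ^+ 2 - rr ^+ 2))).
  by rewrite /b /gs -expRD; congr expR; rewrite sqr_enorm; ring.
have bgle z x (s : R) : 0 <= s -> enorm (x - z) <= s ->
    expR (- (a * (s ^+ 2 - rr ^+ 2))) <= b * gs a z x.
  move=> s0 xs; rewrite bg ler_expR lerN2 ler_wpM2l ?(ltW a0)// lerD2r.
  by rewrite ler_pXn2r// ?nnegrE ?enorm_ge0.
pose c0 := 1 - expR (- (a * ((r + del) ^+ 2 - rr ^+ 2))).
have c1c0 : c1 <= c0.
  rewrite lerB// ler_expR lerN2.
  have -> : q = A * M0 * (2 * r) by rewrite /q /A; field; rewrite !gt_eqF.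
  rewrite -adel -mulrA ler_wpM2l ?(ltW a0)//.
  suff : rr ^+ 2 <= r ^+ 2 by have := mulr_gt0 del0 del0; rewrite !expr2; lra.
  by rewrite ler_pXn2r// ?nnegrE ?(ltW rr0) ?(ltW r0)// /rr gerBl ltW.
have c00 : 0 < c0 by exact: lt_le_trans c1c0.
exists a, b, del, (eta / 2), eta, c0; split.
- split; split => //; [exact: ltW|by rewrite divr_gt0| |by rewrite gerBl expR_ge0|lra].
  by apply: lt_le_trans edel; rewrite ltr_pdivrMr// ltr_pMr// ltr1n.
- move=> z x y rx ye; rewrite /chi max_r// subr_ge0 bg -expR0 ler_expR oppr_le0.
  rewrite mulr_ge0 ?(ltW a0)// subr_ge0 ler_pXn2r// ?nnegrE ?enorm_ge0 ?(ltW rr0)//.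
  have := enorm_shift x y z.
  by rewrite /rr; lra.
- move=> z x rx xd.
  (* F is the minimum of 1 and [b * gs a z]: nonnegative everywhere and Gaussian within eta of x, as
     [gauss_Dlt] demands. *)
  pose F w := 1 - chi a b z w.
  have mF : mrV F.
    by apply: mrVB; [exact: mrV_cst|apply: mrV_continuous; exact: chi_continuous].
  have F0 w : 0 <= F w by rewrite subr_ge0 chi_le1// ltW.
  have Fg y : enorm y <= eta -> F (x + y) = b * gs a z (x + y).
    move=> ye; rewrite /F /chi max_r; first by rewrite subKr.
    rewrite subr_ge0 bg -expR0 ler_expR oppr_le0.
    rewrite mulr_ge0 ?(ltW a0)// subr_ge0 ler_pXn2r// ?nnegrE ?enorm_ge0 ?(ltW rr0)//.
    have := enorm_shift x y z.
    by rewrite /rr; lra.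
  have Fx : F x = b * gs a z x by rewrite -[x]addr0 Fg// enorm0 ltW.
  have dE : - (2 * a * F x) *: (x - z) = - dchi a b z x.
    by apply/rowP => i; rewrite Fx !mxE /gs1 !mxE; ring.
  have DE : Dlt (chi a b z) x (dchi a b z x) =
      fun y => -1 * Dlt F x (- (2 * a * F x) *: (x - z)) y.
    apply/funext => y; rewrite dE /Dlt /F.
    by rewrite -[- dchi _ _ _ _]scaleN1r dotvZr; ring.
  have aD : adm (Dlt F x (- (2 * a * F x) *: (x - z))).
    pose B := ball x (eta / d.+1%:R).
    have B0 : 0 < eta / d.+1%:R by rewrite divr_gt0.
    have oB : open B by exact: ball_open.
    have Bx : B x by exact: ballxx.
    have jF : jet2 B F (fun i x => b * gs1 a z i x) (fun i k x => b * gs2 a z i k x).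
      apply: (jet2_eq oB _ (jet2Z b (jet2_gs B a z))) => w.
      rewrite /B -ball_normE/= => xw.
      rewrite -[w](subrK x) addrC Fg//; apply: le_trans (enorm_le_norm _) _.
      rewrite distrC; apply: (@le_trans _ _ (d%:R * (eta / d.+1%:R))).
        by rewrite ler_wpM2l// ltW.
      rewrite mulrA ler_pdivrMr// mulrC ler_wpM2l ?(ltW eta0)// ler_nat; exact: leqnSn.
    have := adm_Dlt_jet oB Bx jF mF; move=> h.
    rewrite (_ : _ *: _ = \row_i (b * gs1 a z i x)); last first.
      by apply/rowP => i; rewrite Fx !mxE /gs1 !mxE; ring.
    by apply: h; apply: bndB; [exact: bnd_cst|exact: chi_bnd (ltW b0)].
  have := gauss_Dlt hj mF F0 (ltW a0) eta0 eta1 Fg aD.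
  rewrite DE (IjZ hj)//; set J := Ij j (Dlt _ _ _) => HJ.
  rewrite -mulr_sumr sum_gs2 mulN1r mulrCA -lerN2 opprD !opprK.
  rewrite mulNr -mulrN -/eta.
  have bgx : E1^-1 <= b * gs a z x.
    apply: le_trans (bgle z x (r + del) _ xd); last by rewrite addr_ge0// ltW.
    rewrite /E1 -expRN ler_expR lerN2 -AM -adel -mulrA ler_wpM2l ?(ltW a0)//.
    have h1 : 0 <= (del - eta) * (2 * r + 1) by rewrite mulr_ge0 ?subr_ge0// ltW.
    have h2 : 0 <= (del + eta) * (1 - (del - eta)).
      by apply: mulr_ge0; [rewrite addr_ge0// ltW|clear -del2 eta0; lra].
    by rewrite /rr; clear -h1 h2; lra.
  set s := enorm (x - z) in rx xd HJ *.
  have nu0 : 0 <= nu by apply: (Ij_ge0 hj); [exact: adm_tail|exact: tail_ge0].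
  have mm0 : 0 <= mm by apply: (Ij_ge0 hj); [exact: adm_moment|exact: moment_ge0].
  pose Br := 4 * a ^+ 2 * s ^+ 2 - 2 * d%:R * a - (a * Lam j + nu + 2 * a * s * mm).
  suff HB : `|K| * E1 <= Br.
    have : K <= b * gs a z x * Br.
      apply: le_trans (ler_norm K) _.
      rewrite -[leLHS](mulfK (lt0r_neq0 E10)) mulrC.
      apply: ler_pM => //; first by rewrite invr_ge0 ltW.
      by rewrite mulr_ge0// ltW.
    move=> h; apply: (le_trans h); rewrite -Fx in HJ *.
    by move: HJ; rewrite -/nu -/mm /Br mulrN -Fx; clear; lra.
  have e2 : 0 < eta ^+ 2 by rewrite exprn_gt0.
  (* After scaling by eta^2 the Laplacian contributes 4 A^2 s^2. The terms linear in a, the long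
     jumps together with the drift, and the target |K| e cost at most A^2 r^2 each, and r <= s. *)
  rewrite -(ler_pM2r e2).
  have -> : Br * eta ^+ 2 = 4 * A ^+ 2 * s ^+ 2 - eta * (A * (2 * d%:R + Lam j)) -
     eta ^+ 2 * nu - 2 * A * s * (eta * mm).
    by rewrite /Br -aeta; ring.
  have h1 : eta * (A * (2 * d%:R + Lam j)) <= A ^+ 2 * r ^+ 2.
    have dL : 0 < 2 * d%:R + Lam j + 1 by rewrite ltr_wpDl// addr_ge0// mulr_ge0.
    have := eL; rewrite ler_pdivlMr// => h.
    apply: (@le_trans _ _ (A * (eta * (2 * d%:R + Lam j + 1)))).
      by rewrite mulrCA ler_wpM2l ?(ltW A0)// ler_wpM2l ?(ltW eta0)// lerDl.
    by apply: le_trans (ler_wpM2l (ltW A0) h) _; rewrite mulrA -expr2.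
  have h2 : `|K| * E1 * eta ^+ 2 <= A ^+ 2 * r ^+ 2.
    have dK : 0 < `|K| * E1 + 1 by rewrite ltr_wpDl// mulr_ge0// ltW.
    have := eK; rewrite ler_pdivlMr// => h; apply: le_trans h.
    rewrite mulrC expr2 -mulrA ler_wpM2l ?(ltW eta0)//.
    apply: le_trans (_ : 1 * (`|K| * E1) <= _); last by rewrite mul1r lerDl.
    by rewrite ler_wpM2r// mulr_ge0// ltW.
  have h3 : eta ^+ 2 * nu + 2 * A * s * (eta * mm) <= A ^+ 2 * r ^+ 2.
    have s1 : s <= r + 1 by lra.
    have s0 : 0 <= s by exact: enorm_ge0.
    have h4 : 2 * A * s * (eta * mm) <=
        2 * A * (r + 1) * (A ^+ 2 * r ^+ 2 / (1 + 2 * A * (r + 1))).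
      apply: ler_pM => //; first by rewrite !mulr_ge0// ltW.
        by rewrite mulr_ge0// ltW.
      by rewrite ler_wpM2l// mulr_ge0// ltW.
    apply: le_trans (lerD enu h4) _.
    by rewrite -[X in X + _]mul1r -mulrDl mulrCA divff ?mulr1// gt_eqF.
  have h5 : A ^+ 2 * r ^+ 2 <= A ^+ 2 * s ^+ 2.
    rewrite ler_wpM2l ?exprn_ge0 ?(ltW A0)// ler_pXn2r// ?nnegrE ?(ltW r0)//.
    exact: enorm_ge0.
  by lra.
- move=> z x xd; rewrite /chi le_max; apply/orP; right; rewrite lerB//.
  rewrite bg ler_expR lerN2 ler_wpM2l ?(ltW a0)// lerD2r.
  by rewrite ler_pXn2r// ?nnegrE ?enorm_ge0// addr_ge0// ltW.
- split=> z x xd.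
    rewrite /chi gt_max c00/= ltrD2l ltrN2 bg ltr_expR ltrN2 ltr_pM2l// ltrD2r.
    by rewrite ltr_pXn2r// ?nnegrE ?enorm_ge0// addr_ge0// ltW.
  rewrite /chi ge_max mulr_ge0 ?(ltW t0) ?(ltW c00)//=.
  have re0 : 0 <= r + eta by rewrite addr_ge0// ltW.
  have xd' : enorm (x - z) <= r + eta by lra.
  apply: (@le_trans _ _ (tau * c1)); last by rewrite ler_wpM2l// ltW.
  apply: (@le_trans _ _ (a * ((r + eta) ^+ 2 - rr ^+ 2))).
    have := expR_ge1Dx (- (a * ((r + eta) ^+ 2 - rr ^+ 2))).
    by have := bgle z x _ re0 xd'; lra.
  have -> : a * ((r + eta) ^+ 2 - rr ^+ 2) = 4 * r * A by rewrite /rr -aeta; ring.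
  have -> : tau * c1 = A * (2 * (2 * r + 1)).
    apply: (mulfI (lt0r_neq0 M00)); rewrite [LHS]mulVf ?gt_eqF//.
    by rewrite -[LHS]AM; ring.
  by have := ltW A0; lra.
Qed.

(** The case eta = 1 of [gauss_Dlt]: the moment between 1 and 1 is empty and the tail is at most
    [Lam j]. Away from the centre the a^2 term dominates for large a. *)
Lemma hopf_Lop (a : R) z x : 0 <= a ->
  (4 * a ^+ 2 * enorm (x - z) ^+ 2 - 2 * d%:R * a - a * Lam j - Lam j) * gs a z x
    <= Lop j (gs a z) x.
Proof.
move=> a0; rewrite (Lop_jet j openT I (jet2_gs setT a z)) sum_gs2 row_gs1.
have mg : mrV (gs a z) by apply: mrV_continuous; exact: continuous_gs.
have bg : bnd (gs a z).
  by exists 1 => y; rewrite ger0_norm ?gs_le1// ltW// gs_gt0.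
have aD := adm_Dlt_jet openT I (jet2_gs setT a z) mg bg (x := x).
rewrite row_gs1 in aD.
have := @gauss_Dlt R d j hj (gs a z) a 1 1 z x mg (fun y => ltW (gs_gt0 a z y)) a0
  ltr01 (lexx 1) (fun y _ => esym (mul1r _)) aD.
have m0 : Ij j (moment 1) = 0.
  rewrite -(Ij0 hj); congr (Ij j _); apply/funext => y.
  by rewrite /moment; case: ltP => //= y1; rewrite ?mul0r// leNgt y1 mul0r.
rewrite m0 mulr0 addr0 => h.
have n1 : Ij j (tail 1) <= Lam j.
  apply: (le_Ij hj); [exact: adm_tail|exact: adm_mwt|move=> y].
  by have := @tail_le R d 1 y ltr01 (lexx 1); rewrite expr1n mul1r.
have := ler_wpM2l (ltW (gs_gt0 a z x)) n1; lra.
Qed.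

End barrier.

(** * Adding a classical approximation to a viscosity supersolution *)
Section visc_sum.
Context {R : realType} {d : nat}.
Local Notation vec := 'rV[R]_d.
Local Notation e_ := (@unitv R d).
Implicit Types (x y z : vec) (U N : set vec) (F G : vec -> R).

Lemma cvg0_le (u : nat -> R) (A : R) :
  (forall n, 0 <= u n) -> (forall n, u n ^+ 2 <= A * (n.+1%:R)^-1) ->
  u n @[n --> \oo] --> 0.
Proof.
move=> u0 uA; apply/cvgrPdist_le => e e0.
have A0 : 0 <= A by have := uA 0; rewrite invr1 mulr1; apply: le_trans; exact: sqr_ge0.
have [n0 Hn0] := small_inv (divr_gt0 (exprn_gt0 2 e0) (ltr_wpDl A0 ltr01)).
exists n0 => // n /= /Hn0 h; rewrite sub0r normrN ger0_norm//.
rewrite -(@ler_pXn2r _ 2)// ?nnegrE ?(ltW e0)//; apply: le_trans (uA n) _.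
have A1 : 0 < A + 1 by rewrite ltr_wpDl.
move: h; rewrite ler_pdivlMr// => h; apply: le_trans h.
by rewrite mulrC ler_wpM2l// lerDl.
Qed.

Lemma cvg_bigsum (I : Type) (r : seq I) (u : nat -> I -> R) (l : I -> R) :
  (forall i, u n i @[n --> \oo] --> l i) ->
  (\sum_(i <- r) u n i) @[n --> \oo] --> \sum_(i <- r) l i.
Proof.
move=> ul; elim: r => [|a r IH].
  rewrite big_nil (_ : (fun n => _) = fun=> 0); first exact: cvg_cst.
  by apply/funext => n; rewrite big_nil.
rewrite big_cons (_ : (fun n => \sum_(i <- a :: r) u n i) =
  fun n => u n a + \sum_(i <- r) u n i); first exact: cvgD.
by apply/funext => n; rewrite big_cons.
Qed.

Lemma seq_cont F x (z_ : nat -> vec) (r_ : nat -> R) :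
  {for x, continuous F} -> (forall n, `|z_ n - x| <= r_ n) ->
  r_ n @[n --> \oo] --> 0 -> F (z_ n) @[n --> \oo] --> F x.
Proof.
move=> cF zr r0; apply/cvgrPdist_le => e e0.
have [rho rho0 H] := near_box (near_cont cF e0).
have /cvgrPdist_le/(_ rho rho0) := r0; apply: filterS => n.
rewrite sub0r normrN => rn; rewrite distrC ltW//; apply: H.
by apply: le_trans (zr n) _; apply: le_trans (ler_norm _) rn.
Qed.

Lemma compact_box x (rho : R) : 0 < rho -> compact [set z : vec | `|z - x| <= rho].
Proof.
move=> r0; have -> : [set z : vec | `|z - x| <= rho] = closed_ball x rho.
  by rewrite closed_ballE//; apply/seteqP; split=> z /=; rewrite /closed_ball_/= distrC.
apply: bounded_closed_compact; last exact: closed_ball_closed.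
exists (`|x| + rho); split; first exact: num_real.
move=> M MK z; rewrite closed_ballE// /closed_ball_/= => xz.
apply: ltW; apply: le_lt_trans MK; rewrite -[z](subrK x) addrC.
by apply: le_trans (ler_normD _ _) _; rewrite lerD2l distrC.
Qed.

Lemma lsc_continuous (A : set vec) u : continuous u -> lsc_within A u.
Proof.
move=> cu x a; rewrite lte_fin => au.
have cA : {within A, continuous u} by exact: continuous_subspaceT.
exists [set y | a < u y]; last by move=> y /=; rewrite lte_fin.
have oa : nbhs (u x) [set t | a < t] by apply: open_nbhs_nbhs; split => //; exact: open_gt.
exact: (cA x _ oa).
Qed.

Definition qd z x : R := enorm (x - z) ^+ 2.
Definition qd1 z (i : 'I_d) x : R := 2 * (x - z) ord0 i.
Definition qd2 (i k : 'I_d) x : R := 2 * (i == k)%:R.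

Lemma qdE z x y : qd z (x + y) = qd z x + 2 * dotv y (x - z) + enorm y ^+ 2.
Proof.
by rewrite /qd !sqr_enorm (_ : x + y - z = x - z + y) ?dotvv_add// addrAC.
Qed.

Lemma jet2_qd z : jet2 setT (qd z) (qd1 z) qd2.
Proof.
split=> [x _|i x _|i x _|i k x _|i k x _].
- rewrite (_ : qd z = fun x => \sum_i (x - z) ord0 i * (x - z) ord0 i); last first.
    by apply/funext => y; rewrite /qd sqr_enorm.
  apply: continuous_sumf => i; apply: continuousMf; exact: continuous_coordB.
- apply: is_derive_line0.
  have -> : (fun s : R => qd z (x + s *: e_ i)) =
      fun s : R => qd z x + (2 * (x - z) ord0 i) * s + s ^+ 2.
    apply/funext => s; rewrite qdE dotvZl enormZ enorm_unitv mulr1 real_normK ?num_real//.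
    by rewrite dotvC dotv_unitv; ring.
  by apply: is_derive_eq; rewrite -![_ *: _]/(_ * _) /qd1; ring.
- apply: continuousZf; exact: continuous_coordB.
- have h := @is_deriveZ _ _ _ (fun x : vec => (x - z) ord0 i) 2 x (e_ k) _ (is_derive_coordB z x i k).
  exact: (is_derive_eq h).
- exact: cst_continuous.
Qed.

Variable j : vec -> R.
Hypothesis hj : levy_density j.

(* A notion of solution of L psi = h stronger than the viscosity one: psi is a
   uniform limit of C^2 functions P for which L P is close to h near each point.
   Such a psi can be added to any viscosity supersolution, which replaces the
   doubling of variables. *)
Definition nice (D : set vec) (psi h : vec -> R) : Prop :=
  [/\ continuous psi, bnd psi &
  forall x0, D x0 -> forall tau : R, 0 < tau -> exists2 rho : R, 0 < rho &
  forall tau' : R, 0 < tau' -> exists P p1 p2,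
    [/\ jet2 setT P p1 p2, bnd P, forall x, `|P x - psi x| <= tau' &
        forall x, `|x - x0| <= rho -> `|Lop j P x - h x0| <= tau]].

(** Variant of [Dlt_le] for patched functions, which are smooth only on a max-norm ball. The
    condition d s <= 1 keeps this ball inside the Euclidean unit ball, where the compensator is
    active. *)
Lemma Dlt_le_box F x (p : vec) (s M C : R) :
  0 < s -> d%:R * s <= 1 -> s <= 1 -> 0 <= C -> 0 <= M ->
  (forall y, `|y| < s -> `|F (x + y) - F x - dotv y p| <= C * enorm y ^+ 2) ->
  (forall y, s <= `|y| -> `|F (x + y) - F x| <= M) ->
  forall y, `|Dlt F x p y| <= (C + (M + enorm p) / s ^+ 2) * mwt y.
Proof.
move=> s0 ds s1 C0 M0 FC FM y; have s2 : 0 < s ^+ 2 by rewrite exprn_gt0.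
have [ys|sy] := ltP `|y| s.
  have y1 : enorm y <= 1.
    apply: le_trans (enorm_le_norm y) _; apply: le_trans ds.
    by rewrite ler_wpM2l// ltW.
  rewrite /Dlt y1 mul1r; apply: le_trans (FC y ys) _.
  rewrite -(mwt_small y1) ler_wpM2r ?mwt_ge0// lerDl.
  by rewrite divr_ge0 ?(ltW s2)// !addr_ge0 ?enorm_ge0.
have ey : s <= enorm y by apply: le_trans sy (norm_le_enorm y).
apply: le_trans (ler_normB _ _) _.
rewrite mulrDl -[leLHS]add0r lerD ?mulr_ge0 ?mwt_ge0// mulrDl [leRHS]mulrDl.
apply: lerD; last exact: cut_dotv_le.
apply: le_trans (FM y sy) _; rewrite mulrAC ler_pdivlMr// ler_wpM2l//.
exact: mwt_lower.
Qed.

Lemma jet2_continuous F f1 f2 : jet2 setT F f1 f2 -> continuous F.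
Proof. by move=> jF x; exact: (jet2_cont jF). Qed.

Section touching.
Variables (D : set vec) (v f psi h : vec -> R) (s : R).
Hypotheses (oD : open D) (cv : continuous v) (bv : bnd v)
  (vv : visc_supersol j D v f) (cf : forall x, D x -> {for x, continuous f})
  (npsi : nice D psi h).
Let w x := v x + s * psi x.

Variables (x0 : vec) (N : set vec) (phi : vec -> R) (f1 : 'I_d -> vec -> R)
  (f2 : 'I_d -> 'I_d -> vec -> R).
Hypotheses (oN : open N) (Nx0 : N x0) (ND : N `<=` D) (jphi : jet2 N phi f1 f2)
  (phiw : forall y, N y -> phi y <= w y) (phix0 : phi x0 = w x0)
  (bphi : exists M, forall y, N y -> `|phi y| <= M).

Let cw : continuous w.
Proof. by case: npsi => cpsi _ _; apply: continuousDf => //; exact: continuousZf. Qed.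

Let bw : bnd w.
Proof. by case: npsi => _ bpsi _; apply: bndD => //; exact: bndZ. Qed.

(* A test function touching v + s psi strictly at a point touches v + s P at a
   nearby point once P is uniformly close to psi. *)
Lemma visc_sum_approx (sigma tau : R) : 0 < sigma -> 0 < tau ->
  Lop j (patch w N phi) x0 <=
    f x0 + s * h x0 + `|s| * tau + sigma * (2 * d%:R + Lam j).
Proof.
move=> sg0 t0; case: npsi => cpsi bpsi /(_ x0 (ND Nx0) tau t0)[rho1 rho10 Hn].
(* Subtracting sigma |x - x0|^2 makes the contact at x0 strict; its price is the term sigma (2 d +
   Lam) of the conclusion. *)
pose phi' x := phi x + (- sigma) * qd x0 x.
pose g1 i x := f1 i x + (- sigma) * qd1 x0 i x.
pose g2 i k x := f2 i k x + (- sigma) * qd2 i k x.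
have jphi' : jet2 N phi' g1 g2.
  by apply: jet2D => //; apply: jet2Z; apply: jet2_sub (jet2_qd x0).
have [rt [K [rt0 K0 rtN g1K TK]]] := taylor2_local oN Nx0 jphi'.
pose S := Num.min (Num.min rt rho1) (d.+1%:R)^-1.
have S0 : 0 < S by rewrite !lt_min rt0 rho10 invr_gt0 ltr0Sn.
have Srt : S <= rt by rewrite /S !ge_min lexx.
have Sr1 : S <= rho1 by rewrite /S !ge_min lexx orbT.
have Sd : S <= (d.+1%:R)^-1 by rewrite /S !ge_min lexx !orbT.
pose s2 := S / 2; have s20 : 0 < s2 by rewrite divr_gt0.
have s2S : s2 + s2 = S by rewrite /s2 -splitr.
have s2lS : s2 <= S by rewrite -s2S lerDl ltW.
have S1 : S <= 1 by apply: le_trans Sd _; rewrite invf_le1// ler1n.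
have s21 : s2 <= 1 by exact: le_trans s2lS S1.
have ds2 : d%:R * s2 <= 1.
  apply: (@le_trans _ _ (d%:R * (d.+1%:R)^-1)).
    by rewrite ler_wpM2l// (le_trans s2lS).
  by rewrite ler_pdivrMr// mul1r ler_nat.
(* Tolerance for the uniform error of P: weighed against the quadratic gap it keeps every perturbed
   contact point within s2 of x0, and with error kap / (n + 1) the squared distance is O(1 / n). *)
pose kap := sigma * s2 ^+ 2 / (2 * `|s| + 1) / 2.
have sp : 0 < 2 * `|s| + 1 by rewrite ltr_wpDl// mulr_ge0.
have kap0 : 0 < kap by rewrite !divr_gt0// mulr_gt0// exprn_gt0.
have tn0 n : 0 < kap * n.+1%:R^-1 by rewrite mulr_gt0// invr_gt0.
have /choice[T HT] : forall n, exists T : (vec -> R) * ('I_d -> vec -> R) * ('I_d -> 'I_d -> vec -> R),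
    [/\ jet2 setT T.1.1 T.1.2 T.2, bnd T.1.1,
      forall x, `|T.1.1 x - psi x| <= kap * n.+1%:R^-1 &
      forall x, `|x - x0| <= rho1 -> `|Lop j T.1.1 x - h x0| <= tau].
  by move=> n; have [P [p1 [p2 HP]]] := Hn _ (tn0 n); exists (P, p1, p2).
pose P n := (T n).1.1.
have cP n : continuous (P n) by case: (HT n) => jP _ _ _; exact: jet2_continuous jP.
have BN z : `|z - x0| <= S -> N z by move=> zS; apply: rtN; exact: le_trans zS Srt.
have /choice[x_ Hx] : forall n, exists x, `|x - x0| <= S /\
    forall z, `|z - x0| <= S -> v x + s * P n x - phi' x <= v z + s * P n z - phi' z.
  move=> n; pose Bs := [set z : vec | `|z - x0| <= S].
  have Bs0 : Bs !=set0 by exists x0; rewrite /Bs/= subrr normr0 ltW.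
  have cB : {within Bs, continuous (fun z => v z + s * P n z - phi' z)}.
    apply: continuous_in_subspaceT => z /[!inE] zB.
    have h1 : {for z, continuous (fun z => v z + s * P n z)}.
      by apply: continuousDat; [exact: cv|apply: continuousZat; exact: cP].
    have h2 : {for z, continuous (fun z => -1 * phi' z)}.
      by apply: continuousZat; apply: (jet2_cont jphi'); exact: BN.
    rewrite (_ : (fun z => v z + s * P n z - phi' z) =
      fun z => (v z + s * P n z) + -1 * phi' z); first exact: (continuousDat h1 h2).
    by apply/funext => t; rewrite mulN1r.
  have [x /set_mem xB xmin] := EVT_min_rV Bs0 (compact_box S0) cB.
  by exists x; split => // z zB; apply: xmin; rewrite inE.
have phi'w z : `|z - x0| <= S -> phi' z + sigma * `|z - x0| ^+ 2 <= w z.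
  move=> zS; have Nz := BN z zS; apply: le_trans (phiw Nz).
  rewrite /phi' /qd mulNr -addrA gerDl addrC subr_le0 ler_wpM2l ?(ltW sg0)//.
  by rewrite ler_pXn2r// ?nnegrE ?enorm_ge0// norm_le_enorm.
have phi'0 : phi' x0 = w x0.
  by rewrite /phi' /qd subrr enorm0 expr0n/= mulr0 addr0.
have xn2 n : `|x_ n - x0| ^+ 2 <= (s2 ^+ 2 / 2) * n.+1%:R^-1.
  have [xS xmin] := Hx n; have := xmin x0; rewrite subrr normr0 => /(_ (ltW S0)).
  have := phi'w _ xS; rewrite /w phi'0 /w.
  have [_ _ Hpsi _] := HT n; have := Hpsi (x_ n); have := Hpsi x0; rewrite -/(P n).
  move=> a1 a2 b1 b2.
  have c1 : s * (psi (x_ n) - P n (x_ n)) <= `|s| * (kap * n.+1%:R^-1).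
    apply: le_trans (ler_norm _) _; rewrite normrM ler_wpM2l//.
    by rewrite distrC.
  have c2 : s * (P n x0 - psi x0) <= `|s| * (kap * n.+1%:R^-1).
    by apply: le_trans (ler_norm _) _; rewrite normrM ler_wpM2l.
  have c3 : sigma * `|x_ n - x0| ^+ 2 <= 2 * `|s| * (kap * n.+1%:R^-1).
    set kn := kap / _ in c1 c2 *; clearbody kn; lra.
  have c4 : 2 * `|s| * kap <= sigma * (s2 ^+ 2 / 2).
    rewrite (_ : sigma * (s2 ^+ 2 / 2) = kap * (2 * `|s| + 1)); last first.
      by rewrite /kap; field; rewrite gt_eqF.
    by rewrite mulrC ler_wpM2l ?(ltW kap0)// lerDl.
  rewrite -(ler_pM2l sg0); apply: le_trans c3 _.
  by rewrite !mulrA ler_wpM2r ?invr_ge0//; move: c4; rewrite !mulrA.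
have r_0 : `|x_ n - x0| @[n --> \oo] --> 0 by exact: cvg0_le xn2.
have xs2 n : `|x_ n - x0| < s2.
  rewrite -(@ltr_pXn2r _ 2)// ?nnegrE ?(ltW s20)//; apply: le_lt_trans (xn2 n) _.
  rewrite -mulrA gtr_pMr ?exprn_gt0// -invfM invf_lt1 ?mulr_gt0//.
  by rewrite (lt_le_trans (ltr1n R 2)) // -natrM ler_nat leq_pmulr.
pose Nn n := ball (x_ n) s2.
have NnP n z : Nn n z <-> `|z - x_ n| < s2 by rewrite /Nn -ball_normE/= distrC.
have NnS n z : closure (Nn n) z -> `|z - x0| <= S.
  move=> /(closure_box s20) zx; rewrite -(subrK (x_ n) z) -addrA -s2S.
  by apply: le_trans (ler_normD _ _) _; apply: lerD => //; exact: ltW.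
have NnN n : Nn n `<=` N by move=> z /subset_closure /NnS /BN.
have Nnx n : Nn n (x_ n) by exact: ballxx.
have oNn n : open (Nn n) by exact: ball_open.
pose k n := v (x_ n) + s * P n (x_ n) - phi' (x_ n).
pose phn n x := (phi' x + (- s) * P n x) + k n.
pose p1 n := (T n).1.2; pose p2 n := (T n).2.
have jP n : jet2 setT (P n) (p1 n) (p2 n) by case: (HT n).
have bP n : bnd (P n) by case: (HT n).
have jphn n : jet2 N (phn n) (fun i x => (g1 i x + (- s) * p1 n i x) + 0)
    (fun i l x => (g2 i l x + (- s) * p2 n i l x) + 0).
  apply: jet2D; last exact: jet2_cst.
  by apply: jet2D => //; apply: jet2Z; exact: jet2_sub (jP n).
have mv : mrV v by exact: mrV_continuous.
have mP n : mrV (P n) by exact: mrV_continuous.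
pose V n := patch v (Nn n) (phn n).
have mV n : mrV (V n).
  by apply: mrV_patch => // z /NnN Nz; exact: (jet2_cont (jphn n)).
have phnv n z : Nn n z -> phn n z <= v z.
  move=> /subset_closure/NnS zS; have [_ /(_ z zS)] := Hx n.
  by rewrite /phn /k; lra.
have [M MP] : exists M, forall z, `|v z| <= M /\ forall n, `|v z + s * P n z| <= M.
  have [M1 HM1] := bv; have [M2 HM2] := bpsi.
  exists (M1 + `|s| * (M2 + kap)) => z.
  have M20 : 0 <= M2 by apply: le_trans (HM2 x0).
  split=> [|n].
    by apply: le_trans (HM1 z) _; rewrite lerDl mulr_ge0// addr_ge0// ltW.
  apply: le_trans (ler_normD _ _) _; apply: lerD => //; rewrite normrM ler_wpM2l//.
  rewrite -(subrK (psi z) (P n z)) addrC; apply: le_trans (ler_normD _ _) _.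
  apply: lerD => //; have [_ _ /(_ z) h1 _] := HT n; apply: le_trans h1 _.
  by rewrite ger_pMr// invf_le1// ler1n.
(* Adding s P back to the patched v cancels P on the ball, where W is phi' plus a constant. The
   bound on its increments therefore involves no derivative of P, for which no uniform control
   exists. *)
pose W n := fun x => V n x + s * P n x.
have WE n x : W n x = if `|x - x_ n| < s2 then phi' x + k n else v x + s * P n x.
  rewrite /W /V /patch; case: ifPn => [/set_mem/NnP ->|/negP Nnx'].
    by rewrite /phn; ring.
  by case: ifP => // xs; case: Nnx'; apply/mem_set/NnP.
have jW n : jet2 (Nn n) (W n) g1 g2.
  have : jet2 (Nn n) (fun x => phi' x + k n) (fun i x => g1 i x + 0) (fun i l x => g2 i l x + 0).
    by apply: jet2D; [exact: jet2_sub (NnN n) jphi'|exact: jet2_cst].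
  have -> : (fun i x => g1 i x + 0) = g1.
    by apply/funext => i; apply/funext => x; rewrite addr0.
  have -> : (fun i l x => g2 i l x + 0) = g2.
    by apply/funext => i; apply/funext => l; apply/funext => x; rewrite addr0.
  by apply: jet2_eq => // x /NnP xs; rewrite WE xs.
have xK p (z : vec) : p + z - p = z by rewrite addrAC subrr add0r.
pose G n := Dlt (W n) (x_ n) (\row_i g1 i (x_ n)).
have Wx n : W n (x_ n) = v (x_ n) + s * P n (x_ n).
  by rewrite WE subrr normr0 s20 /k addrC subrK.
pose CC := K + (M + M + d%:R * K) / s2 ^+ 2.
have M0 : 0 <= M by apply: le_trans (MP x0).1.
have g1Kn n : enorm (\row_i g1 i (x_ n)) <= d%:R * K.
  apply: le_trans (enorm_le_sum _) _.
  have -> : d%:R * K = \sum_(i < d) K by rewrite sumr_const card_ord mulr_natl.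
  apply: ler_sum => i _; rewrite mxE; apply: g1K; apply: le_trans Srt.
  by have [] := Hx n.
have GC n y : `|G n y| <= CC * mwt y.
  have : `|G n y| <= (K + (M + M + enorm (\row_i g1 i (x_ n))) / s2 ^+ 2) * mwt y.
    apply: Dlt_le_box => // [|z zs|z zs].
    - by rewrite addr_ge0.
    - rewrite !WE xK zs subrr normr0 s20.
      have := TK (x_ n) (le_trans (Hx n).1 Srt) z (le_trans (ltW zs) (le_trans s2lS Srt)).
      by congr (`|_| <= _); ring.
    - rewrite Wx WE xK ltNge zs/=.
      by apply: le_trans (ler_normB _ _) _; apply: lerD; exact: (MP _).2.
  move=> /le_trans; apply; rewrite ler_wpM2r ?mwt_ge0// lerD2l.
  by rewrite ler_wpM2r ?invr_ge0 ?exprn_ge0 ?(ltW s20)// lerD2l.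
have mW n : mrV (W n).
  by apply: mrVD => //; apply: mrVM; [exact: mrV_cst|].
have mG n : mrV (G n) by exact: mrV_Dlt.
pose W0 := patch w (ball x0 s2) phi'.
have NB0 : ball x0 s2 `<=` N.
  by move=> z; rewrite -ball_normE/= distrC => /ltW zs; apply: BN; exact: le_trans zs s2lS.
have W0E x : W0 x = if `|x - x0| < s2 then phi' x else w x.
  by rewrite /W0 /patch; congr (if _ then _ else _); apply/asboolP/idP;
    rewrite -ball_normE/= distrC.
pose G0 := Dlt W0 x0 (\row_i g1 i x0).
have mW0 : mrV W0.
  apply: mrV_patch; [exact: ball_open| |exact: mrV_continuous].
  by move=> x /NB0 Nx; exact: (jet2_cont jphi').
have mG0 : mrV G0 by exact: mrV_Dlt.
have shn x n : `|x_ n + x - (x0 + x)| <= `|x_ n - x0|.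
  by rewrite opprD addrACA subrr addr0.
have Pn_cvg x : P n (x_ n + x) @[n --> \oo] --> psi (x0 + x).
  apply/cvgrPdist_le => e e0.
  have /cvgrPdist_le/(_ (e / 2) (divr_gt0 e0 (ltr0Sn R 1))) :=
    seq_cont (cpsi (x0 + x)) (shn x) r_0.
  have [n0 Hn0] := small_inv (divr_gt0 (divr_gt0 e0 (ltr0Sn R 1)) kap0).
  have nf : \forall n \near \oo, (n.+1%:R : R)^-1 <= e / 2 / kap by exists n0.
  apply: filterS2 nf => n nk pn; rewrite (splitr e).
  rewrite -(subrK (psi (x_ n + x)) (psi (x0 + x))) -addrA.
  apply: le_trans (ler_normD _ _) _; apply: lerD => //.
  rewrite distrC; have [_ _ /(_ (x_ n + x)) h1 _] := HT n; apply: le_trans h1 _.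
  by move: nk; rewrite ler_pdivlMr// mulrC.
have xn_cvg F : {for x0, continuous F} -> F (x_ n) @[n --> \oo] --> F x0.
  by move=> cF; apply: seq_cont r_0 => // n.
have cG n y : G n y = (if `|y| < s2 then phi' (x_ n + y) - phi' (x_ n)
    else (v (x_ n + y) + s * P n (x_ n + y)) - (v (x_ n + 0) + s * P n (x_ n + 0)))
    - (enorm y <= 1)%R%:R * \sum_i y ord0 i * g1 i (x_ n).
  rewrite /G /Dlt; congr (_ - _ * _); last by apply: eq_bigr => i _; rewrite mxE.
  rewrite addr0 Wx WE xK.
  by case: ifP => // _; rewrite /k; ring.
have GG y : G n y @[n --> \oo] --> G0 y.
  under eq_fun do rewrite cG.
  have -> : G0 y = (if `|y| < s2 then phi' (x0 + y) - phi' x0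
      else (v (x0 + y) + s * psi (x0 + y)) - (v (x0 + 0) + s * psi (x0 + 0)))
      - (enorm y <= 1)%R%:R * \sum_i y ord0 i * g1 i x0.
    rewrite /G0 /Dlt; congr (_ - _ * _); last by apply: eq_bigr => i _; rewrite mxE.
    rewrite addr0 !W0E subrr normr0 s20 xK.
    by case: ifP => // _; rewrite phi'0.
  apply: cvgB.
    case: ifP => ys.
      apply: cvgB.
        apply: (seq_cont _ (shn y) r_0); apply: (jet2_cont jphi'); apply: NB0.
        by rewrite -ball_normE/= opprD addrA subrr sub0r normrN.
      by apply: xn_cvg; exact: (jet2_cont jphi').
    apply: cvgB; apply: cvgD.
    - by apply: (seq_cont _ (shn y) r_0); exact: cv.
    - by apply: cvgM; [exact: cvg_cst|exact: Pn_cvg].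
    - by apply: (seq_cont _ (shn 0) r_0); exact: cv.
    - by apply: cvgM; [exact: cvg_cst|exact: Pn_cvg].
  apply: cvgM; first exact: cvg_cst.
  apply: cvg_bigsum => i; apply: cvgM; first exact: cvg_cst.
  by apply: xn_cvg; exact: (jet2_cont1 jphi').
have IG := Ij_cvg hj mG mG0 GC GG.
(* At each contact point L W splits into L of the patched v, bounded by the viscosity inequality,
   and s L P, which is within |s| tau of s h x0. *)
have key n : \sum_i g2 i i (x_ n) + Ij j (G n) <= f (x_ n) + (s * h x0 + `|s| * tau).
  have jV : jet2 (Nn n) (V n) (fun i x => (g1 i x + (- s) * p1 n i x) + 0)
      (fun i l x => (g2 i l x + (- s) * p2 n i l x) + 0).
    apply: (jet2_eq (oNn n) _ (jet2_sub (NnN n) (jphn n))) => x Nx.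
    by rewrite /V /patch mem_set.
  have bV : bnd (V n).
    have [M1 HM1] := bP n.
    have [M2 HM2] := bndZ s (bP n).
    have bWn : bnd (W n).
      have h1 : forall y, `|Dlt (W n) (x_ n) (\row_i g1 i (x_ n)) y| <= `|CC|.
        move=> y; apply: le_trans (GC n y) _; apply: le_trans (ler_norm _) _.
        by rewrite normrM ler_piMr// ger0_norm ?mwt_ge0 ?mwt_le1.
      exists (`|CC| + `|W n (x_ n)| + enorm (\row_i g1 i (x_ n))) => z.
      have zK : x_ n + (z - x_ n) = z by rewrite addrC subrK.
      have := h1 (z - x_ n); rewrite /Dlt zK => h2.
      have h3 : `|(enorm (z - x_ n) <= 1)%R%:R * dotv (z - x_ n) (\row_i g1 i (x_ n))|
          <= enorm (\row_i g1 i (x_ n)).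
        case: (leP (enorm (z - x_ n)) 1) => z1 /=; last by rewrite mul0r normr0 enorm_ge0.
        rewrite mul1r; apply: le_trans (dotv_le_enorm _ _) _.
        by rewrite ler_piMl ?enorm_ge0.
      move: h2 h3; set A := _ * dotv _ _; set B := W n z; set E := W n (x_ n).
      rewrite !ler_norml => /andP[a1 a2] /andP[b1 b2].
      have := ler_norm E; have := ler_norm (- E); rewrite normrN => e1 e2.
      by apply/andP; split; lra.
    have -> : V n = fun x => W n x - s * P n x.
      by apply/funext => x; rewrite /W addrK.
    exact: bndB bWn (bndZ s (bP n)).
  have hV : Lop j (V n) (x_ n) <= f (x_ n).
    case: vv => _ _ _; apply; first by apply: ND; exact: NnN.
    - by split => // z /NnN/ND.
    - by apply: (jet2_C2_closure oN (jphn n)) => // z /NnS/BN.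
    - by move=> z /phnv; rewrite subr_le0.
    - by rewrite /phn /k; ring.
  have -> : \sum_i g2 i i (x_ n) + Ij j (G n) = Lop j (V n) (x_ n) + s * Lop j (P n) (x_ n).
    rewrite -(Lop_jet j (oNn n) (Nnx n) (jW n)).
    rewrite -(LopZ hj s openT I (jP n) (mP n) (bP n)).
    have jsP : jet2 (Nn n) (fun y => s * P n y) (fun i x => s * p1 n i x) (fun i l x => s * p2 n i l x).
      by apply: jet2Z; exact: jet2_sub (jP n).
    rewrite -(LopD hj (oNn n) (Nnx n) jV jsP)//.
    - by apply: mrVM => //; exact: mrV_cst.
    - exact: bndZ.
  apply: lerD => //.
  have [_ _ _ /(_ (x_ n))] := HT n; rewrite -/(P n).
  move=> /(_ (le_trans (Hx n).1 Sr1)) hh.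
  rewrite -lerBlDl -mulrBr; apply: le_trans (ler_norm _) _.
  by rewrite normrM ler_wpM2l.
have lim : \sum_i g2 i i x0 + Ij j G0 <= f x0 + (s * h x0 + `|s| * tau).
  have l1 : (\sum_i g2 i i (x_ n) + Ij j (G n)) - (f (x_ n) + (s * h x0 + `|s| * tau))
     @[n --> \oo] --> (\sum_i g2 i i x0 + Ij j G0) - (f x0 + (s * h x0 + `|s| * tau)).
    apply: cvgB; apply: cvgD => //.
    - by apply: cvg_bigsum => i; apply: xn_cvg; exact: (jet2_cont2 jphi').
    - by apply: xn_cvg; apply: cf; exact: ND.
    - exact: cvg_cst.
  rewrite -subr_le0; apply: (cvgr_to_le l1); near=> n.
  by rewrite subr_le0.
pose U0 := patch w N phi.
have jU0 : jet2 N U0 f1 f2.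
  by apply: (jet2_eq oN _ jphi) => x Nx; rewrite /U0 /patch mem_set.
have U0w x : U0 x <= w x.
  by rewrite /U0 /patch; case: ifPn => // /set_mem; exact: phiw.
have g10 : \row_i g1 i x0 = \row_i f1 i x0.
  by apply/rowP => i; rewrite !mxE /g1 /qd1 subrr mxE !mulr0 addr0.
have g20 : \sum_i g2 i i x0 = \sum_i f2 i i x0 - sigma * (2 * d%:R).
  rewrite /g2 big_split/=; congr (_ + _).
  under eq_bigr do rewrite /qd2 eqxx mulr1.
  by rewrite sumr_const card_ord -[LHS]mulr_natl; ring.
have aG0 : adm G0.
  apply: (@adm_le _ _ CC) => // y; have cn : `|G n y| @[n --> \oo] --> `|G0 y| by apply: cvg_norm; exact: GG.
  by apply: (cvgr_to_le cn); near=> n; exact: GC.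
(* Undoes the perturbation: on the small ball it amounts to sigma |y|^2, which is sigma times the
   Lévy weight there, and off the ball the original patched function lies below w. *)
have U0le y : Dlt U0 x0 (\row_i f1 i x0) y <= G0 y + sigma * mwt y.
  have E : U0 x0 = W0 x0.
    by rewrite W0E subrr normr0 s20 /U0 /patch mem_set// phix0 phi'0.
  suff : U0 (x0 + y) <= W0 (x0 + y) + sigma * mwt y.
    rewrite /G0 g10 /Dlt E.
    set q1 := _ * dotv _ _; set q2 := sigma * _; lra.
  rewrite W0E xK.
  case: ifP => ys; last first.
    by apply: le_trans (U0w _) _; rewrite addrC lerDl mulr_ge0 ?mwt_ge0// ltW.
  have Ny : N (x0 + y).
    by apply: NB0; rewrite -ball_normE/= opprD addrA subrr sub0r normrN.
  rewrite /U0 /patch mem_set// /phi' qdE subrr dotvC dotv0l /qd subrr enorm0.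
  rewrite expr0n/= mulr0 !add0r mwt_small; first by rewrite mulNr subrK.
  apply: le_trans (enorm_le_norm y) _; apply: le_trans ds2.
  by rewrite ler_wpM2l// ltW.
have aU0 : adm (Dlt U0 x0 (\row_i f1 i x0)).
  apply: (adm_Dlt_jet oN Nx0 jU0).
    by apply: mrV_patch => //; [move=> x; exact: (jet2_cont jphi)|exact: mrV_continuous].
  have [M1 HM1] := bphi; have [M2 HM2] := bw; exists (`|M1| + `|M2|) => z.
  rewrite /U0 /patch; case: ifPn => [/set_mem/HM1 zM|_].
    by apply: le_trans zM _; rewrite ler_wpDr// ler_norm.
  by apply: le_trans (HM2 z) _; rewrite ler_wpDl// ler_norm.
rewrite (Lop_jet j oN Nx0 jU0).
have := le_Ij hj aU0 (admD aG0 (admZ sigma (@adm_mwt R d))) U0le.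
rewrite (IjD hj)//; last by apply: admZ; exact: adm_mwt.
rewrite (IjZ hj); last exact: adm_mwt.
by move: lim; rewrite g20 /Lam; lra.
Unshelve. all: by end_near. Qed.

End touching.
End visc_sum.

(** * Maximum principles *)
Section viscosity_theory.
Context {R : realType} {d : nat}.
Local Notation vec := 'rV[R]_d.
Local Notation e_ := (@unitv R d).
Implicit Types (x y z : vec) (U N D : set vec) (F G u v w : vec -> R).

Lemma bounded_set_box D : bounded_set D -> exists2 M : R, 0 < M & forall z, D z -> `|z| < M.
Proof.
move=> [M [_ DM]]; exists (`|M| + 2) => [|z Dz]; first by rewrite ltr_wpDl.
have : `|z| <= `|M| + 1 by apply: DM => //; rewrite (le_lt_trans (ler_norm M))// ltrDl.
by move=> /le_lt_trans; apply; rewrite ltrD2l ltr1n.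
Qed.

Lemma compact_closure D : bounded_set D -> compact (closure D).
Proof.
move=> /bounded_set_box[M M0 DM].
apply: bounded_closed_compact; last exact: closed_closure.
exists M; split; first exact: num_real.
move=> K MK z cz; apply: ltW; apply: le_lt_trans MK.
have : closure (ball (0 : vec) M) z.
  by apply: closure_subset cz => w /DM; rewrite -ball_normE/= sub0r normrN.
by move=> /(closure_box M0); rewrite subr0.
Qed.

Lemma C2_closure_bounded D N F : bounded_set D -> N `<=` D -> C2_closure N F ->
  exists M, forall y, N y -> `|F y| <= M.
Proof.
move=> bD ND [cF _ _].
have cN : compact (closure N).
  apply: compact_closure; case: bD => M [Mr DM]; exists M; split => // K MK z Nz.
  exact/DM/ND.
have [[z Nz]|N0] := pselect (N !=set0); last first.
  by exists 0 => y Ny; case: N0; exists y.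
have cN0 : closure N !=set0 by exists z; exact: subset_closure.
have cnF : {within closure N, continuous (fun x => `|F x|)}.
  by move=> x; apply: cvg_norm; exact: cF.
have [x _ xmax] := EVT_max_rV cN0 cN cnF.
by exists `|F x| => y Ny; apply: xmax; rewrite inE; exact: subset_closure.
Qed.

(** The first exit point of the segment from a to b. It converts closeness to the complement into
    closeness to the frontier, where the exterior spheres are given. *)
Lemma frontier_between D (a b : vec) : open D -> D a -> ~ D b ->
  exists2 y, frontier D y & enorm (a - y) <= enorm (a - b).
Proof.
move=> oD Da Db; pose p t := a + t *: (b - a).
pose T := [set t : R | 0 <= t /\ ~ D (p t)].
have p1 : p 1 = b by rewrite /p scale1r addrC subrK.
have T1 : T 1 by split; rewrite ?p1.
have lT : has_lbound T by exists 0 => t [].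
have hT : has_inf T by split => //; exists 1.
pose t := inf T.
have t0 : 0 <= t by apply: lb_le_inf; [exists 1|move=> s []].
have t1 : t <= 1 by exact: ge_inf.
have inD s : 0 <= s -> s < t -> D (p s).
  move=> s0 st; apply: contrapT => nD.
  by have := ge_inf lT (conj s0 nD : T s); rewrite leNgt st.
have dp s r : p s - p r = (s - r) *: (b - a).
  by rewrite /p opprD addrACA subrr add0r scalerBl.
have near_p (e : R) : 0 < e -> exists2 dl : R, 0 < dl & forall s, `|s - t| < dl -> `|p s - p t| < e.
  move=> e0; have n1 : 0 < `|b - a| + 1 by rewrite ltr_wpDl.
  exists (e / (`|b - a| + 1)); first by rewrite divr_gt0.
  move=> s st; rewrite dp normrZ; apply: (@le_lt_trans _ _ (`|s - t| * (`|b - a| + 1))).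
    by rewrite ler_wpM2l// lerDl.
  by rewrite -ltr_pdivlMr.
have nDt : ~ D (p t).
  move=> Dt; have [rho r0 H] := open_box oD Dt.
  have [dl dl0 Hd] := near_p _ r0.
  have [s [s0 nDs] st] := inf_adherent dl0 hT.
  have ts : t <= s by exact: (ge_inf lT (conj s0 nDs : T s)).
  apply: nDs; apply: H; apply: ltW; apply: Hd.
  by rewrite ger0_norm ?subr_ge0// ltrBlDl.
have tp : 0 < t.
  rewrite lt_neqAle t0 andbT; apply/eqP => t00; apply: nDt.
  by rewrite -t00 /p scale0r addr0.
exists (p t); last first.
  have -> : a - p t = t *: (a - b) by rewrite /p opprD addrA subrr sub0r -scalerN opprB.
  by rewrite enormZ ger0_norm// ler_piMl// enorm_ge0.
split; last by move=> /interior_subset.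
move=> B /nbhs_ballP[e /= e0 eB].
have [dl dl0 Hd] := near_p _ e0.
pose s := Num.max 0 (t - dl / 2).
have s0 : 0 <= s by rewrite le_max lexx.
have st : s < t by rewrite gt_max tp/= ltrBlDr ltrDl divr_gt0.
exists (p s); split; first exact: inD.
apply: eB; rewrite -ball_normE/= distrC; apply: Hd.
rewrite ltr0_norm ?subr_lt0// opprB ltrBlDr addrC -ltrBlDr.
apply: (@lt_le_trans _ _ (t - dl / 2)); last by rewrite le_max lexx orbT.
by rewrite ltrD2l ltrN2 ltr_pdivrMr// ltr_pMr// ltr1n.
Qed.

Variable j : vec -> R.
Hypothesis hj : levy_density j.

Lemma le_addgt0 (a b : R) : (forall e, 0 < e -> a <= b + e) -> a <= b.
Proof. by move=> H; apply/ler_addgt0Pr. Qed.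

Lemma split_error (A e : R) : 0 <= A -> 0 <= e -> A * (e / (2 * (A + 1))) <= e / 2.
Proof.
move=> A0 e0; have A1 : 0 < A + 1 by rewrite ltr_wpDl.
have -> : A * (e / (2 * (A + 1))) = e / 2 * (A / (A + 1)) by field; rewrite gt_eqF.
by rewrite ler_piMr ?divr_ge0// ler_pdivrMr// mul1r lerDl.
Qed.

(** [visc_sum_approx] with the two error terms each made at most e / 2, for arbitrary e. *)
Lemma visc_sum D v f psi h (s : R) :
  open D -> bounded_set D -> continuous v -> bnd v -> visc_supersol j D v f ->
  (forall x, D x -> {for x, continuous f}) -> nice j D psi h ->
  visc_supersol j D (fun x => v x + s * psi x) (fun x => f x + s * h x).
Proof.
move=> oD bD cv bv vv cf npsi; have [cpsi bpsi _] := npsi.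
have cw : continuous (fun x => v x + s * psi x).
  by apply: continuousDf => //; exact: continuousZf.
split.
- exact: mrV_continuous.
- by apply/bounded_fun_bnd; apply: bndD => //; exact: bndZ.
- exact: lsc_continuous.
- move=> x Dx N [oN Nx ND] phi cphi phiw phix.
  have jphi := C2_closure_jet2 oN cphi.
  apply: le_addgt0 => e e0.
  have s1 : 0 < 2 * (`|s| + 1) by rewrite mulr_gt0// ltr_wpDl.
  have L0 := Lam_ge0 hj.
  have L1 : 0 < 2 * (2 * d%:R + Lam j + 1).
    by rewrite mulr_gt0// ltr_wpDl// addr_ge0// mulr_ge0.
  have := @visc_sum_approx R d j hj D v f psi h s cv bv vv cf npsi x N phi _ _ oN Nx ND
    jphi _ _ _ (e / (2 * (2 * d%:R + Lam j + 1))) (e / (2 * (`|s| + 1)))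
    (divr_gt0 e0 L1) (divr_gt0 e0 s1).
  move=> /(_ _ _ _)/le_trans; apply.
  + by move=> y Ny; rewrite -subr_le0; exact: phiw.
  + by apply/eqP; rewrite -subr_eq0 phix.
  + exact: C2_closure_bounded bD ND cphi.
  rewrite -addrA lerD2l [leRHS]splitr; apply: lerD.
    by apply: split_error => //; exact: ltW.
  by rewrite mulrC; apply: split_error; [rewrite addr_ge0// mulr_ge0|exact: ltW].
Qed.

Lemma C2_closureZ N F (k : R) : open N -> C2_closure N F -> C2_closure N (fun x => k * F x).
Proof.
move=> oN cF; have jF := C2_closure_jet2 oN cF; have jk := jet2Z k jF.
case: cF => c0 c1 c2.
have cZ (g : vec -> R) : {within closure N, continuous g} ->
    {within closure N, continuous (fun x => k * g x)}.
  by move=> cg x; apply: continuousZat; exact: cg.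
split; first exact: cZ.
- move=> i; split=> [x Nx|]; first by have [] := jet2_d1 jk i Nx.
  have [_ [g cg ig]] := c1 i; exists (fun x => k * g x); first exact: cZ.
  by move=> x /[!inE] Nx; rewrite (jet2_partial jk)// ig// inE.
- move=> i l; split=> [x Nx|].
    have [dx _] := jet2_d2 jk i l Nx; apply: near_eq_derivable dx.
    by apply: near_open oN Nx _ => y Ny; rewrite (jet2_partial jk).
  have [_ [g cg ig]] := c2 i l; exists (fun x => k * g x); first exact: cZ.
  by move=> x /[!inE] Nx; rewrite (jet2_partial2 oN jk)// ig// inE.
Qed.

Lemma bnd_patch u N phi : bnd u -> (exists M, forall y, N y -> `|phi y| <= M) ->
  bnd (patch u N phi).
Proof.
move=> [M uM] [M' pM]; exists (`|M| + `|M'|) => y; rewrite /patch; case: ifPn => [/set_mem Ny|_].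
  by apply: le_trans (pM y Ny) _; rewrite ler_wpDl// ler_norm.
by apply: le_trans (uM y) _; rewrite ler_wpDr// ler_norm.
Qed.

(** Rescaling a test function by the inverse of - t exchanges touching from above and from below.
    The result is the form in which a subsolution enters [visc_sum]. *)
Lemma visc_sub_neg D u f (t : R) : bounded_set D -> continuous u -> 0 < t ->
  visc_subsol j D u f -> visc_supersol j D (fun x => - t * u x) (fun x => - t * f x).
Proof.
move=> bD cu t0 [mu /bounded_fun_bnd bu _ H].
have ctu : continuous (fun x => - t * u x) by exact: continuousZf.
split.
- exact: mrV_continuous.
- by apply/bounded_fun_bnd; exact: bndZ.
- exact: lsc_continuous.
- move=> x Dx N oND phi cphi phiu phix; have [oN Nx ND] := oND.
  have tN0 : - t != 0 by rewrite oppr_eq0 gt_eqF.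
  pose phi2 y := (- t)^-1 * phi y.
  have c2 : C2_closure N phi2 by exact: C2_closureZ.
  have phiE y : phi y = - t * phi2 y by rewrite /phi2 mulrA divff// mul1r.
  have := H x Dx N oND phi2 c2.
  have -> : patch (fun x => - t * u x) N phi = fun y => - t * patch u N phi2 y.
    by apply/funext => y; rewrite /patch; case: ifP => // _; exact: phiE.
  have j2 := C2_closure_jet2 oN c2.
  have jp : jet2 N (patch u N phi2) (fun i => 'D_(e_ i) phi2) (fun i k => 'D_(e_ k) ('D_(e_ i) phi2)).
    by apply: (jet2_eq oN _ j2) => y Ny; rewrite /patch mem_set.
  rewrite (LopZ hj _ oN Nx jp).
  + rewrite !mulNr lerN2 ler_pM2l//; apply.
      by move=> y /phiu; rewrite phiE -mulrBr mulNr oppr_le0 pmulr_rge0.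
    by move/eqP: phix; rewrite phiE -mulrBr mulf_eq0 (negbTE tN0)/= => /eqP.
  + by apply: mrV_patch => // y Ny; exact: (jet2_cont j2).
  + by apply: bnd_patch => //; exact: C2_closure_bounded bD ND c2.
Qed.

Lemma jet2_local_max U F f1 f2 x : open U -> U x -> jet2 U F f1 f2 ->
  (forall y, U y -> F y <= F x) -> forall i, f1 i x = 0 /\ f2 i i x <= 0.
Proof.
move=> oU Ux jF Fmax i.
have [rho [K [r0 K0 rU f1K TK]]] := taylor2_local oU Ux jF.
have line (t : R) : `|t| <= rho -> U (x + t *: e_ i).
  move=> tr; apply: rU; rewrite [x + _]addrC addrK normrZ.
  by apply: le_trans tr; rewrite unitv_norm mulr1.
have small (t : R) : `|t| <= rho -> t * f1 i x <= K * t ^+ 2.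
  move=> tr; have := TK x _ (t *: e_ i); rewrite subrr normr0 (ltW r0) => /(_ isT).
  rewrite normrZ unitv_norm mulr1 => /(_ tr).
  rewrite enormZ enorm_unitv mulr1 real_normK ?num_real// dotvZl dotvC dotv_unitv mxE.
  by have := Fmax _ (line t tr); rewrite ler_norml => h /andP[h2 _]; lra.
have f0 : f1 i x = 0.
  apply/eqP; rewrite eq_le; apply/andP; split.
  - apply: le_addgt0 => e e0; rewrite add0r.
    (* Dividing t f1 <= K t^2 by t bounds f1 by K t, which is at most e for this t. *)
    pose t := Num.min rho (e / (K + 1)).
    have K1 : 0 < K + 1 by rewrite ltr_wpDl.
    have t0 : 0 < t by rewrite lt_min r0 divr_gt0.
    have := small t; rewrite ger0_norm ?(ltW t0)// ge_min lexx => /(_ isT).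
    rewrite expr2 mulrCA ler_pM2l// => /le_trans; apply.
    have : t <= e / (K + 1) by rewrite ge_min lexx orbT.
    rewrite ler_pdivlMr// mulrC; apply: le_trans.
    by rewrite ler_wpM2r ?(ltW t0)// lerDl.
  - rewrite -oppr_le0; apply: le_addgt0 => e e0; rewrite add0r.
    pose t := Num.min rho (e / (K + 1)).
    have K1 : 0 < K + 1 by rewrite ltr_wpDl.
    have t0 : 0 < t by rewrite lt_min r0 divr_gt0.
    have := small (- t); rewrite normrN ger0_norm ?(ltW t0)// ge_min lexx => /(_ isT).
    rewrite sqrrN expr2 mulrCA mulNr -mulrN ler_pM2l// => /le_trans; apply.
    have : t <= e / (K + 1) by rewrite ge_min lexx orbT.
    rewrite ler_pdivlMr// mulrC; apply: le_trans.
    by rewrite ler_wpM2r ?(ltW t0)// lerDl.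
split => //; rewrite leNgt; apply/negP => m0.
have cf2 : {for x, continuous (f2 i i)} by exact: (jet2_cont2 jF).
have [rho1 r10 H1] := near_box (near_cont cf2 m0).
pose t := Num.min rho rho1; have t0 : 0 < t by rewrite lt_min r0.
have tr : `|t| <= rho by rewrite ger0_norm ?(ltW t0)// ge_min lexx.
have d1 (s : R) : `|s| <= `|t| -> is_derive (x + s *: e_ i) (e_ i) F (f1 i (x + s *: e_ i)).
  by move=> st; apply: (jet2_d1 jF); apply: line; exact: le_trans st tr.
(* As f1 vanishes at x, two mean values write the increment of F as t s f2 at a nearby point; with s
   > 0 a positive f2 would contradict the maximum. *)
have [s [st /(_ (lt0r_neq0 t0)) sgt] Es] := mvt_line d1.
have s0 : 0 < s by move: sgt; rewrite pmulr_lgt0.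
have d2 (q : R) : `|q| <= `|s| -> is_derive (x + q *: e_ i) (e_ i) (f1 i) (f2 i i (x + q *: e_ i)).
  move=> qs; apply: (jet2_d2 jF); apply: line.
  by apply: le_trans qs _; apply: le_trans st tr.
have [q [qs _] Eq] := mvt_line d2.
have : 0 < f2 i i (x + q *: e_ i).
  have := H1 (x + q *: e_ i); rewrite [x + _]addrC addrK normrZ unitv_norm mulr1.
  have -> : `|q| <= rho1.
    apply: le_trans qs _; apply: le_trans st _.
    by rewrite ger0_norm ?(ltW t0)// ge_min lexx orbT.
  by move=> /(_ isT); rewrite addrC ltr_norml => /andP[h _]; lra.
move=> f2p; have := Fmax _ (line t tr); rewrite -subr_le0 Es.
by move: Eq; rewrite f0 subr0 => ->; rewrite leNgt mulr_gt0// mulr_gt0.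
Qed.

(** Seed for [visc_sum]: a multiple of a nice function added to zero becomes a viscosity
    supersolution. The patched test function has a global maximum at x, where its gradient vanishes
    and both parts of L are nonpositive. *)
Lemma visc_zero D : bounded_set D -> visc_supersol j D (fun=> 0) (fun=> 0).
Proof.
move=> bD; split.
- exact: mrV_cst.
- by apply/bounded_fun_bnd; exact: bnd_cst.
- by apply: lsc_continuous; exact: cst_continuous.
- move=> x Dx N [oN Nx ND] phi cphi phiw phix.
  have jphi := C2_closure_jet2 oN cphi.
  pose W := patch (fun=> 0) N phi.
  have jW : jet2 N W (fun i => 'D_(e_ i) phi) (fun i k => 'D_(e_ k) ('D_(e_ i) phi)).
    by apply: (jet2_eq oN _ jphi) => y Ny; rewrite /W /patch mem_set.
  have W0 y : W y <= 0.
    rewrite /W /patch; case: ifPn => // /set_mem/phiw.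
    by rewrite subr0.
  have Wx : W x = 0 by rewrite /W /patch mem_set//; move: phix; rewrite subr0.
  have H := jet2_local_max oN Nx jW.
  have {}H i : 'D_(e_ i) phi x = 0 /\ 'D_(e_ i) ('D_(e_ i) phi) x <= 0.
    by apply: H => y _; rewrite Wx.
  rewrite (Lop_jet j oN Nx jW) -[leRHS]addr0; apply: lerD.
    by apply: sumr_le0 => i _; case: (H i).
  have aW : adm (Dlt W x (\row_i 'D_(e_ i) phi x)).
    apply: (adm_Dlt_jet oN Nx jW).
      by apply: mrV_patch; [|move=> y; exact: (jet2_cont jphi)|exact: mrV_cst].
    by apply: bnd_patch; [exact: bnd_cst|exact: C2_closure_bounded bD ND cphi].
  rewrite -(Ij0 hj); apply: (le_Ij hj) => //; first exact: adm_cst0.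
  move=> y; rewrite /Dlt Wx subr0 /dotv big1 ?mulr0 ?subr0 ?W0// => i _.
  by rewrite mxE (H i).1 mulr0.
Qed.

Lemma chi_jet (a b : R) z x (eta : R) : 0 < eta ->
  (forall y, enorm y <= eta -> chi a b z (x + y) = 1 - b * gs a z (x + y)) ->
  exists U, [/\ open U, U x & jet2 U (chi a b z) (fun i x => - b * gs1 a z i x)
    (fun i k x => - b * gs2 a z i k x)].
Proof.
move=> e0 Hc; exists (ball x (eta / d.+1%:R)).
have B0 : 0 < eta / d.+1%:R by rewrite divr_gt0.
have oB : open (ball x (eta / d.+1%:R)) by exact: ball_open.
split => //; first exact: ballxx.
have := jet2D (jet2_cst (ball x (eta / d.+1%:R)) 1) (jet2Z (- b) (jet2_gs _ a z)).
have -> : (fun i x => 0 + - b * gs1 a z i x) = (fun i x => - b * gs1 a z i x).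
  by apply/funext => i; apply/funext => y; rewrite add0r.
have -> : (fun i k x => 0 + - b * gs2 a z i k x) = (fun i k x => - b * gs2 a z i k x).
  by apply/funext => i; apply/funext => k; apply/funext => y; rewrite add0r.
apply: (jet2_eq oB) => w; rewrite -ball_normE/= => xw.
have -> : w = x + (w - x) by rewrite addrC subrK.
rewrite Hc ?mulNr//; apply: le_trans (enorm_le_norm _) _.
rewrite distrC; apply: (@le_trans _ _ (d%:R * (eta / d.+1%:R))).
  by rewrite ler_wpM2l// ltW.
by rewrite mulrA ler_pdivrMr// mulrC ler_wpM2l ?(ltW e0)// ler_nat.
Qed.

(* A narrow-domain maximum principle: the zeroth-order term is harmless in a thin
   layer along the frontier because the barriers there have very negative L. *)
Lemma boundary_mp D (C : R) : open D -> bounded_set D -> uniform_exterior_sphere D -> 0 <= C ->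
  exists2 del : R, 0 < del & forall w g,
  continuous w -> visc_supersol j D w g -> (forall x, ~ D x -> 0 <= w x) ->
  (forall x, D x -> (forall q, ~ D q -> del <= enorm (x - q)) -> 0 <= w x) ->
  (forall x, D x -> w x < 0 -> g x <= C * `|w x|) -> forall x, 0 <= w x.
Proof.
move=> oD bD [r r0 hs] C0.
(* The barrier is taken with C + 1, one more than the zeroth-order coefficient; the surplus produces
   the final contradiction m (C + 1) <= C m. *)
have [a [b [del [del' [eta [c0 [[[a0 b0 del0 _ _] [eta0 eta1 c00 c01 _]] HA HB HC [HC' _]]]]]]]] :=
  @barrier R d j hj r (C + 1) 1 r0 ltr01 (lexx 1).
exists del => // w g cw vw wout wdeep wg x; rewrite leNgt; apply/negP => wx.
have Dx : D x by apply: contrapT => /wout; rewrite leNgt wx.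
have cD := compact_closure bD.
have cD0 : closure D !=set0 by exists x; exact: subset_closure.
have [x0 /set_mem x0D x0min] := EVT_min_rV cD0 cD (@continuous_subspaceT _ _ _ _ cw).
have wx0 : w x0 < 0.
  by apply: le_lt_trans wx; apply: x0min; rewrite inE; exact: subset_closure.
have Dx0 : D x0 by apply: contrapT => /wout; rewrite leNgt wx0.
have [q nDq qx] : exists2 q, ~ D q & enorm (x0 - q) < del.
  apply: contrapT => H; have := wdeep x0 Dx0; rewrite leNgt wx0 => H2.
  apply: notF; apply: H2 => q nDq; rewrite leNgt; apply/negP => qd; apply: H; exists q => //.
have [y fy yx] := frontier_between oD Dx0 nDq.
have [z [nDz yz zD]] := hs y fy.
have rD p : D p -> r <= enorm (p - z).
  move=> Dp; rewrite leNgt; apply/negP => pz.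
  by have : (eball z r `&` D) p by []; rewrite zD.
have x0z : enorm (x0 - z) < r + del.
  rewrite -(subrK y x0) -addrA; apply: le_lt_trans (ler_enormD _ _) _.
  by rewrite yz addrC ltrD2l; exact: le_lt_trans yx qx.
pose m := - w x0; have m0 : 0 < m by rewrite oppr_gt0.
(* Where the barrier exceeds c0, Q lies below - m, the minimum of w; at x0 the barrier is below c0
   and w is below Q. Hence the minimum of w - Q is negative and is attained inside D, in the layer
   where L of the barrier is controlled. *)
pose Q p := (- (m / c0)) * chi a b z p.
have mc0 : 0 < m / c0 by rewrite divr_gt0.
have cQ : continuous Q by apply: continuousZf; exact: chi_continuous.
have cP : continuous (fun p => w p - Q p) by exact: continuousBf.
have [x1 /set_mem x1D x1min] := EVT_min_rV cD0 cD (@continuous_subspaceT _ _ _ _ cP).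
have P1 : w x1 - Q x1 < 0.
  apply: (@le_lt_trans _ _ (w x0 - Q x0)); first by apply: x1min; rewrite inE.
  rewrite /Q mulNr opprK -[w x0]opprK -/m addrC subr_lt0 mulrAC ltr_pdivrMr//.
  by rewrite ltr_pM2l//; exact: HC'.
have Q0 p : 0 <= - Q p by rewrite /Q mulNr opprK mulr_ge0 ?chi_ge0// ltW.
have Dx1 : D x1.
  apply: contrapT => /wout w1; have := addr_ge0 w1 (Q0 x1).
  by rewrite leNgt P1.
have w1m : - m <= w x1 by rewrite opprK; apply: x0min; rewrite inE; exact: subset_closure.
have w10 : w x1 < 0 by apply: le_lt_trans P1; rewrite lerDl.
have x1z : enorm (x1 - z) < r + del.
  rewrite ltNge; apply/negP => /HC c1; move: P1; rewrite ltNge => /negP; apply.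
  rewrite /Q mulNr opprK -lerBlDr sub0r; apply: le_trans w1m.
  by rewrite lerN2 mulrAC ler_pdivlMr// ler_pM2l.
have rx1 := rD _ Dx1.
have [U [oU Ux1 jU]] := chi_jet eta0 (fun y ye => HA z x1 y rx1 ye).
have jQ := jet2Z (- (m / c0)) jU.
have mchi : mrV (chi a b z) by apply: mrV_continuous; exact: chi_continuous.
have bchi : bnd (chi a b z) by exact: chi_bnd (ltW b0).
have T : Lop j Q x1 <= g x1.
  apply: (visc_supersol_touch hj oD Dx1 oU Ux1 jQ _ _ vw).
  - exact: mrV_continuous.
  - exact: bndZ.
  - move=> p; have [pD|pD] := pselect (closure D p); first by apply: x1min; rewrite inE.
    have nDp : ~ D p by move=> Dp; apply: pD; exact: subset_closure.
    by apply: (le_trans (ltW P1)); exact: (addr_ge0 (wout p nDp) (Q0 p)).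
have := HB z x1 rx1 (ltW x1z); rewrite -/(dchi a b z x1).
have -> : \sum_i - b * gs2 a z i i x1 + Ij j (Dlt (chi a b z) x1 (dchi a b z x1)) =
    Lop j (chi a b z) x1 by rewrite (Lop_jet j oU Ux1 jU).
have LQ : Lop j Q x1 = (- (m / c0)) * Lop j (chi a b z) x1.
  exact: (LopZ hj _ oU Ux1 jU).
move=> /(ler_wpM2l (ltW mc0)) h1.
have h2 : C * `|w x1| <= C * m.
  by rewrite ler_wpM2l// ltr0_norm// lerNl.
have h3 : m * (C + 1) <= m / c0 * (C + 1).
  by rewrite ler_wpM2r ?addr_ge0// ler_pdivlMr// ler_piMr// ltW.
have h4 := wg _ Dx1 w10.
move: T; rewrite LQ mulNr => T; rewrite mulrN in h1.
have h5 : m * (C + 1) <= C * m.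
  apply: (le_trans h3); rewrite -lerNr in h1; apply: (le_trans h1).
  by apply: (le_trans T); apply: (le_trans h4).
by move: h5; rewrite mulrDr mulr1 mulrC gerDl leNgt m0.
Qed.

(** Hopf's comparison. Near x1 the function w keeps half of its value there. A Gaussian bump
    vanishing at radius rho and scaled by this half is, for large a, a strict subsolution on the
    remaining annulus, so w cannot drop below it. *)
Lemma strong_mp_ball D w g (C : R) x1 (rho : R) :
  open D -> bounded_set D -> 0 <= C -> continuous w -> (forall x, 0 <= w x) ->
  visc_supersol j D w g -> (forall x, D x -> g x <= C * w x) ->
  0 < w x1 -> (forall z, enorm (z - x1) <= rho -> D z) ->
  forall z, enorm (z - x1) < rho -> 0 < w z.
Proof.
move=> oD bD C0 cw w0 vw gC w1 rD z zx.
have rho0 : 0 < rho by apply: le_lt_trans zx; exact: enorm_ge0.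
have w12 : 0 < w x1 / 2 by rewrite divr_gt0.
have [s' s'0 Hs] := near_box (near_cont (cw x1) w12).
pose s := Num.min s' rho; have s0 : 0 < s by rewrite lt_min s'0.
have ws p : enorm (p - x1) <= s -> w x1 / 2 <= w p.
  move=> ps; have := Hs p; rewrite (le_trans (norm_le_enorm _)); last first.
    by apply: le_trans ps _; rewrite ge_min lexx.
  by move=> /(_ isT); rewrite ltr_norml => /andP[h _]; lra.
have L0 := Lam_ge0 hj.
pose B := 2 * d%:R + Lam j.
have B0 : 0 <= B by rewrite addr_ge0// mulr_ge0.
have [a [a0 Ha]] : exists a, 0 <= a /\ C + 1 <= 4 * a ^+ 2 * s ^+ 2 - 2 * d%:R * a - a * Lam j - Lam j.
  pose k := 4 * s ^+ 2; have k0 : 0 < k by rewrite mulr_gt0// exprn_gt0.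
  (* With a = 1 + e and e k = B + C + 1 + Lam, the expression k a^2 - B a - Lam equals (1 + e) (k +
     C + 1 + Lam) - Lam, which is at least C + 1. *)
  exists (1 + (B + C + 1 + Lam j) / k).
  set e := _ / k; have e0 : 0 <= e by rewrite divr_ge0 ?(ltW k0)// !addr_ge0.
  split; first by rewrite addr_ge0.
  have ek : e * k = B + C + 1 + Lam j by rewrite /e divfK// gt_eqF.
  have : (1 + e) ^+ 2 * k - B * (1 + e) - Lam j = (1 + e) * (k + (C + 1 + Lam j)) - Lam j.
    by rewrite expr2 -mulrA [(1 + e) * k]mulrDl mul1r ek; ring.
  have h : 0 <= e * (k + (C + 1 + Lam j)) by rewrite mulr_ge0 ?addr_ge0// ltW.
  by rewrite /B /k in k0 h *; lra.
pose c1 := expR (- a * rho ^+ 2); pose t := w x1 / 2.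
pose phi p := t * (gs a x1 p - c1).
have phiout p : rho <= enorm (p - x1) -> phi p <= 0.
  move=> pr; rewrite /phi pmulr_rle0// subr_le0 /gs /c1 -sqr_enorm ler_expR !mulNr lerN2.
  by rewrite ler_wpM2l// ler_pXn2r// ?nnegrE ?enorm_ge0 ?(ltW rho0).
have phiin p : enorm (p - x1) < rho -> a != 0 -> 0 < phi p.
  move=> pr aN0; have a00 : 0 < a by rewrite lt_neqAle eq_sym aN0.
  rewrite /phi pmulr_rgt0// subr_gt0 /gs /c1 -sqr_enorm ltr_expR !mulNr ltrN2.
  by rewrite ltr_pM2l// ltr_pXn2r// ?nnegrE ?enorm_ge0 ?(ltW rho0).
have aN0 : a != 0.
  by apply/eqP => a00; move: Ha; rewrite a00; have := L0; rewrite expr2; lra.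
apply: lt_le_trans (phiin z zx aN0) _.
have cphi : continuous phi.
  by apply: continuousZf; apply: continuousBf; [exact: continuous_gs|exact: continuous_cstf].
have jphi : jet2 setT phi (fun i x => t * (gs1 a x1 i x + 0)) (fun i k x => t * (gs2 a x1 i k x + 0)).
  by apply: jet2Z; apply: jet2D; [exact: jet2_gs|exact: (jet2_cst setT (- c1))].
have Dz : D z by apply: rD; exact: ltW.
have cP : continuous (fun p => w p - phi p) by exact: continuousBf.
have cD0 : closure D !=set0 by exists z; exact: subset_closure.
have [x0 /set_mem x0D x0min] := EVT_min_rV cD0 (compact_closure bD) (@continuous_subspaceT _ _ _ _ cP).
rewrite -subr_ge0; apply: (@le_trans _ _ (w x0 - phi x0)); last first.
  by apply: x0min; rewrite inE; exact: subset_closure.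
rewrite leNgt; apply/negP => P0.
have x0r : enorm (x0 - x1) < rho.
  rewrite ltNge; apply/negP => /phiout h; move: P0; rewrite ltNge subr_ge0.
  by rewrite (le_trans h).
have Dx0 : D x0 by apply: rD; exact: ltW.
have sx0 : s <= enorm (x0 - x1).
  rewrite leNgt; apply/negP => /ltW/ws h; move: P0; rewrite ltNge => /negP; apply.
  rewrite subr_ge0; apply: le_trans h; rewrite /phi ler_piMr ?(ltW w12)//.
  by have := gs_le1 x1 x0 a0; have := expR_ge0 (- a * rho ^+ 2); rewrite -/c1; lra.
have T : Lop j phi x0 <= g x0.
  apply: (visc_supersol_touch hj oD Dx0 openT I jphi _ _ vw).
  - exact: mrV_continuous.
  - apply: bndZ; apply: bndB; last exact: bnd_cst.
    by exists 1 => p; rewrite ger0_norm ?gs_le1// ltW// gs_gt0.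
  - move=> p; have [pD|pD] := pselect (closure D p); first by apply: x0min; rewrite inE.
    apply: (le_trans (ltW P0)); rewrite subr_ge0; apply: le_trans (w0 p).
    apply: phiout; rewrite leNgt; apply/negP => pr; apply: pD; apply: subset_closure.
    by apply: rD; exact: ltW.
have mg : mrV (gs a x1) by apply: mrV_continuous; exact: continuous_gs.
have bg : bnd (gs a x1).
  by exists 1 => p; rewrite ger0_norm ?gs_le1// ltW// gs_gt0.
have LE : Lop j phi x0 = t * Lop j (gs a x1) x0.
  have j1 := jet2D (jet2_gs setT a x1) (jet2_cst setT (- c1)).
  rewrite (LopZ hj t openT I j1); last 2 first.
  - by apply: mrVD => //; exact: mrV_cst.
  - by apply: bndD => //; exact: bnd_cst.
  rewrite (LopD hj openT I (jet2_gs setT a x1) (jet2_cst setT (- c1)))//.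
  - by rewrite (Lop_cst hj) addr0.
  - exact: mrV_cst.
  - exact: bnd_cst.
have g0 := gs_gt0 a x1 x0.
have H := hopf_Lop hj x1 x0 a0.
have s2 : s ^+ 2 <= enorm (x0 - x1) ^+ 2.
  by rewrite ler_pXn2r// ?nnegrE ?enorm_ge0 ?(ltW s0).
have h1 : (C + 1) * gs a x1 x0 <= Lop j (gs a x1) x0.
  apply: le_trans H; rewrite ler_pM2r//; apply: le_trans Ha _.
  rewrite !lerD2r ler_wpM2l// mulr_ge0// exprn_ge0//.
have h2 : w x0 <= t * gs a x1 x0.
  move: P0; rewrite subr_lt0 => /ltW/le_trans; apply; rewrite /phi ler_pM2l//.
  by rewrite gerBl expR_ge0.
have h3 := gC _ Dx0.
have h4 := ler_wpM2l C0 h2.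
have h5 := ler_wpM2l (ltW w12) h1; rewrite -/t in h5.
have h6 : 0 < t * gs a x1 x0 by rewrite mulr_gt0.
have h7 : t * ((C + 1) * gs a x1 x0) <= C * (t * gs a x1 x0).
  by rewrite -LE in h5; apply: (le_trans h5); apply: (le_trans T); apply: (le_trans h3).
by move: h7; rewrite mulrCA mulrDl mul1r gerDl leNgt h6.
Qed.

(** The positivity set is open by continuity and closed relative to D: a limit point lies in a ball
    about a nearby positive point to which [strong_mp_ball] applies. Connectedness concludes. *)
Lemma strong_mp D w g (C : R) :
  open D -> bounded_set D -> connected D -> 0 <= C -> continuous w -> (forall x, 0 <= w x) ->
  visc_supersol j D w g -> (forall x, D x -> g x <= C * w x) ->
  (exists2 x, D x & 0 < w x) -> forall x, D x -> 0 < w x.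
Proof.
move=> oD bD coD C0 cw w0 vw gC [x1 Dx1 w1] x Dx.
pose A := [set y | 0 < w y].
have oA : open A by exact: open_fun_gt.
suff E : D `&` A = D by have [] : (D `&` A) x by rewrite E.
apply: coD; first by exists x1.
  by exists A.
exists (closure (D `&` A)); first exact: closed_closure.
apply/seteqP; split => [y [Dy Ay]|y [Dy cy]].
  by split => //; apply: subset_closure.
split => //; have [s s0 Hs] := open_box oD Dy.
(* Division by d + 1 turns closeness in the max norm of the topology into Euclidean distance at most
   s / 4. *)
pose rho := s / 4 / d.+1%:R; have rho0 : 0 < rho by rewrite !divr_gt0.
have : nbhs y (ball y rho) by exact: nbhsx_ballx.
move=> /cy[y1 [[Dy1 Ay1]]]; rewrite -ball_normE/= => yy1.
have dr : d%:R * rho <= s / 4.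
  by rewrite /rho mulrCA -[leRHS]mulr1 ler_pM2l ?divr_gt0// ler_pdivrMr// mul1r ler_nat.
have s40 : 0 < s / 4 by rewrite divr_gt0.
have ey : enorm (y - y1) <= s / 4.
  by apply: le_trans (enorm_le_norm _) _; apply: le_trans dr; rewrite ler_wpM2l// ltW.
apply: (@strong_mp_ball D w g C y1 (s / 2) oD bD C0 cw w0 vw gC Ay1) => [z zy1|]; last first.
  by apply: le_lt_trans ey _; lra.
apply: Hs; rewrite -(subrK y1 z) -addrA; apply: le_trans (ler_normD _ _) _.
have := le_trans (norm_le_enorm _) zy1; have := le_trans (norm_le_enorm _) ey.
by rewrite [`|y - y1|]distrC; lra.
Qed.

End viscosity_theory.

(** * Comparison of eigenfunctions *)
Section eigen_comparison.
Context {R : realType} {d : nat}.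
Local Notation vec := 'rV[R]_d.
Local Notation e_ := (@unitv R d).
Implicit Types (x y z : vec) (U N D : set vec) (F G u v w psi : vec -> R).

Lemma within_closure_bounded D u : bounded_set D -> {within closure D, continuous u} ->
  exists2 M, 0 <= M & forall y, D y -> `|u y| <= M.
Proof.
move=> bD cu; have [[z Dz]|D0] := pselect (D !=set0); last first.
  by exists 0 => // y Dy; case: D0; exists y.
have cD0 : closure D !=set0 by exists z; exact: subset_closure.
have cnu : {within closure D, continuous (fun x => `|u x|)}.
  by move=> x; apply: cvg_norm; exact: cu.
have [x _ xmax] := EVT_max_rV cD0 (compact_closure bD) cnu.
by exists `|u x| => // y Dy; apply: xmax; rewrite inE; exact: subset_closure.
Qed.

(** The points at distance at least del from the complement form a compact set. They are the points
    on which [boundary_mp] asks for nonnegativity as a hypothesis. *)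
Lemma deep_min D u (del : R) : bounded_set D -> 0 < del -> continuous u ->
  (forall x, D x -> 0 < u x) -> exists2 m, 0 < m &
  forall x, D x -> (forall q, ~ D q -> del <= enorm (x - q)) -> m <= u x.
Proof.
move=> bD del0 cu u0.
pose K := [set x : vec | forall q, ~ D q -> del <= enorm (x - q)].
have KD x : K x -> D x.
  move=> Kx; apply: contrapT => /Kx; rewrite subrr enorm0.
  by rewrite leNgt del0.
have clK : closed K.
  rewrite (_ : K = \bigcap_(q in ~` D) [set x | del <= enorm (x - q)]) //.
  apply: closed_bigI => q _.
  rewrite (_ : mkset _ = ~` [set x | enorm (x - q) < del]); last first.
    by apply/seteqP; split => y /=; rewrite leNgt; [move/negP|move/negP].
  apply: open_closedC; apply: open_fun_lt.
  rewrite (_ : (fun y => enorm (y - q)) = fun y => Num.sqrt (qd q y)); last first.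
    by apply/funext => y; rewrite /qd sqrtr_sqr ger0_norm ?enorm_ge0.
  apply: continuous_compf; last exact: sqrt_continuous.
  exact: jet2_continuous (jet2_qd q).
have [[z Kz]|K0] := pselect (K !=set0); last first.
  by exists 1 => // x Dx Kx; case: K0; exists x.
have cK : compact K.
  apply: bounded_closed_compact => //; case: bD => M [Mr DM].
  by exists M; split => // B MB y Ky; apply: DM => //; exact: KD.
have [x0 /set_mem Kx0 x0min] := EVT_min_rV (ex_intro _ z Kz) cK (@continuous_subspaceT _ _ _ _ cu).
exists (u x0); first exact/u0/KD.
by move=> x Dx Kx; apply: x0min; rewrite inE.
Qed.

Variable j : vec -> R.
Hypothesis hj : levy_density j.
Variables (D : set vec) (c : vec -> R).
Hypotheses (oD : open D) (bD : bounded_set D) (coD : connected D)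
  (sD : uniform_exterior_sphere D) (hc : {within closure D, continuous c}) (D0 : D 0).

(* Take the largest t with t psi <= v in D. The boundary maximum principle
   prevents contact at the frontier, and at an interior contact point the strong
   maximum principle forces v = t psi. *)
Lemma compare_eigen v psi (lam mu : R) :
  continuous v -> bnd v -> continuous psi -> bnd psi ->
  (forall x, 0 <= v x) -> (forall x, D x -> 0 < v x) ->
  (forall x, D x -> 0 < psi x) -> (forall x, ~ D x -> psi x = 0) -> mu <= lam ->
  (forall t, 0 < t -> visc_supersol j D (fun x => v x + - t * psi x)
    (fun x => - c x * v x - lam * v x + t * (c x * psi x + mu * psi x))) ->
  lam = mu /\ exists2 t, 0 < t & forall x, D x -> v x = t * psi x.
Proof.
move=> cv bv cpsi bpsi v0 vD psiD psi0 mulam Hv.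
have [Cc Cc0 HC] := within_closure_bounded bD hc.
pose C := Cc + `|lam|; have C0 : 0 <= C by rewrite addr_ge0.
pose g t x := - c x * v x - lam * v x + t * (c x * psi x + mu * psi x).
pose w t x := v x + - t * psi x.
(* Because mu <= lam, the last term has the favourable sign, and both maximum principles apply to
   [w t] with constant C. *)
have gE t x : g t x = - (c x + lam) * w t x - t * (lam - mu) * psi x.
  by rewrite /g /w; ring.
have psi_ge0 x : 0 <= psi x.
  by have [/psiD/ltW//|/psi0 ->] := pselect (D x).
have gC t x : 0 < t -> D x -> g t x <= C * `|w t x|.
  move=> t0 Dx; rewrite gE lerBlDr -[leLHS]addr0; apply: lerD; last first.
    by rewrite !mulr_ge0 ?subr_ge0// ltW.
  apply: le_trans (ler_norm _) _; rewrite normrM ler_wpM2r// normrN.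
  by apply: le_trans (ler_normD _ _) _; rewrite lerD2r HC.
have cw t : continuous (w t) by apply: continuousDf => //; exact: continuousZf.
have [del del0 Hbmp] := boundary_mp hj oD bD sD C0.
have bmp t : 0 < t -> (forall x, D x -> (forall q, ~ D q -> del <= enorm (x - q)) -> 0 <= w t x) ->
    forall x, 0 <= w t x.
  move=> t0 deep; apply: (Hbmp (w t) (g t)) => //.
  - exact: Hv.
  - by move=> x nDx; rewrite /w psi0// mulr0 addr0.
  - by move=> x Dx _; exact: gC.
have [M HM] := bpsi; have M1 : 0 < `|M| + 1 by rewrite ltr_wpDl.
have psiM x : psi x <= `|M| + 1.
  apply: le_trans (ler_norm _) _; apply: le_trans (HM x) _.
  by rewrite (le_trans (ler_norm M))// lerDl.
(* A margin m in the deep part pays for raising t by m / (|M| + 1), since psi is at most |M| + 1;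
   [boundary_mp] carries the inequality into the layer. *)
have improve t m : 0 <= t -> 0 < m -> (forall x, D x ->
    (forall q, ~ D q -> del <= enorm (x - q)) -> m <= w t x) ->
    forall x, 0 <= w (t + m / (`|M| + 1)) x.
  move=> t0 m0 H; apply: bmp; first by rewrite ltr_wpDl// divr_gt0.
  move=> x Dx deep; have := H x Dx deep.
  have : m / (`|M| + 1) * psi x <= m by rewrite mulrAC ler_pdivrMr// ler_pM2l.
  by rewrite /w; lra.
pose T := [set t : R | 0 < t /\ forall x, 0 <= w t x].
have [m m0 Hm] := deep_min bD del0 cv vD.
have T0 : T (m / (`|M| + 1)).
  split; first by rewrite divr_gt0.
  have := improve 0 m (lexx 0) m0; rewrite add0r; apply => x Dx deep.
  by rewrite /w oppr0 mul0r addr0; exact: Hm.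
have ubT x : D x -> ubound T (v x / psi x).
  by move=> Dx t [_ /(_ x)]; rewrite /w mulNr subr_ge0 ler_pdivlMr// psiD.
have hT : has_sup T by split; [exists (m / (`|M| + 1))|exists (v 0 / psi 0); exact: ubT].
pose t := sup T.
have tT s : T s -> s <= t by move=> Ts; apply: sup_upper_bound.
have t0 : 0 < t by apply: lt_le_trans (tT _ T0); rewrite divr_gt0.
have w0 x : 0 <= w t x.
  have [Dx|/psi0 px] := pselect (D x); last by rewrite /w px mulr0 addr0.
  rewrite /w mulNr subr_ge0 -ler_pdivlMr ?psiD//.
  by apply: ge_sup; [exists (m / (`|M| + 1))|exact: ubT].
(* If the difference were positive anywhere, it would be positive throughout D, leaving a margin in
   the deep part and hence room to enlarge the maximal t. *)
have wD x : D x -> w t x = 0.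
  move=> Dx; apply/eqP; rewrite eq_le w0 andbT leNgt; apply/negP => wx.
  have wpos : forall y, D y -> 0 < w t y.
    apply: (strong_mp hj oD bD coD C0 (cw t) w0 (Hv t t0)); last by exists x.
    by move=> y Dy; rewrite -(ger0_norm (w0 y)); exact: gC.
  have [m' m'0 Hm'] := deep_min bD del0 (cw t) wpos.
  have H := improve t m' (ltW t0) m'0 Hm'.
  have : T (t + m' / (`|M| + 1)) by split => //; rewrite addr_gt0// divr_gt0.
  by move/tT; rewrite gerDl leNgt divr_gt0.
split; last first.
  by exists t => // x /wD/eqP; rewrite /w mulNr subr_eq0 => /eqP.
apply/eqP; rewrite eq_le mulam andbT -subr_le0.
(* The zero function touches [w t] from below at the origin, so the equation gives 0 <= - t (lam -
   mu) psi 0, that is lam <= mu. *)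
have touch y : w t 0 - 0 <= w t y - 0 by rewrite !subr0 wD.
have := visc_supersol_touch hj oD D0 openT I (jet2_cst setT 0) (@mrV_cst R d 0)
  (@bnd_cst R d 0) (Hv t t0) touch.
rewrite (Lop_cst hj) -/(g t 0) gE wD// mulr0 sub0r.
by rewrite oppr_ge0 pmulr_lle0 ?psiD// pmulr_rle0.
Qed.

Lemma visc_sup_neg u f : bounded_set D -> continuous u -> bnd u ->
  visc_supersol j D (fun x => -1 * u x) (fun x => -1 * f x) -> visc_subsol j D u f.
Proof.
move=> _ cu bu [_ _ _ H].
split.
- exact: mrV_continuous.
- exact/bounded_fun_bnd.
- apply: lsc_continuous; rewrite (_ : \- u = fun x => -1 * u x).
    exact: continuousZf.
  by apply/funext => y; rewrite mulN1r.
- move=> x Dx N oND phi cphi phiu phix; have [oN Nx ND] := oND.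
  pose phi2 y := -1 * phi y.
  have c2 : C2_closure N phi2 by exact: C2_closureZ.
  have := H x Dx N oND phi2 c2.
  have -> : patch (fun x => -1 * u x) N phi2 = fun y => -1 * patch u N phi y.
    by apply/funext => y; rewrite /patch; case: ifP.
  have j2 := C2_closure_jet2 oN cphi.
  have jp : jet2 N (patch u N phi) (fun i => 'D_(e_ i) phi) (fun i k => 'D_(e_ k) ('D_(e_ i) phi)).
    by apply: (jet2_eq oN _ j2) => y Ny; rewrite /patch mem_set.
  rewrite (LopZ hj _ oN Nx jp).
  + have h1 y : N y -> phi2 y - -1 * u y <= 0.
      by move=> /phiu; rewrite /phi2 -mulrBr mulN1r oppr_le0.
    have h2 : phi2 x - -1 * u x = 0 by rewrite /phi2 -mulrBr phix mulr0.
    by move=> /(_ h1 h2); rewrite !mulN1r lerN2.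
  + by apply: mrV_patch => //; [move=> y Ny; exact: (jet2_cont j2)|exact: mrV_continuous].
  + by apply: bnd_patch => //; exact: C2_closure_bounded bD ND cphi.
Qed.

Lemma nice_scale psi h (k : R) : 0 < k -> nice j D psi h ->
  nice j D (fun x => k * psi x) (fun x => k * h x).
Proof.
move=> k0 [cpsi bpsi H]; split; [exact: continuousZf|exact: bndZ|].
move=> x0 Dx0 tau t0; have [rho r0 Hr] := H x0 Dx0 (tau / k) (divr_gt0 t0 k0).
exists rho => // tau' t'0; have [P [p1 [p2 [jP bP PH LP]]]] := Hr (tau' / k) (divr_gt0 t'0 k0).
exists (fun x => k * P x), (fun i x => k * p1 i x), (fun i l x => k * p2 i l x); split.
- exact: jet2Z.
- exact: bndZ.
- move=> x; rewrite -mulrBr normrM gtr0_norm// mulrC -ler_pdivlMr//.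
- move=> x xr; rewrite (LopZ hj k openT I jP)//; last by apply: mrV_continuous; exact: jet2_continuous jP.
  by rewrite -mulrBr normrM gtr0_norm// mulrC -ler_pdivlMr//; exact: LP.
Qed.

Lemma eigenvalue_rhs_continuous u (lam : R) : continuous u ->
  forall x, D x -> {for x, continuous (fun x => - c x * u x - lam * u x)}.
Proof.
move=> cu x Dx; have cc := within_closure_for oD Dx hc.
rewrite (_ : (fun _ => _) = fun x => (-1 * c x) * u x + (- lam) * u x); last first.
  by apply/funext => y; ring.
apply: continuousDat; last by apply: continuousZat; exact: cu.
by apply: continuousMat; [exact: continuousZat|exact: cu].
Qed.

Section with_nice.
Variables (lam1 : R) (psi : vec -> R).
Hypotheses (npsi : nice j D psi (fun x => - c x * psi x - lam1 * psi x))
  (psiD : forall x, D x -> 0 < psi x) (psi0 : forall x, ~ D x -> psi x = 0).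

Hypothesis psi00 : psi 0 = 1.

Let cpsi : continuous psi. Proof. by case: npsi. Qed.
Let bpsi : bnd psi. Proof. by case: npsi. Qed.
Let psi_ge0 x : 0 <= psi x.
Proof. by have [/psiD/ltW//|/psi0 ->] := pselect (D x). Qed.

Lemma nice_eigen_sol : eigen_sol j D c lam1 psi.
Proof.
have S (s : R) : visc_supersol j D (fun x => s * psi x)
    (fun x => s * (- c x * psi x - lam1 * psi x)).
  have c0 : continuous (fun _ : vec => 0 : R) by exact: cst_continuous.
  have := visc_sum hj s oD bD c0 (@bnd_cst R d 0)
    (visc_zero hj bD) (fun x _ => c0 x) npsi.
  by congr (visc_supersol _ _ _ _); apply/funext => x; rewrite add0r.
split; first by apply: visc_sup_neg => //; exact: S.
by have := S 1; congr (visc_supersol _ _ _ _); apply/funext => x; rewrite mul1r.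
Qed.

Lemma supersol_compare v (lam : R) : continuous v -> bnd v -> (forall x, 0 <= v x) ->
  (forall x, D x -> 0 < v x) -> eigen_supersol j D c lam v -> lam1 <= lam ->
  lam = lam1 /\ exists2 t, 0 < t & forall x, D x -> v x = t * psi x.
Proof.
move=> cv bv v0 vD vv l1; apply: compare_eigen => // t t0.
have := visc_sum hj (- t) oD bD cv bv vv (@eigenvalue_rhs_continuous v lam cv) npsi.
by congr (visc_supersol _ _ _ _); apply/funext => x; ring.
Qed.

(** The roles are exchanged: multiples of the arbitrary eigenfunction u are slid under the nice psi,
    by adding psi to the supersolution - t u. This is the direction that the variational definition
    of the eigenvalue does not provide. *)
Lemma subsol_compare u (mu : R) : continuous u -> bnd u ->
  (forall x, D x -> 0 < u x) -> (forall x, ~ D x -> u x = 0) ->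
  eigen_sol j D c mu u -> mu <= lam1 -> lam1 = mu.
Proof.
move=> cu bu uD u0 [us _] m1.
suff : lam1 = mu /\ exists2 t, 0 < t & forall x, D x -> psi x = t * u x by case.
apply: compare_eigen => // t t0.
have cN : continuous (fun x => - t * u x) by exact: continuousZf.
have := visc_sum hj 1 oD bD cN (bndZ (- t) bu) (visc_sub_neg hj bD cu t0 us) _ npsi.
have cf x : D x -> {for x, continuous (fun x => - t * (- c x * u x - mu * u x))}.
  by move=> Dx; apply: continuousZat; exact: (@eigenvalue_rhs_continuous u mu cu x Dx).
move=> /(_ cf); congr (visc_supersol _ _ _ _); apply/funext => x; ring.
Qed.

(** Comparison with psi bounds every admissible value by [lam1], and psi itself attains it. Equality
    in the comparison gives proportionality, and [subsol_compare] excludes smaller Dirichlet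
    eigenvalues. *)
Lemma nice_eigen_theorem :
  exists lambdaD : R, principal_eigenvalue j D c = lambdaD%:E /\
  exists psiD : vec -> R,
    [/\ pos_eigenfunction j D c lambdaD psiD /\ psiD 0 = 1,
        (forall psi, pos_eigenfunction j D c lambdaD psi -> psi 0 = 1 ->
           psi = psiD),
        (forall (u : vec -> R) (lambda : R),
           Cb_nonneg u -> (forall x, D x -> 0 < u x) ->
           eigen_supersol j D c lambda u ->
           lambda <= lambdaD /\
           (lambda = lambdaD -> (forall x, ~ D x -> u x = 0) ->
              exists2 k : R, 0 < k & forall x, u x = k * psiD x)) &
        (forall (lambda : R) (u : vec -> R),
           pos_eigenfunction j D c lambda u -> lambda = lambdaD)].
Proof.
have le1 v lam : Cb_nonneg v -> (forall x, D x -> 0 < v x) ->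
    eigen_supersol j D c lam v -> lam <= lam1.
  move=> [[cv /bounded_fun_bnd bv] v0] vD vv; rewrite leNgt; apply/negP => l1.
  by have [E _] := supersol_compare cv bv v0 vD vv (ltW l1); rewrite E ltxx in l1.
exists lam1; split.
  apply/eqP; rewrite eq_le; apply/andP; split.
    apply: ge_ereal_sup => _ [lam [v [Cv vD vv]] <-].
    by rewrite lee_fin; exact: le1 Cv vD vv.
  apply: ereal_sup_ubound; exists lam1 => //; exists psi; split => //.
    by split; [split => //; exact/bounded_fun_bnd|].
  by case: nice_eigen_sol.
have nonneg u : (forall x, D x -> 0 < u x) -> (forall x, ~ D x -> u x = 0) ->
    forall x, 0 <= u x.
  by move=> uD u0 x; have [/uD/ltW//|/u0 ->] := pselect (D x).
have mult v : continuous v -> bnd v -> (forall x, 0 <= v x) -> (forall x, D x -> 0 < v x) ->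
    eigen_supersol j D c lam1 v -> (forall x, ~ D x -> v x = 0) ->
    exists2 k : R, 0 < k & forall x, v x = k * psi x.
  move=> cv bv v0 vD vv vout.
  have [_ [t t0 tv]] := supersol_compare cv bv v0 vD vv (lexx _).
  exists t => // x; have [/tv//|nDx] := pselect (D x).
  by rewrite vout// psi0// mulr0.
exists psi; split.
- split => //; split => //; [|exact: nice_eigen_sol].
  by split => //; exact/bounded_fun_bnd.
- move=> p [[cp /bounded_fun_bnd bp] [_ sp] p0 pD] p1.
  have [k _ kp] := mult p cp bp (nonneg p pD p0) pD sp p0.
  have k1 : k = 1 by rewrite -p1 kp psi00 mulr1.
  by apply/funext => x; rewrite kp k1 mul1r.
- move=> u lam Cu uD us; split; first exact: le1 Cu uD us.
  move=> lamE u0; rewrite lamE in us; case: Cu => -[cu /bounded_fun_bnd bu] uge0.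
  exact: mult.
- move=> lam u [Cu us u0 uD]; have ug := nonneg u uD u0.
  have l1 := le1 u lam (conj Cu ug) uD us.2.
  by case: Cu => cu /bounded_fun_bnd bu; rewrite (subsol_compare cu bu uD u0 us l1).
Qed.

End with_nice.
End eigen_comparison.

(** * A monotone finite-difference scheme *)
Section scheme.
Context {R : realType} {d : nat}.
Local Notation vec := 'rV[R]_d.
Local Notation e_ := (@unitv R d).
Implicit Types (x y z p : vec) (F G : vec -> R) (h : R) (S : seq (R * vec)).

Definition sop S F x : R := \sum_(a <- S) a.1 * (F (x + a.2) - F x).

Definition dop h F x : R :=
  \sum_i (F (x + h *: e_ i) + F (x - h *: e_ i) - 2 * F x) / h ^+ 2.

(* A discretisation of L on the lattice h Z^d: second differences, plus a finite
   list S of jumps with their weights (which also absorbs, upwind, the drift coming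
   from the compensator). *)
Definition Lh h S F x : R := dop h F x + sop S F x.

Definition lat h x : Prop := forall i, exists m : int, x ord0 i = m%:~R * h.

(* The quantitative smoothness under which the consistency error of the scheme is
   controlled by M alone. *)
Record reg F x p (f2 : 'I_d -> R) (M eta : R) : Prop := Reg {
  reg_meas : mrV F;
  reg_bnd : forall y, `|F y| <= M;
  reg_lip : forall y z, `|F y - F z| <= M * enorm (y - z);
  reg_taylor : forall y, enorm y <= eta -> `|F (x + y) - F x - dotv y p| <= M * enorm y ^+ 2;
  reg_second : forall i t, 0 < t -> t <= eta ->
    `|F (x + t *: e_ i) + F (x - t *: e_ i) - 2 * F x - t ^+ 2 * f2 i| <= M * t ^+ 3 }.

Lemma latD h x y : lat h x -> lat h y -> lat h (x + y).
Proof.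
move=> hx hy i; have [m Em] := hx i; have [k Ek] := hy i; exists (m + k).
by rewrite mxE Em Ek rmorphD/= mulrDl.
Qed.

Lemma latN h x : lat h x -> lat h (- x).
Proof.
by move=> hx i; have [m Em] := hx i; exists (- m); rewrite mxE Em rmorphN mulNr.
Qed.

Lemma latB h x y : lat h x -> lat h y -> lat h (x - y).
Proof. by move=> hx /latN; exact: latD. Qed.

Lemma lat0 h : lat h 0.
Proof. by move=> i; exists 0; rewrite mxE mul0r. Qed.

Lemma lat_unit h (k : int) i : lat h ((k%:~R * h) *: e_ i).
Proof.
move=> l; exists (if l == i then k else 0); rewrite mxE unitvE.
by case: (l == i); rewrite ?mulr1 ?mulr0 ?mul0r.
Qed.

Lemma lat_unit1 h i : lat h (h *: e_ i).
Proof. by have := @lat_unit h 1 i; rewrite mul1r. Qed.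

(** The lattice points with coordinates between - N h and N h, indexed by a finite type. Each is the
    lower corner of its [cell], which is half-open so that distinct cells are disjoint. *)
Definition cellpt h (N : nat) (f : {ffun 'I_d -> 'I_(N.*2.+1)}) : vec :=
  \row_i (((f i : nat)%:R - N%:R) * h).

Definition cell h (N : nat) (f : {ffun 'I_d -> 'I_(N.*2.+1)}) (y : vec) : bool :=
  [forall i, (cellpt h f ord0 i <= y ord0 i) && (y ord0 i < cellpt h f ord0 i + h)].

Lemma cellpt_lat h N (f : {ffun 'I_d -> 'I_(N.*2.+1)}) : lat h (cellpt h f).
Proof. by move=> i; exists ((f i : nat)%:Z - N%:Z); rewrite mxE rmorphB. Qed.

Lemma cell_inj h N (f g : {ffun 'I_d -> 'I_(N.*2.+1)}) y :
  0 < h -> cell h f y -> cell h g y -> f = g.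
Proof.
move=> h0 /forallP fy /forallP gy; apply/ffunP => i; apply/val_inj/eqP.
have /andP[f1 f2] := fy i; have /andP[g1 g2] := gy i; rewrite /= eqn_leq.
have lt (a b : nat) : (a%:R - N%:R) * h < (b%:R - N%:R) * h + h :> R -> (a <= b)%N.
  have -> : (b%:R - N%:R) * h + h = (b%:R + 1 - N%:R) * h by ring.
  by rewrite ltr_pM2r// ltrD2r natr1 ltr_nat ltnS.
by rewrite !mxE in f1 f2 g1 g2; rewrite !lt// (le_lt_trans f1, le_lt_trans g1).
Qed.

Lemma cell_ex h N y : 0 < h -> (forall i, `|y ord0 i| <= N%:R * h) ->
  exists f : {ffun 'I_d -> 'I_(N.*2.+1)}, cell h f y.
Proof.
move=> h0 yN.
have H i : exists k : 'I_(N.*2.+1),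
    (((k : nat)%:R - N%:R) * h <= y ord0 i) && (y ord0 i < ((k : nat)%:R - N%:R) * h + h).
  pose t := y ord0 i / h + N%:R.
  have := yN i; rewrite ler_norml => /andP[y1 y2].
  have t0 : 0 <= t by rewrite /t -lerBlDr sub0r ler_pdivlMr// mulNr.
  have t1 : t <= (N.*2)%:R.
    by rewrite /t -addnn natrD lerD2r ler_pdivrMr.
  have /andP[k1 k2] := truncn_itv t0.
  have kN : (Num.truncn t < N.*2.+1)%N.
    by rewrite ltnS -(ler_nat R); apply: le_trans k1 t1.
  exists (Ordinal kN) => /=; move: k1 k2; rewrite /t => k1 k2.
  apply/andP; split; first by rewrite -ler_pdivlMr// lerBlDr.
  set k := Num.truncn _ in k2 *.
  have -> : (k%:R - N%:R) * h + h = (k%:R + 1 - N%:R) * h by ring.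
  by rewrite -ltr_pdivrMr// ltrBrDr natr1.
have /choice[f Hf] := H; exists [ffun i => f i]; apply/forallP => i.
by rewrite !mxE ffunE.
Qed.

Lemma measurable_coord_set (i : 'I_d) (a b : R) :
  measurable ([set y | (a <= y ord0 i) && (y ord0 i < b)] : set (borel_rV R d)).
Proof.
have := @measurable_coord R d i measurableT `[a, b[%classic (measurable_itv _).
rewrite setTI; congr measurable; apply/seteqP; split => y /=; by rewrite in_itv.
Qed.

Lemma mrV_indic_cell h N (f : {ffun 'I_d -> 'I_(N.*2.+1)}) : mrV (fun y => (cell h f y)%:R).
Proof.
rewrite [X in mrV X](_ : _ = fun y : vec => if cell h f y then 1 else 0); last first.
  by apply/funext => y; case: ifP.
apply: mrV_if; [|exact: mrV_cst|exact: mrV_cst].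
rewrite (_ : mkset _ = \bigcap_(i in [set: 'I_d])
   [set y : vec | (cellpt h f ord0 i <= y ord0 i) && (y ord0 i < cellpt h f ord0 i + h)]).
  apply: fin_bigcap_measurable; first exact: finite_finset.
  by move=> i _; exact: measurable_coord_set.
apply/seteqP; split => y /=; first by move=> /forallP H i _; exact: H.
by move=> H; apply/forallP => i; exact: H.
Qed.

Lemma cell_near h N (f : {ffun 'I_d -> 'I_(N.*2.+1)}) y : 0 < h -> cell h f y ->
  enorm (cellpt h f - y) <= d%:R * h.
Proof.
move=> h0 /forallP H; apply: le_trans (enorm_le_norm _) _; rewrite ler_wpM2l//.
apply: mx_norm_le => [|i]; first exact: ltW.
by have /andP[h1 h2] := H i; rewrite !mxE in h1 h2 *; rewrite ler_norml; apply/andP; split; lra.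
Qed.

Variable j : vec -> R.
Hypothesis hj : levy_density j.

(** The scheme drops the jumps of length at most eps; by dominated convergence their second moment,
    which bounds the resulting error, vanishes with eps. *)
Lemma small_tail (e e0 : R) : 0 < e -> 0 < e0 -> e0 <= 1 ->
  exists eps, [/\ 0 < eps, eps <= e0 & Ij j (fun y => (1 - tail eps y) * mwt y) <= e].
Proof.
move=> e0' e00 e01; pose et n : R := e0 * n.+1%:R^-1.
have et0 n : 0 < et n by rewrite mulr_gt0// invr_gt0.
have ete n : et n <= e0 by rewrite ger_pMr// invf_le1// ler1n.
have t01 eps (y : vec) : 0 <= 1 - tail eps y <= 1.
  by rewrite /tail; case: (ltP eps (enorm y)) => _ /=; rewrite ?subrr ?subr0 ?lexx ?ler01.
pose F n y := (1 - tail (et n) y) * mwt y.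
have mF n : mrV (F n).
  by apply: mrVM; [apply: mrVB; [exact: mrV_cst|exact: mrV_tail]|exact: mrV_mwt].
have cF : Ij j (F n) @[n --> \oo] --> Ij j (fun=> 0).
  apply: (Ij_cvg hj (C := 1)) => //; first exact: mrV_cst.
    move=> n y; have /andP[a b] := t01 (et n) y.
    by rewrite normrM !ger0_norm ?mwt_ge0// ler_wpM2r ?mwt_ge0.
  move=> y; have [y0|y0] := eqVneq (enorm y) 0.
    have my : mwt y = 0 by rewrite mwt_small ?y0 ?ler01// expr0n.
    by rewrite (_ : F^~ y = fun=> 0); [exact: cvg_cst|apply/funext => n; rewrite /F my mulr0].
  have yp : 0 < enorm y by rewrite lt_neqAle eq_sym y0 enorm_ge0.
  apply/cvgrPdist_le => eps eps0.
  have [n0 Hn0] := small_inv (divr_gt0 (divr_gt0 yp (ltr0Sn R 1)) e00).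
  exists n0 => // n /= /Hn0; rewrite ler_pdivlMr// mulrC -/(et n) => hn.
  rewrite /F /tail (_ : (et n < enorm y) = true); first by rewrite subrr mul0r subrr normr0 ltW.
  by apply: le_lt_trans hn _; rewrite ltr_pdivrMr// ltr_pMr// ltr1n.
have {cF}/cvgrPdist_le/(_ e e0')[n0 _ Hn] := cF.
exists (et n0); split => //; have := Hn n0 (leqnn _).
by rewrite (Ij0 hj) sub0r normrN => /(le_trans (ler_norm _)).
Qed.

Lemma small_out (e : R) : 0 < e ->
  exists n : nat, Ij j (tail n.+1%:R) <= e.
Proof.
move=> e0; pose F n : vec -> R := tail n.+1%:R.
have cF : Ij j (F n) @[n --> \oo] --> Ij j (fun=> 0).
  apply: (Ij_cvg hj (C := 1)); [by move=> n; exact: mrV_tail|exact: mrV_cst| |].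
    move=> n y; rewrite ger0_norm ?tail_ge0// mul1r /F /tail; case: ltP => ny /=; last exact: mwt_ge0.
    rewrite mwt_large//; apply: ltW; apply: le_lt_trans ny; by rewrite ler1n.
  move=> y; apply/cvgrPdist_le => eps eps0.
  exists (Num.truncn (enorm y)) => // n /= ny.
  rewrite /F /tail ltNge (_ : enorm y <= n.+1%:R) /=; first by rewrite subrr normr0 ltW.
  by apply: ltW; apply: lt_le_trans (truncnS_gt _) _; rewrite ler_nat.
have {cF}/cvgrPdist_le/(_ e e0)[n0 _ Hn] := cF.
exists n0; have := Hn n0 (leqnn _).
by rewrite (Ij0 hj) sub0r normrN => /(le_trans (ler_norm _)).
Qed.

Lemma Ij_sum (I : Type) (s : seq I) (F : I -> vec -> R) : (forall a, adm (F a)) ->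
  adm (fun y => \sum_(a <- s) F a y) /\
  Ij j (fun y => \sum_(a <- s) F a y) = \sum_(a <- s) Ij j (F a).
Proof.
move=> aF; elim: s => [|a s [IH1 IH2]].
  rewrite big_nil (_ : (fun y => _) = fun=> 0); last by apply/funext => y; rewrite big_nil.
  by split; [exact: adm_cst0|exact: (Ij0 hj)].
rewrite big_cons (_ : (fun y => _) = fun y => F a y + \sum_(a <- s) F a y); last first.
  by apply/funext => y; rewrite big_cons.
by split; [exact: admD|rewrite (IjD hj)// IH2].
Qed.

Definition pospart (t : R) : R := (`|t| + t) / 2.

Lemma pospart_ge0 t : 0 <= pospart t.
Proof. by rewrite divr_ge0// -lerBlDr sub0r -normrN ler_norm. Qed.

Lemma pospartB t : t = pospart t - pospart (- t).
Proof. by rewrite /pospart normrN; field. Qed.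

Lemma pospartD t : `|t| = pospart t + pospart (- t).
Proof. by rewrite /pospart normrN; field. Qed.

Definition mid (eps : R) y : R := tail eps y * (enorm y <= 1)%R%:R.

Lemma adm_mid_coord (eps s : R) i : 0 < eps -> eps <= 1 -> `|s| = 1 ->
  adm (fun y => mid eps y * pospart (s * y ord0 i)).
Proof.
move=> e0 e1 s1; apply: (@adm_le_adm _ _ _ (tail eps)); last exact: adm_tail.
  apply: mrVM; first by apply: mrVM; [exact: mrV_tail|exact: mrV_indic_enorm].
  apply: mrV_continuous; apply: continuousMf; last exact: continuous_cstf.
  have cs : continuous (fun y : vec => s * y ord0 i) by apply: continuousZf; exact: continuous_coord.
  apply: continuousDf => //; apply: (continuous_compf cs); exact: norm_continuous.
move=> y; rewrite /mid; case: (leP (enorm y) 1) => y1 /=; last first.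
  by rewrite mulr0 mul0r normr0 tail_ge0.
rewrite mulr1 ger0_norm; last by rewrite mulr_ge0 ?tail_ge0 ?pospart_ge0.
apply: ler_piMr; first exact: tail_ge0.
rewrite /pospart ler_pdivrMr// mul1r.
have h1 : `|s * y ord0 i| <= 1.
  by rewrite normrM s1 mul1r; apply: le_trans (coord_le_enorm _ _) y1.
by have := le_trans (ler_norm _) h1; lra.
Qed.

(** Jumps of length at most eps are dropped. Longer ones inside a large box are moved to the lower
    corner of their cell, with the mass of the cell as weight. The compensator of the jumps between
    eps and 1 becomes one-sided differences, with direction chosen to keep the weights
    nonnegative. *)
Lemma scheme (n : nat) : exists h S,
  [/\ 0 < h, h <= n.+1%:R^-1, forall a, a \in S -> 0 <= a.1 /\ lat h a.2 &
  forall F x p f2 M eta, n.+1%:R^-1 <= eta -> reg F x p f2 M eta ->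
    `|Lh h S F x - (\sum_i f2 i + Ij j (Dlt F x p))| <= M * n.+1%:R^-1].
Proof.
pose E : R := n.+1%:R^-1; rewrite -/E.
have E0 : 0 < E by rewrite invr_gt0.
have E1 : E <= 1 by rewrite invf_le1// ler1n.
have E40 : 0 < E / 4 by rewrite divr_gt0.
have E80 : 0 < E / 8 by rewrite divr_gt0.
have [eps [eps0 epsE sm]] := small_tail E40 E0 E1.
have eps1 : eps <= 1 by exact: le_trans E1.
have [rr out] := small_out E80.
pose nu := Ij j (tail eps).
have nu0 : 0 <= nu by apply: (Ij_ge0 hj); [exact: adm_tail|exact: tail_ge0].
(* The mesh is chosen after eps, because the mass nu of the jumps longer than eps may be large:
   rounding costs d h M for each unit of this mass, as do the one-sided differences, and the second
   differences add d h M once. *)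
pose den := 2 * (d%:R * (2 * nu + 1) + 1).
have den0 : 0 < den by rewrite mulr_gt0// ltr_wpDl// mulr_ge0// addr_ge0// mulr_ge0.
pose h := E / den; have h0 : 0 < h by rewrite divr_gt0.
have den1 : 1 <= den.
  have : 0 <= d%:R * (2 * nu + 1) by rewrite mulr_ge0// addr_ge0// mulr_ge0.
  by rewrite /den; lra.
have hE : h <= E by rewrite ler_pdivrMr// ler_peMr// ltW.
have hden : d%:R * h * (2 * nu + 1) <= E / 2.
  have -> : E / 2 = h * (d%:R * (2 * nu + 1) + 1).
    by rewrite /h /den; field; rewrite gt_eqF// ltr_wpDl// mulr_ge0// addr_ge0// mulr_ge0.
  have -> : d%:R * h * (2 * nu + 1) = h * (d%:R * (2 * nu + 1)) by ring.
  by rewrite ler_wpM2l ?(ltW h0)// lerDl.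
pose N := (Num.truncn (rr.+1%:R / h : R)).+1.
have HN : rr.+1%:R <= N%:R * h.
  rewrite -ler_pdivrMr//; apply: ltW; exact: truncnS_gt.
pose K := [the finType of {ffun 'I_d -> 'I_(N.*2.+1)}].
pose af (f : K) y : R := (cell h f y)%:R * tail eps y.
have aaf f : adm (af f).
  apply: (@adm_le_adm _ _ _ (tail eps)); last exact: adm_tail.
    by apply: mrVM; [exact: mrV_indic_cell|exact: mrV_tail].
  move=> y; rewrite /af ger0_norm ?mulr_ge0 ?tail_ge0//.
  by case: (cell h f y); rewrite ?mul1r ?mul0r ?tail_ge0.
pose bf (s : R) i y : R := mid eps y * pospart (s * y ord0 i).
have N1 : `|-1 : R| = 1 by rewrite normrN1.
have P1 : `|1 : R| = 1 by rewrite normr1.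
have abp i : adm (bf 1 i) by exact: adm_mid_coord.
have abn i : adm (bf (-1) i) by exact: adm_mid_coord.
(* Splitting y_i by its sign, the compensator - y_i D_i F is written with steps - h for the positive
   part and + h for the negative part, so both weights are nonnegative. *)
pose S := [seq (Ij j (af f), cellpt h f) | f : K] ++
  ([seq (Ij j (bf 1 i) / h, - (h *: e_ i)) | i : 'I_d] ++
   [seq (Ij j (bf (-1) i) / h, h *: e_ i) | i : 'I_d]).
exists h, S; split => //.
  move=> a; rewrite /S !mem_cat => /orP[|/orP[]] /mapP[b _ ->] /=.
  - split; last exact: cellpt_lat.
    by apply: (Ij_ge0 hj) => // y; rewrite mulr_ge0 ?tail_ge0.
  - split; last by apply: latN; exact: lat_unit1.
    rewrite divr_ge0 ?(ltW h0)//; apply: (Ij_ge0 hj) => // y.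
    by rewrite mulr_ge0 ?pospart_ge0// mulr_ge0 ?tail_ge0.
  - split; last exact: lat_unit1.
    rewrite divr_ge0 ?(ltW h0)//; apply: (Ij_ge0 hj) => // y.
    by rewrite mulr_ge0 ?pospart_ge0// mulr_ge0 ?tail_ge0.
move=> F x p f2 M eta Eeta [mF FM FL FT F2].
have M0 : 0 <= M by apply: le_trans (FM 0).
have heta : h <= eta by exact: le_trans hE Eeta.
pose Dm i := (F (x - h *: e_ i) - F x) / h.
pose Dp i := (F (x + h *: e_ i) - F x) / h.
(* All weights are integrals against [j], so the jump part of the scheme is one integral, and its
   error can be bounded pointwise under the integral sign. *)
pose Hf y := (\sum_(f <- enum K) (F (x + cellpt h f) - F x) * af f y) +
  (\sum_(i <- enum 'I_d) Dm i * bf 1 i y + \sum_(i <- enum 'I_d) Dp i * bf (-1) i y).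
have a1 f : adm (fun y => (F (x + cellpt h f) - F x) * af f y) by exact: admZ.
have a2 i : adm (fun y => Dm i * bf 1 i y) by exact: admZ.
have a3 i : adm (fun y => Dp i * bf (-1) i y) by exact: admZ.
have [s1 i1] := Ij_sum (enum K) a1.
have [s2 i2] := Ij_sum (enum 'I_d) a2.
have [s3 i3] := Ij_sum (enum 'I_d) a3.
have s23 := admD s2 s3.
have aH : adm Hf by exact: admD.
have sopE : sop S F x = Ij j Hf.
  rewrite /Hf (IjD hj)// (IjD hj)// i1 i2 i3 /sop /S !big_cat/= !big_map.
  congr (_ + (_ + _)).
  - by apply: eq_bigr => f _ /=; rewrite (IjZ hj)// mulrC.
  - by apply: eq_bigr => i _ /=; rewrite (IjZ hj)// /Dm; ring.
  - by apply: eq_bigr => i _ /=; rewrite (IjZ hj)// /Dp; ring.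
have aD : adm (Dlt F x p).
  apply: (@adm_le _ _ (M + (M + M + enorm p) / eps ^+ 2)); first exact: mrV_Dlt.
  apply: Dlt_le => // y ye; apply: FT; apply: ltW; apply: lt_le_trans ye _.
  exact: le_trans epsE Eeta.
(* The three sources of error: the Taylor remainder of the dropped jumps, rounding and one-sided
   differences at d h M each, and far jumps that may lie in no cell. *)
pose B y := M * ((1 - tail eps y) * mwt y) + (2 * d%:R * h * M) * tail eps y +
  (2 * M) * tail rr.+1%:R y.
have asm : adm (fun y => (1 - tail eps y) * mwt y).
  apply: (@adm_le _ _ 1).
    by apply: mrVM; [apply: mrVB; [exact: mrV_cst|exact: mrV_tail]|exact: mrV_mwt].
  move=> y; rewrite normrM ler_pM// ?ger0_norm ?mwt_ge0// /tail;
    by case: (ltP eps (enorm y)) => _ /=; rewrite ?subrr ?subr0 ?lexx ?ler01 ?normr0 ?normr1 ?lexx ?ler01.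
have aout : adm (tail rr.+1%:R : vec -> R).
  apply: (@adm_le _ _ 1); first exact: mrV_tail.
  move=> y; rewrite ger0_norm ?tail_ge0// mul1r /tail; case: (ltP rr.+1%:R (enorm y)) => ny /=; last exact: mwt_ge0.
  by rewrite mwt_large//; apply: ltW; apply: le_lt_trans ny; by rewrite ler1n.
have aB : adm B by do !apply: admD; apply: admZ => //; exact: adm_tail.
have IB : Ij j B <= M * (E / 2) + (2 * d%:R * h * M) * nu.
  rewrite /B (IjD hj); [|apply: admD; apply: admZ => //; exact: adm_tail|exact: admZ].
  rewrite (IjD hj); [|exact: admZ|apply: admZ; exact: adm_tail].
  rewrite !(IjZ hj)//; last exact: adm_tail.
  have k1 := ler_wpM2l M0 sm; have k2 := ler_wpM2l M0 out.
  by rewrite -/nu; move: k1 k2; set q1 := Ij j _; set q2 := Ij j (tail rr.+1%:R); lra.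
have pmE i : `|- p ord0 i - Dm i| <= M * h /\ `|p ord0 i - Dp i| <= M * h.
  have T1 := FT (- (h *: e_ i)); have T2 := FT (h *: e_ i).
  rewrite enormN in T1; rewrite !enormZ enorm_unitv mulr1 gtr0_norm// in T1 T2.
  have {}T1 := T1 heta; have {}T2 := T2 heta.
  rewrite -scaleNr !dotvZl dotvC dotv_unitv in T1 T2.
  have k1 : - p ord0 i - Dm i = - ((F (x - h *: e_ i) - F x - - h * p ord0 i) / h).
    by rewrite /Dm; field; rewrite gt_eqF.
  have k2 : p ord0 i - Dp i = - ((F (x + h *: e_ i) - F x - h * p ord0 i) / h).
    by rewrite /Dp; field; rewrite gt_eqF.
  rewrite k1 k2 !normrN !normrM normfV (gtr0_norm h0) !ler_pdivrMr//.
  have E2 : M * h * h = M * h ^+ 2 by ring.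
  by rewrite -scaleNr !E2.
have DH y : `|Dlt F x p y - Hf y| <= B y.
  rewrite /B /Hf.
  have [ye|ye] := leP (enorm y) eps.
    have t0 : tail eps y = 0 by rewrite /tail ltNge ye.
    rewrite big1 => [|f _]; last by rewrite /af t0 !mulr0.
    rewrite big1 => [|i _]; last by rewrite /bf /mid t0 !(mul0r, mulr0).
    rewrite big1 => [|i _]; last by rewrite /bf /mid t0 !(mul0r, mulr0).
    have y1 : enorm y <= 1 by exact: le_trans ye eps1.
    rewrite t0 mulr0 !(addr0, subr0) mul1r mwt_small// /Dlt y1 mul1r.
    apply: (@le_trans _ _ (M * enorm y ^+ 2)).
      by apply: FT; apply: le_trans ye _; exact: le_trans epsE Eeta.
    by rewrite lerDl mulr_ge0 ?tail_ge0// mulr_ge0.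
  have t1 : tail eps y = 1 by rewrite /tail ye.
  pose cy := (enorm y <= 1)%R%:R : R.
  have hA : `|F (x + y) - F x - \sum_(f <- enum K) (F (x + cellpt h f) - F x) * af f y| <=
      d%:R * h * M + 2 * M * tail rr.+1%:R y.
    have [[f0 Hf0]|nof] := pselect (exists f : K, cell h f y).
      rewrite big_enum/= (bigD1 f0)//= big1 => [|f ff0]; last first.
        rewrite /af (_ : cell h f y = false) ?mul0r ?mulr0//.
        by apply/negP => cf; move/eqP: ff0; apply; exact: cell_inj cf Hf0.
      rewrite addr0 /af Hf0 t1 !mulr1 opprB addrA subrK.
      apply: (@le_trans _ _ (d%:R * h * M)); last by rewrite lerDl mulr_ge0 ?tail_ge0// mulr_ge0.
      apply: le_trans (FL _ _) _; rewrite mulrC ler_wpM2r//.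
      by rewrite opprD addrACA subrr add0r enormB; exact: cell_near.
    have -> : \sum_(f <- enum K) (F (x + cellpt h f) - F x) * af f y = 0.
      apply: big1 => f _; rewrite /af (_ : cell h f y = false) ?mul0r ?mulr0//.
      by apply/negP => cf; apply: nof; exists f.
    have -> : tail rr.+1%:R y = 1.
      rewrite /tail ltNge; case: leP => //= yr; case: nof; apply: cell_ex => // i.
      by apply: le_trans (coord_le_enorm _ _) _; exact: le_trans yr HN.
    rewrite subr0 mulr1; apply: (@le_trans _ _ (M + M)).
      by apply: le_trans (ler_normB _ _) _; exact: lerD.
    have q0 : 0 <= d%:R * h * M by exact: mulr_ge0 (mulr_ge0 (ler0n _ _) (ltW h0)) M0.
    by rewrite mulrDl mul1r ler_wpDl.
  have hB : `|cy * dotv y p + (\sum_(i <- enum 'I_d) Dm i * bf 1 i y +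
      \sum_(i <- enum 'I_d) Dp i * bf (-1) i y)| <= d%:R * h * M.
    rewrite !big_enum/= -big_split/= /dotv mulr_sumr -big_split/=.
    have -> : d%:R * h * M = \sum_(i < d) M * h.
      by rewrite sumr_const card_ord -mulr_natl; ring.
    apply: le_trans (ler_norm_sum _ _ _) _; apply: ler_sum => i _.
    rewrite /bf /mid t1 mul1r -/cy mul1r mulN1r.
    rewrite /cy; case: (leP (enorm y) 1) => y1; last first.
      by rewrite !mul0r !mulr0 !addr0 normr0; exact: mulr_ge0 M0 (ltW h0).
    rewrite !mul1r {1}(pospartB (y ord0 i)).
    set u1 := pospart (y ord0 i); set u2 := pospart (- y ord0 i).
    have u10 : 0 <= u1 by exact: pospart_ge0.
    have u20 : 0 <= u2 by exact: pospart_ge0.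
    have u12 : u1 + u2 <= 1.
      by rewrite -pospartD; apply: le_trans (coord_le_enorm _ _) y1.
    clearbody u1 u2.
    have -> : (u1 - u2) * p ord0 i + (Dm i * u1 + Dp i * u2) =
      - (u1 * (- p ord0 i - Dm i) + u2 * (p ord0 i - Dp i)) by ring.
    have [k1 k2] := pmE i.
    rewrite normrN; apply: le_trans (ler_normD _ _) _.
    rewrite !normrM (ger0_norm u10) (ger0_norm u20).
    apply: (@le_trans _ _ (u1 * (M * h) + u2 * (M * h))).
      by apply: lerD; rewrite ler_wpM2l.
    by rewrite -mulrDl ler_piMl//; exact: mulr_ge0 M0 (ltW h0).
  rewrite t1 subrr mul0r mulr0 add0r mulr1 /Dlt -/cy.
  set s1' := \sum_(f <- _) _ in hA *; set s2' := \sum_(i <- _) _ + _ in hB *.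
  have -> : F (x + y) - F x - cy * dotv y p - (s1' + s2') =
    (F (x + y) - F x - s1') - (cy * dotv y p + s2') by ring.
  apply: le_trans (ler_normB _ _) _; apply: le_trans (lerD hA hB) _.
  by rewrite le_eqVlt; apply/orP; left; apply/eqP; ring.
have I1 : `|sop S F x - Ij j (Dlt F x p)| <= M * (E / 2) + (2 * d%:R * h * M) * nu.
  rewrite distrC sopE -(IjB hj)//; apply: le_trans IB.
  by apply: (Ij_norm_le hj) => //; exact: admB.
have I2 : `|dop h F x - \sum_i f2 i| <= d%:R * h * M.
  rewrite /dop -sumrB.
  have -> : d%:R * h * M = \sum_(i < d) M * h.
    by rewrite sumr_const card_ord -mulr_natl; ring.
  apply: le_trans (ler_norm_sum _ _ _) _; apply: ler_sum => i _.
  have -> : (F (x + h *: e_ i) + F (x - h *: e_ i) - 2 * F x) / h ^+ 2 - f2 i =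
    (F (x + h *: e_ i) + F (x - h *: e_ i) - 2 * F x - h ^+ 2 * f2 i) / h ^+ 2.
    by field; rewrite gt_eqF.
  rewrite normrM normfV [X in _ / X]gtr0_norm ?exprn_gt0// ler_pdivrMr ?exprn_gt0//.
  have E3 : M * h * h ^+ 2 = M * h ^+ 3 by ring.
  by rewrite E3; exact: F2.
have -> : Lh h S F x - (\sum_i f2 i + Ij j (Dlt F x p)) =
  (dop h F x - \sum_i f2 i) + (sop S F x - Ij j (Dlt F x p)) by rewrite /Lh; ring.
apply: le_trans (ler_normD _ _) _; apply: le_trans (lerD I2 I1) _.
have := ler_wpM2l M0 hden.
have -> : M * (d%:R * h * (2 * nu + 1)) = d%:R * h * M + 2 * d%:R * h * M * nu by ring.
by lra.
Qed.

End scheme.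

(** * Limits along an ultrafilter *)

Section ultralimit.
Context {R : realType}.

Lemma nat_ultrafilter : exists U : set_system nat, UltraFilter U /\ \oo `<=` U.
Proof. by apply: ultraFilterLemma. Qed.

(** One ultrafilter makes all bounded sequences converge at once, so limits at uncountably many
    points are obtained without diagonal extraction. *)
Lemma ultra_bounded_cvg (U : set_system nat) {UU : UltraFilter U} (u : nat -> R) (M : R) :
  U [set n | `|u n| <= M] -> exists l : R, u n @[n --> U] --> l.
Proof.
move=> UM; have cM := @segment_compact R (- M) M.
have FF : ProperFilter (fmap u U) := @fmap_proper_filter _ _ u U (@ultra_proper _ U UU).
have FM : fmap u U `[- M, M]%classic.
  have S : [set n | `|u n| <= M] `<=` u @^-1` `[- M, M]%classic.
    by move=> n /= un; rewrite /= in_itv/= -ler_norml.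
  exact: (filterS S UM).
have [l [_ cl]] := cM _ FF FM; exists l; apply/cvgrPdist_le => e e0.
have [//|UC] := in_ultra_setVsetC [set n | `|l - u n| <= e] UU.
have UC' : fmap u U [set t | ~ `|l - t| <= e] by [].
have [t [/= nt lt]] := cl _ _ UC' (nbhsx_ballx l e e0).
by case: nt; rewrite ltW.
Qed.

Lemma cvgU_bigsum (U : set_system nat) {UU : UltraFilter U} (I : eqType) (r : seq I)
    (u : nat -> I -> R) (l : I -> R) :
  (forall i, i \in r -> u n i @[n --> U] --> l i) ->
  (\sum_(i <- r) u n i) @[n --> U] --> \sum_(i <- r) l i.
Proof.
elim: r => [_|a r IH ul].
  rewrite big_nil (_ : (fun n => _) = fun=> 0); first exact: cvg_cst.
  by apply/funext => n; rewrite big_nil.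
rewrite big_cons (_ : (fun n => \sum_(i <- a :: r) u n i) =
  fun n => u n a + \sum_(i <- r) u n i); last by apply/funext => n; rewrite big_cons.
apply: cvgD; first by apply: ul; rewrite mem_head.
by apply: IH => i ir; apply: ul; rewrite in_cons ir orbT.
Qed.

End ultralimit.

(** * Perron-Frobenius for positive matrices *)

Section perron.
Context {R : realType} {T : eqType}.
Implicit Types (pts : seq T) (A : T -> T -> R) (v F : T -> R).

Lemma seq_argmax pts v x0 : x0 \in pts ->
  exists2 x, x \in pts & forall y, y \in pts -> v y <= v x.
Proof.
elim: pts x0 => // a s IH x0 _; case: s IH => [_|b s IH].
  by exists a; [rewrite mem_head|move=> y; rewrite inE => /eqP ->].
have [x xs xmax] := IH b (mem_head _ _).
have [h|h] := leP (v a) (v x).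
  exists x; first by rewrite in_cons xs orbT.
  by move=> y; rewrite in_cons => /predU1P[->//|/xmax].
exists a; first exact: mem_head.
move=> y; rewrite in_cons => /predU1P[->//|/xmax yx].
by apply: le_trans yx _; exact: ltW.
Qed.

Lemma le_bigsum_mem pts F x : (forall y, y \in pts -> 0 <= F y) -> x \in pts ->
  F x <= \sum_(y <- pts) F y.
Proof.
move=> F0 xp; rewrite (big_rem x)//= lerDl big_seq; apply: sumr_ge0 => y yp.
by apply: F0; exact: mem_rem yp.
Qed.

(* Collatz-Wielandt: maximise min_x (A v x / v x) over the simplex. *)
Lemma perron pts A x0 : x0 \in pts ->
  (forall x y, x \in pts -> y \in pts -> 0 < A x y) ->
  exists v r, (forall x, x \in pts -> 0 < v x) /\
    forall x, x \in pts -> \sum_(y <- pts) A x y * v y = r * v x.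
Proof.
move=> x0p A0; pose Av v x := \sum_(y <- pts) A x y * v y.
pose ok r v := [/\ forall x, x \in pts -> 0 <= v x, \sum_(y <- pts) v y = 1 &
  forall x, x \in pts -> r * v x <= Av v x].
have size0 : 0 < (size pts)%:R :> R by rewrite ltr0n; case: (pts) x0p.
have Av_ge0 v x : (forall y, y \in pts -> 0 <= v y) -> x \in pts -> 0 <= Av v x.
  move=> v0 xp; rewrite /Av big_seq; apply: sumr_ge0 => y yp.
  by rewrite mulr_ge0 ?v0// ltW// A0.
have sum_gt0 v x : (forall y, y \in pts -> 0 <= v y) -> x \in pts -> 0 < v x ->
    0 < \sum_(y <- pts) v y.
  by move=> v0 xp vx; apply: lt_le_trans vx _; exact: le_bigsum_mem.
have v_le1 r v : ok r v -> forall x, x \in pts -> v x <= 1.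
  by move=> [v0 v1 _] x xp; rewrite -v1; exact: le_bigsum_mem.
pose X := [set r | exists v, ok r v].
have X0 : X 0.
  exists (fun=> (size pts)%:R^-1); split => [x _|//|x xp].
  - by rewrite invr_ge0 ltW.
  - by rewrite big_const_seq count_predT iter_addr_0 -(mulr_natr (size pts)%:R^-1) mulVf ?gt_eqF.
  - by rewrite mul0r; apply: Av_ge0 => // y _; rewrite invr_ge0 ltW.
pose B := \sum_(x <- pts) \sum_(y <- pts) A x y.
have ubX : ubound X B.
  move=> r [v okv]; have [v0 v1 rv] := okv.
  rewrite -[r]mulr1 -v1 mulr_sumr /B !big_seq; apply: ler_sum => x xp.
  apply: le_trans (rv x xp) _; rewrite /Av !big_seq; apply: ler_sum => y yp.
  by rewrite ler_piMr ?(v_le1 _ _ okv)// ltW// A0.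
have hX : has_sup X by split; [exists 0|exists B].
pose rs := sup X.
have [U [UU sU]] := nat_ultrafilter.
(* A maximising sequence in the simplex; its coordinatewise limit along the ultrafilter stays in the
   simplex and attains the supremum. *)
have /choice[V HV] : forall n, exists rv : R * (T -> R),
    ok rv.1 rv.2 /\ rs - n.+1%:R^-1 < rv.1.
  move=> n; have n0 : 0 < n.+1%:R^-1 :> R by rewrite invr_gt0.
  by have [r [v okv] h] := sup_adherent n0 hX; exists (r, v).
have Vle1 n x : x \in pts -> `|(V n).2 x| <= 1.
  move=> xp; have [okv _] := HV n; have [v0 _ _] := okv.
  by rewrite ger0_norm ?v0// (v_le1 _ _ okv).
have /choice[v Hv] : forall x, exists l : R, x \in pts -> (V n).2 x @[n --> U] --> l.
  move=> x; have [xp|xp] := boolP (x \in pts); last by exists 0.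
  have [|l Hl] := @ultra_bounded_cvg R U UU (fun n => (V n).2 x) 1; last by exists l.
  by apply: filterS filterT => n _ /=; exact: Vle1.
have rcv : (V n).1 @[n --> U] --> rs.
  apply/cvgrPdist_le => e e0; have [n0 Hn0] := small_inv e0.
  apply: sU; exists n0 => // n /= /Hn0 ne; have [okv h] := HV n.
  have rX : (V n).1 <= rs by apply: sup_upper_bound => //; exists (V n).2.
  by rewrite ger0_norm ?subr_ge0//; move: h; rewrite ltrBlDr addrC -ltrBlDr => /ltW/le_trans; apply.
have v0 x : x \in pts -> 0 <= v x.
  move=> xp; apply: (cvgr_to_ge (Hv x xp)); apply: filterS filterT => n _ /=.
  by have [[v0 _ _] _] := HV n; exact: v0.
have v1 : \sum_(y <- pts) v y = 1.
  have h : (\sum_(y <- pts) (V n).2 y) @[n --> U] --> \sum_(y <- pts) v y.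
    exact: cvgU_bigsum.
  have h1 : (fun n => \sum_(y <- pts) (V n).2 y) = fun=> 1.
    by apply/funext => n; have [[_ -> _] _] := HV n.
  rewrite h1 in h; have h2 : (1 : R) @[n --> U] --> (1 : R) by exact: cvg_cst.
  exact: (cvg_unique _ h h2).
have Avx x : x \in pts -> rs * v x <= Av v x.
  move=> xp; have l1 : (V n).1 * (V n).2 x @[n --> U] --> rs * v x.
    by apply: cvgM => //; exact: Hv.
  have l2 : Av (V n).2 x @[n --> U] --> Av v x.
    by apply: cvgU_bigsum => y yp; apply: cvgM; [exact: cvg_cst|exact: Hv].
  have l3 : Av (V n).2 x - (V n).1 * (V n).2 x @[n --> U] --> Av v x - rs * v x by exact: cvgB.
  rewrite -subr_ge0; apply: (cvgr_to_ge l3); apply: filterS filterT => n _ /=.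
  by rewrite subr_ge0; have [[_ _ h] _] := HV n; exact: h.
have [x1 x1p vx1] : exists2 x, x \in pts & 0 < v x.
  apply: contrapT => H; have : \sum_(y <- pts) v y = 0.
    rewrite big_seq big1// => y yp; apply/eqP; rewrite eq_le v0// andbT leNgt.
    by apply/negP => vy; apply: H; exists y.
  by rewrite v1 => /eqP; rewrite oner_eq0.
have Avp x : x \in pts -> 0 < Av v x.
  move=> xp; apply: (@lt_le_trans _ _ (A x x1 * v x1)); first by rewrite mulr_gt0// A0.
  apply: (@le_bigsum_mem pts (fun y => A x y * v y)) => // y yp.
  by rewrite mulr_ge0 ?v0// ltW// A0.
(* If A v exceeds rs v at one entry, positivity of A makes A (A v) exceed rs (A v) at every entry,
   so the normalised A v would admit a larger value than the supremum. *)
have eqv x : x \in pts -> Av v x = rs * v x.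
  move=> xp; apply/eqP; rewrite eq_le Avx// andbT leNgt; apply/negP => hx.
  pose w y := Av v y - rs * v y; pose z y := Av v y.
  have w0 y : y \in pts -> 0 <= w y by move=> yp; rewrite subr_ge0 Avx.
  have wx : 0 < w x by rewrite subr_gt0.
  have Z0 : 0 < \sum_(y <- pts) z y.
    by apply: (sum_gt0 z x) => // [y yp|]; [apply: ltW|]; exact: Avp.
  have z1 y : y \in pts -> z y <= \sum_(y <- pts) z y.
    by apply: le_bigsum_mem => t tp; apply: ltW; exact: Avp.
  pose Z := \sum_(y <- pts) z y.
  (* A positive lower bound for the whole column of x: the inverse of a sum of inverses stands in
     for the minimum. *)
  pose a := (\sum_(y <- pts) (A y x)^-1)^-1.
  have a0 : 0 < a.
    rewrite invr_gt0; apply: (sum_gt0 (fun y => (A y x)^-1) x) => // [y yp|].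
      by rewrite invr_ge0 ltW// A0.
    by rewrite invr_gt0 A0.
  have aA y : y \in pts -> a <= A y x.
    move=> yp; rewrite /a -[leRHS]invrK lef_pV2 ?posrE.
    - apply: (@le_bigsum_mem pts (fun y => (A y x)^-1)) => // t tp.
      by rewrite invr_ge0 ltW// A0.
    - by rewrite -invr_gt0.
    - by rewrite invr_gt0 A0.
  pose e := a * w x / Z; have e0 : 0 < e by rewrite divr_gt0// mulr_gt0.
  have : X (rs + e).
    exists (fun y => z y / Z); split.
    - by move=> y yp; rewrite divr_ge0 ?(ltW Z0)// ltW// Avp.
    - by rewrite -mulr_suml divff// gt_eqF.
    - move=> y yp; rewrite mulrA.
      have -> : Av (fun t => z t / Z) y = Av z y / Z.
        by rewrite /Av mulr_suml; apply: eq_bigr => t _; rewrite mulrA.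
      rewrite ler_pM2r ?invr_gt0// mulrDl.
      have -> : Av z y = rs * z y + Av w y.
        rewrite [Av z y]/Av [Av w y]/Av -[z y]/(\sum_(t <- pts) A y t * v t).
        rewrite mulr_sumr -big_split/=; apply: eq_bigr => t _.
        by rewrite /w -/(z t); ring.
      rewrite lerD2l; apply: (@le_trans _ _ (a * w x)).
        rewrite /e mulrAC ler_pdivrMr// ler_pM2l ?mulr_gt0//; exact: z1.
      apply: (@le_trans _ _ (A y x * w x)); first by rewrite ler_pM2r// aA.
      apply: (@le_bigsum_mem pts (fun t => A y t * w t)) => // t tp.
      by rewrite mulr_ge0 ?w0// ltW// A0.
  move=> Xe; have : rs + e <= rs by apply: sup_upper_bound.
  by rewrite gerDl leNgt e0.
exists v, rs; split => // x xp.
rewrite lt_neqAle v0// andbT eq_sym; apply/eqP => vx.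
by have := Avp x xp; rewrite eqv// vx mulr0 ltxx.
Qed.

End perron.

(** * Perron eigenpairs of the scheme *)

Section discrete_eigen.
Context {R : realType} {d : nat}.
Local Notation vec := 'rV[R]_d.
Local Notation e_ := (@unitv R d).

Lemma lat_cellpt (h : R) (N : nat) x : 0 < h -> lat h x -> `|x| <= N%:R * h ->
  exists f : {ffun 'I_d -> 'I_(N.*2.+1)}, x = cellpt h f.
Proof.
move=> h0 lx xN.
have [f /forallP Hf] := @cell_ex R d h N x h0 (fun i => le_trans (coord_le_norm x i) xN).
exists f; apply/rowP => i; have /andP[h1 h2] := Hf i; have [m Em] := lx i.
move: h1 h2; rewrite !mxE Em => h1 h2; congr (_ * _).
move: h1; rewrite ler_pM2r// => h1.
have h3 : m%:~R < ((f i : nat)%:Z - N%:Z + 1)%:~R :> R.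
  rewrite -(ltr_pM2r h0) rmorphD rmorphB/=; move: h2; congr (_ < _); ring.
have h4 : ((f i : nat)%:Z - N%:Z)%:~R <= m%:~R :> R by rewrite rmorphB.
move: h3 h4; rewrite ltr_int ler_int ltzD1 => h3 h4.
have -> : m = (f i : nat)%:Z - N%:Z by apply/eqP; rewrite eq_le h3 h4.
by rewrite rmorphB.
Qed.

Lemma lattice_pts (D : set vec) (h : R) : bounded_set D -> 0 < h ->
  exists2 pts : seq vec, uniq pts & forall x, (x \in pts) = `[< D x /\ lat h x >].
Proof.
move=> /bounded_set_box[M M0 DM] h0.
pose N := (Num.truncn (M / h : R)).+1.
have HN : M <= N%:R * h by rewrite -ler_pdivrMr//; apply: ltW; exact: truncnS_gt.
pose L := [seq cellpt h f | f : {ffun 'I_d -> 'I_(N.*2.+1)}].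
exists (undup [seq x <- L | `[< D x >]]); first exact: undup_uniq.
move=> x; rewrite mem_undup mem_filter; apply/andP/asboolP => [[/asboolP Dx /mapP[f _ xE]]|[Dx lx]].
  by split => //; rewrite xE; exact: cellpt_lat.
split; first exact/asboolP.
have [f xE] := lat_cellpt h0 lx (le_trans (ltW (DM x Dx)) HN).
by apply/mapP; exists f; rewrite ?mem_enum.
Qed.

Lemma sum_delta (pts : seq vec) (z : vec) (F : vec -> R) : uniq pts ->
  (forall y, y \notin pts -> F y = 0) -> \sum_(y <- pts) (z == y)%:R * F y = F z.
Proof.
move=> up F0; have [zp|zp] := boolP (z \in pts).
  rewrite (bigD1_seq z)//= eqxx mul1r big1 ?addr0// => y yz.
  by rewrite eq_sym (negbTE yz) mul0r.
rewrite F0// big_seq big1// => y yp; case: eqP => [zy|]; last by rewrite mul0r.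
by rewrite zy yp in zp.
Qed.

(** The scheme plus c becomes a positive matrix after adding b + Cc on the diagonal and e0 to every
    entry. The diagonal shift only moves the eigenvalue. The shift e0 stands in for connectivity of
    the lattice graph, at the price of an error of known sign in the equation. *)
Lemma discrete_eigen (D : set vec) (c : vec -> R) (h Cc : R) (S : seq (R * vec)) (n : nat) :
  bounded_set D -> D 0 -> 0 < h -> (forall a, a \in S -> 0 <= a.1) ->
  (forall x, D x -> `|c x| <= Cc) ->
  exists psi lam, [/\ forall x, D x -> lat h x -> 0 < psi x <= 1,
    forall x, ~ (D x /\ lat h x) -> psi x = 0,
    exists x, [/\ D x, lat h x & psi x = 1] &
    forall x, D x -> lat h x -> - n.+1%:R^-1 <= Lh h S psi x + c x * psi x + lam * psi x <= 0].
Proof.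
move=> bD D0 h0 S0 HC; have [pts up ptsE] := lattice_pts bD h0.
have mp x : D x -> lat h x -> x \in pts by move=> Dx lx; rewrite ptsE; exact/asboolP.
have pm x : x \in pts -> D x /\ lat h x by rewrite ptsE => /asboolP.
have p0 : 0 \in pts by apply: mp => //; exact: lat0.
(* The normalised vector is at most 1, so the artificial entries contribute at most e0 times the
   number of points, below 1 / (n + 1). *)
pose e0 : R := n.+1%:R^-1 / (size pts).+1%:R.
have e00 : 0 < e0 by rewrite divr_gt0// invr_gt0.
pose a x y : R := \sum_(i < d) ((x + h *: e_ i == y)%:R + (x - h *: e_ i == y)%:R) / h ^+ 2 +
  \sum_(s <- S) s.1 * (x + s.2 == y)%:R.
pose b : R := \sum_(i < d) 2 / h ^+ 2 + \sum_(s <- S) s.1.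
have a0 x y : 0 <= a x y.
  rewrite addr_ge0//; first by apply: sumr_ge0 => i _; rewrite divr_ge0 ?addr_ge0// exprn_ge0// ltW.
  by rewrite big_seq; apply: sumr_ge0 => s /S0 s0; rewrite mulr_ge0.
pose A x y := a x y + e0 + (x == y)%:R * (Cc + c x).
have A0 x y : x \in pts -> y \in pts -> 0 < A x y.
  move=> xp yp; rewrite /A ltr_wpDr ?ltr_wpDl// mulr_ge0//.
  have [Dx _] := pm x xp; have := HC x Dx; rewrite ler_norml => /andP[h1 _].
  by rewrite -lerBlDl sub0r.
have [v [r [v0 Hv]]] := perron p0 A0.
have [xm xmp vmax] := seq_argmax v p0.
pose psi x := if x \in pts then v x / v xm else 0.
have vm := v0 _ xmp.
have psi0 y : y \notin pts -> psi y = 0 by rewrite /psi => /negbTE ->.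
have psi01 y : y \in pts -> 0 < psi y <= 1.
  by move=> yp; rewrite /psi yp divr_gt0 ?v0//= ler_pdivrMr// mul1r vmax.
have Hpsi x : x \in pts -> \sum_(y <- pts) A x y * psi y = r * psi x.
  move=> xp; rewrite {2}/psi xp mulrA -Hv// mulr_suml big_seq [RHS]big_seq.
  by apply: eq_bigr => y yp; rewrite /psi yp mulrA.
have LE x : Lh h S psi x = \sum_(y <- pts) a x y * psi y - b * psi x.
  have -> : \sum_(y <- pts) a x y * psi y =
     \sum_(i < d) (psi (x + h *: e_ i) + psi (x - h *: e_ i)) / h ^+ 2 +
     \sum_(s <- S) s.1 * psi (x + s.2).
    under eq_bigr do rewrite /a mulrDl.
    rewrite big_split/=; congr (_ + _).
      under eq_bigr do rewrite mulr_suml.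
      rewrite exchange_big/=; apply: eq_bigr => i _.
      rewrite -(sum_delta (x + h *: e_ i) up psi0) -(sum_delta (x - h *: e_ i) up psi0).
      by rewrite -big_split/= mulr_suml; apply: eq_bigr => y _; ring.
    under eq_bigr do rewrite mulr_suml.
    rewrite exchange_big/=; apply: eq_bigr => s _.
    by rewrite -(sum_delta (x + s.2) up psi0) mulr_sumr; apply: eq_bigr => y _; ring.
  have dE : dop h psi x = \sum_(i < d) (psi (x + h *: e_ i) + psi (x - h *: e_ i)) / h ^+ 2 -
      (\sum_(i < d) 2 / h ^+ 2) * psi x.
    by rewrite /dop mulr_suml -sumrB; apply: eq_bigr => i _; ring.
  have sE : sop S psi x = \sum_(s <- S) s.1 * psi (x + s.2) - (\sum_(s <- S) s.1) * psi x.
    by rewrite /sop mulr_suml -sumrB; apply: eq_bigr => s _; ring.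
  by rewrite /Lh dE sE /b; ring.
exists psi, (b + Cc - r); split.
- by move=> x Dx lx; apply: psi01; exact: mp.
- by move=> x nx; apply: psi0; apply/negP => /pm.
- have [Dm lm] := pm _ xmp; exists xm; split => //.
  by rewrite /psi xmp divff// gt_eqF.
- move=> x Dx lx; have xp := mp x Dx lx.
  have E : Lh h S psi x + c x * psi x + (b + Cc - r) * psi x = - (e0 * \sum_(y <- pts) psi y).
    have RE : r * psi x = \sum_(y <- pts) a x y * psi y + e0 * (\sum_(y <- pts) psi y) +
        (Cc + c x) * psi x.
      rewrite -Hpsi// -(sum_delta x up psi0) !mulr_sumr -!big_split/=.
      by apply: eq_bigr => y _; rewrite /A; ring.
    by rewrite LE mulrBl RE; ring.
  rewrite E oppr_le0 lerN2; have s0 : 0 <= \sum_(y <- pts) psi y.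
    by rewrite big_seq; apply: sumr_ge0 => y /psi01/andP[/ltW].
  rewrite mulr_ge0 ?(ltW e00)// andbT.
  have s1 : \sum_(y <- pts) psi y <= (size pts).+1%:R.
    apply: (@le_trans _ _ (\sum_(y <- pts) 1)).
      by rewrite big_seq [leRHS]big_seq; apply: ler_sum => y /psi01/andP[].
    by rewrite big_const_seq count_predT iter_addr_0 ler_nat.
  by rewrite /e0 mulrAC ler_pdivrMr// ler_pM2l ?invr_gt0.
Qed.

End discrete_eigen.

(** * Consistency bounds for Gaussians and barriers *)

Section gaussian_reg.
Context {R : realType} {d : nat}.
Local Notation vec := 'rV[R]_d.
Local Notation e_ := (@unitv R d).
Implicit Types (x y z : vec) (F : vec -> R).

(** The mean value theorem for the symmetrised function [G], then for f1 on each half-line, uses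
    only a Lipschitz bound on f2 at x. The cubic error becomes O(h) after division by h^2. *)
Lemma second_diff F (f1 f2 : vec -> R) x i (t K : R) : 0 < t -> 0 <= K ->
  (forall s, `|s| <= t -> is_derive (x + s *: e_ i) (e_ i) F (f1 (x + s *: e_ i))) ->
  (forall s, `|s| <= t -> is_derive (x + s *: e_ i) (e_ i) f1 (f2 (x + s *: e_ i))) ->
  (forall s, `|s| <= t -> `|f2 (x + s *: e_ i) - f2 x| <= K * `|s|) ->
  `|F (x + t *: e_ i) + F (x - t *: e_ i) - 2 * F x - t ^+ 2 * f2 x| <= 2 * K * t ^+ 3.
Proof.
move=> t0 K0 d1 d2 lip.
pose G s := F (x + s *: e_ i) + F (x + (- s) *: e_ i) - f2 x * s ^+ 2.
pose G' s := f1 (x + s *: e_ i) - f1 (x + (- s) *: e_ i) - f2 x * (2 * s).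
have dG (s : R) : `|s| <= t -> is_derive s 1 G (G' s).
  move=> st.
  have a1 : is_derive s 1 (fun s => F (x + s *: e_ i)) (f1 (x + s *: e_ i)).
    by apply/is_derive_line; exact: d1.
  have a2 : is_derive s 1 (fun s => F (x + (- s) *: e_ i)) (- f1 (x + (- s) *: e_ i)).
    have b1 : is_derive (- s) 1 (fun s => F (x + s *: e_ i)) (f1 (x + (- s) *: e_ i)).
      by apply/is_derive_line; apply: d1; rewrite normrN.
    have b2 : is_derive s 1 (-%R : R -> R) (-1) by exact: is_deriveNid.
    have b3 := @is_derive1_comp R (fun s => F (x + s *: e_ i)) (-%R : R -> R) s _ _ b1 b2.
    by apply: (is_derive_eq b3); rewrite ?mulrN1 ?mulN1r -?[_ *: _]/(_ * _) ?mulrN1 ?mulN1r.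
  have a3 : is_derive s 1 (fun s : R => f2 x * s ^+ 2) (f2 x * (2 * s)).
    by apply: is_derive_eq; rewrite -![_ *: _]/(_ * _); ring.
  exact: (is_deriveB (is_deriveD a1 a2) a3).
have cG : {within `[0, t], continuous G}.
  apply: continuous_in_subspaceT => s /[!inE]; rewrite /= in_itv/= => /andP[s0 st].
  have st' : `|s| <= t by rewrite ger0_norm.
  have [dGs _] := dG s st'.
  exact/differentiable_continuous/derivable1_diffP.
have dG0 (s : R) : s \in `]0, t[ -> is_derive s 1 G (G' s).
  by rewrite in_itv/= => /andP[s0 st]; apply: dG; rewrite ger0_norm// ltW.
have [s] := MVT t0 dG0 cG; rewrite in_itv/= => /andP[s0 st].
have -> : G t - G 0 = F (x + t *: e_ i) + F (x - t *: e_ i) - 2 * F x - t ^+ 2 * f2 x.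
  by rewrite /G oppr0 scale0r addr0 scaleNr; ring.
move=> ->; rewrite subr0 normrM (gtr0_norm t0).
have sabs : `|s| = s by rewrite gtr0_norm.
have d2' (q : R) : `|q| <= `|s| -> is_derive (x + q *: e_ i) (e_ i) f1 (f2 (x + q *: e_ i)).
  by move=> qs; apply: d2; rewrite (le_trans qs)// sabs ltW.
have d2'' (q : R) : `|q| <= `|- s| -> is_derive (x + q *: e_ i) (e_ i) f1 (f2 (x + q *: e_ i)).
  by rewrite normrN; exact: d2'.
have [q1 [q1s _] E1] := mvt_line d2'; have [q2 [q2s _] E2] := mvt_line d2''.
rewrite normrN in q2s.
have -> : G' s = s * (f2 (x + q1 *: e_ i) - f2 x) + s * (f2 (x + q2 *: e_ i) - f2 x).
  rewrite /G' -[f1 (x + s *: e_ i)](subrK (f1 x)) E1 -[f1 (x + - s *: e_ i)](subrK (f1 x)) E2.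
  ring.
have B q : `|q| <= `|s| -> `|s * (f2 (x + q *: e_ i) - f2 x)| <= K * t ^+ 2.
  move=> qs; rewrite normrM sabs expr2 mulrCA; apply: ler_pM => //; [exact: ltW|exact: ltW|].
  apply: le_trans (lip q _) _; first by rewrite (le_trans qs)// sabs ltW.
  by rewrite ler_wpM2l// (le_trans qs)// sabs ltW.
apply: (@le_trans _ _ ((K * t ^+ 2 + K * t ^+ 2) * t)).
  rewrite ler_wpM2r ?(ltW t0)//; apply: le_trans (ler_normD _ _) _.
  by apply: lerD; exact: B.
by rewrite le_eqVlt; apply/orP; left; apply/eqP; ring.
Qed.

Lemma lip_of_partials F (f1 : 'I_d -> vec -> R) (K : R) : 0 <= K ->
  (forall i z, is_derive z (e_ i) F (f1 i z)) -> (forall i z, `|f1 i z| <= K) ->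
  forall y z, `|F y - F z| <= d%:R * K * enorm (y - z).
Proof.
move=> K0 dF fK y z; have [xi _ E] := @mvt_coord R d F f1 z (y - z) (fun i p _ => dF i p).
have zy : z + (y - z) = y by rewrite addrC subrK.
rewrite zy in E; rewrite E.
have -> : d%:R * K * enorm (y - z) = \sum_(i < d) enorm (y - z) * K.
  by rewrite sumr_const card_ord -mulr_natl; ring.
apply: le_trans (ler_norm_sum _ _ _) _; apply: ler_sum => i _; rewrite normrM.
by apply: ler_pM => //; exact: coord_le_enorm.
Qed.

(** With u = |x - z|, this combines exp(- a u^2) (1 + a u^2) <= 1 and 2 a u <= (a + 1) (1 + a u^2).
    The bound is uniform in x and so gives a global Lipschitz constant. *)
Lemma gs1_bound (a : R) z i x : 0 <= a -> `|gs1 a z i x| <= a + 1.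
Proof.
move=> a0; rewrite /gs1 !normrM normrN normrM (ger0_norm (ler0n R 2)) (ger0_norm a0).
rewrite (gtr0_norm (gs_gt0 a z x)).
have c1 := coord_le_enorm (x - z) i; set u := enorm (x - z) in c1.
have u0 : 0 <= u by exact: enorm_ge0.
have g0 := gs_gt0 a z x.
have g1 : gs a z x * (1 + a * u ^+ 2) <= 1.
  have := expR_ge1Dx (a * u ^+ 2); move=> /(ler_wpM2l (ltW g0))/le_trans; apply.
  by rewrite /gs -expRD -/u /u sqr_enorm mulNr addNr expR0.
apply: (@le_trans _ _ (2 * a * (u * gs a z x))).
  by rewrite ler_wpM2l ?mulr_ge0// ler_wpM2r// ltW.
have h1 : 0 <= a * (u - 1) ^+ 2 by rewrite mulr_ge0// sqr_ge0.
have h2 : 2 * a * u <= (a + 1) * (1 + a * u ^+ 2).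
  have h3 : 0 <= a * (a * u ^+ 2) by rewrite !mulr_ge0// sqr_ge0.
  by move: h1; rewrite sqrrB; move: h3; rewrite !expr2 mulr2n; lra.
rewrite mulrA; apply: le_trans (ler_wpM2r (ltW g0) h2) _.
by rewrite -mulrA ler_piMr ?addr_ge0// mulrC.
Qed.

Section local_bounds.
Variables (a R0 : R) (z x : vec).
Hypotheses (a0 : 0 <= a) (R00 : 0 <= R0) (xz : enorm (x - z) <= R0).

Lemma gs2_bound i k : `|gs2 a z i k x| <= 2 * a * (1 + R0 * (a + 1)).
Proof.
rewrite /gs2 normrM normrN normrM (ger0_norm (ler0n R 2)) (ger0_norm a0).
rewrite ler_wpM2l ?mulr_ge0//; apply: le_trans (ler_normD _ _) _; apply: lerD.
  rewrite normrM (gtr0_norm (gs_gt0 a z x)); case: (i == k); last by rewrite normr0 mul0r ler01.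
  by rewrite normr1 mul1r gs_le1.
rewrite normrM; apply: ler_pM => //; last exact: gs1_bound.
exact: le_trans (coord_le_enorm _ _) xz.
Qed.

Lemma gs3_bound i : `|gs3 a z i x| <=
  2 * a * ((a + 1) + ((a + 1) + R0 * (2 * a * (1 + R0 * (a + 1))))).
Proof.
rewrite /gs3 normrM normrN normrM (ger0_norm (ler0n R 2)) (ger0_norm a0).
rewrite ler_wpM2l ?mulr_ge0//; apply: le_trans (ler_normD _ _) _; apply: lerD.
  exact: gs1_bound.
apply: le_trans (ler_normD _ _) _; apply: lerD; first exact: gs1_bound.
rewrite normrM; apply: ler_pM => //; last exact: gs2_bound.
exact: le_trans (coord_le_enorm _ _) xz.
Qed.

End local_bounds.

(** F need be smooth only within eta of x, which admits truncated barriers. M is fixed before F, x,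
    z and eta, so the mesh can be made fine without knowing the later contact point or exterior
    sphere. *)
Lemma reg_affine_gs (a m B L R0 : R) : 0 <= a -> 0 <= B -> 0 <= L -> 0 <= R0 ->
  exists2 M, 0 <= M & forall F x z (k eta : R), mrV F -> (forall y, `|F y| <= B) ->
   (forall y y', `|F y - F y'| <= L * enorm (y - y')) -> enorm (x - z) <= R0 ->
   0 < eta -> eta <= 1 ->
   (forall y, enorm y <= eta -> F (x + y) = k + m * gs a z (x + y)) ->
   reg F x (\row_i (m * gs1 a z i x)) (fun i => m * gs2 a z i i x) M eta.
Proof.
move=> a0 B0 L0 R00.
pose R1 := R0 + d%:R; have R10 : 0 <= R1 by rewrite addr_ge0.
pose K2 := 2 * a * (1 + R1 * (a + 1)).
have K20 : 0 <= K2 by rewrite !mulr_ge0// addr_ge0// mulr_ge0// addr_ge0.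
pose K3 := 2 * a * ((a + 1) + ((a + 1) + R1 * K2)).
have K30 : 0 <= K3.
  have a10 : 0 <= a + 1 by rewrite addr_ge0.
  apply: mulr_ge0; first by rewrite mulr_ge0.
  by do 2![apply: addr_ge0 => //]; exact: mulr_ge0.
pose M := B + (L + `|m| * (d%:R * d%:R * K2 + 2 * K3)).
have dd0 : 0 <= d%:R * d%:R :> R by rewrite mulr_ge0.
have q1 : 0 <= d%:R * d%:R * K2 := mulr_ge0 dd0 K20.
have q2 : 0 <= 2 * K3 := mulr_ge0 (ler0n R 2) K30.
have q0 : 0 <= d%:R * d%:R * K2 + 2 * K3 := addr_ge0 q1 q2.
have mq0 : 0 <= `|m| * (d%:R * d%:R * K2 + 2 * K3) := mulr_ge0 (normr_ge0 m) q0.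
have M0 : 0 <= M := addr_ge0 B0 (addr_ge0 L0 mq0).
exists M => // F x z k eta mF FB FL xz eta0 eta1 Fg.
have near (y : vec) : `|y| <= 1 -> enorm (x + y - z) <= R1.
  move=> y1; rewrite addrAC; apply: le_trans (ler_enormD _ _) _; apply: lerD => //.
  by apply: le_trans (enorm_le_norm _) _; rewrite ler_piMr.
have nearz (p : vec) : `|p - x| <= 1 -> enorm (p - z) <= R1.
  by move=> /near; rewrite addrCA subrr addr0.
have FE y : enorm y <= eta -> F (x + y) - F x = m * (gs a z (x + y) - gs a z x).
  move=> ye; rewrite Fg// -{2}[x]addr0 Fg ?enorm0 ?(ltW eta0)// addr0; ring.
split => //.
- by move=> y; apply: le_trans (FB y) _; rewrite /M lerDl; exact: addr_ge0 L0 mq0.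
- move=> y y'; apply: le_trans (FL y y') _; rewrite ler_wpM2r ?enorm_ge0//.
  by rewrite /M ler_wpDl// lerDl; exact: mq0.
- move=> y ye; rewrite FE//.
  have -> : dotv y (\row_i (m * gs1 a z i x)) = m * dotv y (\row_i gs1 a z i x).
    by rewrite -dotvZr; congr dotv; apply/rowP => i; rewrite !mxE.
  rewrite -mulrBr normrM.
  have y1 : `|y| <= 1 by apply: le_trans (norm_le_enorm _) _; exact: le_trans ye eta1.
  have T := @taylor2 R d setT (gs a z) _ _ x 1 K2 (jet2_gs setT a z) (fun _ _ => I)
    (fun i k' p px => gs2_bound a0 (nearz p px) i k') y y1.
  apply: le_trans (ler_wpM2l (normr_ge0 m) T) _; rewrite mulrA ler_wpM2r ?sqr_ge0//.
  by rewrite /M addrA ler_wpDl ?addr_ge0// ler_wpM2l// lerDl; exact: q2.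
- move=> i t t0 te.
  have te1 : `|t| = t by rewrite gtr0_norm.
  have et : enorm (t *: e_ i) = t by rewrite enormZ enorm_unitv mulr1.
  have [e1 e2] : enorm (t *: e_ i) <= eta /\ enorm (- (t *: e_ i)) <= eta.
    by rewrite enormN et.
  have -> : F (x + t *: e_ i) + F (x - t *: e_ i) - 2 * F x - t ^+ 2 * (m * gs2 a z i i x) =
     m * (gs a z (x + t *: e_ i) + gs a z (x - t *: e_ i) - 2 * gs a z x - t ^+ 2 * gs2 a z i i x).
    have -> : F (x + t *: e_ i) + F (x - t *: e_ i) - 2 * F x =
      (F (x + t *: e_ i) - F x) + (F (x - t *: e_ i) - F x) by ring.
    by rewrite !FE//; ring.
  rewrite normrM.
  have T : `|gs a z (x + t *: e_ i) + gs a z (x - t *: e_ i) - 2 * gs a z x - t ^+ 2 * gs2 a z i i x|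
      <= 2 * K3 * t ^+ 3.
    apply: (@second_diff _ (gs1 a z i) (gs2 a z i i)) => // [s _|s _|s st].
    - exact: is_derive_gs.
    - exact: is_derive_gs1.
    - have dl (q : R) : `|q| <= `|s| ->
          is_derive (x + q *: e_ i) (e_ i) (gs2 a z i i) (gs3 a z i (x + q *: e_ i)).
        by move=> _; exact: is_derive_gs2.
      have [q [qs _] ->] := mvt_line dl; rewrite normrM mulrC ler_wpM2r//.
      apply: (gs3_bound a0); apply: near; rewrite normrZ unitv_norm mulr1.
      by apply: le_trans qs _; apply: le_trans st _; exact: le_trans te eta1.
  apply: le_trans (ler_wpM2l (normr_ge0 m) T) _; rewrite mulrA ler_wpM2r ?exprn_ge0 ?(ltW t0)//.
  by rewrite /M addrA ler_wpDl ?addr_ge0// ler_wpM2l// lerDr; exact: q1.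
Qed.

Lemma gs_lip (a : R) z y y' : 0 <= a ->
  `|gs a z y - gs a z y'| <= d%:R * (a + 1) * enorm (y - y').
Proof.
move=> a0; apply: (lip_of_partials (f1 := gs1 a z)); first exact: addr_ge0.
  by move=> i p; exact: is_derive_gs.
by move=> i p; exact: gs1_bound.
Qed.

Lemma chi_lip (a b : R) z y y' : 0 <= a -> 0 <= b ->
  `|chi a b z y - chi a b z y'| <= b * (d%:R * (a + 1)) * enorm (y - y').
Proof.
move=> a0 b0; have H : `|chi a b z y - chi a b z y'| <= `|b * (gs a z y - gs a z y')|.
  rewrite /chi mulrBr; set p := b * gs a z y; set q := b * gs a z y'.
  have m (t : R) : Num.max 0 t = (`|t| + t) / 2.
    have [t0|t0] := leP 0 t; first by rewrite ger0_norm// mulrDl -splitr.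
    by rewrite ltr0_norm// addNr mul0r.
  rewrite !m; have -> : (`|1 - p| + (1 - p)) / 2 - (`|1 - q| + (1 - q)) / 2 =
    ((`|1 - p| - `|1 - q|) - (p - q)) / 2 by field.
  rewrite normrM normfV (gtr0_norm (ltr0Sn R 1)) ler_pdivrMr// mulr_natr mulr2n.
  apply: le_trans (ler_normB _ _) _; rewrite lerD2r.
  apply: le_trans (ler_dist_dist _ _) _.
  by have -> : 1 - p - (1 - q) = - (p - q) by [ring]; rewrite normrN.
by apply: le_trans H _; rewrite normrM (ger0_norm b0) -mulrA ler_wpM2l// gs_lip.
Qed.

End gaussian_reg.

(** * A priori estimates for the discrete eigenpairs *)

Section discrete_estimates.
Context {R : realType} {d : nat}.
Local Notation vec := 'rV[R]_d.
Local Notation e_ := (@unitv R d).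
Implicit Types (x y z p q : vec) (F G : vec -> R).

(** Monotonicity of the scheme: it is a combination of increments from x with nonnegative weights.
    Comparing increments rather than values allows contact up to a constant. *)
Lemma le_Lh h (S : seq (R * vec)) F G x : 0 < h ->
  (forall a, a \in S -> 0 <= a.1 /\ lat h a.2) -> lat h x ->
  (forall y, lat h y -> F y - F x <= G y - G x) -> Lh h S F x <= Lh h S G x.
Proof.
move=> h0 S0 lx FG; rewrite /Lh; apply: lerD.
  apply: ler_sum => i _; rewrite ler_pM2r ?invr_gt0 ?exprn_gt0//.
  have h1 := FG _ (latD lx (@lat_unit1 R d h i)).
  have h2 := FG _ (latB lx (@lat_unit1 R d h i)).
  have E f : f (x + h *: e_ i) + f (x - h *: e_ i) - 2 * f x =
    (f (x + h *: e_ i) - f x) + (f (x - h *: e_ i) - f x) :> R by ring.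
  by rewrite !E; exact: lerD.
rewrite /sop big_seq [leRHS]big_seq; apply: ler_sum => a /S0[a0 la].
by rewrite ler_wpM2l//; apply: FG; exact: latD.
Qed.

Lemma Lh_cst h (S : seq (R * vec)) (k : R) x : Lh h S (fun=> k) x = 0.
Proof.
rewrite /Lh /dop /sop !big1 ?addr0// => [a _|i _]; first by rewrite subrr mulr0.
by rewrite (_ : k + k - 2 * k = 0) ?mul0r//; ring.
Qed.

Lemma LhZ h (S : seq (R * vec)) (k : R) F x : Lh h S (fun y => k * F y) x = k * Lh h S F x.
Proof.
rewrite /Lh mulrDr /dop /sop !mulr_sumr; congr (_ + _); apply: eq_bigr => i _; ring.
Qed.

Variable j : vec -> R.
Hypothesis hj : levy_density j.
Variables (D : set vec) (c : vec -> R).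
Hypotheses (oD : open D) (bD : bounded_set D)
  (sD : uniform_exterior_sphere D) (D0 : D 0).
Variable Cc : R.
Hypothesis HC : forall x, D x -> `|c x| <= Cc.

Record discrete_eigenpair (n : nat) (h : R) (S : seq (R * vec)) (psi : vec -> R) (lam : R) : Prop := DiscreteEigenpair {
  ds_h0 : 0 < h;
  ds_hn : h <= n.+1%:R^-1;
  ds_S : forall a, a \in S -> 0 <= a.1 /\ lat h a.2;
  ds_cons : forall F x p f2 M eta, n.+1%:R^-1 <= eta -> reg F x p f2 M eta ->
    `|Lh h S F x - (\sum_i f2 i + Ij j (Dlt F x p))| <= M * n.+1%:R^-1;
  ds_pos : forall x, D x -> lat h x -> 0 < psi x <= 1;
  ds_out : forall x, ~ (D x /\ lat h x) -> psi x = 0;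
  ds_max : exists x, [/\ D x, lat h x & psi x = 1];
  ds_eq : forall x, D x -> lat h x ->
    - n.+1%:R^-1 <= Lh h S psi x + c x * psi x + lam * psi x <= 0 }.

Lemma discrete_eigenpair_exists n : exists h S psi lam, discrete_eigenpair n h S psi lam.
Proof.
have [h [S [h0 hn HS Hc]]] := scheme hj n.
have [psi [lam [H1 H2 H3 H4]]] :=
  discrete_eigen n bD D0 h0 (fun a aS => (HS a aS).1) HC.
by exists h, S, psi, lam; split.
Qed.

Let Cc0 : 0 <= Cc. Proof. by apply: le_trans (HC D0). Qed.

Lemma inv_nat_le1 n : (n.+1%:R : R)^-1 <= 1.
Proof. by rewrite invf_le1// ler1n. Qed.

Section one_level.
Variables (n : nat) (h : R) (S : seq (R * vec)) (psi : vec -> R) (lam : R).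
Hypothesis ds : discrete_eigenpair n h S psi lam.

Lemma ds_ge0 x : 0 <= psi x.
Proof.
have [[Dx lx]|nx] := pselect (D x /\ lat h x); last by rewrite (ds_out ds).
by have /andP[/ltW] := ds_pos ds Dx lx.
Qed.

Lemma ds_le1 x : psi x <= 1.
Proof.
have [[Dx lx]|nx] := pselect (D x /\ lat h x); last by rewrite (ds_out ds).
by have /andP[] := ds_pos ds Dx lx.
Qed.

(** At a point where psi attains its maximum 1, monotonicity makes the scheme nonpositive, and the
    discrete inequality bounds lam from below. *)
Lemma lam_ge : - (Cc + 1) <= lam.
Proof.
have [x [Dx lx px]] := ds_max ds; have /andP[e1 _] := ds_eq ds Dx lx.
have L : Lh h S psi x <= 0.
  rewrite -(Lh_cst h S 0 x); apply: (le_Lh (ds_h0 ds) (ds_S ds) lx) => y ly.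
  by rewrite subrr subr_le0 px ds_le1.
have := HC Dx; rewrite ler_norml => /andP[_ c1]; have := inv_nat_le1 n.
by move: e1 L; rewrite px !mulr1; set E := n.+1%:R^-1; lra.
Qed.

(** From here the eigenvalue equation is treated as one with bounded right-hand side; the boundary
    and reflection estimates use nothing else of it. *)
Lemma ds_rhs (Lam0 : R) x : `|lam| <= Lam0 -> D x -> lat h x ->
  `|Lh h S psi x| <= Cc + Lam0 + 1.
Proof.
move=> l0 Dx lx; have /andP[e1 e2] := ds_eq ds Dx lx.
have p0 := ds_ge0 x; have p1 := ds_le1 x.
have h1 : `|c x * psi x| <= Cc.
  rewrite normrM (ger0_norm p0) -[Cc]mulr1; apply: ler_pM => //; exact: HC.
have h2 : `|lam * psi x| <= Lam0.
  by rewrite normrM (ger0_norm p0) -[Lam0]mulr1; apply: ler_pM.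
have := inv_nat_le1 n; move: h1 h2 e1 e2; set E := n.+1%:R^-1; rewrite !ler_norml.
by move=> /andP[a1 a2] /andP[b1 b2] e1 e2 E1; apply/andP; split; lra.
Qed.

End one_level.

(* Compare psi from below with the largest multiple of a Gaussian bump supported
   in a ball around 0. *)
Lemma lam_le : exists Lam0 n0, forall n h S psi lam, (n0 <= n)%N -> discrete_eigenpair n h S psi lam -> lam <= Lam0.
Proof.
have [rho' r'0 Hr] := open_box oD D0.
pose rho := rho' ; pose s := rho / 2.
have rho0 : 0 < rho by []. have s0 : 0 < s by rewrite divr_gt0.
have rD z : enorm z <= rho -> D z.
  by move=> zr; apply: Hr; rewrite subr0; apply: le_trans (norm_le_enorm _) zr.
have L0 := Lam_ge0 hj.
pose B := 2 * d%:R + Lam j; have B0 : 0 <= B by rewrite addr_ge0// mulr_ge0.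
have [a [a0 Ha]] : exists a, 0 < a /\ 1 <= 4 * a ^+ 2 * s ^+ 2 - 2 * d%:R * a - a * Lam j - Lam j.
  pose k := 4 * s ^+ 2; have k0 : 0 < k by rewrite mulr_gt0// exprn_gt0.
  exists (1 + (B + 1 + Lam j) / k).
  set e := _ / k; have e0 : 0 <= e by rewrite divr_ge0 ?(ltW k0)// !addr_ge0.
  split; first by rewrite ltr_pwDl.
  have ek : e * k = B + 1 + Lam j by rewrite /e divfK// gt_eqF.
  have : (1 + e) ^+ 2 * k - B * (1 + e) - Lam j = (1 + e) * (k + (1 + Lam j)) - Lam j.
    by rewrite expr2 -mulrA [(1 + e) * k]mulrDl mul1r ek; ring.
  have hh : 0 <= e * (k + (1 + Lam j)) by rewrite mulr_ge0 ?addr_ge0// ltW.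
  by rewrite /B /k in k0 hh *; lra.
(* The value of the Gaussian at radius rho: subtracting it makes phi positive exactly inside the
   ball. *)
pose c1 := expR (- a * rho ^+ 2).
pose phi x := gs a 0 x - c1.
have c10 : 0 < c1 by exact: expR_gt0.
have c11 : c1 <= 1 by rewrite -expR0 ler_expR mulNr oppr_le0 mulr_ge0 ?(ltW a0)// sqr_ge0.
have gE x : gs a 0 x = expR (- a * enorm x ^+ 2) by rewrite /gs subr0 sqr_enorm.
have [M M0 HM] := @reg_affine_gs R d a 1 2 (d%:R * (a + 1)) rho (ltW a0) (ler0n R 2)
  (mulr_ge0 (ler0n R d) (addr_ge0 (ltW a0) ler01)) (ltW rho0).
have regphi x : enorm x <= rho ->
    reg phi x (\row_i (1 * gs1 a 0 i x)) (fun i => 1 * gs2 a 0 i i x) M 1.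
  move=> xr; apply: (HM phi x 0 (- c1) 1) => //.
  - by apply: mrVB; [apply: mrV_continuous; exact: continuous_gs|exact: mrV_cst].
  - move=> y; apply: le_trans (ler_normB _ _) _; rewrite (gtr0_norm (gs_gt0 _ _ _)) gtr0_norm//.
    by apply: lerD => //; apply: gs_le1; exact: ltW.
  - move=> y y'; rewrite /phi opprB addrA subrK; apply: gs_lip; exact: ltW.
  - by rewrite subr0.
  - by move=> y _; rewrite /phi mul1r addrC.
have mphi : mrV phi.
  by apply: mrVB; [apply: mrV_continuous; exact: continuous_gs|exact: mrV_cst].
pose LL x := \sum_i 1 * gs2 a 0 i i x + Ij j (Dlt phi x (\row_i (1 * gs1 a 0 i x))).
have LLE x : LL x = Lop j (gs a 0) x.
  rewrite (Lop_jet j openT I (jet2_gs setT a 0)) /LL; congr (_ + _).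
    by apply: eq_bigr => i _; rewrite mul1r.
  congr (Ij j _); apply/funext => y; rewrite /Dlt /phi opprB addrA subrK.
  by congr (_ - _ * dotv _ _); apply/rowP => i; rewrite !mxE mul1r.
have LLge x : s <= enorm x -> c1 <= LL x \/ rho < enorm x.
  move=> sx; have [xr|xr] := leP (enorm x) rho; [left|by right].
  rewrite LLE; apply: le_trans (hopf_Lop hj 0 x (ltW a0)); rewrite subr0.
  have g0 := gs_gt0 a 0 x.
  apply: (@le_trans _ _ (gs a 0 x)).
    rewrite gE ler_expR !mulNr lerN2 ler_wpM2l ?(ltW a0)//.
    by rewrite ler_pXn2r// ?nnegrE ?enorm_ge0 ?(ltW rho0).
  rewrite ler_peMl ?(ltW g0)//; apply: le_trans Ha _; rewrite !lerD2r ler_wpM2l//.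
    by rewrite mulr_ge0// exprn_ge0// ltW.
  by rewrite ler_pXn2r// ?nnegrE ?enorm_ge0 ?(ltW s0).
pose LB := (2 * d%:R * a) + a * Lam j + Lam j.
have LB0 : 0 <= LB by rewrite !addr_ge0 ?mulr_ge0 ?(ltW a0).
have LLlow x : - LB <= LL x.
  rewrite LLE; apply: le_trans (hopf_Lop hj 0 x (ltW a0)).
  have g0 := gs_gt0 a 0 x; have g1 := gs_le1 0 x (ltW a0).
  have k1 : LB * gs a 0 x <= LB by rewrite ler_piMr.
  have k2 : 0 <= (4 * a ^+ 2 * enorm (x - 0) ^+ 2) * gs a 0 x.
    apply: mulr_ge0; last exact: ltW.
    by apply: mulr_ge0; [apply: mulr_ge0 => //; exact: sqr_ge0|exact: sqr_ge0].
  apply: (@le_trans _ _ (- (LB * gs a 0 x))); first by rewrite lerN2.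
  by move: k2; rewrite /LB; lra.
pose pm := expR (- a * s ^+ 2) - c1.
have srho : s < rho by rewrite /s ltr_pdivrMr// ltr_pMr// ltr1n.
have pm0 : 0 < pm.
  rewrite subr_gt0 ltr_expR !mulNr ltrN2 ltr_pM2l//.
  by rewrite ltr_pXn2r// ?nnegrE ?(ltW rho0) ?(ltW s0).
have M1 : 0 < M + 1 by rewrite ltr_wpDl.
have [n0 Hn0] := small_inv (divr_gt0 (divr_gt0 c10 (ltr0Sn R 1)) M1).
exists (Cc + (LB + 1) / pm), n0 => n h S psi lam nn ds.
have := Hn0 n nn; set E := n.+1%:R^-1 => En.
have E1 : E <= 1 by exact: inv_nat_le1.
have ME : M * E <= c1 / 2.
  move: En; rewrite ler_pdivlMr// => En; apply: le_trans En.
  by rewrite mulrC ler_wpM2l ?invr_ge0// lerDl.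
have ME1 : M * E <= 1 by apply: le_trans ME _; lra.
have cons x : enorm x <= rho -> `|Lh h S phi x - LL x| <= M * E.
  by move=> xr; apply: (ds_cons ds) (regphi x xr).
have [pts up ptsE] := lattice_pts bD (ds_h0 ds).
pose sub := [seq x <- pts | enorm x < rho].
have sub0 : 0 \in sub.
  rewrite mem_filter enorm0 rho0 ptsE; apply/asboolP; split => //; exact: lat0.
have phipos x : enorm x < rho -> 0 < phi x.
  move=> xr; rewrite subr_gt0 gE ltr_expR !mulNr ltrN2 ltr_pM2l//.
  by rewrite ltr_pXn2r// ?nnegrE ?enorm_ge0 ?(ltW rho0).
have phineg x : rho <= enorm x -> phi x <= 0.
  move=> xr; rewrite subr_le0 gE ler_expR !mulNr lerN2 ler_wpM2l ?(ltW a0)//.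
  by rewrite ler_pXn2r// ?nnegrE ?enorm_ge0 ?(ltW rho0).
have [x0 x0s xmin] := seq_argmax (fun x => - (psi x / phi x)) sub0.
move: (x0s); rewrite mem_filter => /andP[x0r]; rewrite ptsE => /asboolP[Dx0 lx0].
have px0 : 0 < psi x0 by have /andP[] := ds_pos ds Dx0 lx0.
have fx0 := phipos x0 x0r.
pose t := psi x0 / phi x0; have t0 : 0 < t by rewrite divr_gt0.
have tphi0 : t * phi x0 = psi x0 by rewrite /t divfK// gt_eqF.
have tphi y : lat h y -> t * phi y <= psi y.
  move=> ly; have [yr|yr] := ltP (enorm y) rho; last first.
    by apply: (@le_trans _ _ 0); [rewrite pmulr_rle0// phineg|exact: ds_ge0 ds y].
  have ys : y \in sub.
    by rewrite mem_filter yr ptsE; apply/asboolP; split => //; apply: rD; exact: ltW.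
  by have := xmin y ys; rewrite lerN2 -/t ler_pdivlMr// phipos.
have L1 : t * Lh h S phi x0 <= Lh h S psi x0.
  rewrite -LhZ; apply: (le_Lh (ds_h0 ds) (ds_S ds) lx0) => y ly.
  by rewrite tphi0 lerD2r tphi.
have /andP[_ e2] := ds_eq ds Dx0 lx0.
have e3 : t * (Lh h S phi x0 + (c x0 + lam) * phi x0) <= 0.
  rewrite mulrDr mulrCA tphi0 mulrDl; apply: le_trans e2.
  by rewrite -addrA lerD2r.
have e4 : Lh h S phi x0 + (c x0 + lam) * phi x0 <= 0 by rewrite -(pmulr_rle0 _ t0).
have c2 := cons x0 (ltW x0r).
have c3 := HC Dx0.
have LB1 : 0 <= (LB + 1) / pm.
  by apply: divr_ge0; [exact: addr_ge0 LB0 ler01|exact: ltW].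
(* For contact in the annulus the scheme is positive on phi, which forces c + lam <= 0. For contact
   in the inner ball phi is at least pm and its L at least - LB, which gives the bound with (LB + 1)
   / pm. *)
have [sx|sx] := leP s (enorm x0).
  have [c1L|] := LLge x0 sx; last by rewrite ltNge (ltW x0r).
  have : (c x0 + lam) * phi x0 <= 0.
    by move: c2 ME c10; rewrite ler_norml => /andP[u1 u2]; set q := (c x0 + lam) * _ in e4 *; lra.
  rewrite pmulr_lle0// => h1; move: c3; rewrite ler_norml => /andP[v1 v2].
  by lra.
have pmx : pm <= phi x0.
  rewrite lerD2r gE ler_expR !mulNr lerN2 ler_wpM2l ?(ltW a0)//.
  by rewrite ler_pXn2r// ?nnegrE ?enorm_ge0 ?(ltW s0)// ltW.
have h1 : (c x0 + lam) * phi x0 <= LB + 1.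
  move: c2; rewrite ler_norml => /andP[u1 u2]; have := LLlow x0.
  by set q := (c x0 + lam) * _ in e4 *; lra.
have [cl|cl] := leP (c x0 + lam) 0.
  by move: c3; rewrite ler_norml => /andP[v1 v2]; lra.
have h2 : (c x0 + lam) * pm <= LB + 1.
  by apply: le_trans h1; rewrite ler_pM2l.
move: h2; rewrite -ler_pdivlMr// => h2.
by move: c3; rewrite ler_norml => /andP[v1 v2]; lra.
Qed.

(** The function chi / c0 is at least 1, hence above psi, beyond the layer, and in the layer the
    scheme is more negative on it than on psi, so it dominates psi everywhere. Close to the frontier
    it is at most tau. *)
Lemma boundary_small (F0 tau : R) : 0 <= F0 -> 0 < tau -> tau <= 1 ->
  exists2 del, 0 < del & exists n0, forall n h S psi lam, (n0 <= n)%N -> discrete_eigenpair n h S psi lam ->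
  (forall x, D x -> lat h x -> `|Lh h S psi x| <= F0) ->
  forall a b, D a -> ~ D b -> enorm (a - b) <= del -> psi a <= tau.
Proof.
move=> F00 t0 t1; have [r r0 hs] := sD.
(* Of the 2 added to F0, one unit pays for the consistency error M / (n + 1) and the other makes the
   comparison strict. *)
have [a [b [del [del' [eta [c0 [[[a0 b0 del0 del'0 dd] [eta0 eta1 c00 c01 del1]] HA HB HC1 [_ HD]]]]]]]] :=
  @barrier R d j hj r (F0 + 2) tau r0 t0 t1.
exists del' => //.
have [M M0 HM] := @reg_affine_gs R d a (- b) 1 (b * (d%:R * (a + 1))) (r + 1) a0 ler01
  (mulr_ge0 (ltW b0) (mulr_ge0 (ler0n R d) (addr_ge0 a0 ler01))) (addr_ge0 (ltW r0) ler01).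
have M1 : 0 < M + 1 by rewrite ltr_wpDl.
have [n1 Hn1] := small_inv eta0; have [n2 Hn2] := small_inv (divr_gt0 ltr01 M1).
exists (maxn n1 n2) => n h S psi lam; rewrite geq_max => /andP[nn1 nn2] ds HF p q Dp nDq pq.
have := Hn1 n nn1; have := Hn2 n nn2; set E := n.+1%:R^-1 => En2 En1.
have ME : M * E <= 1.
  move: En2; rewrite ler_pdivlMr// => En2; apply: le_trans En2.
  by rewrite mulrC ler_wpM2l ?invr_ge0// lerDl.
have [y fy yp] := frontier_between oD Dp nDq.
have [z [nDz yz zD]] := hs y fy.
have rD x : D x -> r <= enorm (x - z).
  move=> Dx; rewrite leNgt; apply/negP => xz.
  by have : (eball z r `&` D) x by []; rewrite zD.
have pz : enorm (p - z) <= r + del'.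
  rewrite -(subrK y p) -addrA; apply: le_trans (ler_enormD _ _) _.
  by rewrite yz addrC lerD2l; exact: le_trans yp pq.
have [lp|nlp] := pselect (lat h p); last by rewrite (ds_out ds) ?(ltW t0)// => -[].
pose w x := c0^-1 * chi a b z x.
have ci0 : 0 < c0^-1 by rewrite invr_gt0.
have w0 x : 0 <= w x by rewrite mulr_ge0 ?chi_ge0// ltW.
suff psiw : forall x, lat h x -> psi x <= w x.
  apply: le_trans (psiw p lp) _; rewrite /w mulrC ler_pdivrMr//; exact: HD.
have [pts up ptsE] := lattice_pts bD (ds_h0 ds).
have p0 : 0 \in pts by rewrite ptsE; apply/asboolP; split => //; exact: lat0.
have [x1 x1p xmax] := seq_argmax (fun x => psi x - w x) p0.
move: (x1p); rewrite ptsE => /asboolP[Dx1 lx1].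
have out y' : ~ (D y' /\ lat h y') -> psi y' - w y' <= 0.
  by move=> ny; rewrite (ds_out ds)// sub0r oppr_le0.
have [neg|pos] := leP (psi x1 - w x1) 0.
  move=> x lx; rewrite -subr_le0; have [Dx|nDx] := pselect (D x).
    by apply: le_trans neg; apply: xmax; rewrite ptsE; exact/asboolP.
  by apply: out => -[].
exfalso.
have rx1 := rD _ Dx1.
have x1z : enorm (x1 - z) <= r + del.
  rewrite leNgt; apply/negP => /ltW/HC1 c1; move: pos; rewrite ltNge => /negP; apply.
  rewrite subr_le0; apply: le_trans (ds_le1 ds x1) _.
  by rewrite /w mulrC ler_pdivlMr// mul1r.
have L1 : Lh h S psi x1 <= Lh h S w x1.
  apply: (le_Lh (ds_h0 ds) (ds_S ds) lx1) => x lx.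
  have : psi x - w x <= psi x1 - w x1.
    have [Dx|nDx] := pselect (D x); first by apply: xmax; rewrite ptsE; exact/asboolP.
    by apply: le_trans (ltW pos); apply: out => -[].
  by lra.
have R1 : reg (chi a b z) x1 (\row_i (- b * gs1 a z i x1)) (fun i => - b * gs2 a z i i x1) M eta.
  apply: (HM _ _ z 1 eta) => //.
  - by apply: mrV_continuous; exact: chi_continuous.
  - by move=> x; rewrite ger0_norm ?chi_ge0 ?chi_le1// ltW.
  - by move=> x x'; apply: chi_lip => //; exact: ltW.
  - by apply: le_trans x1z _; rewrite lerD2l.
  - by move=> x xe; rewrite HA// mulNr.
have := ds_cons ds En1 R1; rewrite -/E -/(dchi a b z x1) => c1.
have hb := HB z x1 rx1 x1z.
set L2 := \sum_i _ + _ in c1 hb.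
have L3 : Lh h S (chi a b z) x1 <= - (F0 + 1).
  by move: c1; rewrite ler_norml => /andP[_ c2]; lra.
have L4 : Lh h S w x1 <= - (F0 + 1).
  rewrite LhZ; apply: (@le_trans _ _ (c0^-1 * - (F0 + 1))); first by rewrite ler_pM2l.
  rewrite mulrN lerN2 ler_peMl ?addr_ge0// invf_ge1//.
have := HF x1 Dx1 lx1; rewrite ler_norml => /andP[f1 _].
by move: (le_trans f1 (le_trans L1 L4)); lra.
Qed.

End discrete_estimates.

(** * Equicontinuity of the discrete eigenfunctions *)
Section reflection.
Context {R : realType} {d : nat}.
Local Notation vec := 'rV[R]_d.
Local Notation e_ := (@unitv R d).
Implicit Types (x y z p q : vec).

Variables (D : set vec) (h : R) (S : seq (R * vec)) (psi : vec -> R) (F0 tau del : R).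
Hypotheses (bD : bounded_set D) (D0 : D 0) (h0 : 0 < h) (h1 : h <= 1).
Hypothesis S0 : forall a, a \in S -> 0 <= a.1 /\ lat h a.2.
Hypothesis psi01 : forall x, 0 <= psi x <= 1.
Hypothesis psi_out : forall x, ~ (D x /\ lat h x) -> psi x = 0.
Hypotheses (F00 : 0 <= F0) (tau0 : 0 < tau) (del0 : 0 < del) (del1 : del <= 1).
Hypothesis psiL : forall x, D x -> lat h x -> `|Lh h S psi x| <= F0.
Hypothesis psib : forall a b, D a -> ~ D b -> enorm (a - b) <= del -> psi a <= tau.
Hypothesis bh : (F0 + 1) * h ^+ 2 <= tau.

(** In the modulus [B], the curvature b is such that the reflected second difference beats the two
    right-hand sides. The slope A gives B t >= tau + t / del on [0, 3], so B exceeds 1 from del on;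
    the end 3 leaves room for t + 2 h with t and h at most 1. *)
Let b := F0 + 1.
Let A := 3 * b + del^-1.
Let B (t : R) := tau + A * t - b * t ^+ 2.

Let b0 : 0 < b. Proof. by rewrite ltr_wpDl. Qed.
Let A0 : 0 < A. Proof. by rewrite addr_gt0 ?mulr_gt0 ?invr_gt0. Qed.

Let quad_ge (t : R) : 0 <= t -> t <= 3 -> t / del <= A * t - b * t ^+ 2.
Proof.
move=> t0 t3; rewrite -subr_ge0 (_ : _ - _ = b * t * (3 - t)).
  by rewrite mulr_ge0 ?subr_ge0// mulr_ge0// ltW.
by rewrite /A; ring.
Qed.

Let B_ge_tau (t : R) : 0 <= t -> t <= 3 -> tau <= B t.
Proof.
move=> t0 t3; rewrite /B -addrA lerDl; apply: le_trans (quad_ge t0 t3).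
by rewrite divr_ge0// ltW.
Qed.

Let B_ge1 (t : R) : del <= t -> t <= 3 -> 1 <= B t.
Proof.
move=> t0 t3; have q := quad_ge (le_trans (ltW del0) t0) t3.
have t1 : 1 <= t / del by rewrite ler_pdivlMr// mul1r.
rewrite /B -addrA; apply: le_trans t1 (le_trans q _); rewrite lerDr; exact: ltW.
Qed.

(* Coupling by reflection: at a maximum over pairs (p, p - k h e) of psi p - psi q
   - B (k h), all directions but e are moved synchronously, whereas along e the two
   points are moved oppositely, so that k becomes k + 2 or k - 2 and the concavity
   of B contributes - 8 (F0 + 1). *)
Lemma lip_dir_small (i : 'I_d) (e : vec) p (k : nat) : e = e_ i \/ e = - e_ i -> k%:R * h <= 3 ->
  psi p - psi (p - (k%:R * h) *: e) <= B (k%:R * h).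
Proof.
move=> ei k3.
have sym (F : vec -> R) x : F (x + h *: e_ i) + F (x - h *: e_ i) = F (x + h *: e) + F (x - h *: e).
  by case: ei => ->//; rewrite scalerN opprK addrC.
have le : lat h (h *: e).
  by case: ei => ->; rewrite ?scalerN; [|apply: latN]; exact: lat_unit1.
have ekl (m : nat) : lat h ((m%:R * h) *: e).
  elim: m => [|m IH]; first by rewrite mul0r scale0r; exact: lat0.
  by rewrite -natr1 mulrDl mul1r scalerDl; exact: latD.
have en : enorm e = 1 by case: ei => ->; rewrite ?enormN enorm_unitv.
pose W (a : vec * nat) := psi a.1 - psi (a.1 - (a.2%:R * h) *: e) - B (a.2%:R * h).
have [pts up ptsE] := lattice_pts bD h0.
pose K := Num.truncn (3 / h).
have KE (m : nat) : (m <= K)%N = (m%:R * h <= 3).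
  rewrite /K -ler_pdivlMr//; apply/idP/idP => mK.
    apply: (@le_trans _ _ (Num.truncn (3 / h))%:R); first by rewrite ler_nat.
    by rewrite truncn_le// divr_ge0// ltW.
  rewrite -ltnS -(ltr_nat R); apply: le_lt_trans mK _; exact: truncnS_gt.
pose s := [seq (x, m) | x <- pts, m <- iota 0 K.+1].
have s0 : (0, 0%N) \in s.
  apply: allpairs_f; first by rewrite ptsE; apply/asboolP; split => //; exact: lat0.
  by rewrite mem_iota.
have [[x m] xs xmax] := seq_argmax W s0.
have [/allpairsP[[x' m']/= [xp mi [Ex Em]]]] := xs; subst x' m'.
have {mi} m3 : m%:R * h <= 3 by rewrite -KE -ltnS; have : m \in iota 0 K.+1 by []; rewrite mem_iota add0n.
move: xp; rewrite ptsE => /asboolP[Dx lx].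
have out (x' : vec) (m' : nat) : m'%:R * h <= 3 -> ~ (D x' /\ lat h x') -> W (x', m') <= 0.
  move=> m'3 nx; rewrite /W /= (psi_out nx) sub0r -opprD oppr_le0.
  apply: addr_ge0; first by have /andP[] := psi01 (x' - (m'%:R * h) *: e).
  by apply: le_trans (ltW tau0) _; apply: B_ge_tau => //; rewrite mulr_ge0// ltW.
have max' (x' : vec) (m' : nat) : m'%:R * h <= 3 -> D x' /\ lat h x' -> W (x', m') <= W (x, m).
  move=> m'3 Dx'; apply: xmax; apply: allpairs_f; first by rewrite ptsE; exact/asboolP.
  by rewrite mem_iota add0n ltnS KE.
have [neg|pos] := leP (W (x, m)) 0.
  rewrite -subr_le0; have [Dp|nDp] := pselect (D p /\ lat h p).
    by apply: le_trans neg; exact: (max' p k).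
  exact: (out p k).
exfalso.
have maxW (x' : vec) (m' : nat) : m'%:R * h <= 3 -> W (x', m') <= W (x, m).
  move=> m'3; have [Dp|nDp] := pselect (D x' /\ lat h x'); first exact: max'.
  by apply: le_trans (ltW pos); exact: out.
set t := m%:R * h in m3.
have t0 : 0 <= t by rewrite mulr_ge0// ltW.
pose q := x - t *: e.
have WE : W (x, m) = psi x - psi q - B t by [].
have /andP[px0 px1] := psi01 x; have /andP[pq0 pq1] := psi01 q.
(* A positive maximum confines the pair: beyond del the modulus exceeds 1, for coincident points W
   is - tau, and a partner outside D would place x within del of the complement, where psi <=
   tau. *)
have tdel : t < del.
  rewrite ltNge; apply/negP => /B_ge1/(_ m3) B1.
  by move: pos; rewrite WE; move: (B t) B1 => Bt B1; lra.
have m0 : (0 < m)%N.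
  rewrite lt0n; apply/negP => /eqP m0; move: pos; rewrite WE /q /t m0 mul0r scale0r subr0 subrr.
  by rewrite (_ : B 0 = tau) ?sub0r ?oppr_gt0 ?ltNge ?(ltW tau0)// /B; ring.
have Dq : D q.
  apply: contrapT => nDq; have : psi x <= tau.
    apply: psib Dx nDq _; rewrite /q opprB addrC subrK enormZ en mulr1 ger0_norm//; exact: ltW.
  move=> xt; have Bt := B_ge_tau t0 m3; move: pos; rewrite WE ltNge => /negP; apply.
  rewrite subr_le0; apply: le_trans Bt; apply: le_trans xt; rewrite gerBl //.
have lq : lat h q by apply: latB => //; exact: ekl.
have pqE : psi x - psi q = W (x, m) + B t by rewrite WE subrK.
have shift v : psi (x + v) - psi (q + v) <= psi x - psi q.
  rewrite pqE -lerBlDr; have := maxW (x + v) m m3; rewrite {1}/W /=.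
  by rewrite (_ : x + v - (m%:R * h) *: e = q + v)// /q addrAC.
have sopL : sop S psi x - sop S psi q <= 0.
  rewrite /sop -sumrB big_seq; apply: sumr_le0 => a /S0[a0 _].
  rewrite -mulrBr mulr_ge0_le0//; have := shift a.2; lra.
have t1 : t <= 1 by apply: le_trans (ltW tdel) del1.
have th3 : t + 2 * h <= 3.
  by rewrite (_ : 3 = 1 + 2 * 1) ?lerD// ?ler_pM2l//; ring.
have th3' : t - 2 * h <= 3.
  by apply: le_trans m3; rewrite gerBl mulr_ge0// ltW.
have h20 : 0 < h ^+ 2 by rewrite exprn_gt0.
have k1 : psi (x + h *: e) - psi (q - h *: e) <= W (x, m) + B (t + 2 * h).
  have tE : (m + 2)%:R * h = t + 2 * h by rewrite natrD mulrDl.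
  have m23 : (m + 2)%:R * h <= 3 by rewrite tE.
  have := maxW (x + h *: e) _ m23; rewrite {1}/W /= tE.
  rewrite (_ : x + h *: e - (t + 2 * h) *: e = q - h *: e).
    by move=> m1; rewrite -lerBlDr.
  by rewrite /q; apply/rowP => l; rewrite !mxE; ring.
have k2 : psi (x - h *: e) - psi (q + h *: e) <= W (x, m) + B (t - 2 * h).
  have [m2|m2] := leqP 2 m.
    have tE : (m - 2)%:R * h = t - 2 * h by rewrite natrB// mulrBl.
    have m23 : (m - 2)%:R * h <= 3 by rewrite tE.
    have := maxW (x - h *: e) _ m23; rewrite {1}/W /= tE.
    rewrite (_ : x - h *: e - (t - 2 * h) *: e = q + h *: e).
      by move=> m1; rewrite -lerBlDr.
    by rewrite /q; apply/rowP => l; rewrite !mxE; ring.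
  (* For neighbouring points the reflection swaps x and q, and the difference changes sign. The
     bound with B (- h) then follows from b h^2 <= tau and the positivity of W. *)
  have m1 : m = 1%N by apply/eqP; rewrite eqn_leq m0 andbT.
  have th : t = h by rewrite /t m1 mul1r.
  have -> : x - h *: e = q by rewrite /q th.
  have -> : q + h *: e = x by rewrite /q th subrK.
  rewrite -opprB pqE th; have -> : B (h - 2 * h) = tau - A * h - b * h ^+ 2.
    by rewrite /B; ring.
  rewrite /B; move: bh pos; rewrite -/b; move: (W (x, m)) (A * h) (b * h ^+ 2) => w u v; lra.
have dopi : psi (x + h *: e_ i) + psi (x - h *: e_ i) - 2 * psi x
   - (psi (q + h *: e_ i) + psi (q - h *: e_ i) - 2 * psi q) <= - (8 * b) * h ^+ 2.
  rewrite !sym; have BB : B (t + 2 * h) + B (t - 2 * h) = 2 * B t - 8 * b * h ^+ 2.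
    by rewrite /B; ring.
  rewrite mulNr; move: k1 k2 pqE BB.
  move: (B _) (B _) (B _) (W _) (8 * b * _) => u1 u2 u3 w v; lra.
have dopL : dop h psi x - dop h psi q <= - (8 * b).
  rewrite /dop -sumrB (bigD1 i)//= -[leRHS]addr0; apply: lerD.
    by rewrite -mulrBl ler_pdivrMr.
  apply: sumr_le0 => l _; rewrite -mulrBl pmulr_lle0 ?invr_gt0//.
  have := shift (h *: e_ l); have := shift (- (h *: e_ l)); lra.
have := psiL Dx lx; have := psiL Dq lq; rewrite !ler_norml /Lh => /andP[u1 u2] /andP[u3 u4].
have F0b : F0 = b - 1 by rewrite /b; lra.
move: u1 u2 u3 u4 F0b b0 sopL dopL; move: (dop _ _ _) (dop _ _ _) (sop _ _ _) (sop _ _ _) b.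
by move=> a1 a2 a3 a4 bb; lra.
Qed.

Lemma lip_dir (i : 'I_d) (e : vec) p (k : nat) : e = e_ i \/ e = - e_ i ->
  psi p - psi (p - (k%:R * h) *: e) <= tau + A * (k%:R * h).
Proof.
move=> ei; set t := k%:R * h; have t0 : 0 <= t by rewrite mulr_ge0// ltW.
have [t3|t3] := leP t 3.
  apply: le_trans (lip_dir_small p ei t3) _; rewrite /B gerBl mulr_ge0 ?(ltW b0)//; exact: sqr_ge0.
have /andP[p0 p1] := psi01 p; have /andP[q0 q1] := psi01 (p - t *: e).
have d1 : 1 <= del^-1 by rewrite invf_ge1.
have : 1 * 1 <= A * t.
  apply: ler_pM => //; last by apply: le_trans (ltW t3); rewrite ler1n.
  by apply: le_trans d1 _; rewrite lerDr mulr_ge0// ltW.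
rewrite mul1r => At; apply: (@le_trans _ _ (1 - 0)); first exact: lerB.
by rewrite subr0; apply: le_trans At _; rewrite lerDr ltW.
Qed.

(** Points p and q are joined by d axis-parallel moves, each costing tau plus A times its length;
    hence the factor d on tau. *)
Lemma lip_lat p q : lat h p -> lat h q ->
  `|psi p - psi q| <= d%:R * tau + A * \sum_i `|p ord0 i - q ord0 i|.
Proof.
have one (i : 'I_d) x (m : int) : psi x - psi (x - (m%:~R * h) *: e_ i) <= tau + A * `|m%:~R * h|.
  case: (intP m) => [|k|k].
  - rewrite mul0r scale0r subr0 subrr normr0 mulr0 addr0; exact: ltW.
  - have := @lip_dir i (e_ i) x k.+1 (or_introl erefl).
    by rewrite ger0_norm// mulr_ge0// ltW.
  - have := @lip_dir i (- e_ i) x k.+1 (or_intror erefl).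
    rewrite rmorphN mulNr normrN ger0_norm; last by rewrite mulr_ge0// ltW.
    by rewrite scalerN scaleNr.
suff H x y : lat h x -> lat h y ->
    psi x - psi y <= d%:R * tau + A * \sum_i `|x ord0 i - y ord0 i|.
  move=> lp lq; rewrite ler_norml lerNl opprB !H// andbT.
  apply: le_trans (H _ _ lq lp) _; rewrite lerD2l ler_wpM2l ?(ltW A0)//.
  by apply: ler_sum => i _; rewrite distrC.
move=> lx ly.
pose z (m : nat) : vec := \row_(i < d) (if (i < m)%N then y ord0 i else x ord0 i).
have z0 : z 0%N = x by apply/rowP => i; rewrite mxE.
have zd : z d = y by apply/rowP => i; rewrite mxE ltn_ord.
have step (m : nat) (md : (m <= d)%N) : psi x - psi (z m) <=
    m%:R * tau + A * \sum_(i < d | (i < m)%N) `|x ord0 i - y ord0 i|.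
  elim: m md => [|m IH] md.
    by rewrite z0 subrr big_pred0// mul0r mulr0 addr0.
  pose im : 'I_d := Ordinal md.
  have [a Ea] := lx im; have [b' Eb] := ly im.
  have zS : z m.+1 = z m - ((a - b')%:~R * h) *: e_ im.
    apply/rowP => l; rewrite !mxE eqxx andTb ltnS; case: (eqVneq l im) => [->|lim] /=.
      by rewrite leqnn ltnn Ea Eb rmorphB/= mulr1; ring.
    rewrite mulr0 subr0 leq_eqVlt (_ : (l == m :> nat) = false)//.
    by apply/negbTE; apply: contra lim => /eqP lm; apply/eqP/val_inj.
  rewrite (bigD1 im)/= ?ltnS// (eq_bigl (fun i : 'I_d => (i < m)%N)); last first.
    move=> l; rewrite ltnS ltn_neqAle andbC; congr (_ && _).
  have := one im (z m) (a - b'); rewrite -zS => o1; have o2 := IH (ltnW md).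
  have Eab : (a - b')%:~R * h = x ord0 im - y ord0 im by rewrite Ea Eb rmorphB mulrBl.
  rewrite Eab in o1; rewrite -natr1 mulrDl mul1r mulrDr.
  move: o1 o2; move: (m%:R * tau) (A * _) (A * _) => u1 u2 u3; lra.
have := step d (leqnn d); rewrite zd => s1; apply: le_trans s1 _.
by rewrite lerD2l ler_wpM2l ?(ltW A0)// [leRHS](eq_bigl (fun i : 'I_d => (i < d)%N))// => l; rewrite ltn_ord.
Qed.

End reflection.

(** * Smoothing lattice functions *)
Section smooth_step.
Context {R : realType}.

(** Horner induction gives one constant for size, derivative, Lipschitz and Taylor bounds on
    [0, 1]. *)
Lemma poly_on01 (p : {poly R}) : exists2 C : R, 0 <= C & forall a b : R,
  0 <= a <= 1 -> 0 <= b <= 1 ->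
  [/\ `|p.[a]| <= C, `|(deriv p).[a]| <= C, `|p.[b] - p.[a]| <= C * `|b - a| &
    `|p.[b] - p.[a] - (deriv p).[a] * (b - a)| <= C * (b - a) ^+ 2].
Proof.
elim/poly_ind: p => [|p k IHp].
  exists 0 => // a b _ _; rewrite deriv0 !hornerE; split; rewrite ?(subrr, mul0r, subr0, normr0, oppr0, addr0)//.
case: IHp => C C0 IH; exists (C + C + `|k|) => [|a b a01 b01]; first by rewrite !addr_ge0.
have [h1 h2 h3 h4] := IH a b a01 b01.
have /andP[a0 a1] := a01; have /andP[b0 b1] := b01.
have k0 := normr_ge0 k.
have E x : (p * 'X + k%:P).[x] = p.[x] * x + k by rewrite !hornerE.
have E' : (deriv (p * 'X + k%:P)).[a] = p.[a] + (deriv p).[a] * a.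
  by rewrite !poly.derivE !hornerE addrC.
rewrite !E E'; split.
- apply: le_trans (ler_normD _ _) _; rewrite lerD2r normrM (ger0_norm a0).
  apply: (@le_trans _ _ C); last by rewrite lerDl.
  by rewrite -[leRHS]mulr1; apply: ler_pM.
- apply: (@le_trans _ _ (C + C)); last by rewrite lerDl.
  apply: le_trans (ler_normD _ _) _; apply: lerD => //; rewrite normrM (ger0_norm a0).
  by rewrite -[leRHS]mulr1; apply: ler_pM.
- have -> : p.[b] * b + k - (p.[a] * a + k) = (p.[b] - p.[a]) * b + p.[a] * (b - a) by ring.
  apply: (@le_trans _ _ ((C + C) * `|b - a|)); last by rewrite ler_wpM2r// lerDl.
  apply: le_trans (ler_normD _ _) _; rewrite [leRHS]mulrDl; apply: lerD; rewrite normrM.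
    by rewrite (ger0_norm b0) -[leRHS]mulr1; apply: ler_pM.
  exact: ler_wpM2r.
- set T := (X in `|X|); have -> : T =
    (p.[b] - p.[a] - (deriv p).[a] * (b - a)) * b + (deriv p).[a] * (b - a) ^+ 2 by rewrite /T; ring.
  have s0 := sqr_ge0 (b - a).
  apply: (@le_trans _ _ ((C + C) * (b - a) ^+ 2)); last by rewrite ler_wpM2r// lerDl.
  apply: le_trans (ler_normD _ _) _; rewrite [leRHS]mulrDl; apply: lerD; rewrite normrM.
    by rewrite (ger0_norm b0) -[leRHS]mulr1; apply: ler_pM.
  by rewrite (ger0_norm s0); exact: ler_wpM2r.
Qed.

Lemma is_derive_second_order (f : R -> R) (a D C : R) :
  (forall b, `|f b - f a - D * (b - a)| <= C * (b - a) ^+ 2) -> is_derive a 1 f D.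
Proof.
move=> H; have C0 : 0 <= C.
  have := H (a + 1); rewrite [a + 1]addrC addrK expr1n !mulr1; apply: le_trans; exact: normr_ge0.
have L : h^-1 *: ((f \o shift a) (h *: 1) - f a) @[h --> 0^'] --> D.
  apply/cvgrPdist_le => e e0; near=> h.
  have h0 : h != 0 by near: h; exact: nbhs_dnbhs_neq.
  have hs : `|h| <= e / (C + 1).
    near: h; apply: dnbhs0_le; rewrite divr_gt0// ltr_wpDl//.
  have := H (h + a); rewrite addrK /shift /= [h *: 1]mulr1 => Hh.
  rewrite -[_ *: _]/(_ * _) distrC.
  have -> : h^-1 * (f (h + a) - f a) - D = h^-1 * (f (h + a) - f a - D * h).
    by rewrite [RHS]mulrBr [D * h]mulrC mulKf.
  rewrite normrM normfV mulrC ler_pdivrMr ?normr_gt0//; apply: le_trans Hh _.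
  rewrite -real_normK ?num_real// expr2 mulrA ler_wpM2r//.
  have C1 : 0 < C + 1 by rewrite ltr_wpDl.
  move: hs; rewrite ler_pdivlMr// => hs; apply: le_trans hs.
  by rewrite mulrC ler_wpM2l// lerDl.
have dv : derivable f a 1 by apply/cvg_ex; exists D.
by apply: DeriveDef => //; apply/cvg_lim.
Unshelve. all: by end_near. Qed.

Definition clamp (t : R) : R := Num.max 0 (Num.min 1 t).

Lemma clamp01 t : 0 <= clamp t <= 1.
Proof. by rewrite /clamp le_max lexx /= ge_max ler01 ge_min lexx. Qed.

Lemma clampE t : [\/ t <= 0 /\ clamp t = 0, 0 <= t <= 1 /\ clamp t = t | 1 <= t /\ clamp t = 1].
Proof.
rewrite /clamp; have [t0|t0] := leP t 0.
  constructor 1; split=> //; have [|_] := leP 1 t; first by lra.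
  by apply/max_idPl.
have [t1|t1] := leP 1 t; first by constructor 3; split => //; apply/max_idPr.
by constructor 2; split; [rewrite !ltW|apply/max_idPr; exact: ltW].
Qed.

Lemma clamp_lip a b : `|clamp b - clamp a| <= `|b - a|.
Proof.
have [[h1 ->]|[h1 ->]|[h1 ->]] := clampE a; have [[h2 ->]|[h2 ->]|[h2 ->]] := clampE b;
  rewrite ?subrr ?normr0//; have [l1 l2] := (ler_norm (b - a), ler_norm (- (b - a)));
  rewrite normrN in l2; rewrite ler_norml; apply/andP; split; lra.
Qed.

(** The kinks of [clamp] are harmless because the derivative of p vanishes there. Either clamping
    does not change the increment, or t is within |b - t| of a kink or beyond it, so that p' at the
    clamped point is O(|b - t|) and the error is quadratic. *)
Lemma is_derive_clamp (p : {poly R}) (t : R) : (deriv p).[0] = 0 -> (deriv p).[1] = 0 ->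
  is_derive t 1 (fun s => p.[clamp s]) ((deriv p).[clamp t]).
Proof.
move=> p0 p1; have [C C0 HC] := poly_on01 p; have [C' C'0 HC'] := poly_on01 (deriv p).
apply: (is_derive_second_order (C := C + (C' + C'))) => b.
have bt0 := sqr_ge0 (b - t).
have [_ _ _ T] := HC _ _ (clamp01 t) (clamp01 b).
have -> : p.[clamp b] - p.[clamp t] - (deriv p).[clamp t] * (b - t) =
   (p.[clamp b] - p.[clamp t] - (deriv p).[clamp t] * (clamp b - clamp t)) +
   (deriv p).[clamp t] * (clamp b - clamp t - (b - t)) by ring.
apply: le_trans (ler_normD _ _) _; rewrite [leRHS]mulrDl; apply: lerD.
  apply: le_trans T _; rewrite ler_wpM2l// -real_normK ?num_real// -[leRHS]real_normK ?num_real//.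
  by rewrite ler_pXn2r ?nnegrE//; exact: clamp_lip.
rewrite normrM; have B2 : `|clamp b - clamp t - (b - t)| <= 2 * `|b - t|.
  apply: le_trans (ler_normB _ _) _; rewrite mulr2n mulrDl mul1r lerD2r; exact: clamp_lip.
have B1 : clamp b - clamp t - (b - t) = 0 \/ `|(deriv p).[clamp t]| <= C' * `|b - t|.
  have near01 (e : R) : 0 <= e <= 1 -> (deriv p).[e] = 0 -> `|e - clamp t| <= `|b - t| ->
      `|(deriv p).[clamp t]| <= C' * `|b - t|.
    move=> e01 e0 et; have [_ _ h _] := HC' _ _ (clamp01 t) e01.
    by move: h; rewrite e0 sub0r normrN => h; apply: le_trans h _; exact: ler_wpM2l.
  have z01 : 0 <= (0 : R) <= 1 by rewrite lexx ler01.
  have o01 : 0 <= (1 : R) <= 1 by rewrite lexx ler01.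
  have [[h1 E]|[h1 E]|[h1 E]] := clampE t.
  - by right; apply: (near01 0) => //; rewrite E subrr normr0.
  - have [[h2 E2]|[h2 E2]|[h2 E2]] := clampE b.
    + right; apply: (near01 0) => //; rewrite E sub0r normrN distrC !ger0_norm; lra.
    + by left; rewrite E E2 subrr.
    + right; apply: (near01 1) => //; rewrite E !ger0_norm; lra.
  - by right; apply: (near01 1) => //; rewrite E subrr normr0.
case: B1 => [->|B1]; first by rewrite normr0 mulr0 mulr_ge0// addr_ge0.
apply: (@le_trans _ _ ((C' * `|b - t|) * (2 * `|b - t|))); first by apply: ler_pM.
rewrite -[(b - t) ^+ 2]real_normK ?num_real// le_eqVlt; apply/orP; left; apply/eqP; ring.
Qed.

(* The polynomial with pstep' = 140 t ^ 3 (1 - t) ^ 3: three derivatives vanish at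
   0 and 1, so clamping the argument keeps it of class C^3. *)
Definition pstep : {poly R} := 'X^4 *+ 35 - 'X^5 *+ 84 + 'X^6 *+ 70 - 'X^7 *+ 20.

Definition step (m : nat) (t : R) : R := (derivn m pstep).[clamp t].

Let A : {poly R} := 'X * (1 - 'X).

Lemma deriv_pstep : deriv pstep = A ^+ 3 *+ 140.
Proof. by rewrite /pstep /A !poly.derivE; ring. Qed.

Lemma pstep_end m : (m < 3)%N -> (derivn m.+1 pstep).[0] = 0 /\ (derivn m.+1 pstep).[1] = 0.
Proof.
have A0 : A.[0] = 0 by rewrite /A hornerM hornerX mul0r.
have A1 : A.[1] = 0 by rewrite /A hornerM hornerD hornerN hornerX hornerC subrr mulr0.
move: A0 A1 deriv_pstep; move: A => B B0 B1 E1.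
have E2 : deriv (deriv pstep) = (deriv B * B ^+ 2) *+ 3 *+ 140.
  by rewrite E1 derivMn deriv_exp mulrC.
have E3 : deriv (deriv (deriv pstep)) =
    (deriv (deriv B) * B ^+ 2 + deriv B * (deriv B * B *+ 2)) *+ 3 *+ 140.
  by rewrite E2 !derivMn derivM deriv_exp expr1.
have Z (q : {poly R}) k t : q.[t] = 0 -> (q *+ k).[t] = 0 by rewrite hornerMn => ->; rewrite mul0rn.
have Bn (t : R) : B.[t] = 0 -> (B ^+ 2).[t] = 0 /\ (B ^+ 3).[t] = 0.
  by move=> Bt; rewrite !horner_exp Bt !expr0n.
have V (t : R) : B.[t] = 0 -> [/\ (deriv pstep).[t] = 0, (deriv (deriv pstep)).[t] = 0 &
    (deriv (deriv (deriv pstep))).[t] = 0].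
  move=> Bt; have [b2 b3] := Bn t Bt; split; [rewrite E1|rewrite E2|rewrite E3].
  - exact: Z.
  - apply: (Z _ 140%N); apply: (Z _ 3%N).
    by rewrite hornerM b2 mulr0.
  - apply: (Z _ 140%N); apply: (Z _ 3%N); rewrite hornerD hornerM b2 mulr0 add0r hornerM (Z _ 2%N) ?mulr0//.
    by rewrite hornerM Bt mulr0.
have [V0 V0' V0''] := V 0 B0; have [V1 V1' V1''] := V 1 B1.
by case: m => [|[|[|m]]].
Qed.

Lemma is_derive_step m (t : R) : (m < 3)%N -> is_derive t 1 (step m) (step m.+1 t).
Proof.
by move=> m3; have [p0 p1] := pstep_end m3; rewrite /step derivnS; apply: is_derive_clamp; rewrite -derivnS.
Qed.

Lemma step_lip m : exists2 C : R, 0 <= C & forall a b, `|step m b - step m a| <= C * `|b - a|.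
Proof.
have [C C0 H] := poly_on01 (derivn m pstep); exists C => // a b.
have [_ _ h _] := H _ _ (clamp01 a) (clamp01 b).
by apply: le_trans h _; rewrite ler_wpM2l//; exact: clamp_lip.
Qed.

Lemma step0_le0 t : t <= 0 -> step 0 t = 0.
Proof.
have P0 : pstep.[0] = 0.
  have X0 n : ('X^(n.+1) : {poly R}).[0] = 0 by rewrite hornerXn exprS mul0r.
  by rewrite /pstep [LHS]hornerD [X in X + _]hornerD [X in X + _ + _]hornerD !hornerN !hornerMn !X0 !mul0rn subr0 addr0 subr0.
move=> t0; rewrite /step derivn0; have [[_ ->]|[h ->]|[h _]] := clampE t; [by []| |by lra].
by have -> : t = 0 by apply/eqP; rewrite eq_le t0; case/andP: h.
Qed.

Lemma step0_ge1 t : 1 <= t -> step 0 t = 1.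
Proof.
have P1 : pstep.[1] = 1 by rewrite /pstep [LHS]hornerD [X in X + _]hornerD [X in X + _ + _]hornerD !hornerN !hornerMn !hornerXn !expr1n; ring.
move=> t1; rewrite /step derivn0; have [[h _]|[h ->]|[h ->]] := clampE t; [by lra| |by []].
by have -> : t = 1 by apply/eqP; rewrite eq_le t1 andbT; case/andP: h.
Qed.

Lemma step0_homo a b : a <= b -> step 0 a <= step 0 b.
Proof.
rewrite le_eqVlt => /predU1P[->//|ab].
have ds (t : R) : is_derive t 1 (step 0) (step 1 t) by exact: is_derive_step.
have cs : {within `[a, b], continuous (step 0)}.
  apply: continuous_in_subspaceT => t _; have [dt _] := ds t.
  exact/differentiable_continuous/derivable1_diffP.
have [t _ E] := MVT ab (fun t _ => ds t) cs.
rewrite -subr_ge0 E mulr_ge0 ?subr_ge0 ?(ltW ab)// /step derivnS derivn0 deriv_pstep.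
have /andP[c0 c1] := clamp01 t.
by rewrite hornerMn mulrn_wge0// horner_exp exprn_ge0// /A !hornerE mulr_ge0// subr_ge0.
Qed.

End smooth_step.

Section kernel1d.
Context {R : realType}.
Implicit Types (eps h s t : R).

(* For m = 0 a difference of steps, hence telescoping along h Z into an exact
   partition of unity; in general its m-th derivative, of size O(h). *)
Definition kern eps h (m : nat) s : R := eps^-1 ^+ m * (step m (s / eps) - step m ((s - h) / eps)).

Lemma is_derive_kern eps h m s : (m < 3)%N -> is_derive s 1 (kern eps h m) (kern eps h m.+1 s).
Proof.
move=> m3; have D b : is_derive s 1 (fun t => step m ((t - b) / eps)) (eps^-1 * step m.+1 ((s - b) / eps)).
  have d1 : is_derive s 1 (fun t : R => (t - b) / eps) eps^-1.
    have : is_derive s 1 (fun t : R => eps^-1 * (t - b)) eps^-1.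
      by apply: is_derive_eq; rewrite -![_ *: _]/(_ * _) subr0 mulr1.
    by congr is_derive; apply/funext => t; rewrite mulrC.
  have d2 := is_derive_step ((s - b) / eps) m3.
  have := @is_derive1_comp R (step m) (fun t : R => (t - b) / eps) s _ _ d2 d1.
  by rewrite mulrC.
have D0 := D 0; have Dh := D h.
have DB : is_derive s 1 (fun t => step m ((t - 0) / eps) - step m ((t - h) / eps))
  (eps^-1 * step m.+1 ((s - 0) / eps) - eps^-1 * step m.+1 ((s - h) / eps)).
  by apply: (@is_deriveB _ _ _ (fun t => step m ((t - 0) / eps)) (fun t => step m ((t - h) / eps))).
have DZ : is_derive s 1 (fun t => eps^-1 ^+ m * (step m ((t - 0) / eps) - step m ((t - h) / eps)))
  (eps^-1 ^+ m * (eps^-1 * step m.+1 ((s - 0) / eps) - eps^-1 * step m.+1 ((s - h) / eps))).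
  by apply: (@is_deriveZ _ _ _ (fun t => step m ((t - 0) / eps) - step m ((t - h) / eps))).
move: DZ; congr is_derive; first by apply/funext => t; rewrite /kern subr0.
by rewrite /kern subr0 exprSr; ring.
Qed.

(** The two steps are evaluated at points h / eps apart and are Lipschitz. The factor h offsets the
    number of lattice points in [mollified_bound], so smoothed functions have bounds depending on
    eps but not on the mesh. *)
Lemma kern_bound eps : 0 < eps -> exists2 C : R, 0 <= C & forall h m s, 0 < h -> (m < 4)%N ->
  `|kern eps h m s| <= C * h.
Proof.
move=> e0; have /choice[Cs HC] : forall m : nat, exists C : R, 0 <= C /\
    forall a b : R, `|step m b - step m a| <= C * `|b - a|.
  by move=> m; have [C C0 H] := @step_lip R m; exists C.
pose F (m : nat) := eps^-1 ^+ m * (Cs m * eps^-1).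
have ei : 0 <= eps^-1 by rewrite invr_ge0 ltW.
have F0 m : 0 <= F m by rewrite mulr_ge0 ?exprn_ge0// mulr_ge0// (HC m).1.
exists (\sum_(m < 4) F m) => [|h m s h0 m4]; first exact: sumr_ge0.
apply: (@le_trans _ _ (F m * h)).
  rewrite /kern normrM ger0_norm ?exprn_ge0// /F -mulrA ler_wpM2l ?exprn_ge0//.
  apply: le_trans ((HC m).2 _ _) _; rewrite -mulrA ler_wpM2l ?(HC m).1//.
  rewrite -mulrBl opprB addrC subrK mulrC ger0_norm//; apply: mulr_ge0 => //; exact: ltW.
rewrite ler_pM2r// (bigD1 (Ordinal m4))//= lerDl; exact: sumr_ge0.
Qed.

Lemma kern0E eps h s : kern eps h 0 s = step 0 (s / eps) - step 0 ((s - h) / eps).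
Proof. by rewrite /kern expr0 mul1r. Qed.

Lemma kern0_ge0 eps h s : 0 < eps -> 0 < h -> 0 <= kern eps h 0 s.
Proof.
move=> e0 h0; rewrite kern0E subr_ge0; apply: step0_homo.
by rewrite ler_pM2r ?invr_gt0// gerBl ltW.
Qed.

Lemma kern0_supp eps h s : 0 < eps -> 0 < h -> kern eps h 0 s != 0 -> `|s| <= eps + h.
Proof.
move=> e0 h0; apply: contraNT; rewrite -ltNge kern0E => sb.
have [s0|s0] := leP s 0.
  rewrite !step0_le0 ?subrr//; first by rewrite pmulr_lle0 ?invr_gt0// subr_le0 (le_trans s0)// ltW.
  by rewrite pmulr_lle0 ?invr_gt0.
move: sb; rewrite gtr0_norm// => sb.
have s2 : eps <= s - h by rewrite lerBrDr ltW.
rewrite !step0_ge1 ?subrr// ler_pdivlMr// mul1r//.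
by apply: le_trans s2 _; rewrite gerBl ltW.
Qed.

Lemma sum_kern0 eps h (N : nat) s :
  \sum_(k < N.*2.+1) kern eps h 0 (s - (k%:R - N%:R) * h) =
  step 0 ((s + N%:R * h) / eps) - step 0 ((s - N.+1%:R * h) / eps).
Proof.
pose g (k : nat) : R := - step 0 ((s - (k%:R - N%:R) * h) / eps).
rewrite -(big_mkord xpredT (fun k : nat => kern eps h 0 (s - (k%:R - N%:R) * h))).
rewrite (eq_bigr (fun k => g k.+1 - g k)); last first.
  move=> k _; rewrite kern0E /g opprK [RHS]addrC; congr (_ - step 0 (_ / _)).
  by rewrite -natr1; ring.
rewrite telescope_sumr// /g opprK [LHS]addrC sub0r mulNr opprK; congr (_ - step 0 (_ / _)).
by rewrite -addnn -!natr1 natrD; ring.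
Qed.

Lemma sum_kern0_le1 eps h (N : nat) s : 0 < eps -> 0 < h ->
  \sum_(k < N.*2.+1) kern eps h 0 (s - (k%:R - N%:R) * h) <= 1.
Proof.
move=> e0 h0; rewrite sum_kern0; have st t : 0 <= step 0 t <= 1.
  apply/andP; split.
    have [t0|t0] := leP t 0; first by rewrite step0_le0.
    by rewrite -(@step0_le0 R 0)//; apply: step0_homo; exact: ltW.
  have [t1|t1] := leP 1 t; first by rewrite step0_ge1.
  by rewrite -(@step0_ge1 R 1)//; apply: step0_homo; exact: ltW.
have /andP[_ a1] := st ((s + N%:R * h) / eps).
have /andP[a2 _] := st ((s - N.+1%:R * h) / eps).
by rewrite lerBlDr; apply: le_trans a1 _; rewrite lerDl.
Qed.

Lemma sum_kern0_1 eps h (N : nat) s : 0 < eps -> 0 < h -> `|s| + eps <= N%:R * h ->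
  \sum_(k < N.*2.+1) kern eps h 0 (s - (k%:R - N%:R) * h) = 1.
Proof.
move=> e0 h0 sN; have [l1 l2] := (ler_norm s, ler_norm (- s)); rewrite normrN in l2.
rewrite sum_kern0 step0_ge1; last by rewrite ler_pdivlMr// mul1r; lra.
rewrite step0_le0 ?subr0// pmulr_lle0 ?invr_gt0// -natr1 mulrDl mul1r; lra.
Qed.

End kernel1d.

Section kernel.
Context {R : realType} {d : nat}.
Local Notation vec := 'rV[R]_d.
Local Notation e_ := (@unitv R d).
Implicit Types (x y z p q : vec) (a : 'I_d -> nat).

(** The tensor-product kernel; a is the multi-index of derivatives taken, so one family covers the
    weight and all its partial derivatives. *)
Definition wa (eps h : R) a z : R := \prod_l kern eps h (a l) (z ord0 l).

Definition incr (i : 'I_d) a : 'I_d -> nat := fun l => (a l + (l == i))%N.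

Lemma is_derive_wa (eps h : R) a i z : (a i < 3)%N ->
  is_derive z (e_ i) (wa eps h a) (wa eps h (incr i a) z).
Proof.
move=> ai; apply: is_derive_line0.
have E a' s : wa eps h a' (z + s *: e_ i) =
    kern eps h (a' i) (z ord0 i + s) * \prod_(l | l != i) kern eps h (a' l) (z ord0 l).
  rewrite /wa (bigD1 i)//=; congr (_ * _).
    by rewrite !mxE !eqxx mulr1.
  by apply: eq_bigr => l li; rewrite !mxE (negbTE li) andbF mulr0 addr0.
have -> : (fun s => wa eps h a (z + s *: e_ i)) =
    (\prod_(l | l != i) kern eps h (a l) (z ord0 l)) *: (kern eps h (a i) \o (fun s : R => z ord0 i + s)).
  by apply/funext => s; rewrite E mulrC.
have d1 : is_derive (0 : R) 1 (fun s : R => z ord0 i + s) 1.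
  by apply: (is_derive_second_order (C := 0)) => b; rewrite mul0r le_eqVlt; apply/orP; left; rewrite normr_eq0; apply/eqP; ring.
have d2 := @is_derive_kern R eps h (a i) (z ord0 i + 0) ai.
have d3 := @is_derive1_comp R (kern eps h (a i)) (fun s : R => z ord0 i + s) 0 _ _ d2 d1.
apply: is_derive_eq; rewrite -[LHS]/(_ * _) -[z in RHS](addr0 z) -(scale0r (e_ i)) E /incr eqxx addn1 mulr1 [RHS]mulrC.
by congr (_ * _); apply: eq_bigr => l /negbTE ->; rewrite addn0.
Qed.

Lemma continuous_kern (eps h : R) m : continuous (kern eps h m).
Proof.
have cs : continuous (step m : R -> R).
  have [C C0 H] := @step_lip R m.
  move=> t; apply/cvgrPdist_le => e e0.
  have C1 : 0 < C + 1 by rewrite ltr_wpDl.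
  have eC : 0 < e / (C + 1) by rewrite divr_gt0.
  exists (e / (C + 1)) => //= s /ltW ts; rewrite distrC; apply: le_trans (H _ _) _.
  apply: (@le_trans _ _ ((C + 1) * `|s - t|)); first by rewrite ler_wpM2r// lerDl.
  by rewrite mulrC -ler_pdivlMr// distrC.
have cb b : continuous (fun t : R => step m ((t - b) / eps)).
  have c1 : continuous (fun t : R => t - b).
    by apply: (@continuousBf _ R (fun t => t) (fun=> b)); [move=> t; exact: cvg_id|exact: continuous_cstf].
  have c2 : continuous (fun t : R => (t - b) / eps).
    by apply: (@continuousMf _ R (fun t => t - b) (fun=> eps^-1)); [exact: c1|exact: continuous_cstf].
  exact: (continuous_compf c2 cs).
apply: (@continuousMf _ R (fun=> eps^-1 ^+ m)
  (fun t => step m (t / eps) - step m ((t - h) / eps))); first exact: continuous_cstf.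
apply: (@continuousBf _ R (fun t => step m (t / eps))); last exact: cb.
by rewrite (_ : (fun t => _) = fun t => step m ((t - 0) / eps)) //; apply/funext => t; rewrite subr0.
Qed.

Lemma continuous_wa (eps h : R) a : continuous (wa eps h a).
Proof.
rewrite /wa; elim: (index_enum _) => [|l s IH].
  by rewrite (_ : (fun z => _) = fun=> 1); [exact: continuous_cstf|apply/funext => z; rewrite big_nil].
rewrite (_ : (fun z => _) = fun z => kern eps h (a l) (z ord0 l) *
  \prod_(l <- s) kern eps h (a l) (z ord0 l)); last by apply/funext => z; rewrite big_cons.
apply: continuousMf => //; apply: (@continuous_compf _ _ (fun z : vec => z ord0 l) (kern eps h (a l))); [exact: continuous_coord|exact: continuous_kern].
Qed.

Lemma wa_bound (eps h : R) a z (B : R) : (forall m s, (m < 4)%N -> `|kern eps h m s| <= B) ->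
  (forall l, (a l < 4)%N) -> `|wa eps h a z| <= B ^+ d.
Proof.
move=> HB a4; rewrite /wa normr_prod -[X in _ ^+ X]card_ord -prodr_const.
by apply: ler_prod => l _; rewrite normr_ge0 HB.
Qed.

Local Notation zero := ((fun=> 0%N) : 'I_d -> nat).

Lemma w0_ge0 (eps h : R) z : 0 < eps -> 0 < h -> 0 <= wa eps h zero z.
Proof. by move=> e0 h0; apply: prodr_ge0 => l _; exact: kern0_ge0. Qed.

Lemma w0_supp (eps h : R) z : 0 < eps -> 0 < h -> wa eps h zero z != 0 -> `|z| <= eps + h.
Proof.
move=> e0 h0; rewrite prodf_seq_neq0 => /allP H; apply: mx_norm_le => [|l].
  by rewrite addr_ge0// ltW.
apply: (kern0_supp e0 h0); exact: (H l (mem_index_enum _)).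
Qed.

Lemma sum_w0 (eps h : R) (N : nat) z :
  \sum_(f : {ffun 'I_d -> 'I_(N.*2.+1)}) wa eps h zero (z - cellpt h f) =
  \prod_l \sum_(k < N.*2.+1) kern eps h 0 (z ord0 l - (k%:R - N%:R) * h).
Proof.
rewrite bigA_distr_bigA /=; apply: eq_bigr => f _; apply: eq_bigr => l _.
by rewrite !mxE.
Qed.

Lemma sum_w0_le1 (eps h : R) (N : nat) z : 0 < eps -> 0 < h ->
  \sum_(f : {ffun 'I_d -> 'I_(N.*2.+1)}) wa eps h zero (z - cellpt h f) <= 1.
Proof.
move=> e0 h0; rewrite sum_w0; apply: prodr_ile1 => l _.
by rewrite sum_kern0_le1// sumr_ge0// => k _; exact: kern0_ge0.
Qed.

Lemma sum_w0_1 (eps h : R) (N : nat) z : 0 < eps -> 0 < h -> `|z| + eps <= N%:R * h ->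
  \sum_(f : {ffun 'I_d -> 'I_(N.*2.+1)}) wa eps h zero (z - cellpt h f) = 1.
Proof.
move=> e0 h0 zN; rewrite sum_w0 big1// => l _; apply: sum_kern0_1 => //.
by apply: le_trans zN; rewrite lerD2r coord_le_norm.
Qed.

End kernel.

Section lists.
Context {R : realType} {T : eqType}.

Lemma sum_subseq (s t : seq T) (F : T -> R) : uniq s -> uniq t -> {subset s <= t} ->
  (forall x, x \in t -> x \notin s -> F x = 0) -> \sum_(x <- s) F x = \sum_(x <- t) F x.
Proof.
move=> us ut st F0; rewrite [RHS](bigID (mem s))/= [X in _ + X]big1_seq ?addr0.
  rewrite -[RHS]big_filter; apply: perm_big; apply: uniq_perm => //; first exact: filter_uniq.
  move=> x; rewrite mem_filter; apply/idP/andP => [xs|[]//]; split => //; exact: st.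
by move=> x /andP[xs xt]; exact: F0.
Qed.

End lists.

Section smoothing.
Context {R : realType} {d : nat}.
Local Notation vec := 'rV[R]_d.
Local Notation e_ := (@unitv R d).
Local Notation zero := ((fun=> 0%N) : 'I_d -> nat).
Implicit Types (x y z p q v : vec) (a : 'I_d -> nat).

Lemma is_derive_bigsum (I : Type) (s : seq I) (F D : I -> vec -> R) z v :
  (forall k, is_derive z v (F k) (D k z)) ->
  is_derive z v (fun x => \sum_(k <- s) F k x) (\sum_(k <- s) D k z).
Proof.
move=> H; elim: s => [|k s IH].
  rewrite big_nil (_ : (fun x => _) = fun=> 0); last by apply/funext => x; rewrite big_nil.
  exact: is_derive_cst.
rewrite big_cons (_ : (fun x => _) = fun x => F k x + \sum_(l <- s) F l x); last first.
  by apply/funext => x; rewrite big_cons.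
by apply: (@is_deriveD _ _ _ (F k)).
Qed.

Variables (eps h : R) (N : nat) (psi : vec -> R).
Hypotheses (eps0 : 0 < eps) (h0 : 0 < h).
Local Notation cells := {ffun 'I_d -> 'I_(N.*2.+1)}.

Definition mollified a z : R := \sum_(f : cells) psi (cellpt h f) * wa eps h a (z - cellpt h f).

Lemma is_derive_mollified a i z : (a i < 3)%N -> is_derive z (e_ i) (mollified a) (mollified (incr i a) z).
Proof.
move=> ai; apply: (@is_derive_bigsum _ _ (fun (f : cells) x => psi (cellpt h f) * wa eps h a (x - cellpt h f))
  (fun (f : cells) x => psi (cellpt h f) * wa eps h (incr i a) (x - cellpt h f))) => f.
apply: (@is_deriveZ _ _ _ (fun x => wa eps h a (x - cellpt h f))).
apply: is_derive_line0.
have := is_derive_wa eps h (z - cellpt h f) ai.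
rewrite -{1}[z - _]addr0 -(scale0r (e_ i)) => /is_derive_line; congr is_derive.
by apply/funext => s; rewrite addrAC.
Qed.

Lemma continuous_mollified a : continuous (mollified a).
Proof.
apply: continuous_sumf => f; apply: continuousMf; first exact: continuous_cstf.
have cs : continuous (fun z : vec => z - cellpt h f).
  by move=> z; apply: continuousB; [exact: cvg_id|exact: cst_continuous].
by move=> z; apply: continuous_comp; [exact: cs|exact: continuous_wa].
Qed.

Lemma incr_le i a (m : nat) : (forall l, (a l <= m)%N) -> forall l, (incr i a l <= m.+1)%N.
Proof. by move=> am l; rewrite /incr -addn1 leq_add// leq_b1. Qed.

Lemma jet2_mollified : jet2 setT (mollified zero) (fun i => mollified (incr i zero)) (fun i k => mollified (incr k (incr i zero))).
Proof.
split => [x _|i x _|i x _|i k x _|i k x _]; try exact: continuous_mollified.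
  exact: is_derive_mollified.
by apply: is_derive_mollified; rewrite ltnS; apply: leq_trans (_ : 1 <= 2)%N; first exact: incr_le.
Qed.

Lemma mollified_bound a (C : R) z : (forall p, `|psi p| <= 1) ->
  (forall m s, (m < 4)%N -> `|kern eps h m s| <= C * h) -> (forall l, (a l < 4)%N) ->
  `|mollified a z| <= (N.*2.+1%:R * (C * h)) ^+ d.
Proof.
move=> p1 HC a4; apply: le_trans (ler_norm_sum _ _ _) _.
apply: (@le_trans _ _ (\sum_(f : cells) (C * h) ^+ d)).
  apply: ler_sum => f _; rewrite normrM -[leRHS]mul1r; apply: ler_pM => //; exact: wa_bound.
by rewrite sumr_const card_ffun !card_ord [leRHS]exprMn -natrX mulr_natl.
Qed.

(** Bounds on the derivatives up to order three yield every clause of [reg]: the Lipschitz clause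
    needs d, the Taylor clause d^2, and the second differences a factor 2 covered by the 3. *)
Lemma mollified_reg (B : R) x : 0 <= B -> (forall a z, (forall l, (a l < 4)%N) -> `|mollified a z| <= B) ->
  reg (mollified zero) x (\row_i mollified (incr i zero) x) (fun i => mollified (incr i (incr i zero)) x)
    (B * (d%:R * d%:R + d%:R + 3)) 1.
Proof.
move=> B0 HB; set M := B * _.
have i1 i l : (incr i zero l <= 1)%N by exact: incr_le.
have i2 i k l : (incr k (incr i zero) l <= 2)%N by exact: incr_le.
have i3 i k m l : (incr m (incr k (incr i zero)) l <= 3)%N by exact: incr_le.
have dd0 : 0 <= (d%:R * d%:R : R) by rewrite mulr_ge0.
have d0 : 0 <= (d%:R : R) by [].
have BM (t : R) : t <= d%:R * d%:R + d%:R + 3 -> B * t <= M by move=> tM; exact: ler_wpM2l.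
have j2 := jet2_mollified.
split.
- by apply: mrV_continuous; exact: continuous_mollified.
- move=> y; apply: le_trans (HB _ _ _) _ => //; rewrite -[leLHS]mulr1; apply: BM.
  by apply: (@le_trans _ _ 3); rewrite ?ler1n// lerDr addr_ge0.
- move=> y z; apply: le_trans (lip_of_partials (f1 := fun i => mollified (incr i zero)) B0 _ _ y z) _.
  + by move=> i p; exact: is_derive_mollified.
  + by move=> i p; apply: HB => l; exact: leq_ltn_trans (i1 i l) _.
  + rewrite ler_wpM2r ?enorm_ge0// mulrC; apply: BM; rewrite -addrA addrCA lerDl addr_ge0//.
- move=> y y1; apply: le_trans (taylor2 (U := setT) (rho := 1) (K := B) j2 _ _ _) _ => //.
  + by move=> i k z _; apply: HB => l; exact: leq_ltn_trans (i2 i k l) _.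
  + exact: le_trans (norm_le_enorm _) y1.
  + rewrite ler_wpM2r ?sqr_ge0// mulrC; apply: BM; rewrite -addrA lerDl addr_ge0//.
- move=> i t t0 t1; apply: le_trans (second_diff (f1 := mollified (incr i zero)) (K := B) t0 B0 _ _ _) _.
  + by move=> s _; exact: is_derive_mollified.
  + by move=> s _; apply: is_derive_mollified; exact: leq_ltn_trans (i1 i i) _.
  + move=> s _; have [s' _ ->] := @mvt_line _ _ (mollified (incr i (incr i zero))) (e_ i)
      (mollified (incr i (incr i (incr i zero)))) x s
      (fun s _ => @is_derive_mollified _ i _ (leq_ltn_trans (i2 i i i) (isT : (2 < 3)%N))).
    rewrite normrM mulrC ler_wpM2r//; apply: HB => l; exact: leq_ltn_trans (i3 i i i l) _.
  + rewrite ler_wpM2r ?exprn_ge0 ?(ltW t0)// mulrC; apply: BM.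
    by apply: (@le_trans _ _ 3); rewrite ?ler_nat// lerDr addr_ge0.
Qed.

(** The weights sum to 1 well inside the box and to at most 1 everywhere. Where mass may be lost,
    the value H to be approximated has to be 0. *)
Lemma mollified_approx (G : vec -> R) (H tau : R) x : 0 <= tau ->
  (forall f : cells, wa eps h zero (x - cellpt h f) != 0 -> `|G (cellpt h f) - H| <= tau) ->
  H = 0 \/ `|x| + eps <= N%:R * h ->
  `|\sum_(f : cells) G (cellpt h f) * wa eps h zero (x - cellpt h f) - H| <= tau.
Proof.
move=> t0 GH HN; pose w (f : cells) := wa eps h zero (x - cellpt h f).
have w0 (f : cells) : 0 <= w f by exact: w0_ge0.
have HE : H = \sum_(f : cells) H * w f.
  rewrite -mulr_sumr; case: HN => [->|xN]; first by rewrite mul0r.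
  by rewrite sum_w0_1// mulr1.
rewrite {1}HE -sumrB; apply: le_trans (ler_norm_sum _ _ _) _.
apply: (@le_trans _ _ (\sum_(f : cells) tau * w f)); last first.
  by rewrite -mulr_sumr -[leRHS]mulr1 ler_wpM2l// sum_w0_le1.
apply: ler_sum => f _; rewrite -mulrBl normrM (ger0_norm (w0 f)) -/(w f).
have [->|wn] := eqVneq (w f) 0; first by rewrite !mulr0.
by rewrite ler_wpM2r// GH.
Qed.

(* Smoothing commutes with the scheme, as both are translation invariant on the
   lattice. *)
Lemma mollified_Lh (S : seq (R * vec)) x : (forall b : R * vec, b \in S -> lat h b.2) ->
  (forall p, lat h p -> (forall f : cells, p <> cellpt h f) -> psi p = 0) ->
  `|x| + eps + h <= N%:R * h ->
  Lh h S (mollified zero) x = \sum_(f : cells) Lh h S psi (cellpt h f) * wa eps h zero (x - cellpt h f).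
Proof.
move=> S0 psi0 xN.
pose w q := wa eps h zero (x - q).
pose L := [seq cellpt h f | f <- index_enum cells].
have inL (f : cells) : cellpt h f \in L by apply: map_f; exact: mem_index_enum.
have uL : uniq L.
  rewrite map_inj_uniq ?index_enum_uniq// => f g fg.
  have H : cell h f (cellpt h f).
    by apply/forallP => i; rewrite lexx ltrDl.
  by apply: (cell_inj h0 H); rewrite fg; apply/forallP => i; rewrite lexx ltrDl.
have LE (F : vec -> R) : \sum_(f : cells) F (cellpt h f) = \sum_(p <- L) F p by rewrite big_map.
pose V := 0 :: [seq h *: e_ i | i <- index_enum 'I_d] ++
  [seq - (h *: e_ i) | i <- index_enum 'I_d] ++ [seq b.2 | b <- S].
have latV v : v \in V -> lat h v.
  rewrite in_cons !mem_cat => /orP[/eqP->|/or3P[/mapP[i _ ->]|/mapP[i _ ->]|/mapP[b bS ->]]].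
  - exact: lat0.
  - exact: lat_unit1.
  - by apply: latN; exact: lat_unit1.
  - exact: S0.
(* A common finite list holding the translates of the grid by all shifts of the scheme. After
   substitution every shifted smoothing is a sum over T with the same weights [w q], and the
   commutation holds termwise. *)
pose T := undup [seq p - v | v <- V, p <- L].
have latT q : q \in T -> lat h q.
  rewrite mem_undup => /allpairsP[[v p]/= [vV /mapP[f _ ->] ->]].
  by apply: latB; [exact: cellpt_lat|exact: latV].
have g v : v \in V -> mollified zero (x + v) = \sum_(q <- T) psi (q + v) * w q.
  move=> vV; rewrite /mollified (LE (fun p => psi p * wa eps h zero (x + v - p))).
  transitivity (\sum_(q <- [seq p - v | p <- L]) psi (q + v) * w q).
    rewrite [RHS]big_map; apply: eq_bigr => p _; rewrite subrK /w opprB; congr (_ * wa _ _ _ _).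
    by rewrite addrA.
  apply: sum_subseq; [|exact: undup_uniq| |].
  - by rewrite map_inj_uniq// => p q; exact: addIr.
  - move=> q /mapP[p pL ->]; rewrite mem_undup; exact: allpairs_f.
  - move=> q qT qn; rewrite psi0 ?mul0r//; first by apply: latD; [exact: latT|exact: latV].
    move=> f qf; case/negP: qn; apply/mapP; exists (q + v); last by rewrite addrK.
    by rewrite qf.
have V0 : 0 \in V by rewrite mem_head.
have g0 : mollified zero x = \sum_(q <- T) psi q * w q.
  by rewrite -[x]addr0 g//; apply: eq_bigr => q _; rewrite addr0.
have Vi i : h *: e_ i \in V.
  have m : h *: e_ i \in [seq h *: e_ k | k <- index_enum 'I_d].
    by apply: (map_f (fun k => h *: e_ k)); exact: mem_index_enum.
  by rewrite in_cons !mem_cat m ?orbT.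
have Vi' i : - (h *: e_ i) \in V.
  have m : - (h *: e_ i) \in [seq - (h *: e_ k) | k <- index_enum 'I_d].
    by apply: (map_f (fun k => - (h *: e_ k))); exact: mem_index_enum.
  by rewrite in_cons !mem_cat m ?orbT.
have VS (b : R * vec) : b \in S -> b.2 \in V.
  by move=> bS; rewrite in_cons !mem_cat (map_f snd bS) ?orbT.
rewrite (LE (fun q => Lh h S psi q * w q)).
transitivity (\sum_(q <- T) Lh h S psi q * w q); last first.
  apply/esym; apply: sum_subseq => //; first exact: undup_uniq.
    by move=> p pL; rewrite mem_undup; apply/allpairsP; exists (0, p); rewrite subr0.
  move=> q qT qn; have [->|wn] := eqVneq (w q) 0; first by rewrite mulr0.
  have qx := w0_supp eps0 h0 wn.
  have qN : `|q| <= N%:R * h.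
    rewrite -[q](subKr x); apply: le_trans (ler_normB _ _) _; apply: le_trans xN.
    by rewrite -addrA lerD2l.
  have [f qf] := lat_cellpt h0 (latT q qT) qN.
  by case/negP: qn; rewrite qf.
under [RHS]eq_bigr do rewrite /Lh mulrDl.
rewrite big_split /=; congr (_ + _).
  under [RHS]eq_bigr do rewrite /dop mulr_suml.
  rewrite exchange_big /dop; apply: eq_bigr => i _ /=.
  rewrite !g// g0 mulr_sumr -big_split/= -sumrB mulr_suml; apply: eq_bigr => q _; ring.
under [RHS]eq_bigr do rewrite /sop mulr_suml.
rewrite exchange_big /sop big_seq [RHS]big_seq; apply: eq_bigr => b bS /=.
rewrite g ?VS// g0 -sumrB mulr_sumr; apply: eq_bigr => q _; ring.
Qed.

End smoothing.

(** * Passage to the limit *)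
Section limit.
Context {R : realType} {d : nat}.
Local Notation vec := 'rV[R]_d.
Local Notation e_ := (@unitv R d).
Implicit Types (x y z p q : vec).

Lemma lat_near (h : R) x : 0 < h -> exists p, lat h p /\ `|p - x| <= h.
Proof.
move=> h0; pose N := (Num.truncn (`|x| / h)).+1.
have xN i : `|x ord0 i| <= N%:R * h.
  apply: le_trans (coord_le_norm _ _) _; rewrite -ler_pdivrMr//; apply: ltW; exact: truncnS_gt.
have [f /forallP Hf] := cell_ex h0 xN; exists (cellpt h f); split; first exact: cellpt_lat.
apply: mx_norm_le => [|i]; first exact: ltW.
have /andP[h1 h2] := Hf i; move: h1 h2; rewrite !mxE; set u := _ * h => h1 h2.
by rewrite ler_norml; apply/andP; split; lra.
Qed.

Lemma limU_le (U : set_system nat) (u : nat -> R) (l k : R) (A : set nat) : ProperFilter U ->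
  u n @[n --> U] --> l -> U A -> (forall n, A n -> u n <= k) -> l <= k.
Proof.
move=> UU ul UA uk; apply: le_addgt0 => e e0.
have Ue : U [set n | `|l - u n| <= e] by move/cvgrPdist_le: ul => /(_ e e0).
have [n [/= h1 An]] := @filter_ex _ U UU _ (filterI Ue UA).
have := uk n An; move: h1; rewrite ler_norml => /andP[_ h1]; lra.
Qed.

Variable j : vec -> R.
Hypothesis hj : levy_density j.
Variables (D : set vec) (c : vec -> R).
Hypotheses (oD : open D) (bD : bounded_set D)
  (sD : uniform_exterior_sphere D) (D0 : D 0).
Variable Cc : R.
Hypothesis HC : forall x, D x -> `|c x| <= Cc.
Hypothesis cD : forall x, D x -> {for x, continuous c}.

Variables (h_ : nat -> R) (S_ : nat -> seq (R * vec)) (psi_ : nat -> vec -> R) (lam_ : nat -> R).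
Hypothesis ds : forall n, discrete_eigenpair j D c n (h_ n) (S_ n) (psi_ n) (lam_ n).
Variables (Lam1 : R) (n0 : nat).
Hypothesis lamB : forall n, (n0 <= n)%N -> `|lam_ n| <= Lam1.

Let Cc0 : 0 <= Cc. Proof. by apply: le_trans (HC D0). Qed.
Let Lam10 : 0 <= Lam1. Proof. by apply: le_trans (lamB (leqnn n0)). Qed.
Let F0 := Cc + Lam1 + 1.
Let F00 : 0 <= F0. Proof. by rewrite !addr_ge0. Qed.
Let h0 n : 0 < h_ n := ds_h0 (ds n).
Let h1 n : h_ n <= 1. Proof. exact: le_trans (ds_hn (ds n)) (inv_nat_le1 _). Qed.

Let psi01 n x : 0 <= psi_ n x <= 1.
Proof. by rewrite (ds_ge0 (ds n)) (ds_le1 (ds n)). Qed.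

Let rhs n x : (n0 <= n)%N -> D x -> lat (h_ n) x -> `|Lh (h_ n) (S_ n) (psi_ n) x| <= F0.
Proof. by move=> nn; apply: (ds_rhs HC (ds n)); exact: lamB. Qed.

Lemma h_small (e : R) : 0 < e -> exists m, forall n, (m <= n)%N -> h_ n <= e.
Proof.
move=> e0; have [m Hm] := small_inv e0; exists m => n mn.
exact: le_trans (ds_hn (ds n)) (Hm n mn).
Qed.

Lemma boundary_uniform (tau : R) : 0 < tau -> exists2 del, 0 < del & exists m, forall n, (m <= n)%N ->
  forall a b, D a -> ~ D b -> enorm (a - b) <= del -> psi_ n a <= tau.
Proof.
move=> t0; pose t1 := Num.min tau 1.
have t10 : 0 < t1 by rewrite lt_min t0 ltr01.
have t11 : t1 <= 1 by rewrite ge_min lexx orbT.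
have [del d0 [m Hm]] := boundary_small hj c oD bD sD D0 F00 t10 t11.
exists del => //; exists (maxn n0 m) => n; rewrite geq_max => /andP[nn mn] a b Da Db ab.
apply: (@le_trans _ _ t1); last by rewrite ge_min lexx.
by apply: Hm (ds n) _ _ _ Da Db ab => //; exact: (fun x => @rhs n x nn).
Qed.

(** The boundary layer for the given tolerance fixes del, and with it A, independently of n;
    [lip_lat] then applies once the mesh satisfies (F0 + 1) h^2 <= t1. *)
Lemma equicontinuous (tau : R) : 0 < tau -> exists2 rho, 0 < rho & exists m, forall n, (m <= n)%N ->
  forall p q, lat (h_ n) p -> lat (h_ n) q -> `|p - q| <= rho -> `|psi_ n p - psi_ n q| <= tau.
Proof.
move=> t0; pose dd : R := d%:R; have dd0 : 0 <= dd by [].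
(* Half of tau covers the d t1 of [lip_lat]; the other half covers its A term through the choice of
   rho. *)
pose t1 := tau / (2 * (dd + 1)).
have dd1 : 0 < 2 * (dd + 1) by rewrite mulr_gt0// ltr_wpDl.
have t10 : 0 < t1 by rewrite divr_gt0.
have [del' d'0 [m Hm]] := boundary_uniform t10.
pose del := Num.min del' 1.
have d0 : 0 < del by rewrite lt_min d'0 ltr01.
have d1 : del <= 1 by rewrite ge_min lexx orbT.
have dd' : del <= del' by rewrite ge_min lexx.
pose A := 3 * (F0 + 1) + del^-1.
have F1 : 0 < F0 + 1 by rewrite ltr_wpDl.
have A0 : 0 < A by rewrite addr_gt0 ?mulr_gt0 ?invr_gt0.
have Ad0 : 0 <= A * dd by rewrite mulr_ge0// ltW.
have Ad1 : 0 < 2 * (A * dd + 1) by rewrite mulr_gt0// ltr_wpDl.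
have [m2 Hm2] := h_small (divr_gt0 t10 F1).
exists (tau / (2 * (A * dd + 1))); first by rewrite divr_gt0.
exists (maxn n0 (maxn m m2)) => n; rewrite !geq_max => /and3P[nn mn mn2] p q lp lq pq.
have bh : (F0 + 1) * h_ n ^+ 2 <= t1.
  have := Hm2 n mn2; rewrite ler_pdivlMr// mulrC => H; apply: le_trans H.
  rewrite ler_pM2l// expr2 ler_piMr//; exact: ltW.
have := lip_lat bD D0 (h0 n) (h1 n) (ds_S (ds n)) (psi01 n) (ds_out (ds n)) F00 t10 d0 d1
  (fun x => @rhs n x nn) (fun a b Da Db ab => Hm n mn a b Da Db (le_trans ab dd')) bh lp lq.
move=> H; apply: le_trans H _; rewrite -/A -/dd.
have s1 : \sum_i `|p ord0 i - q ord0 i| <= dd * (tau / (2 * (A * dd + 1))).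
  apply: (@le_trans _ _ (\sum_(i < d) tau / (2 * (A * dd + 1)))).
    by apply: ler_sum => i _; apply: le_trans pq; have := coord_le_norm (p - q) i; rewrite !mxE.
  by rewrite sumr_const card_ord /dd -[leRHS]/(d%:R * _) [leRHS]mulr_natl.
apply: (@le_trans _ _ (tau / 2 + tau / 2)); last by rewrite -splitr.
apply: lerD.
  rewrite /t1 mulrA ler_pdivrMr// mulrA mulfVK// mulrC ler_wpM2l ?(ltW t0)// lerDl//.
apply: (@le_trans _ _ (A * (dd * (tau / (2 * (A * dd + 1)))))); first by rewrite ler_wpM2l// ltW.
rewrite !mulrA ler_pdivrMr// mulrA mulfVK// mulrC ler_wpM2l ?(ltW t0)// lerDl//.
Qed.

Variable U : set_system nat.
Hypotheses (UU : UltraFilter U) (UN : \oo `<=` U).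

Let PU : ProperFilter U := @ultra_proper _ U UU.

Let Uge m : U [set n | (m <= n)%N]. Proof. exact: UN (nbhs_infty_ge m). Qed.

(** [psi_ n] vanishes off its lattice, so its value near x has to be read at a lattice point
    [fl n x] within [h_ n] of x. *)
Variables (fl : nat -> vec -> vec) (psi : vec -> R) (lam : R).
Hypothesis flP : forall n x, lat (h_ n) (fl n x) /\ `|fl n x - x| <= h_ n.
Hypothesis psi_lim : forall x, psi_ n (fl n x) @[n --> U] --> psi x.
Hypothesis lam_lim : lam_ n @[n --> U] --> lam.

Lemma psi_ge0 x : 0 <= psi x.
Proof.
rewrite -oppr_le0; apply: (limU_le (u := fun n => - psi_ n (fl n x)) PU _ (Uge 0)).
  by apply: cvgN; exact: psi_lim.
by move=> n _; rewrite oppr_le0; have /andP[] := psi01 n (fl n x).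
Qed.

Lemma psi_le1 x : psi x <= 1.
Proof.
apply: (limU_le PU (@psi_lim x) (Uge 0)) => n _; by have /andP[] := psi01 n (fl n x).
Qed.

Lemma psi_modulus (tau : R) : 0 < tau ->
  exists2 rho, 0 < rho & forall x y, `|x - y| <= rho -> `|psi x - psi y| <= tau.
Proof.
move=> t0; have [rho0 r0 [m Hm]] := equicontinuous t0.
have r3 : 0 < rho0 / 3 by rewrite divr_gt0.
have [m2 Hm2] := h_small r3.
exists (rho0 / 3) => // x y xy.
have one x' y' : `|x' - y'| <= rho0 / 3 -> psi x' - psi y' <= tau.
  move=> xy'; apply: (limU_le (u := fun n => psi_ n (fl n x') - psi_ n (fl n y')) PU _ (Uge (maxn m m2))).
    by apply: cvgB; exact: psi_lim.
  move=> n /=; rewrite geq_max => /andP[mn mn2].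
  have [lx fx] := flP n x'; have [ly fy] := flP n y'; have hn := Hm2 n mn2.
  apply: le_trans (ler_norm _) _; apply: Hm => //.
  have -> : fl n x' - fl n y' = (fl n x' - x') + (x' - y') - (fl n y' - y').
    by apply/rowP => i; rewrite !mxE; ring.
  apply: le_trans (ler_normB _ _) _; have := ler_normD (fl n x' - x') (x' - y').
  move: fx fy hn xy'; set a1 := `|_|; set a2 := `|_|; set a3 := `|_|; set a4 := `|_|.
  by move=> *; lra.
by rewrite ler_norml lerNl opprB !one// distrC.
Qed.

Lemma psi_continuous : continuous psi.
Proof.
move=> x; have FF : Filter (nbhs x) := nbhs_filter x.
apply/cvgrPdist_le => e e0; have [rho r0 H] := psi_modulus e0.
have nb : nbhs x (ball x rho) by apply: nbhsx_ballx.
apply: filterS nb => y; rewrite -ball_normE/= => /ltW xy; exact: H.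
Qed.

Lemma psi_out x : ~ D x -> psi x = 0.
Proof.
move=> nDx; apply/eqP; rewrite eq_le psi_ge0 andbT; apply: le_addgt0 => e e0; rewrite add0r.
have [del d0 [m Hm]] := boundary_uniform e0.
have dd1 : 0 < d%:R + 1 :> R by rewrite ltr_wpDl.
have [m2 Hm2] := h_small (divr_gt0 d0 dd1).
apply: (limU_le PU (@psi_lim x) (Uge (maxn m m2))) => n /=; rewrite geq_max => /andP[mn mn2].
have [Df|nDf] := pselect (D (fl n x)); last by rewrite (ds_out (ds n)) ?(ltW e0)// => -[].
apply: Hm Df nDx _ => //; apply: le_trans (enorm_le_norm _) _.
have := Hm2 n mn2; rewrite ler_pdivlMr// => H; apply: le_trans H.
rewrite mulrC; apply: ler_pM => //; first exact: (flP n x).2.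
by rewrite lerDl.
Qed.

(** Convergence along U holds simultaneously on a finite net of D, and the moduli of [psi_ n] and
    psi extend it to all lattice points of D; outside D both functions vanish. *)
Lemma psi_uniform (tau : R) : 0 < tau ->
  U [set n | forall p, lat (h_ n) p -> `|psi_ n p - psi p| <= tau].
Proof.
move=> t0; have t3 : 0 < tau / 3 by rewrite divr_gt0.
have [rho1 r10 [m1 Hm1]] := equicontinuous t3; have [rho2 r20 H2] := psi_modulus t3.
pose r := Num.min (rho1 / 2) rho2.
have r12 : 0 < rho1 / 2 by rewrite divr_gt0.
have r0 : 0 < r by rewrite lt_min r12.
have [rr1 rr2] : r <= rho1 / 2 /\ r <= rho2 by rewrite /r !ge_min !lexx orbT.
have [m2 Hm2] := h_small r12.
have [M M0 DM] := bounded_set_box bD.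
pose N := (Num.truncn (M / r)).+1.
have MN : M <= N%:R * r by rewrite -ler_pdivrMr//; apply: ltW; exact: truncnS_gt.
have Uf : U [set n | forall f : {ffun 'I_d -> 'I_(N.*2.+1)},
    `|psi (cellpt r f) - psi_ n (fl n (cellpt r f))| <= tau / 3].
  apply: filter_forall => f; have := @psi_lim (cellpt r f).
  by move/cvgrPdist_le => /(_ _ t3).
apply: filterS (filterI Uf (Uge (maxn m1 m2))) => n [/= Hf].
rewrite geq_max => /andP[mn1 mn2] p lp.
have [Dp|nDp] := pselect (D p); last first.
  by rewrite psi_out// (ds_out (ds n)) ?subrr ?normr0 ?(ltW t0)// => -[].
have [f /forallP pf] := cell_ex r0 (fun i => le_trans (coord_le_norm p i) (le_trans (ltW (DM p Dp)) MN)).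
set z := cellpt r f.
have zp : `|z - p| <= r.
  apply: mx_norm_le => [|i]; first exact: ltW.
  have /andP[g1 g2] := pf i; move: g1 g2; rewrite /z !mxE; set u := _ * r => g1 g2.
  by rewrite ler_norml; apply/andP; split; lra.
have [lz fz] := flP n z.
have a1 : `|psi_ n p - psi_ n (fl n z)| <= tau / 3.
  apply: Hm1 => //; rewrite distrC -(subrK z (fl n z)) -addrA; apply: le_trans (ler_normD _ _) _.
  rewrite [leRHS]splitr; apply: lerD; last exact: le_trans zp rr1.
  exact: le_trans fz (Hm2 n mn2).
have a2 := Hf f; have a3 := H2 z p (le_trans zp rr2).
move: a1 a2 a3; rewrite -/z !ler_norml => /andP[b1 b2] /andP[b3 b4] /andP[b5 b6].
by apply/andP; split; lra.
Qed.

(** Uniform closeness preserves the normalisation to maximum 1; the strong maximum principle later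
    spreads positivity over D. *)
Lemma psi_nonzero : exists2 x, D x & 0 < psi x.
Proof.
have t0 : 0 < (2^-1 : R) by rewrite invr_gt0.
have [n /= Hn] := @filter_ex _ U PU _ (psi_uniform t0).
have [x [Dx lx px]] := ds_max (ds n); exists x => //.
have := Hn x lx; rewrite px ler_norml => /andP[_ h]; lra.
Qed.

Lemma lam_bound : `|lam| <= Lam1.
Proof.
rewrite ler_norml; apply/andP; split.
  rewrite lerNl; apply: (limU_le (u := fun n => - lam_ n) PU _ (Uge n0)); first by apply: cvgN.
  by move=> n /lamB; rewrite ler_norml lerNl => /andP[].
by apply: (limU_le PU lam_lim (Uge n0)) => n /lamB; rewrite ler_norml => /andP[].
Qed.

(** The discrete equation determines the scheme up to 1 / (n + 1). Continuity of c and psi, uniform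
    closeness of [psi_ n] and convergence of [lam_ n] let the right-hand side be frozen at x0. *)
Lemma discrete_rhs x0 (tau : R) : D x0 -> 0 < tau -> exists2 rho, 0 < rho &
  U [set n | forall q, lat (h_ n) q -> `|q - x0| <= rho ->
    `|Lh (h_ n) (S_ n) (psi_ n) q - (- c x0 * psi x0 - lam * psi x0)| <= tau].
Proof.
move=> Dx0 t0; pose K := 3 + 2 * Cc + 2 * Lam1.
have K0 : 0 < K by rewrite /K -addrA ltr_wpDr// addr_ge0// mulr_ge0.
pose e := tau / K; have e0 : 0 < e by rewrite divr_gt0.
have [r1 r10 H1] := open_box oD Dx0.
have [r2 r20 H2] := psi_modulus e0.
have [r3 r30 H3] : exists2 r, 0 < r & forall q, `|q - x0| <= r -> `|c q - c x0| <= e.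
  have FF : Filter (nbhs x0) := nbhs_filter x0.
  have := cD Dx0; move/cvgrPdist_le => /(_ e e0)/nbhs_ballP[r /= r0 Hr].
  exists (r / 2) => [|q qr]; first by rewrite divr_gt0.
  rewrite distrC; apply: Hr; rewrite -ball_normE/= distrC; apply: le_lt_trans qr _.
  by rewrite ltr_pdivrMr// ltr_pMr// ltr1n.
pose rho := Num.min r1 (Num.min r2 r3).
have [m Hm] := small_inv e0.
have Ulam : U [set n | `|lam - lam_ n| <= e] by move/cvgrPdist_le: lam_lim => /(_ e e0).
exists rho; first by rewrite !lt_min r10 r20.
apply: filterS (filterI (filterI Ulam (psi_uniform e0)) (Uge (maxn n0 m))) => n [[/= l1 pu]].
rewrite geq_max => /andP[nn mn] q lq; rewrite /rho !le_min => /and3P[q1 q2 q3].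
have Dq := H1 q q1; have p2 := H2 q x0 q2; have c3 := H3 q q3; have p1 := pu q lq.
have /andP[e1 e2] := ds_eq (ds n) Dq lq; have en := Hm n mn.
have cx := HC Dx0; have ln := lam_bound.
have /andP[q0 q01] := psi01 n q.
have p12 : `|psi_ n q - psi x0| <= 2 * e.
  have -> : psi_ n q - psi x0 = (psi_ n q - psi q) + (psi q - psi x0) by ring.
  by apply: le_trans (ler_normD _ _) _; rewrite mulr2n mulrDl mul1r; apply: lerD.
have t1 : `|c q * psi_ n q - c x0 * psi x0| <= e + Cc * (2 * e).
  have -> : c q * psi_ n q - c x0 * psi x0 = (c q - c x0) * psi_ n q + c x0 * (psi_ n q - psi x0).
    by ring.
  apply: le_trans (ler_normD _ _) _; rewrite !normrM; apply: lerD; last by apply: ler_pM.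
  by rewrite -[leRHS]mulr1; apply: ler_pM => //; rewrite ger0_norm.
have t2 : `|lam_ n * psi_ n q - lam * psi x0| <= e + Lam1 * (2 * e).
  have -> : lam_ n * psi_ n q - lam * psi x0 =
    (lam_ n - lam) * psi_ n q + lam * (psi_ n q - psi x0) by ring.
  apply: le_trans (ler_normD _ _) _; rewrite !normrM; apply: lerD; last by apply: ler_pM.
  by rewrite -[leRHS]mulr1 distrC; apply: ler_pM => //; rewrite ger0_norm.
have KE : e + (e + Cc * (2 * e)) + (e + Lam1 * (2 * e)) = tau.
  have <- : e * K = tau by rewrite /e divfK// gt_eqF.
  by rewrite /K; ring.
rewrite -KE; set L := Lh _ _ _ _ in e1 e2 *.
have -> : L - (- c x0 * psi x0 - lam * psi x0) = (L + c q * psi_ n q + lam_ n * psi_ n q)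
   - (c q * psi_ n q - c x0 * psi x0) - (lam_ n * psi_ n q - lam * psi x0) by ring.
apply: le_trans (ler_normB _ _) _; apply: lerD => //.
apply: le_trans (ler_normB _ _) _; apply: lerD => //.
rewrite ler_norml (le_trans e2 (ltW e0)) andbT; apply: le_trans e1.
by rewrite lerN2.
Qed.

(** The order of choices matters. The radius comes from tau alone, the smoothing scale eps then from
    tau', which fixes the regularity constant [Mr], and n comes last, so that the consistency error
    Mr / (n + 1) is below tau / 2 although [Mr] may blow up with small eps. *)
Lemma nice_limit : nice j D psi (fun x => - c x * psi x - lam * psi x).
Proof.
split; first exact: psi_continuous.
  by exists 1 => y; rewrite ger0_norm ?psi_ge0// psi_le1.
move=> x0 Dx0 tau t0; have t2 : 0 < tau / 2 by rewrite divr_gt0.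
set H0 := - c x0 * psi x0 - lam * psi x0.
have [rho1 r10 UL] := discrete_rhs Dx0 t2.
have [rb rb0 Hb] := open_box oD Dx0.
have r12 : 0 < rho1 / 2 by rewrite divr_gt0.
exists (Num.min (rho1 / 2) rb); first by rewrite lt_min r12.
move=> tau' t'0; have t'2 : 0 < tau' / 2 by rewrite divr_gt0.
have [rho2 r20 H2] := psi_modulus t'2.
have [M M0 DM] := bounded_set_box bD.
pose eps := Num.min 1 (Num.min (rho1 / 4) (rho2 / 2)).
have eps0 : 0 < eps by rewrite !lt_min ltr01 !divr_gt0.
have [eps1 epsr1 epsr2] : [/\ eps <= 1, eps <= rho1 / 4 & eps <= rho2 / 2].
  by have : eps <= eps := lexx _; rewrite {2}/eps !le_min => /and3P[].
have [C C0 HK] := kern_bound eps0.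
(* The number 2 M + 9 bounds the side (2 N + 1) h of the grid for every mesh h <= 1, so B does not
   depend on n. *)
pose B := ((2 * M + 9) * C) ^+ d.
have B0 : 0 <= B by rewrite exprn_ge0// mulr_ge0// addr_ge0// mulr_ge0// ltW.
pose Mr := B * (d%:R * d%:R + d%:R + 3).
have Mr0 : 0 <= Mr by rewrite mulr_ge0// !addr_ge0// mulr_ge0.
have Mr1 : 0 < Mr + 1 by rewrite ltr_wpDl.
have [m1 Hm1] := h_small eps0.
have [m2 Hm2] := small_inv (divr_gt0 t2 Mr1).
have [n [[/= ULn UPn]]] := @filter_ex _ U PU _ (filterI (filterI UL (psi_uniform t'2)) (Uge (maxn m1 m2))).
rewrite geq_max => /andP[mn1 mn2].
have he := Hm1 n mn1.
have hn0 := h0 n; have hn1 := h1 n; set h := h_ n in he hn0 hn1 ULn UPn.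
(* Enlarging the box by 3 leaves room for eps and h, both at most 1, around every point of D. *)
pose N := (Num.truncn ((M + 3) / h)).+1.
have MN : M + 3 <= N%:R * h by rewrite -ler_pdivrMr//; apply: ltW; exact: truncnS_gt.
have NM : N.*2.+1%:R * h <= 2 * M + 9.
  have : (Num.truncn ((M + 3) / h))%:R <= (M + 3) / h.
    by rewrite truncn_le// divr_ge0// ?ltW// addr_gt0.
  rewrite ler_pdivlMr// => tr; rewrite -natr1 -addnn natrD /N -natr1.
  by move: tr; move: (Num.truncn _)%:R => u; rewrite !mulrDl mul1r; move: (u * h) => v; lra.
have psi1 p : `|psi_ n p| <= 1 by have /andP[q0 q1] := psi01 n p; rewrite ger0_norm.
have HB a z : (forall l, (a l < 4)%N) -> `|mollified eps h N (psi_ n) a z| <= B.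
  move=> a4; apply: le_trans (mollified_bound N z psi1 (fun m s => HK h m s hn0) a4) _.
  rewrite /B; have -> : N.*2.+1%:R * (C * h) = (N.*2.+1%:R * h) * C by ring.
  have g0 : 0 <= N.*2.+1%:R * h by rewrite mulr_ge0// ltW.
  apply: lerXn2r; rewrite ?nnegrE; [exact: mulr_ge0| |exact: ler_wpM2r].
  by apply: mulr_ge0 => //; exact: le_trans NM.
pose P := mollified eps h N (psi_ n) (fun=> 0%N).
have jP := @jet2_mollified R d eps h N (psi_ n).
exists P, (fun i => mollified eps h N (psi_ n) (incr i (fun=> 0%N))),
  (fun i k => mollified eps h N (psi_ n) (incr k (incr i (fun=> 0%N)))); split => //.
- by exists B => y; exact: HB.
- move=> x; apply: (mollified_approx eps0 hn0 (ltW t'0)) => [f wn|]; last first.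
    have [Dx|nDx] := pselect (D x); last by left; exact: psi_out.
    right; apply: le_trans MN; have := DM x Dx; have := eps1; move: (`|x|) => u; lra.
  have lf := cellpt_lat h f; have := UPn _ lf; have wx := w0_supp eps0 hn0 wn.
  have : `|psi (cellpt h f) - psi x| <= tau' / 2.
    apply: H2; rewrite distrC; apply: le_trans wx _; rewrite [leRHS]splitr; apply: lerD => //.
    exact: le_trans he epsr2.
  move=> a1 a2; rewrite [leRHS]splitr -(subrK (psi (cellpt h f)) (psi_ n _)) -addrA.
  by apply: le_trans (ler_normD _ _) _; apply: lerD.
- move=> x; rewrite le_min => /andP[xr xb]; have Dx := Hb x xb.
  rewrite (Lop_jet j openT I jP) -/P; set Lp := (X in X - H0).
  have cons := ds_cons (ds n) (inv_nat_le1 n) (mollified_reg x B0 HB).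
  rewrite -/h -/P -/Mr -/Lp in cons.
  have cons2 : `|Lh h (S_ n) P x - Lp| <= tau / 2.
    apply: le_trans cons _; have := Hm2 n mn2; rewrite ler_pdivlMr// mulrDr mulr1 mulrC => e1.
    by apply: le_trans e1; rewrite lerDl.
  have xN : `|x| + eps + h <= N%:R * h.
    apply: le_trans MN; have := DM x Dx; move: (`|x|) eps1 hn1 => u; lra.
  have pout p : lat h p -> (forall f : {ffun 'I_d -> 'I_(N.*2.+1)}, p <> cellpt h f) -> psi_ n p = 0.
    move=> lp pf; apply: (ds_out (ds n)) => -[Dp _].
    have pN : `|p| <= N%:R * h by apply: le_trans MN; have := DM p Dp; move: (`|p|) => u; lra.
    by have [f pE] := lat_cellpt hn0 lp pN; exact: (pf f).
  have LE := mollified_Lh eps0 hn0 (fun b bS => (ds_S (ds n) bS).2) pout xN.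
  have A2 : `|Lh h (S_ n) P x - H0| <= tau / 2.
    rewrite /P LE; apply: (mollified_approx eps0 hn0 (ltW t2)) => [f wn|]; last first.
      by right; apply: le_trans xN; rewrite lerDl ltW.
    apply: ULn; first exact: cellpt_lat.
    rewrite -(subrK x (cellpt h f)) -addrA; apply: le_trans (ler_normD _ _) _.
    rewrite [leRHS]splitr; apply: lerD => //; rewrite distrC; apply: le_trans (w0_supp eps0 hn0 wn) _.
    have := epsr1; have := he; lra.
  move: cons2 A2; rewrite [tau in leRHS]splitr !ler_norml => /andP[a1 a2] /andP[a3 a4].
  by apply/andP; split; lra.
Qed.

End limit.

(** * Existence of the nice eigenpair and conclusion *)

Lemma nice_eigenpair (R : realType) (d : nat) (j : 'rV[R]_d -> R) (D : set 'rV[R]_d) (c : 'rV[R]_d -> R) :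
  levy_density j -> open D -> bounded_set D -> connected D -> uniform_exterior_sphere D -> D 0 ->
  {within closure D, continuous c} ->
  exists psi lam, [/\ nice j D psi (fun x => - c x * psi x - lam * psi x),
    forall x, D x -> 0 < psi x & forall x, ~ D x -> psi x = 0].
Proof.
move=> hj oD bD coD sD D0 hc.
have [Cc Cc0 HC] := within_closure_bounded bD hc.
have cD x : D x -> {for x, continuous c} by move=> Dx; exact: within_closure_for hc.
have /choice[h_ /choice[S_ /choice[psi_ /choice[lam_ ds]]]] : forall n, exists h S psi lam, discrete_eigenpair j D c n h S psi lam.
  by move=> n; exact: (discrete_eigenpair_exists hj bD D0 HC n).
have [Lam0 [n0 HL]] := lam_le hj oD bD D0 HC.
pose Lam1 := (Cc + 1) + `|Lam0|.
have C1 : 0 <= Cc + 1 by rewrite addr_ge0.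
have lamB n : (n0 <= n)%N -> `|lam_ n| <= Lam1.
  move=> nn; have g := lam_ge HC (ds n); have l := HL _ _ _ _ _ nn (ds n).
  rewrite ler_norml; apply/andP; split.
    by apply: le_trans g; rewrite lerN2 lerDl.
  by apply: le_trans l _; apply: le_trans (ler_norm _) _; rewrite lerDr.
have [U [UU UN]] := nat_ultrafilter.
have Uge m : U [set n | (m <= n)%N] by exact: UN (nbhs_infty_ge m).
have /choice[fl flP] : forall nx : nat * 'rV[R]_d, exists p, lat (h_ nx.1) p /\ `|p - nx.2| <= h_ nx.1.
  by move=> [n x]; apply: lat_near; exact: ds_h0 (ds n).
pose fl' n x := fl (n, x).
have flP' n x : lat (h_ n) (fl' n x) /\ `|fl' n x - x| <= h_ n by exact: flP (n, x).
have /choice[psi psi_lim] : forall x, exists l : R, psi_ n (fl' n x) @[n --> U] --> l.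
  move=> x; apply: (@ultra_bounded_cvg R U UU _ 1); apply: filterS (Uge 0%N) => n _ /=.
  by rewrite ger0_norm ?(ds_ge0 (ds n))// (ds_le1 (ds n)).
have [lam lam_lim] : exists l : R, lam_ n @[n --> U] --> l.
  by apply: (@ultra_bounded_cvg R U UU _ Lam1); apply: filterS (Uge n0) => n /lamB.
have np := nice_limit hj oD bD sD D0 HC cD ds lamB UU UN flP' psi_lim lam_lim.
have pc := psi_continuous hj oD bD sD D0 HC ds lamB UU UN flP' psi_lim.
have p0 := psi_ge0 ds UU UN psi_lim.
have pz := psi_nonzero hj oD bD sD D0 HC ds lamB UU UN flP' psi_lim.
have lb := lam_bound lamB UU UN lam_lim.
exists psi, lam; split => //; last exact: (psi_out hj oD bD sD D0 HC ds lamB UU UN flP' psi_lim).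
have cst0 : continuous (fun _ : 'rV[R]_d => 0 : R) by exact: continuous_cstf.
have vs := visc_sum hj 1 oD bD cst0 (bnd_cst 0) (visc_zero hj bD) (fun x _ => @cst0 x) np.
have E (F : 'rV[R]_d -> R) : (fun x => 0 + 1 * F x) = F by apply/funext => x; rewrite add0r mul1r.
rewrite !E in vs.
have Lam10 : 0 <= Lam1 by rewrite addr_ge0.
have CL : 0 <= Cc + Lam1 by rewrite addr_ge0.
(* The limit is only known to be nonnegative and nonzero. It is a supersolution with right-hand side
   - (c + lam) psi <= (Cc + Lam1) psi, so it is positive throughout D. *)
move=> x Dx; apply: (strong_mp hj oD bD coD CL pc p0 vs) Dx => // y Dy.
rewrite -mulrBl ler_wpM2r//; apply: lerD.
  by have := HC y Dy; rewrite ler_norml lerNl => /andP[].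
by move: lb; rewrite ler_norml lerNl => /andP[].
Qed.

Theorem theorem1p4 (R : realType) (d : nat) (j : 'rV[R]_d -> R)
    (D : set 'rV[R]_d) (c : 'rV[R]_d -> R)
    (hd : (0 < d)%N)
    (hj : levy_density j)
    (hA1 : condition_A1 j)
    (hD : bounded_lipschitz_domain D)
    (hD0 : D 0)
    (hsphere : uniform_exterior_sphere D)
    (hc : {within closure D, continuous c}) :
  exists lambdaD : R, principal_eigenvalue j D c = lambdaD%:E /\
  exists psiD : 'rV[R]_d -> R,
    [/\ pos_eigenfunction j D c lambdaD psiD /\ psiD 0 = 1,
        (forall psi, pos_eigenfunction j D c lambdaD psi -> psi 0 = 1 ->
           psi = psiD),
        (forall (u : 'rV[R]_d -> R) (lambda : R),
           Cb_nonneg u -> (forall x, D x -> 0 < u x) ->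
           eigen_supersol j D c lambda u ->
           lambda <= lambdaD /\
           (lambda = lambdaD -> (forall x, ~ D x -> u x = 0) ->
              exists2 k : R, 0 < k & forall x, u x = k * psiD x)) &
        (forall (lambda : R) (u : 'rV[R]_d -> R),
           pos_eigenfunction j D c lambda u -> lambda = lambdaD)].
Proof.
have [oD coD bD _] := hD.
have [psi [lam [np psiD psi0]]] := nice_eigenpair hj oD bD coD hsphere hD0 hc.
pose k := (psi 0)^-1; have k0 : 0 < k by rewrite invr_gt0; exact: psiD.
apply: (@nice_eigen_theorem R d j hj D c oD bD coD hsphere hc hD0 lam (fun x => k * psi x)).
- have := nice_scale hj k0 np; congr nice; apply/funext => x; ring.
- by move=> x Dx; rewrite mulr_gt0// psiD.
- by move=> x nDx; rewrite psi0// mulr0.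
- by rewrite /k mulVf// gt_eqF// psiD.
Qed.
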